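(* Let $\Omega\subset\mathbb{R}^D$ be an open, bounded Lipschitz domain. Let $n\in\mathbb{N}$, $k,l\in\mathbb{N}_0$, $0\le k\le n$, $1\le p\le\infty$, and $u_\Omega\in W^{k,p}(\Omega)$. Let $\sigma>0$ be sufficiently small and $\varepsilon>0$ big enough. Then the approximate extension operator $A_\varepsilon^{-1}$ fulfills $$\Vert Eu_\Omega-A_\varepsilon^{-1}u_\Omega\Vert_{W^{l,p}(\Omega_\sigma)}\lesssim\sigma^{k-l}\Vert u_\Omega\Vert_{W^{k,p}(\Omega)}\qquad 0\le l\le\min\{k,n-1\},$$ $$\Vert A_\varepsilon^{-1}u_\Omega\Vert_{W^{l,p}(\Omega_\sigma)}\lesssim\sigma^{k-l}\Vert u_\Omega\Vert_{W^{k,p}(\Omega)}\qquad k\le l\le n-1.$$ The hidden constant is independent of $\sigma$, $u_\Omega$, and how $\partial\Omega$ intersects the Cartesian grid. If one interprets the norms on the left side of the inequalities in the broken, element-wise sense (i.e. as norms computed separately on each grid cell of $\Omega_\sigma$ and combined in $\ell^p$), they also remain true for $l=n$ (in the first inequality this concerns $k=l=n$).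
   Context: Notation $a\lesssim b$: $a\le Cb$ with a constant $C>0$ independent of $a$, $b$, $\sigma$. ''$\sigma$ sufficiently small, $\varepsilon$ big enough'': there are thresholds $\sigma_0,\varepsilon_0>0$ such that the statement holds for $\sigma\le\sigma_0$, $\varepsilon\ge\varepsilon_0$ (the hidden constant may depend on $\varepsilon$). $q$ is the Hölder conjugate of $p$. $E$ is the Stein extension operator: a linear operator extending functions on $\Omega$ to $\mathbb{R}^D$ with $\Vert Eu\Vert_{W^{s,p}(\mathbb{R}^D)}\lesssim\Vert u\Vert_{W^{s,p}(\Omega)}$ for all $s\ge0$, $1\le p\le\infty$. Grid. For $\sigma>0$ and $\mathbf i\in\mathbb{Z}^D$ let $Q_{\mathbf i}=\prod_{d=1}^D(i_d\sigma,(i_d+1)\sigma)$. $\Omega_\sigma$ is the interior of the union of all $\overline{Q_{\mathbf i}}$ with $\mathrm{meas}(Q_{\mathbf i}\cap\Omega)>0$; such $Q_{\mathbf i}$ are the elements of $\Omega_\sigma$. $\Omega_\sigma^\circ$ (uncut) and $\Omega_\sigma^\Gamma$ (cut) are the interiors of the unions of the closures of those elements of $\Omega_\sigma$ with $Q_{\mathbf i}\subset\Omega$, respectively $Q_{\mathbf i}\not\subset\Omega$. $\mathcal F_\sigma$ is the set of all faces $F$ of elements of $\Omega_\sigma^\Gamma$ with $F\not\subset\partial\Omega_\sigma$. Standing assumption: for every element $Q_{\mathbf i}$ of $\Omega_\sigma^\Gamma$ there is a sequence $F_{\mathbf i,1},\dots,F_{\mathbf i,K}$ in $\mathcal F_\sigma$,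 starting at a face of $Q_{\mathbf i}$, such that any two consecutive faces are faces of a single element, the last face belongs to an uncut element of $\Omega_\sigma^\circ$, and $K$ is bounded independently of $\sigma$ and $\mathbf i$. Splines. $V_\sigma^{n,p}(\mathbb{R}^D)$ is the space of compactly supported $C^{n-2}$ functions (no continuity condition if $n=1$) whose restriction to each $Q_{\mathbf i}$ is a polynomial of coordinate-wise degree at most $n-1$, with the $L^p$-norm; $V_\sigma^{n,p}(\Omega_\sigma)$ is its restriction to $\Omega_\sigma$, with the $L^p(\Omega_\sigma)$-norm. $V_\sigma^{-n,p}(\Omega_\sigma):=(V_\sigma^{n,q}(\Omega_\sigma))'$ with the dual norm. Operators. $A,J:V_\sigma^{n,p}(\Omega_\sigma)\to V_\sigma^{-n,p}(\Omega_\sigma)$ are given by $\langle Au_\sigma,v_\sigma\rangle=\int_\Omega u_\sigma v_\sigma\,d\mathbf x$ and $\langle Ju_\sigma,v_\sigma\rangle=\sigma^{2n-1}\sum_{F\in\mathcal F_\sigma}\int_F\llbracket\partial^{n-1}_{\mathbf n_F}u_\sigma\rrbracket\llbracket\partial^{n-1}_{\mathbf n_F}v_\sigma\rrbracket\,dS$, where $\mathbf n_F$ is the coordinate unit vector normal to $F$ and $\llbracket\cdot\rrbracket$ is the difference of the one-sided traces on $F$. $A_\varepsilon:=A+\varepsilon J$, which is invertible for $\sigma$ small and $\varepsilon$ large; $A_\varepsilon^{-1}$ is called the approximate extension operator. A function $u_\Omega\in L^p(\Omega)$ is viewed as an element of $V_\sigma^{-n,p}(\Omega_\sigma)$ via $v_\sigma\mapsto\int_\Omega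 u_\Omega v_\sigma\,d\mathbf x$. *)

(* Defs.v *)
From HB Require Import structures.
From mathcomp Require Import all_boot all_order all_algebra.
From mathcomp Require Import all_classical all_reals all_analysis.

Set Implicit Arguments.
Unset Strict Implicit.
Unset Printing Implicit Defensive.
Import Order.TTheory GRing.Theory Num.Theory.
Import numFieldNormedType.Exports.

Local Open Scope classical_set_scope.
Local Open Scope ring_scope.

Section measurable_rV.
Context {R : realType} (n : nat).

Let coors : 'I_n -> 'rV[R]_n -> R := fun i x => x ord0 i.

Let rV_set0 : g_sigma_preimage coors set0.
Proof. exact: sigma_algebra0. Qed.

Let rV_setC A : g_sigma_preimage coors A -> g_sigma_preimage coors (~` A).
Proof. exact: sigma_algebraC. Qed.

Let rV_bigcup (F : _^nat) : (forall i, g_sigma_preimage coors (F i)) ->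
  g_sigma_preimage coors (\bigcup_i (F i)).
Proof. exact: sigma_algebra_bigcup. Qed.

HB.instance Definition _ :=
  @isMeasurable.Build (measure_tuple_display default_measure_display)
    'rV[R]_n (g_sigma_preimage coors) rV_set0 rV_setC rV_bigcup.

Lemma measurable_coor (i : 'I_n) :
  measurable_fun [set: 'rV[R]_n] (fun x : 'rV[R]_n => x ord0 i).
Proof.
move=> _ Y mY; rewrite setTI; apply: sub_sigma_algebra => /=.
rewrite -bigcup_seq/=; exists i => /=; first by rewrite mem_index_enum.
by exists Y => //; rewrite setTI.
Qed.

Lemma measurable_rV d (T : measurableType d) (f : T -> 'rV[R]_n) :
  (forall i, measurable_fun [set: T] (fun x => f x ord0 i)) ->
  measurable_fun [set: T] f.
Proof.
move=> mf.
have prefS : g_sigma_preimage (fun i => (fun v : 'rV[R]_n => v ord0 i) \o f)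
    `<=` measurable.
  apply: smallest_sub; first exact: sigma_algebra_measurable.
  case: n => [|m] in f mf *; first by rewrite big_ord0.
  rewrite -bigcup_mkord_ord; apply: bigcup_sub => i Ii.
  by move=> A [B mB <-]; exact: mf.
by move: prefS; rewrite g_sigma_preimage_comp => prefS _ A mA; apply: prefS; exists A.
Qed.

End measurable_rV.

(* The vector of R^{n+1} with d-th coordinate t and other coordinates y. *)
Definition insert_coord {R : realType} n (d : 'I_n.+1) (t : R) (y : 'rV[R]_n) :
  'rV[R]_n.+1 := \row_j oapp (fun j' => y ord0 j') t (unlift d j).

Lemma measurable_insert_coord {R : realType} n (d : 'I_n.+1) :
  measurable_fun [set: measurableTypeR R * 'rV[R]_n]
    (fun x => insert_coord d x.1 x.2).
Proof.
apply: measurable_rV => i.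
case: (unliftP d i) => [j ->|->].
  rewrite (_ : (fun _ => _) = (fun v : 'rV[R]_n => v ord0 j) \o snd).
    by apply: measurableT_comp => //; exact: measurable_coor.
  by apply/funext => x; rewrite mxE liftK.
rewrite (_ : (fun _ => _) = fst) //.
by apply/funext => x; rewrite mxE unlift_none.
Qed.

Section lebesgue_step.
Local Open Scope ereal_scope.
Context {R : realType} (n : nat).
Context (mu : {sigma_finite_measure set 'rV[R]_n -> \bar R}).

Let cons_rV (x : measurableTypeR R * 'rV[R]_n) : 'rV[R]_n.+1 := insert_coord ord0 x.1 x.2.

Let uncons_rV (v : 'rV[R]_n.+1) : measurableTypeR R * 'rV[R]_n :=
  (v ord0 ord0, \row_j v ord0 (lift ord0 j)).

Let measurable_cons_rV : measurable_fun setT cons_rV.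
Proof. exact: measurable_insert_coord. Qed.

Let measurable_uncons_rV : measurable_fun setT uncons_rV.
Proof.
apply: measurable_fun_pair => /=; first exact: measurable_coor.
apply: measurable_rV => i.
by under eq_fun do rewrite mxE; exact: measurable_coor.
Qed.

Let cons_rVK : cancel cons_rV uncons_rV.
Proof.
move=> [t y]; rewrite /uncons_rV /cons_rV /insert_coord; congr pair.
  by rewrite mxE unlift_none.
by apply/rowP => j; rewrite !mxE liftK.
Qed.

Definition lebesgue_step : set 'rV[R]_n.+1 -> \bar R :=
  pushforward (@lebesgue_measure R \x mu)
    (fun x : measurableTypeR R * 'rV[R]_n => insert_coord ord0 x.1 x.2).

Let step_preimage (A : set 'rV[R]_n.+1) : measurable A ->
  measurable ((fun x : measurableTypeR R * 'rV[R]_n => insert_coord ord0 x.1 x.2) @^-1` A).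
Proof.
by move=> mA; rewrite -[X in measurable X]setTI; exact: measurable_cons_rV.
Qed.

Let step0 : lebesgue_step set0 = 0.
Proof. by rewrite /lebesgue_step /pushforward preimage_set0 measure0. Qed.

Let step_ge0 A : 0 <= lebesgue_step A.
Proof. exact: measure_ge0. Qed.

Let step_sigma_additive : semi_sigma_additive lebesgue_step.
Proof.
move=> F mF tF mUF; rewrite /lebesgue_step /pushforward preimage_bigcup.
apply: measure_semi_sigma_additive.
- by move=> i; exact: step_preimage.
- apply/trivIsetP => /= i j _ _ ij; rewrite -preimage_setI.
  by move/trivIsetP : tF => /(_ _ _ _ _ ij) ->//; rewrite preimage_set0.
- by rewrite -preimage_bigcup; exact: step_preimage.
Qed.

HB.instance Definition _ := isMeasure.Build _ _ _ lebesgue_step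
  step0 step_ge0 step_sigma_additive.

Let step_sigma_finite : sigma_finite setT lebesgue_step.
Proof.
have /sigma_finiteP[F [FT ndF Foo]] := sigma_finiteT (@lebesgue_measure R).
have /sigma_finiteP[G [GT ndG Goo]] := sigma_finiteT mu.
exists (fun k => uncons_rV @^-1` (F k `*` G k)).
  apply/esym/seteqP; split => // v _.
  have [k _ Fk] : (\bigcup_k F k) (uncons_rV v).1 by rewrite -FT.
  have [l _ Gl] : (\bigcup_l G l) (uncons_rV v).2 by rewrite -GT.
  exists (maxn k l) => //; split.
  - by move: Fk; apply/subsetPset/ndF/leq_maxl.
  - by move: Gl; apply/subsetPset/ndG/leq_maxr.
move=> k; have [mFk Fk] := Foo k; have [mGk Gk] := Goo k; split.
  rewrite -[X in measurable X]setTI; apply: measurable_uncons_rV => //.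
  exact: measurableX.
rewrite /lebesgue_step /pushforward.
have -> : cons_rV @^-1` (uncons_rV @^-1` (F k `*` G k)) = F k `*` G k.
  rewrite -comp_preimage (_ : uncons_rV \o cons_rV = id) //.
  by apply/funext => x; exact: cons_rVK.
by rewrite product_measure1E// lte_mul_pinfty// ge0_fin_numE.
Qed.

HB.instance Definition _ := Measure_isSigmaFinite.Build _ _ _ lebesgue_step
  step_sigma_finite.

End lebesgue_step.

Fixpoint lebesgue_rV {R : realType} (n : nat) :
    {sigma_finite_measure set 'rV[R]_n -> \bar R} :=
  if n is m.+1 then lebesgue_step (lebesgue_rV m) else \d_(0 : 'rV[R]_0).

Section sobolev.
Context {R : realType} (D : nat).
Implicit Types (Om : set 'rV[R]_D) (u g phi : 'rV[R]_D -> R) (p : \bar R).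

Notation mu := (lebesgue_rV D).

Definition unit_vec (d : 'I_D) : 'rV[R]_D := delta_mx ord0 d.

Fixpoint class_C (m : nat) (f : 'rV[R]_D -> R) : Prop :=
  if m is m'.+1 then
    continuous f /\
    forall d, (forall x, derivable f x (unit_vec d)) /\
              class_C m' (fun x => 'D_(unit_vec d) f x)
  else continuous f.

Definition multi_index := {ffun 'I_D -> nat}.

Definition mi_order (alpha : multi_index) : nat := (\sum_d alpha d)%N.

Definition partial (alpha : multi_index) (f : 'rV[R]_D -> R) : 'rV[R]_D -> R :=
  foldr (fun d g => iter (alpha d) (fun h x => 'D_(unit_vec d) h x) g)
    f (enum 'I_D).

Definition test_function Om phi : Prop :=
  [/\ (forall m, class_C m phi),
      compact (closure [set x | phi x != 0]) &
      closure [set x | phi x != 0] `<=` Om].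

Definition locally_integrable_on Om u : Prop :=
  measurable_fun Om u /\
  forall K, compact K -> K `<=` Om -> mu.-integrable K (EFin \o u).

Definition is_weak_partial Om u (alpha : multi_index) g : Prop :=
  [/\ locally_integrable_on Om u, locally_integrable_on Om g &
      forall phi, test_function Om phi ->
        \int[mu]_(x in Om) (u x * partial alpha phi x) =
        (-1) ^+ mi_order alpha * \int[mu]_(x in Om) (g x * phi x)].

Definition Lp_norm Om p u : \bar R := 'N[mu]_p[EFin \o (u \_ Om)]%E.

(* The l^p-combination of nonnegative quantities; only 1 <= p is used. *)
Definition lp_sum (I : choiceType) (S : set I) p (a : I -> \bar R) : \bar R :=
  match p with
  | r%:E => (\esum_(i in S) a i `^ r)%E `^ r^-1
  | +oo => ereal_sup (0%E |` [set a i | i in S])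
  | -oo => 0
  end%E.

(* Weak derivatives are unique almost everywhere, so the infimum is over at
   most one value; it is +oo when some weak derivative of order <= k does not
   exist. Thus the norm is finite exactly on W^{k,p}(Om). *)
Definition sobolev_norm Om (k : nat) p u : \bar R :=
  ereal_inf
    [set lp_sum [set alpha : multi_index | (mi_order alpha <= k)%N] p
           (fun alpha => Lp_norm Om p (g alpha))
    | g in [set g : multi_index -> 'rV[R]_D -> R |
             forall alpha, (mi_order alpha <= k)%N ->
               is_weak_partial Om u alpha (g alpha)]].

Definition in_sobolev Om (k : nat) p u : Prop := (sobolev_norm Om k p u < +oo)%E.

(* Functions on Om are represented by functions on R^D whose values outside Om
   are irrelevant. The operator acts on L^1(Om), which contains every
   W^{s,p}(Om) when Om is bounded. *)
Definition stein_extension Om (E : ('rV[R]_D -> R) -> 'rV[R]_D -> R) : Prop :=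
  [/\ forall (c : R) u v, in_sobolev Om 0 1%E u -> in_sobolev Om 0 1%E v ->
        {ae mu, forall x, E (fun y => c * u y + v y) x = c * E u x + E v x},
      forall u, in_sobolev Om 0 1%E u ->
        {ae mu, forall x, Om x -> E u x = u x} &
      forall (s : nat) p, (1 <= p)%E -> exists C : R,
        forall u, in_sobolev Om s p u ->
          (sobolev_norm setT s p (E u) <= C%:E * sobolev_norm Om s p u)%E].

End sobolev.

Definition boundary (T : topologicalType) (S : set T) : set T :=
  closure S `\` interior S.

(* Near each boundary point, Om is, after an orthogonal change of coordinates,
   the set of points lying above the graph of a Lipschitz function of the
   first D coordinates. *)
Definition lipschitz_domain {R : realType} (D : nat) (Om : set 'rV[R]_D.+1) :=
  forall x, boundary Om x ->
    exists (U : set 'rV[R]_D.+1) (M : 'M[R]_D.+1) (gamma : 'rV[R]_D -> R),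
      [/\ open U, U x, M *m M^T = 1%:M, [lipschitz gamma y | y in setT] &
          forall y, U y ->
            (Om y <-> gamma (col' ord_max (y *m M)) < (y *m M) ord0 ord_max)].

(* The grid has mesh size sigma and a node at the point a, so that the
   position of a domain relative to the grid can vary. *)
Section grid.
Context {R : realType} (D : nat) (sigma : R) (a : 'rV[R]_D.+1).
Implicit Types (Om : set 'rV[R]_D.+1) (i : 'rV[int]_D.+1).

Notation face := ('I_D.+1 * 'rV[int]_D.+1)%type.

Definition grid_coord (d : 'I_D.+1) (z : int) : R := a ord0 d + z%:~R * sigma.

Definition cell i : set 'rV[R]_D.+1 :=
  [set x | forall d,
    grid_coord d (i ord0 d) < x ord0 d < grid_coord d (i ord0 d + 1)].

Definition elements Om : set 'rV[int]_D.+1 :=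
  [set i | (0 < lebesgue_rV D.+1 (cell i `&` Om))%E].

Definition uncut_elements Om : set 'rV[int]_D.+1 :=
  [set i | elements Om i /\ cell i `<=` Om].

Definition cut_elements Om : set 'rV[int]_D.+1 :=
  [set i | elements Om i /\ ~ (cell i `<=` Om)].

Definition grid_domain Om : set 'rV[R]_D.+1 :=
  interior (\bigcup_(i in elements Om) closure (cell i)).

(* The face (d, i) is the common face of cell (i - e_d) and cell i, which is
   normal to e_d. Faces are taken relatively open. *)
Definition face_set (F : face) : set 'rV[R]_D.+1 :=
  [set x | x ord0 F.1 = grid_coord F.1 (F.2 ord0 F.1) /\
    forall d, d != F.1 ->
      grid_coord d (F.2 ord0 d) < x ord0 d < grid_coord d (F.2 ord0 d + 1)].

Definition is_face_of (F : face) i : Prop :=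
  F.2 = i \/ F.2 = i + delta_mx ord0 F.1.

Definition ghost_faces Om : set face :=
  [set F | (exists2 i, cut_elements Om i & is_face_of F i) /\
           ~ (face_set F `<=` boundary (grid_domain Om))].

(* Each cut element is connected to an uncut one by a chain F0 :: s of at most
   K faces. *)
Definition chain_condition Om (K : nat) : Prop :=
  forall i, cut_elements Om i ->
    exists (F0 : face) (s : seq face),
      [/\ (size (F0 :: s) <= K)%N,
          forall F, F \in F0 :: s -> ghost_faces Om F,
          is_face_of F0 i,
          forall j, (j < size s)%N -> exists m,
            [/\ elements Om m, is_face_of (nth F0 (F0 :: s) j) m &
                is_face_of (nth F0 (F0 :: s) j.+1) m] &
          exists2 m, uncut_elements Om m & is_face_of (last F0 s) m].

(* For n = 1 the values on the grid hyperplanes are arbitrary, whence the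
   measurability requirement; splines are to be considered up to equality
   almost everywhere. *)
Definition spline (n : nat) (u : 'rV[R]_D.+1 -> R) : Prop :=
  [/\ measurable_fun setT u,
      compact (closure [set x | u x != 0]),
      (1 < n)%N -> class_C (n - 2) u &
      forall i, exists c : {ffun 'I_D.+1 -> 'I_n} -> R, forall x, cell i x ->
        u x = \sum_alpha c alpha * \prod_d x ord0 d ^+ alpha d].

Definition spline_on Om (n : nat) (u : 'rV[R]_D.+1 -> R) : Prop :=
  exists2 w, spline n w & forall x, grid_domain Om x -> u x = w x.

(* Bounded linear functionals on V^{n,q}, with q the conjugate of p. *)
Definition spline_dual Om (n : nat) (p : \bar R)
    (f : ('rV[R]_D.+1 -> R) -> R) : Prop :=
  (forall (c : R) u v, spline_on Om n u -> spline_on Om n v ->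
     f (fun x => c * u x + v x) = c * f u + f v) /\
  exists C : R, forall v, spline_on Om n v ->
    (`|f v|%:E <= C%:E * Lp_norm (grid_domain Om) (hoelder_conjugate p) v)%E.

(* The L^2(Om) pairing, which gives both the operator A and the embedding of
   functions on Om into the dual of the spline space. *)
Definition mass_form Om (u v : 'rV[R]_D.+1 -> R) : R :=
  \int[lebesgue_rV D.+1]_(x in Om) (u x * v x).

(* The jump at x, across the hyperplane through x normal to e_d, of the m-th
   derivative in the direction e_d. *)
Definition normal_jump (d : 'I_D.+1) (m : nat) (u : 'rV[R]_D.+1 -> R)
    (x : 'rV[R]_D.+1) : R :=
  let g : R -> R := derive1n m (fun t : R => u (x + t *: unit_vec d)) in
  lim (g t @[t --> 0^'+]) - lim (g t @[t --> 0^'-]).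

Definition face_integral (F : face) (f : 'rV[R]_D.+1 -> R) : R :=
  let pt y := insert_coord F.1 (grid_coord F.1 (F.2 ord0 F.1)) y in
  \int[lebesgue_rV D]_(y in pt @^-1` face_set F) f (pt y).

Definition jump_form Om (n : nat) (u v : 'rV[R]_D.+1 -> R) : R :=
  sigma ^+ (2 * n - 1) *
  \sum_(F \in ghost_faces Om)
    face_integral F (fun x => normal_jump F.1 (n - 1) u x *
                              normal_jump F.1 (n - 1) v x).

Definition A_eps Om (n : nat) (eps : R) (u v : 'rV[R]_D.+1 -> R) : R :=
  mass_form Om u v + eps * jump_form Om n u v.

Definition A_eps_invertible Om (n : nat) (p : \bar R) (eps : R) : Prop :=
  [/\ forall u, spline_on Om n u -> spline_dual Om n p (A_eps Om n eps u),
      forall f, spline_dual Om n p f -> exists2 u, spline_on Om n u &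
        forall v, spline_on Om n v -> A_eps Om n eps u v = f v &
      forall u w, spline_on Om n u -> spline_on Om n w ->
        (forall v, spline_on Om n v -> A_eps Om n eps u v = A_eps Om n eps w v) ->
        {ae lebesgue_rV D.+1, forall x, grid_domain Om x -> u x = w x}].

Definition A_eps_inv Om (n : nat) (eps : R) (f : ('rV[R]_D.+1 -> R) -> R) :
    'rV[R]_D.+1 -> R :=
  get [set u | spline_on Om n u /\
               forall v, spline_on Om n v -> A_eps Om n eps u v = f v].

Definition approx_extension Om (n : nat) (eps : R) (u : 'rV[R]_D.+1 -> R) :
    'rV[R]_D.+1 -> R :=
  A_eps_inv Om n eps (mass_form Om u).

Definition broken_sobolev_norm Om (l : nat) (p : \bar R)
    (u : 'rV[R]_D.+1 -> R) : \bar R :=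
  lp_sum (elements Om) p (fun i => sobolev_norm (cell i) l p u).

End grid.

(* Submission.v *)
Require Import Defs.
From HB Require Import structures.
From mathcomp Require Import all_boot all_order all_algebra.
From mathcomp Require Import all_classical all_reals all_analysis.
From mathcomp Require Import measurable_realfun ess_sup_inf ring lra zify.
Set Implicit Arguments.
Unset Strict Implicit.
Unset Printing Implicit Defensive.
Import Order.TTheory GRing.Theory Num.Theory.
Import numFieldNormedType.Exports.

Local Open Scope classical_set_scope.
Local Open Scope ring_scope.

(* In terms of B-spline coefficients, [sigma^-(D+1) (A + eps J)] is a banded matrix with entries bounded
   independently of the mesh size and of the position of the boundary. It is coercive: on an uncut
   element the L^2 norm controls the coefficients, by testing with dual polynomials, and across a ghost
   face the jump of the (n-1)-st normal derivative determines the coefficients which belong to only one of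
   the two elements, so that the control propagates along the chains of faces. A coercive banded matrix has
   an inverse with exponentially decaying entries.
   For [v = E u], let [z] be the quasi-interpolation coefficients given by the dual functionals of the
   cells. The matrix applied to the error between [z] and the coefficients of the approximate extension
   vanishes when v is a polynomial of degree less than k, hence is bounded, by a pointwise Bramble-Hilbert
   lemma, by [sigma^k] times averages of the k-th derivatives of v over neighbouring cells. By the decay,
   the error on each cell, and likewise its derivatives, is dominated by an exponentially weighted sum of
   translated averages; its L^p norm is bounded by Minkowski's inequality and translation invariance, for
   all p at once. *)

(** A cell may meet the domain in an arbitrarily thin sliver, where the mass form alone gives no
    control of the coefficients; the jump form supplies it, and the sum is coercive in the [l^2]
    norm. The passage from this Hilbert space bound to every [p], end points included, is made
    through decay of the inverse and pointwise majorants, never by interpolation. The majorants are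
    fixed positive combinations of averages over translates, so one almost everywhere inequality
    yields all the [L^p] bounds. For this reason the Poincare and Bramble-Hilbert inequalities are
    proved pointwise almost everywhere: increments of a weakly differentiable function are compared
    with its line integrals directly, by testing with tensor products of bumps, without
    mollification. All forms are scaled to the unit cell, where only finitely many polynomials
    occur, so their bounds know nothing of the mesh. The mesh enters through powers of [sigma];
    [sigma <= 1] serves to compare derivatives of different orders, and [eps >= 1] to bound each
    face energy by the total energy. *)

Ltac and_lra := apply/andP; split; lra.

(** * Boxes, Lebesgue measure on row vectors, Tonelli and translation invariance *)

Section meas.
Context {R : realType}.
Open Scope ereal_scope.

Lemma coord_ball D (x y : 'rV[R]_D) (e : R) : (0 < e)%R ->
  ball x e y <-> forall d, (`|x ord0 d - y ord0 d| < e)%R.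
Proof.
move=> e0; split=> [[_ xy] d|xy]; first exact: (xy ord0 d).
by split => // i d; rewrite ord1; exact: xy.
Qed.

Definition obox D (a b : 'rV[R]_D) : set 'rV[R]_D :=
  [set x | forall d, (a ord0 d < x ord0 d < b ord0 d)%R].

Definition cbox D (a b : 'rV[R]_D) : set 'rV[R]_D :=
  [set x | forall d, (a ord0 d <= x ord0 d <= b ord0 d)%R].

Lemma obox_cbox D (a b : 'rV[R]_D) : obox a b `<=` cbox a b.
Proof. by move=> x abx d; have /andP[? ?] := abx d; rewrite !ltW. Qed.

Lemma open_obox D (a b : 'rV[R]_D) : open (obox a b).
Proof.
rewrite openE => x abx; apply/nbhs_ballP.
pose e := \big[Order.min/1%R]_d (Order.min (x ord0 d - a ord0 d) (b ord0 d - x ord0 d))%R.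
have e0 : (0 < e)%R.
  rewrite /e; elim/big_ind : _ => // [u v u0 v0|d _].
    by rewrite lt_min u0.
  by have /andP[? ?] := abx d; rewrite lt_min !subr_gt0; apply/andP.
exists e => //= y /(coord_ball _ _ e0) xy d.
have : (e <= Order.min (x ord0 d - a ord0 d) (b ord0 d - x ord0 d))%R.
  by rewrite /e (bigD1 d)//= ge_min lexx.
rewrite le_min => /andP[ea eb].
have := xy d; rewrite ltr_norml => /andP[? ?]; and_lra.
Qed.

Lemma measurable_coord_preim D (d : 'I_D) (Y : set R) : measurable Y ->
  measurable [set x : 'rV[R]_D | Y (x ord0 d)].
Proof. by move=> mY; rewrite -[X in measurable X]setTI; exact: measurable_coor. Qed.

Lemma measurable_obox D (a b : 'rV[R]_D) : measurable (obox a b).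
Proof.
rewrite (_ : obox a b = \bigcap_(d in [set: 'I_D]) [set x | `]a ord0 d, b ord0 d[%classic (x ord0 d)]).
  apply: fin_bigcap_measurable => // d _; apply: measurable_coord_preim; exact: measurable_itv.
apply/seteqP; split => x /=; first by move=> abx d _; rewrite /= in_itv/=; exact: abx.
by move=> abx d; have := abx d I; rewrite /= in_itv/=.
Qed.

Lemma compact_cbox D (a b : 'rV[R]_D) : compact (cbox a b).
Proof.
have := @rV_compact R D (fun d => `[a ord0 d, b ord0 d]%classic).
move=> /(_ (fun d => @segment_compact _ _ _)).
rewrite (_ : [set v : 'rV_D | forall i, _] = cbox a b) //.
Qed.

Lemma closed_cbox D (a b : 'rV[R]_D) : closed (cbox a b).
Proof. by apply: compact_closed; [exact: norm_hausdorff|exact: compact_cbox]. Qed.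

Lemma rat_between (x y : R) : (x < y)%R -> exists q : rat, (x < ratr q < y)%R.
Proof.
move=> xy; have [q /=] := rat_in_itvoo xy; rewrite in_itv/= => ?.
by exists q.
Qed.

(** Boxes with rational corners are countably many, which makes open sets measurable for the
    sigma-algebra generated by the coordinates. *)
Lemma open_bigcup_obox D (A : set 'rV[R]_D) : open A ->
  A = \bigcup_(ab : 'rV[rat]_D * 'rV[rat]_D)
    (if `[< obox (map_mx ratr ab.1) (map_mx ratr ab.2) `<=` A >] then obox (map_mx ratr ab.1) (map_mx ratr ab.2) else set0).
Proof.
move=> oA; apply/seteqP; split => [x Ax|x [ab _]]; last by case: ifPn => // /asboolP; exact.
have /nbhs_ballP[e /= e0 eA] : nbhs x A by exact: open_nbhs_nbhs.
have xe0 (d : 'I_D) : (x ord0 d - e < x ord0 d)%R by rewrite ltrBlDr ltrDl.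
have xe1 (d : 'I_D) : (x ord0 d < x ord0 d + e)%R by rewrite ltrDl.
pose q0 d := projT1 (cid (rat_between (xe0 d))).
pose q1 d := projT1 (cid (rat_between (xe1 d))).
have q0P d : (x ord0 d - e < ratr (q0 d) < x ord0 d)%R := projT2 (cid (rat_between (xe0 d))).
have q1P d : (x ord0 d < ratr (q1 d) < x ord0 d + e)%R := projT2 (cid (rat_between (xe1 d))).
exists (\row_d q0 d, \row_d q1 d) => //=.
rewrite ifT.
  by move=> d; rewrite !mxE; have /andP[_ ->] := q0P d; have /andP[-> _] := q1P d.
apply/asboolP => y yab; apply: eA; apply/(coord_ball _ _ e0) => d.
have := yab d; rewrite !mxE => /andP[y1 y2].
have /andP[? ?] := q0P d; have /andP[? ?] := q1P d.
rewrite ltr_norml; and_lra.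
Qed.

Lemma open_measurable_rV D (A : set 'rV[R]_D) : open A -> measurable A.
Proof.
move=> /open_bigcup_obox ->; apply: countable_bigcupT_measurable; first exact: countableP.
by move=> ab; case: ifPn => // _; exact: measurable_obox.
Qed.

Lemma closed_measurable_rV D (A : set 'rV[R]_D) : closed A -> measurable A.
Proof. by move=> cA; rewrite -[A]setCK; apply: measurableC; apply: open_measurable_rV; exact: closed_openC. Qed.

Lemma compact_measurable_rV D (A : set 'rV[R]_D) : compact A -> measurable A.
Proof. by move=> cA; apply: closed_measurable_rV; apply: compact_closed => //; exact: norm_hausdorff. Qed.

Lemma measurable_cbox D (a b : 'rV[R]_D) : measurable (cbox a b).
Proof. exact: closed_measurable_rV (@closed_cbox D a b). Qed.

Lemma continuous_measurable_rV D (f : 'rV[R]_D -> R) : continuous f -> measurable_fun setT f.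
Proof.
move=> /continuousP cf; apply: (measurability _ (RGenOpens.measurableE R)).
move=> _ [_ [a [b ->]] <-]; rewrite setTI; apply: open_measurable_rV.
by apply: cf; exact: interval_open.
Qed.

Lemma insert_coord_ord0 D (d : 'I_D.+1) (t : R) (y : 'rV[R]_D) : insert_coord d t y ord0 d = t.
Proof. by rewrite /insert_coord mxE unlift_none. Qed.

Lemma insert_coord_lift D (d : 'I_D.+1) (t : R) (y : 'rV[R]_D) j : insert_coord d t y ord0 (lift d j) = y ord0 j.
Proof. by rewrite /insert_coord mxE liftK. Qed.

Lemma measurable_insert0 D (f : 'rV[R]_D.+1 -> \bar R) : measurable_fun setT f ->
  measurable_fun setT (fun x : measurableTypeR R * 'rV[R]_D => f (insert_coord ord0 x.1 x.2)).
Proof. by move=> mf; apply: measurableT_comp => //; exact: measurable_insert_coord. Qed.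

(** The measure in dimension [D.+1] is by definition the image of a product measure, so this is the
    change of variables for an image measure. *)
Lemma integral_rVS0 D (f : 'rV[R]_D.+1 -> \bar R) :
    measurable_fun setT f -> (forall x, 0 <= f x) ->
  \int[lebesgue_rV D.+1]_x f x =
  \int[@lebesgue_measure R \x lebesgue_rV D]_x f (insert_coord ord0 x.1 x.2).
Proof.
move=> mf f0.
transitivity (\int[pushforward (@lebesgue_measure R \x lebesgue_rV D)
   (fun x : measurableTypeR R * 'rV[R]_D => insert_coord ord0 x.1 x.2)]_x f x).
  reflexivity.
rewrite ge0_integral_pushforward//; last exact: measurable_insert_coord.
Qed.

Lemma integral_rVS D (f : 'rV[R]_D.+1 -> \bar R) :
    measurable_fun setT f -> (forall x, 0 <= f x) ->
  \int[lebesgue_rV D.+1]_x f x =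
  \int[@lebesgue_measure R]_t \int[lebesgue_rV D]_y f (insert_coord ord0 t y).
Proof.
move=> mf f0; rewrite integral_rVS0// fubini_tonelli1//; exact: measurable_insert0.
Qed.

Lemma integral_rV0 (f : 'rV[R]_0 -> \bar R) : measurable_fun setT f ->
  \int[lebesgue_rV 0]_x f x = f 0%R.
Proof. by move=> mf; rewrite (integral_dirac _ measurableT)// diracT mul1e. Qed.

Opaque lebesgue_rV.

Lemma integrable_rVS D (f : 'rV[R]_D.+1 -> \bar R) : measurable_fun setT f ->
  (lebesgue_rV D.+1).-integrable setT f <->
  (@lebesgue_measure R \x lebesgue_rV D).-integrable setT
    (fun x : measurableTypeR R * 'rV[R]_D => f (insert_coord ord0 x.1 x.2)).
Proof.
move=> mf; have ma : measurable_fun setT (fun x => `|f x|) by exact: measurableT_comp.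
have E := integral_rVS0 ma (fun x => abse_ge0 _).
split=> /integrableP[m1 m2]; apply/integrableP; split => //.
- exact: measurable_insert0.
- by rewrite -E.
- by rewrite E.
Qed.

Lemma integral_rVS_int D (f : 'rV[R]_D.+1 -> \bar R) : measurable_fun setT f ->
  \int[lebesgue_rV D.+1]_x f x =
  \int[@lebesgue_measure R \x lebesgue_rV D]_x f (insert_coord ord0 x.1 x.2).
Proof.
move=> mf; rewrite integralE [RHS]integralE.
rewrite (integral_rVS0 (measurable_funepos mf) (fun x => funepos_ge0 f x)).
rewrite (integral_rVS0 (measurable_funeneg mf) (fun x => funeneg_ge0 f x)).
by congr (_ - _); apply: eq_integral => x _; rewrite ?funeposE ?funenegE.
Qed.

Definition shift1 (a : R) (x : measurableTypeR R) : measurableTypeR R := (x + a)%R.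

Lemma measurable_shift1 (a : R) : measurable_fun setT (shift1 a).
Proof. exact: measurable_funD. Qed.

HB.instance Definition _ (a : R) := isMeasurableFun.Build _ _ _ _ (shift1 a) (measurable_shift1 a).

(** Lebesgue measure is determined by its values on half-open intervals, and translation preserves
    their lengths. *)
Lemma lebesgue_measureD (a : R) (A : set (measurableTypeR R)) : measurable A ->
  pushforward lebesgue_measure (shift1 a) A = @lebesgue_measure R A.
Proof.
move=> mA; apply/esym/lebesgue_measure_unique => //= _ [[u v]] _ <-.
rewrite /pushforward (_ : _ @^-1` _ = `]u - a, v - a]%classic)%R; last first.
  by apply/seteqP; split => x /=; rewrite !in_itv/= /shift1 => /andP[? ?]; and_lra.
rewrite !lebesgue_measure_itv/= !lte_fin ltrD2r; case: ifPn => // _.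
by congr (_%:E); ring.
Qed.

Lemma integral_translate1 (a : R) (f : measurableTypeR R -> \bar R) : measurable_fun setT f -> (forall x, 0 <= f x) ->
  \int[lebesgue_measure]_t f (t + a)%R = \int[lebesgue_measure]_t f t.
Proof.
move=> mf f0.
transitivity (\int[pushforward lebesgue_measure (shift1 a)]_t f t).
  by rewrite ge0_integral_pushforward.
by apply: eq_measure_integral => A mA _; rewrite -[RHS](lebesgue_measureD a mA).
Qed.

Lemma measurable_translate D (v : 'rV[R]_D) : measurable_fun setT (fun x : 'rV[R]_D => (x + v)%R).
Proof.
apply: measurable_rV => i; under eq_fun do rewrite mxE.
by apply: measurable_funD => //; exact: measurable_coor.
Qed.

(** Induction on the dimension: Tonelli splits off the first coordinate, which is translated by the
    one-dimensional case, and the others by the induction hypothesis. *)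
Lemma integral_translate D (v : 'rV[R]_D) (f : 'rV[R]_D -> \bar R) :
  measurable_fun setT f -> (forall x, 0 <= f x) ->
  \int[lebesgue_rV D]_x f (x + v)%R = \int[lebesgue_rV D]_x f x.
Proof.
elim: D v f => [|D IH] v f mf f0.
  by apply: eq_integral => x _; congr f; apply/rowP => -[].
have mfv : measurable_fun setT (fun x : 'rV[R]_D.+1 => f (x + v)%R).
  by apply: measurableT_comp => //; exact: measurable_translate.
rewrite (integral_rVS mf f0) (integral_rVS mfv (fun x => f0 _)).
pose v' : 'rV[R]_D := \row_j v ord0 (lift ord0 j).
have E t (y : 'rV[R]_D) : (insert_coord ord0 t y + v = insert_coord ord0 (t + v ord0 ord0) (y + v'))%R.
  apply/rowP => j; rewrite !mxE; case: (unliftP ord0 j) => [j' ->|->] /=.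
    by rewrite !mxE.
  by [].
have mG : measurable_fun setT (fun t : measurableTypeR R => \int[lebesgue_rV D]_y f (insert_coord ord0 t y)).
  by apply: (@measurable_fun_fubini_tonelli_F _ _ _ _ _ _ (fun x => f (insert_coord ord0 x.1 x.2))) => //; exact: measurable_insert0.
rewrite -[RHS](integral_translate1 (v ord0 ord0) mG (fun t => integral_ge0 _ (fun y _ => f0 _))).
apply: eq_integral => t _.
under eq_integral do rewrite E.
have mft : measurable_fun setT (fun y : 'rV[R]_D => f (insert_coord ord0 (t + v ord0 ord0) y)).
  exact: measurableT_comp (measurable_insert0 mf) (measurable_pair1 (t + v ord0 ord0 : measurableTypeR R)%R).
exact: (IH v' (fun y => f (insert_coord ord0 (t + v ord0 ord0) y)) mft).
Qed.

(** For the first coordinate all slices but one are empty; for another coordinate every slice is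
    null by induction on the dimension. *)
Lemma hyperplane_null D (d : 'I_D) (c : R) : lebesgue_rV D [set x | x ord0 d = c] = 0.
Proof.
have mH : measurable [set x : 'rV[R]_D | x ord0 d = c] by exact: (@measurable_coord_preim _ _ [set c]).
have -> : lebesgue_rV D [set x | x ord0 d = c] = \int[lebesgue_rV D]_x (\1_[set x | x ord0 d = c] x)%:E.
  by rewrite integral_indic// setIT.
elim: D d mH => [[]//|D IH] d mH.
have m1 : measurable_fun setT (fun x => (\1_[set x : 'rV[R]_D.+1 | x ord0 d = c] x : R)%:E) by apply/measurable_EFinP.
rewrite (integral_rVS m1); last by move=> x; rewrite lee_fin.
case: (unliftP ord0 d) => [d' Ed|Ed].
  have mH' : measurable [set x : 'rV[R]_D | x ord0 d' = c] by exact: (@measurable_coord_preim _ _ [set c]).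
    rewrite integral0_eq// => t _; rewrite -[RHS](IH d' mH').
    apply: eq_integral => y _; congr EFin; rewrite !indicE; congr (_ _)%:R.
    by apply/idP/idP; rewrite !inE/= Ed insert_coord_lift.
rewrite (ae_eq_integral (cst 0)) ?integral0//.
    apply: (@measurable_fun_fubini_tonelli_F _ _ _ _ _ _ (fun x : measurableTypeR R * 'rV[R]_D => (\1_[set x0 : 'rV[R]_D.+1 | x0 ord0 d = c] (insert_coord ord0 x.1 x.2))%:E)).
      exact: measurable_insert0 m1.
    by move=> x; rewrite lee_fin.
  exists [set c]; split; [exact: measurable_set1|exact: lebesgue_measure_set1|].
move=> t /= /not_implyP[_]; apply: contra_notP => tc.
rewrite integral0_eq// => y _; rewrite indicE memNset//= Ed insert_coord_ord0.
by move=> tc'; apply: tc.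
Qed.

(** B-splines, monomials and the bumps that test weak derivatives all have this form, so that facts
    on one variable lift to [R^D]. *)
Definition tens D (f : 'I_D -> R -> R) (x : 'rV[R]_D) : R := (\prod_d f d (x ord0 d))%R.

Lemma measurable_tens D (f : 'I_D -> R -> R) :
  (forall d, measurable_fun setT (f d)) -> measurable_fun setT (tens f).
Proof.
move=> mf; apply: measurable_prod => d _.
by apply: measurableT_comp => //; exact: measurable_coor.
Qed.

Lemma tens_insert D (f : 'I_D.+1 -> R -> R) t (y : 'rV[R]_D) :
  tens f (insert_coord ord0 t y) = (f ord0 t * tens (fun d => f (lift ord0 d)) y)%R.
Proof.
rewrite /tens big_ord_recl insert_coord_ord0; congr (_ * _)%R.
by apply: eq_bigr => d _; rewrite insert_coord_lift.
Qed.

Lemma integrable_tens D (f : 'I_D -> R -> R) :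
  (forall d, lebesgue_measure.-integrable setT (EFin \o f d : measurableTypeR R -> _)) ->
  (lebesgue_rV D).-integrable setT (EFin \o tens f) /\
  \int[lebesgue_rV D]_x (tens f x)%:E = (\prod_d \int[lebesgue_measure]_t f d t)%R%:E.
Proof.
elim: D f => [|D IH] f fi.
  have m1 : measurable_fun setT (EFin \o @tens 0 f).
    by apply/measurable_EFinP; apply: measurable_tens => -[].
  have E (g : 'rV[R]_0 -> \bar R) : measurable_fun setT g -> \int[lebesgue_rV 0]_x g x = g 0%R by exact: integral_rV0.
  split; last by rewrite E// /tens !big_ord0.
  apply/integrableP; split => //; rewrite E//; last exact: measurableT_comp.
  by rewrite /= ltry.
have [ig Eg] := IH (fun d => f (lift ord0 d)) (fun d => fi _).
set g := tens _ in ig Eg.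
have m1 : measurable_fun setT (EFin \o tens f).
  apply/measurable_EFinP; apply: measurable_tens => d.
  by apply/measurable_EFinP; case/integrableP: (fi d).
pose F (x : measurableTypeR R * 'rV[R]_D) := (f ord0 x.1 * g x.2)%:E.
have FE : F = (fun x => (tens f (insert_coord ord0 x.1 x.2))%:E).
  by apply/funext => x; rewrite tens_insert.
have mF : measurable_fun setT F by rewrite FE; exact: measurable_insert0 m1.
have iF : (@lebesgue_measure R \x lebesgue_rV D).-integrable setT F.
  apply/integrable12ltyP => //.
  have /integrableP[mg gfin] := ig.
  have /integrableP[mf0 ffin] := fi ord0.
  have E t : \int[lebesgue_rV D]_y `|F (t, y)| = `|f ord0 t|%:E * \int[lebesgue_rV D]_y `|(g y)%:E|.
    rewrite -ge0_integralZl//; last exact: measurableT_comp.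
    by apply: eq_integral => y _; rewrite /F /= normrM EFinM.
  under eq_integral do rewrite E.
  have m0 : measurable_fun setT (fun t : measurableTypeR R => `|f ord0 t|%:E).
    by rewrite (_ : (fun _ => _) = abse \o (EFin \o f ord0))//; exact: measurableT_comp.
  have c0 : 0 <= \int[lebesgue_rV D]_y `|(g y)%:E| by exact: integral_ge0.
  rewrite (ge0_integralZr _ measurableT m0)//.
  by apply: lte_mul_pinfty => //; [exact: integral_ge0|rewrite ge0_fin_numE//; exact: integral_ge0].
split; first by apply/integrable_rVS => //; rewrite -FE.
rewrite integral_rVS_int//.
transitivity (\int[@lebesgue_measure R \x lebesgue_rV D]_z F z); first by rewrite FE.
rewrite -integral12_prod_meas1//.
have E t : fubini_F (lebesgue_rV D) F t = (f ord0 t)%:E * (\prod_d \int[lebesgue_measure]_t f (lift ord0 d) t)%R%:E.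
  by rewrite -Eg -integralZl//; apply: eq_integral => y _; rewrite EFinM.
under eq_integral do rewrite E.
rewrite integralZr//; last exact: fi.
rewrite big_ord_recl EFinM; congr (_ * _).
by rewrite /Rintegral fineK//; exact: (integrable_fin_num measurableT (fi ord0)).
Qed.

End meas.

(** * Lp norms *)

Section LpGeneral.
Context d (T : measurableType d) {R : realType} (mu : {measure set T -> \bar R}).
Open Scope ereal_scope.

Lemma ge1_cases (p : \bar R) : 1 <= p -> p = +oo \/ exists2 r : R, p = r%:E & (1 <= r)%R.
Proof. by case: p => [r| |]//; [rewrite lee_fin => r1; right; exists r|left]. Qed.

Lemma le_poweR (r : R) (x y : \bar R) : (0 <= r)%R -> 0 <= x -> x <= y -> x `^ r <= y `^ r.
Proof.
move=> r0 x0 xy; apply: gt0_ler_poweR => //; rewrite in_itv/= ?x0 ?leey//.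
by rewrite (le_trans x0 xy).
Qed.

Lemma Lnorm_le_ae (p : \bar R) (f g : T -> \bar R) : 1 <= p ->
  measurable_fun setT f -> measurable_fun setT g ->
  {ae mu, forall x, `|f x| <= `|g x|} -> 'N[mu]_p[f] <= 'N[mu]_p[g].
Proof.
move=> /ge1_cases[->|[r -> r1]] mf mg fg; rewrite unlock /Lnorm.
  by case: ifPn => // _; apply: le_ess_sup.
have r0 : (0 <= r)%R by rewrite (le_trans _ r1).
apply: le_poweR; rewrite ?invr_ge0//; first by apply: integral_ge0 => x _; exact: poweR_ge0.
apply: ae_ge0_le_integral => //.
- by move=> x _; exact: poweR_ge0.
- by apply: (measurableT_comp (measurable_poweR _)); exact: measurableT_comp.
- by move=> x _; exact: poweR_ge0.
- by apply: (measurableT_comp (measurable_poweR _)); exact: measurableT_comp.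
- by apply: filterS fg => x fgx _; exact: le_poweR.
Qed.

Lemma Lnorm_eq_ae (p : \bar R) (f g : T -> \bar R) : 1 <= p ->
  measurable_fun setT f -> measurable_fun setT g ->
  {ae mu, forall x, f x = g x} -> 'N[mu]_p[f] = 'N[mu]_p[g].
Proof.
move=> p1 mf mg fg; apply/eqP; rewrite eq_le; apply/andP; split; apply: Lnorm_le_ae => //.
- by apply: filterS fg => x ->.
- by apply: filterS fg => x ->.
Qed.

Lemma Lnorm_fin_ae (p : \bar R) (f : T -> \bar R) : 1 <= p ->
  measurable_fun setT f -> (forall x, 0 <= f x) ->
  'N[mu]_p[f] < +oo -> {ae mu, forall x, f x \is a fin_num}.
Proof.
move=> /ge1_cases[->|[r -> r1]] mf f0; rewrite unlock /Lnorm.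
  (* By definition the norm of exponent infinity is 0 when the whole space is null; every property
     then holds almost everywhere. *)
  case: ifPn => [_ Nf|].
    apply: filterS (ess_sup_ge mu (abse \o f)) => x /= fx.
    by rewrite ge0_fin_numE// -[f x]gee0_abs// (le_lt_trans fx).
  rewrite lt0e measure_ge0 andbT negbK => /eqP mu0 _.
  by exists setT; split => //; exact: subsetT.
have r0 : (0 < r)%R by rewrite (lt_le_trans _ r1).
move=> Nf; have fin : \int[mu]_x `|f x| `^ r < +oo.
  by apply: (lty_poweRy _ Nf); rewrite gt_eqF// invr_gt0.
have : mu.-integrable setT (fun x => `|f x| `^ r).
  apply/integrableP; split.
    by apply: (measurableT_comp (measurable_poweR _)); exact: measurableT_comp.
  by under eq_integral do rewrite gee0_abs ?poweR_ge0//.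
move=> /(integrable_ae measurableT); apply: filterS => x /(_ I).
rewrite gee0_abs// ge0_fin_numE ?poweR_ge0// ge0_fin_numE// => fxr.
by apply: (lty_poweRy _ fxr); rewrite gt_eqF.
Qed.

(** Minkowski's inequality is applied to real-valued functions: a finite norm makes an
    extended-valued function finite almost everywhere, and an infinite norm makes the bound
    trivial. *)
Lemma Lnorm_add (p : \bar R) (f g : T -> \bar R) : 1 <= p ->
  measurable_fun setT f -> (forall x, 0 <= f x) ->
  measurable_fun setT g -> (forall x, 0 <= g x) ->
  'N[mu]_p[f \+ g] <= 'N[mu]_p[f] + 'N[mu]_p[g].
Proof.
move=> p1 mf f0 mg g0.
have [->|Nf] := eqVneq 'N[mu]_p[f] +oo; first by rewrite addye ?leey// gt_eqF// (lt_le_trans _ (Lnorm_ge0 _ _ _)).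
have [->|Ng] := eqVneq 'N[mu]_p[g] +oo; first by rewrite addey ?leey// gt_eqF// (lt_le_trans _ (Lnorm_ge0 _ _ _)).
rewrite -ltey in Nf; rewrite -ltey in Ng.
have ff := Lnorm_fin_ae p1 mf f0 Nf; have gf := Lnorm_fin_ae p1 mg g0 Ng.
pose f' := fine \o f; pose g' := fine \o g.
have mf' : measurable_fun setT f' by exact: measurableT_comp.
have mg' : measurable_fun setT g' by exact: measurableT_comp.
have Ef : {ae mu, forall x, f x = (EFin \o f') x} by apply: filterS ff => x fx; rewrite /f' /= fineK.
have Eg : {ae mu, forall x, g x = (EFin \o g') x} by apply: filterS gf => x fx; rewrite /g' /= fineK.
rewrite (Lnorm_eq_ae p1 mf _ Ef); last exact/measurable_EFinP.
rewrite (Lnorm_eq_ae p1 mg _ Eg); last exact/measurable_EFinP.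
rewrite (@Lnorm_eq_ae _ _ (EFin \o (f' \+ g')%R) p1).
- exact: eminkowski.
- exact: emeasurable_funD.
- by apply/measurable_EFinP; exact: measurable_funD.
- by apply: filterS2 Ef Eg => x /= -> ->.
Qed.

Lemma Lnorm_scale (p : \bar R) (c : R) (f : T -> \bar R) : 1 <= p -> (0 <= c)%R ->
  measurable_fun setT f -> Lnorm mu p (fun x => c%:E * f x) = c%:E * 'N[mu]_p[f].
Proof.
move=> /ge1_cases[->|[r -> r1]] c0 mf; rewrite unlock /Lnorm.
  case: ifPn => [mu0|_]; last by rewrite mule0.
  rewrite (_ : abse \o _ = cst c%:E \* (abse \o f)); last first.
    by apply/funext => x /=; rewrite abseM gee0_abs.
  exact: ess_supZl.
have r0 : (0 < r)%R by rewrite (lt_le_trans _ r1).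
under eq_integral do rewrite abseM gee0_abs// poweRM//.
rewrite ge0_integralZl//.
- rewrite poweRM ?poweR_ge0//; last by apply: integral_ge0 => x _; exact: poweR_ge0.
  by rewrite -poweRrM divff ?gt_eqF// poweRe1.
- by apply: (measurableT_comp (measurable_poweR _)); exact: measurableT_comp.
- by move=> x _; exact: poweR_ge0.
- exact: poweR_ge0.
Qed.

Lemma Lnorm_sum (p : \bar R) (I : Type) (s : seq I) (f : I -> T -> \bar R) : 1 <= p ->
  (forall i, measurable_fun setT (f i)) -> (forall i x, 0 <= f i x) ->
  Lnorm mu p (fun x => \sum_(i <- s) f i x) <= \sum_(i <- s) 'N[mu]_p[f i].
Proof.
move=> p1 mf f0; elim: s => [|i s IH].
  rewrite (_ : (fun _ => _) = cst 0); last by apply/funext => x; rewrite big_nil.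
  by rewrite Lnorm0 ?big_nil// gt_eqF// (lt_le_trans _ p1).
rewrite (_ : (fun _ => _) = f i \+ (fun x => \sum_(i <- s) f i x)); last by apply/funext => x; rewrite big_cons.
rewrite big_cons; apply: (le_trans (Lnorm_add p1 _ _ _ _)) => //.
- exact: emeasurable_sum.
- by move=> x; apply: sume_ge0.
- exact: leeD.
Qed.

(** Jensen's inequality for the power [r], obtained from Hoelder's inequality for [F] and the
    indicator of [W] with the exponents [r] and [r / (r - 1)]. *)
Lemma jensen_power (W : set T) (c r : R) (F : T -> \bar R) : measurable W ->
  (0 <= c)%R -> mu W = c%:E -> (1 <= r)%R -> measurable_fun setT F -> (forall x, 0 <= F x) ->
  (\int[mu]_(x in W) F x) `^ r <= (c `^ (r - 1))%:E * \int[mu]_(x in W) F x `^ r.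
Proof.
move=> mW c0 muW r1 mF F0.
have r0 : (0 < r)%R by rewrite (lt_le_trans _ r1).
have I0 : 0 <= \int[mu]_(x in W) F x `^ r by apply: integral_ge0 => x _; exact: poweR_ge0.
have mFr : measurable_fun setT (fun x => F x `^ r) by exact: (measurableT_comp (measurable_poweR _)).
have [E1|rn1] := eqVneq r 1%R.
  rewrite E1 subrr powRr0 mul1e poweRe1; last exact: integral_ge0.
  by under [leRHS]eq_integral do rewrite poweRe1//.
have {}r1 : (1 < r)%R by rewrite lt_neqAle eq_sym rn1.
have [c00|cn0] := eqVneq c 0%R.
  rewrite null_set_integral//; last by rewrite muW c00.
    by rewrite poweR0r ?gt_eqF// mule_ge0// lee_fin powR_ge0.
  exact: measurable_funTS.
have {}c0 : (0 < c)%R by rewrite lt_neqAle eq_sym cn0.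
have [->|Ify] := eqVneq (\int[mu]_(x in W) F x `^ r) +oo.
  by rewrite gt0_muley ?leey// lte_fin powR_gt0.
rewrite -ltey in Ify.
have ae1 : {ae mu, forall x, W x -> F x \is a fin_num}.
  have : mu.-integrable W (fun x => F x `^ r).
    apply/integrableP; split; first exact: measurable_funTS.
    by under eq_integral do rewrite gee0_abs ?poweR_ge0//.
  move=> /(integrable_ae mW); apply: filterS => x /[apply].
  rewrite ge0_fin_numE ?poweR_ge0// ge0_fin_numE// => fxr.
  by apply: (lty_poweRy _ fxr); rewrite gt_eqF.
pose f := (fine \o F) \_ W.
pose q := (r / (r - 1))%R.
have q0 : (0 < q)%R by rewrite divr_gt0// subr_gt0.
have rq : (r^-1 + q^-1 = 1)%R by rewrite /q invf_div; field; rewrite gt_eqF.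
have mf : measurable_fun setT f.
  apply/(measurable_restrictT _ _).1 => //; apply: measurable_funTS; exact: measurableT_comp.
have mW1 : measurable_fun setT (\1_W : T -> R) by exact: measurable_indic.
have := hoelder mu mf mW1 r0 q0 rq.
have -> : 'N[mu]_1[EFin \o (f \* \1_W)%R] = \int[mu]_(x in W) F x.
  rewrite Lnorm1 [RHS]integral_mkcond.
  apply: ae_eq_integral => //.
  - apply: measurableT_comp => //; apply/measurable_EFinP; exact: measurable_funM.
  - by apply/(measurable_restrictT _ _).1 => //; exact: measurable_funTS.
  apply: filterS ae1 => x fx _ /=; rewrite /f /patch indicE.
  case: ifPn => xW /=; last by rewrite mul0r normr0.
  by rewrite mulr1 -[RHS]gee0_abs// -(fineK (fx _))//; exact: set_mem xW.
have -> : 'N[mu]_r%:E[EFin \o f] = (\int[mu]_(x in W) F x `^ r) `^ r^-1.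
  rewrite unlock /Lnorm; congr (_ `^ _); rewrite [RHS]integral_mkcond.
  apply: ae_eq_integral => //.
  - by apply: (measurableT_comp (measurable_poweR _)); apply: measurableT_comp => //; exact/measurable_EFinP.
  - by apply/(measurable_restrictT _ _).1 => //; exact: measurable_funTS.
  apply: filterS ae1 => x fx _ /=; rewrite /f /patch.
  case: ifPn => xW /=; last by rewrite normr0 powR0// gt_eqF.
  by rewrite -[F x in RHS]gee0_abs// -(fineK (fx _))//; exact: set_mem xW.
have -> : 'N[mu]_q%:E[EFin \o (\1_W : T -> R)] = (c `^ q^-1)%:E.
  rewrite unlock /Lnorm -poweR_EFin; congr (_ `^ _).
  transitivity (\int[mu]_x (\1_W x : R)%:E).
    apply: eq_integral => x _ /=; rewrite indicE; case: (_ \in _) => /=.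
      by rewrite normr1 powR1.
    by rewrite normr0 powR0// gt_eqF.
  by rewrite integral_indic// setIT.
move=> H; have := le_poweR (ltW r0) (integral_ge0 _ (fun x _ => F0 x)) H.
move=> /le_trans; apply.
rewrite poweRM ?poweR_ge0//; last by rewrite lee_fin powR_ge0.
rewrite -poweRrM mulVf ?gt_eqF// poweRe1// muleC poweR_EFin -powRrM.
by have -> : (q^-1 * r = r - 1)%R by rewrite /q invf_div mulrVK// unitfE gt_eqF.
Qed.

(** Hoelder's inequality on a set of finite measure, with one constant for all [F]. It yields
    integrability on bounded sets from a finite [L^p] norm, and continuity of spline coefficients in
    the dual norm. *)
Lemma Lnorm_integral_le (p : \bar R) (W : set T) (c : R) : 1 <= p -> measurable W -> (0 <= c)%R -> mu W = c%:E ->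
  exists2 K : R, (0 <= K)%R & forall F : T -> \bar R, measurable_fun setT F -> (forall x, 0 <= F x) ->
  \int[mu]_(x in W) F x <= K%:E * 'N[mu]_p[F].
Proof.
move=> /ge1_cases[->|[r -> r1]] mW c0 muW.
  exists c => // F mF F0; have := Lnorm_ge0 mu +oo F; rewrite unlock /Lnorm; case: ifPn => [_ N0|+ _].
    rewrite muleC -muW -integral_cst//; apply: ae_ge0_le_integral => //.
    - exact: measurable_funTS.
    - apply: filterS (ess_sup_ge mu (abse \o F)) => x /= Fx _.
      by rewrite -[F x]gee0_abs.
  rewrite lt0e measure_ge0 andbT negbK => /eqP mu0.
  rewrite null_set_integral ?mule0//; first exact: measurable_funTS.
  exact: (subset_measure0 mW measurableT _ mu0).
have r0 : (0 < r)%R by exact: lt_le_trans r1.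
exists ((c `^ (r - 1)) `^ r^-1)%R; first exact: powR_ge0.
move=> F mF F0; have X0 : 0 <= \int[mu]_(x in W) F x by exact: integral_ge0.
have := jensen_power mW c0 muW r1 mF F0.
have r0V : (0 <= r^-1)%R by rewrite invr_ge0 ltW.
move=> /(le_poweR r0V (poweR_ge0 _ _)); rewrite -poweRrM divff ?gt_eqF// poweRe1// => h.
apply: le_trans h _; rewrite poweRM ?lee_fin ?powR_ge0//; last by apply: integral_ge0 => x _; exact: poweR_ge0.
rewrite poweR_EFin lee_wpmul2l ?lee_fin ?powR_ge0// unlock /Lnorm.
apply: le_poweR => //; first by apply: integral_ge0 => x _; exact: poweR_ge0.
under [leRHS]eq_integral do rewrite gee0_abs//.
apply: ge0_subset_integral => //; first exact: (measurableT_comp (measurable_poweR _)).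
by move=> x _; exact: poweR_ge0.
Qed.

Lemma Lnorm_lty_integral (p : \bar R) (W : set T) (c : R) (F : T -> \bar R) : 1 <= p ->
  measurable W -> (0 <= c)%R -> mu W = c%:E -> measurable_fun setT F -> (forall x, 0 <= F x) ->
  'N[mu]_p[F] < +oo -> \int[mu]_(x in W) F x < +oo.
Proof.
move=> p1 mW c0 muW mF F0 Nf; have [K K0 h] := Lnorm_integral_le p1 mW c0 muW.
by apply: le_lt_trans (h F mF F0) _; rewrite lte_mul_pinfty.
Qed.

End LpGeneral.

(** * Averages over translates *)

Section averaging.
Context {R : realType} (D : nat) d (T : measurableType d).
Context (nu : {sigma_finite_measure set T -> \bar R}).
Open Scope ereal_scope.
Variables (W : set T) (c : R) (tau : T -> 'rV[R]_D) (G : 'rV[R]_D -> \bar R).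
Hypotheses (mW : measurable W) (c0 : (0 <= c)%R) (nuW : nu W = c%:E).
Hypotheses (mtau : measurable_fun setT tau) (mG : measurable_fun setT G) (G0 : forall x, 0 <= G x).

Lemma measurable_add_rV : measurable_fun setT (fun z : 'rV[R]_D * T => (z.1 + tau z.2)%R).
Proof.
apply: measurable_rV => i; under eq_fun do rewrite mxE.
apply: measurable_funD.
  exact: (measurableT_comp (measurable_coor i)).
by apply: (measurableT_comp (measurable_coor i)); exact: (measurableT_comp mtau).
Qed.

(** The indicator turns an average over [W] into an integral over the whole space, to which
    Tonelli's theorem applies. The parameter [h] lets one computation serve the average itself, its
    powers and a truncation. *)
Let G2 (h : \bar R -> \bar R) (z : 'rV[R]_D * T) := h (G (z.1 + tau z.2)) * (\1_W z.2)%:E.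

Let mG2 h : measurable_fun setT h -> measurable_fun setT (G2 h).
Proof.
move=> mh; apply: emeasurable_funM.
  by apply: (measurableT_comp mh); apply: (measurableT_comp mG); exact: measurable_add_rV.
apply/measurable_EFinP.
by apply: (@measurableT_comp _ _ _ _ _ _ (\1_W : T -> R)).
Qed.

Let EG2 h x : \int[nu]_(t in W) h (G (x + tau t)) = \int[nu]_t G2 h (x, t).
Proof.
rewrite integral_mkcond; apply: eq_integral => t _.
by rewrite /patch /G2 indicE /=; case: ifPn; rewrite ?mule1 ?mule0.
Qed.

Let G20 (h : \bar R -> \bar R) : (forall y, 0 <= y -> 0 <= h y) -> forall z, 0 <= G2 h z.
Proof. by move=> h0 z; apply: mule_ge0; [exact/h0|rewrite lee_fin]. Qed.

Lemma measurable_avg (h : \bar R -> \bar R) : measurable_fun setT h -> (forall y, 0 <= y -> 0 <= h y) ->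
  measurable_fun setT (fun x : 'rV[R]_D => \int[nu]_(t in W) h (G (x + tau t))).
Proof.
move=> mh h0; under eq_fun do rewrite EG2.
exact: (@measurable_fun_fubini_tonelli_F _ _ _ _ _ nu (G2 h) (mG2 mh) (G20 h0)).
Qed.

Lemma avg_fubini (h : \bar R -> \bar R) : measurable_fun setT h -> (forall y, 0 <= y -> 0 <= h y) ->
  \int[lebesgue_rV D]_x \int[nu]_(t in W) h (G (x + tau t)) = c%:E * \int[lebesgue_rV D]_x h (G x).
Proof.
move=> mh h0.
under eq_integral do rewrite EG2.
rewrite (fubini_tonelli _ (mG2 mh) (G20 h0)).
have mhG : measurable_fun setT (h \o G) by exact: measurableT_comp.
have E t : \int[lebesgue_rV D]_x G2 h (x, t) = (\int[lebesgue_rV D]_x h (G x)) * (\1_W t)%:E.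
  rewrite /G2 /= ge0_integralZr//; last 2 first.
  - by apply: (measurableT_comp mh); apply: (measurableT_comp mG); exact: measurable_translate.
  - by move=> x _; exact: h0.
  by rewrite (integral_translate (tau t) mhG (fun x => h0 _ (G0 x))).
under eq_integral do rewrite E.
rewrite ge0_integralZl//.
- have -> : \int[nu]_t (\1_W t)%:E = c%:E by rewrite integral_indic// setIT; exact: nuW.
  by rewrite muleC.
- by apply/measurable_EFinP.
- by apply: integral_ge0 => x _; exact: h0.
Qed.

(** Minkowski's integral inequality for translates. For finite [p], Jensen's inequality under the
    integral, then Tonelli and translation invariance; the exponent infinity is treated through the
    excess over the essential supremum. *)
Lemma Lnorm_avg (p : \bar R) : 1 <= p ->
  Lnorm (lebesgue_rV D) p (fun x : 'rV[R]_D => \int[nu]_(t in W) G (x + tau t)) <= c%:E * 'N[lebesgue_rV D]_p[G].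
Proof.
have mA := measurable_avg (@measurable_id _ _ setT) (fun y y0 => y0).
move=> /ge1_cases[->|[r -> r1]]; rewrite unlock /Lnorm.
  case: ifPn => [mu0|_]; last by rewrite mule0.
  set s := ess_sup _ (abse \o G).
  have s0 : 0 <= s by apply: ess_sup_gee => //; apply/nearW => x; exact: abse_ge0.
  have [cz|cn0] := eqVneq c 0%R.
    rewrite cz mul0e; apply/ess_supP; apply/nearW => x /=.
    have nuW0 : nu W = 0 by rewrite -[LHS]/(nu W) nuW cz.
    rewrite (null_set_integral mW _ nuW0) ?abse0//.
    apply: measurable_funTS; apply: (measurableT_comp mG).
    exact: (measurableT_comp measurable_add_rV (measurable_pair1 x)).
  have {}cn0 : (0 < c)%R by rewrite lt_neqAle eq_sym cn0.
  have [->|] := eqVneq s +oo.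
    by rewrite gt0_muley ?leey// lte_fin.
  rewrite -ltey => sy.
  have sfin : s \is a fin_num by rewrite ge0_fin_numE.
  (* [h] is the excess over the essential supremum [s]. It vanishes almost everywhere along [G], so
     its average over translates has integral zero, and for almost every [x] the average of [G] is
     at most [c * s]. *)
  pose h (y : \bar R) : \bar R := maxe (y - s) 0.
  have mh : measurable_fun setT h.
    by apply: measurable_maxe => //; exact: emeasurable_funB.
  have h0 y : 0 <= y -> 0 <= h y by move=> _; rewrite le_max lexx orbT.
  have I0 : \int[lebesgue_rV D]_x h (G x) = 0.
    rewrite (ae_eq_integral (cst 0)) ?integral0//; first exact: measurableT_comp.
    apply: filterS (ess_sup_ge (lebesgue_rV D) (abse \o G)) => x /= Gx _.
    by apply/max_idPr; rewrite sube_le0 -[G x]gee0_abs.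
  have := avg_fubini mh h0; rewrite I0 mule0 => H.
  have mH := measurable_avg mh h0.
  have H0 x : 0 <= \int[nu]_(t in W) h (G (x + tau t)) by apply: integral_ge0 => t _; exact: h0.
  have ae0 : ae_eq (lebesgue_rV D) setT (fun x : 'rV[R]_D => \int[nu]_(t in W) h (G (x + tau t))) (cst 0).
    apply/(ae_eq_integral_abs _ measurableT mH).
    by under eq_integral do rewrite gee0_abs//.
  apply/ess_supP; apply: filterS ae0 => x /(_ I) /= Hx.
  rewrite gee0_abs; last by apply: integral_ge0.
  apply: (@le_trans _ _ (\int[nu]_(t in W) (s + h (G (x + tau t))))).
    apply: ge0_le_integral => //.
    - apply: measurable_funTS; apply: (measurableT_comp mG).
      exact: (measurableT_comp measurable_add_rV (measurable_pair1 x)).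
    - apply: measurable_funTS; apply: emeasurable_funD => //; apply: (measurableT_comp mh); apply: (measurableT_comp mG).
      exact: (measurableT_comp measurable_add_rV (measurable_pair1 x)).
    - move=> t _; rewrite /h -leeBlDl//; by rewrite le_max lexx.
  rewrite ge0_integralD//; last 2 first.
  - by move=> t _; exact: h0.
  - apply: measurable_funTS; apply: (measurableT_comp mh); apply: (measurableT_comp mG).
    exact: (measurableT_comp measurable_add_rV (measurable_pair1 x)).
  by rewrite Hx adde0 integral_cst// muleC -nuW.
have r0 : (0 < r)%R by rewrite (lt_le_trans _ r1).
have mp : measurable_fun setT (fun y : \bar R => y `^ r) by exact: measurable_poweR.
have p0 (y : \bar R) : 0 <= y -> 0 <= y `^ r by move=> _; exact: poweR_ge0.
have A0 x : 0 <= \int[nu]_(t in W) G (x + tau t) by apply: integral_ge0.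
under eq_integral do rewrite gee0_abs//.
under [X in _ <= _ * X `^ _]eq_integral do rewrite gee0_abs//.
have Jr : 0 <= \int[lebesgue_rV D]_x G x `^ r by apply: integral_ge0 => x _; exact: poweR_ge0.
(* Writing [c] as an [r]-th root allows a comparison under the root: the factor [c ^ (r - 1)] comes
   from Jensen's inequality, the other factor [c] from Tonelli. *)
have -> : c%:E = ((c `^ (r - 1))%:E * c%:E) `^ r^-1.
  rewrite -EFinM poweR_EFin -{3}(powRr1 c0) -powRD; last by rewrite subrK gt_eqF.
  by rewrite subrK -powRrM divff ?gt_eqF// powRr1.
rewrite -poweRM//; last by rewrite -EFinM lee_fin mulr_ge0// powR_ge0.
apply: le_poweR; first by rewrite invr_ge0 ltW.
  by apply: integral_ge0 => x _; exact: poweR_ge0.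
rewrite -muleA -(avg_fubini mp p0) -ge0_integralZl//; last 3 first.
- exact: (measurable_avg mp p0).
- by move=> x _; apply: integral_ge0 => t _; exact: p0.
- by rewrite lee_fin powR_ge0.
apply: ge0_le_integral => //.
- by move=> x _; exact: poweR_ge0.
- exact: (measurableT_comp mp).
- by apply: measurable_funeM; exact: (measurable_avg mp p0).
- move=> x _; apply: jensen_power => //.
  apply: (measurableT_comp mG).
  exact: (measurableT_comp measurable_add_rV (measurable_pair1 x)).
Qed.

End averaging.

(** * Smooth tensor products *)

Section Smooth1.
Context {R : realType}.

Fixpoint Cm (m : nat) (f : R -> R) : Prop :=
  if m is m'.+1 then (forall x, derivable f x 1) /\ Cm m' (derive1 f) else continuous f.

Definition smooth f := forall m, Cm m f.

Lemma Cm_continuous m f : Cm m f -> continuous f.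
Proof.
by case: m => [//|m] [df _] x; apply: differentiable_continuous; exact/derivable1_diffP.
Qed.

Lemma CmW m f : Cm m.+1 f -> Cm m f.
Proof.
elim: m f => [|m IH] f; first exact: Cm_continuous.
by move=> [df Cf]; split => //; exact: IH.
Qed.

Lemma smooth_family (P : (R -> R) -> Prop) :
  (forall f, P f -> (forall x, derivable f x 1) /\ P (derive1 f)) -> forall f, P f -> smooth f.
Proof.
move=> Pd f Pf m; elim: m f Pf => [|m IH] f Pf.
  by move=> x; apply: differentiable_continuous; apply/derivable1_diffP; exact: (Pd _ Pf).1.
by have [df Pf'] := Pd _ Pf; split => //; exact: IH.
Qed.

Lemma Cm_add m f g : Cm m f -> Cm m g -> Cm m (fun x => f x + g x).
Proof.
elim: m f g => [|m IH] f g /=; first by move=> cf cg x; apply: cvgD; [exact: cf|exact: cg].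
move=> [df Cf] [dg Cg]; split; first by move=> x; apply: derivableD.
rewrite (_ : derive1 _ = fun x => derive1 f x + derive1 g x); first exact: IH.
by apply/funext => x; rewrite !derive1E deriveD.
Qed.

Lemma Cm_cst m (c : R) : Cm m (fun=> c).
Proof.
elim: m c => [|m IH] c /=; first by move=> x; exact: cvg_cst.
split; first by move=> x; exact: derivable_cst.
rewrite (_ : derive1 _ = fun=> 0); first exact: IH.
by apply/funext => x; rewrite derive1E derive_cst.
Qed.

Lemma Cm_mul m f g : Cm m f -> Cm m g -> Cm m (fun x => f x * g x).
Proof.
elim: m f g => [|m IH] f g; first by move=> cf cg x; apply: cvgM; [exact: cf|exact: cg].
move=> Cf Cg; have [df Cf'] := Cf; have [dg Cg'] := Cg; split; first by move=> x; apply: derivableM.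
rewrite (_ : derive1 _ = fun x => f x * derive1 g x + g x * derive1 f x); last first.
  by apply/funext => x; rewrite !derive1E deriveM.
by apply: Cm_add; apply: IH => //; exact: CmW.
Qed.

Lemma derive_affine (f : R -> R) (c e x : R) : derivable f (c * x + e) 1 ->
  is_derive x 1 (fun y => f (c * y + e)) (c * (derive1 f) (c * x + e)).
Proof.
move=> df.
have dg : is_derive x 1 (fun y : R => c * y + e) c.
  have := is_derive_poly (c *: 'X + e%:P) x.
  by rewrite derivD derivZ derivX derivC addr0 hornerZ hornerC mulr1; congr (is_derive _ _ _ _); apply/funext => y; rewrite !hornerE.
have df' : is_derive (c * x + e) 1 f (derive1 f (c * x + e)) by rewrite derive1E; exact/derivableP.
by rewrite mulrC; exact: (@is_derive1_comp _ f (fun y => c * y + e) x _ _ df' dg).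
Qed.

Lemma Cm_affine m f (c e : R) : Cm m f -> Cm m (fun x => f (c * x + e)).
Proof.
elim: m f => [|m IH] f.
  move=> cf x; apply: (@continuous_comp _ _ _ (fun y => c * y + e) f); last exact: cf.
  by apply: cvgD; [apply: cvgMr; exact: cvg_id|exact: cvg_cst].
move=> [df Cf]; split; first by move=> x; have [] := derive_affine (df (c * x + e)).
rewrite (_ : derive1 _ = fun x => c * (derive1 f) (c * x + e)).
  by apply: Cm_mul; [exact: Cm_cst|exact: IH].
by apply/funext => x; rewrite derive1E; have [_ ->] := derive_affine (df (c * x + e)).
Qed.

Lemma Cm_horner m (p : {poly R}) : Cm m (fun x => p.[x]).
Proof.
elim: m p => [|m IH] p; first by move=> x; exact: continuous_horner.
split; first by move=> x; exact: derivable_horner.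
rewrite (_ : derive1 _ = fun x => p^`().[x]) //.
by rewrite derivE.
Qed.

(* [flat q] is [q(1/t) exp(-1/t)] extended by 0; this family is closed under
   differentiation. *)
Definition flat (q : {poly R}) (t : R) : R :=
  if 0 < t then q.[t^-1] * expR (- t^-1) else 0.

(** The bound [s^n exp(-s) <= n!] keeps a single term of the exponential series. *)
Lemma expN_horner_bounded (q : {poly R}) : exists2 C : R, 0 <= C &
  forall s, 0 < s -> `|q.[s] * expR (- s)| <= C.
Proof.
have mono n (s : R) : 0 < s -> s ^+ n * expR (- s) <= n`!%:R.
  move=> s0; rewrite expRN ler_pdivrMr ?expR_gt0//.
  case: n => [|n]; first by rewrite expr0 fact0 mul1r (le_trans _ (expR_ge1Dx _))// lerDl ltW.
  rewrite -ler_pdivrMl ?ltr0n ?fact_gt0// mulrC (le_trans _ (expR_ge1Dxn n (ltW s0)))//.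
  by rewrite lerDr ler01.
exists (\sum_(i < size q) `|q`_i| * i`!%:R).
  by apply: sumr_ge0 => i _; rewrite mulr_ge0.
move=> s s0; rewrite horner_coef mulr_suml (le_trans (ler_norm_sum _ _ _))//.
apply: ler_sum => i _; rewrite -mulrA normrM ler_wpM2l// ger0_norm; first exact: mono.
by rewrite mulr_ge0 ?exprn_ge0 ?expR_ge0// ltW.
Qed.

(** Away from 0 this is the chain rule for [q(1/t) exp(-1/t)]. At 0 the boundedness of
    [s^2 q(s) exp(-s)] gives a quadratic bound for [flat q], which forces the difference quotients
    to 0. *)
Lemma flat_derive (q : {poly R}) (t : R) : is_derive t 1 (flat q) (flat ('X^2 * (q - q^`())) t).
Proof.
have [t0|t0|->] := ltgtP t 0.
- have E : \near t, flat q t = (cst 0 : R -> R) t.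
    near=> u; rewrite /flat ifF//; apply/negbTE; rewrite -leNgt ltW//.
    by near: u; exact: lt_nbhsl.
  have -> : flat ('X^2 * (q - q^`())) t = 0 by rewrite /flat ltNge ltW.
  apply: (@near_eq_is_derive _ _ _ (cst 0)) => //.
  by apply: filterS E => u ->.
- pose g (u : R) := q.[u^-1] * expR (- u^-1).
  have E : \near t, flat q t = g t.
    by near=> u; rewrite /flat ifT//; near: u; exact: lt_nbhsr.
  apply: (@near_eq_is_derive _ _ _ g) => //; first by apply: filterS E => u ->.
  have t1 : t != 0 by rewrite gt_eqF.
  have dV : is_derive t 1 (fun u : R => u^-1) (- t^-2).
    have := @is_deriveV R idfun t 1 1 t1 (is_derive_id t 1).
    by rewrite /GRing.scale /= mulr1.
  have dq : is_derive t 1 (fun u : R => q.[u^-1]) (q^`().[t^-1] * - t^-2).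
    have dh : is_derive t^-1 1 (horner q) q^`().[t^-1] by exact: is_derive_poly.
    exact: (is_derive1_comp dh dV).
  have dN : is_derive t 1 (fun u : R => - u^-1) (t^-2).
    by apply: is_derive_eq; rewrite opprK.
  have de : is_derive t 1 (fun u : R => expR (- u^-1)) (expR (- t^-1) * t^-2).
    exact: (is_derive1_comp (is_derive_expR _) dN).
  rewrite /flat t0; apply: is_derive_eq.
  rewrite -![_ *: _]/(_ * _) hornerM hornerXn hornerD hornerN -!exprVn; ring.
- have [C C0 HC] := expN_horner_bounded ('X^2 * q).
  have -> : flat ('X^2 * (q - q^`())) 0 = 0 by rewrite /flat ltxx.
  have f0 : flat q 0 = 0 by rewrite /flat ltxx.
  have B (h : R) : `|flat q h| <= C * `|h| ^+ 2.
    rewrite /flat; case: ifPn => [h0|_]; last by rewrite normr0 mulr_ge0// exprn_ge0.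
    have := HC h^-1; rewrite invr_gt0 => /(_ h0).
    move=> H; have hn : h != 0 by rewrite gt_eqF.
    have -> : q.[h^-1] * expR (- h^-1) = h ^+ 2 * (('X^2 * q).[h^-1] * expR (- h^-1)).
      by rewrite hornerM hornerXn; field.
    by rewrite normrM normrX mulrC ler_wpM2r// exprn_ge0.
  have cv : (fun h : R => h^-1 *: ((flat q \o shift 0) (h *: 1) - flat q 0)) @ 0^' --> (0 : R).
    apply/cvgr0Pnorm_le => e e0; near=> h.
    rewrite /= f0 subr0 addr0 /GRing.scale /= mulr1 normrM normfV.
    have h0 : h != 0 by near: h; exact: nbhs_dnbhs_neq.
    rewrite ler_pdivrMl ?normr_gt0//; apply: (le_trans (B h)).
    rewrite expr2 mulrA mulrC ler_wpM2l//.
    apply: (@le_trans _ _ ((C + 1) * `|h|)); first by rewrite ler_wpM2r// lerDl ler01.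
    rewrite -ler_pdivlMl ?ltr_wpDl//.
    near: h; apply: dnbhs0_le; by rewrite mulr_gt0// invr_gt0 ltr_wpDl.
  apply: DeriveDef; first by apply/cvg_ex; exists 0.
  exact: cvg_lim.
Unshelve. all: by end_near. Qed.

Lemma smooth_flat q : smooth (flat q).
Proof.
apply: (@smooth_family (fun f => exists q, f = flat q)); last by exists q.
move=> f [r ->]; split; first by move=> x; have [] := flat_derive r x.
exists ('X^2 * (r - r^`())); apply/funext => x; rewrite derive1E.
by have [_ ->] := flat_derive r x.
Qed.

(** The factor [m.+1] steepens both flanks, so that the bumps, with values between 0 and 1, converge
    pointwise to the indicator of the open interval. *)
Definition bump (a b : R) (m : nat) (t : R) : R :=
  flat 1 (m.+1%:R * t + - (m.+1%:R * a)) * flat 1 (- m.+1%:R * t + m.+1%:R * b).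

Lemma smooth_bump a b m : smooth (bump a b m).
Proof. by move=> k; apply: Cm_mul; apply: Cm_affine; exact: smooth_flat. Qed.

Lemma flat1_ge0_le1 (t : R) : 0 <= flat 1 t <= 1.
Proof.
rewrite /flat; case: ifPn => [t0|_]; last by rewrite lexx ler01.
rewrite hornerE mul1r expR_ge0/= -expR0 ler_expR oppr_le0 invr_ge0; exact: ltW.
Qed.

Lemma bump_ge0_le1 a b m t : 0 <= bump a b m t <= 1.
Proof.
rewrite /bump; have /andP[p0 p1] := flat1_ge0_le1 (m.+1%:R * t + - (m.+1%:R * a)).
have /andP[q0 q1] := flat1_ge0_le1 (- m.+1%:R * t + m.+1%:R * b).
by rewrite mulr_ge0//= mulr_ile1.
Qed.

Lemma bump_out (a b : R) m (t : R) : ~~ (a < t < b) -> bump a b m t = 0.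
Proof.
rewrite negb_and -!leNgt => /orP[ta|tb]; rewrite /bump.
  by rewrite /flat ltNge -mulrBr pmulr_rle0// subr_le0 ta/= mul0r.
by rewrite mulrC {1}/flat ltNge mulNr addrC -mulrBr pmulr_rle0// subr_le0 tb/= mul0r.
Qed.

Lemma flat1_cvg (t : R) : 0 < t -> (fun m : nat => flat 1 (m.+1%:R * t)) @ \oo --> (1 : R).
Proof.
move=> t0; rewrite [X in X @ _](_ : _ = fun m : nat => expR (- (m.+1%:R^-1 * t^-1))); last first.
  by apply/funext => m; rewrite /flat pmulr_rgt0// t0 hornerE mul1r invfM.
rewrite -[X in _ --> X]expR0; apply: continuous_cvg; first exact: continuous_expR.
rewrite -[X in _ --> X]oppr0; apply: cvgN; rewrite -(mul0r t^-1).
by apply: cvgMl; exact: cvg_harmonic.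
Qed.

Lemma bump_cvg (a b t : R) : (fun m => bump a b m t) @ \oo --> ((nat_of_bool (a < t < b)%R)%:R : R).
Proof.
have [/andP[ta tb]|nab] := boolP (a < t < b); last first.
  rewrite [X in X @ _](_ : _ = cst 0); first exact: cvg_cst.
  by apply/funext => m; exact: bump_out.
rewrite -[X in _ --> X]mulr1.
rewrite [X in X @ _](_ : _ = (fun m : nat => flat 1 (m.+1%:R * (t - a)) * flat 1 (m.+1%:R * (b - t)))).
  by apply: cvgM; apply: flat1_cvg; rewrite subr_gt0.
by apply/funext => m; rewrite /bump; congr (flat 1 _ * flat 1 _); ring.
Qed.

End Smooth1.

Section Tens.
Context {R : realType} (D : nat).
Implicit Types (f : 'I_D -> R -> R).

Definition upd f (d : 'I_D) (g : R -> R) : 'I_D -> R -> R :=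
  fun e => if e == d then g else f e.

Lemma tensD1 f (d : 'I_D) (x : 'rV[R]_D) :
  tens f x = f d (x ord0 d) * \prod_(e | e != d) f e (x ord0 e).
Proof. by rewrite /tens (bigD1 d). Qed.

Lemma tens_upd f (d : 'I_D) g (x : 'rV[R]_D) :
  tens (upd f d g) x = g (x ord0 d) * \prod_(e | e != d) f e (x ord0 e).
Proof.
rewrite (tensD1 _ d) /upd eqxx; congr (_ * _); apply: eq_bigr => e /negbTE ed.
by rewrite ed.
Qed.

Lemma unit_vecE (d e : 'I_D) (t : R) (x : 'rV[R]_D) :
  (t *: unit_vec d + x) ord0 e = (if e == d then t else 0) + x ord0 e.
Proof. by rewrite !mxE /=; case: eqP; rewrite ?mulr1 ?mulr0. Qed.

Lemma tens_line f (d : 'I_D) (t : R) (x : 'rV[R]_D) :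
  tens f (t *: unit_vec d + x) = f d (t + x ord0 d) * \prod_(e | e != d) f e (x ord0 e).
Proof.
rewrite (tensD1 _ d) unit_vecE eqxx; congr (_ * _); apply: eq_bigr => e /negbTE ed.
by rewrite unit_vecE ed add0r.
Qed.

Lemma is_derive_tens f (d : 'I_D) (x : 'rV[R]_D) : derivable (f d) (x ord0 d) 1 ->
  is_derive x (unit_vec d) (tens f) (tens (upd f d (derive1 (f d))) x).
Proof.
move=> df; set c := \prod_(e | e != d) f e (x ord0 e).
have E : (fun h : R => h^-1 *: ((tens f \o shift x) (h *: unit_vec d) - tens f x)) =
    (fun h : R => c *: (h^-1 *: ((f d \o shift (x ord0 d)) (h *: 1) - f d (x ord0 d)))).
  apply/funext => h /=; rewrite tens_line (tensD1 _ d) -/c [h *: 1]mulr1 /GRing.scale /=; ring.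
have cv : (fun h : R => h^-1 *: ((tens f \o shift x) (h *: unit_vec d) - tens f x)) @ 0^'
    --> tens (upd f d (derive1 (f d))) x.
  rewrite E tens_upd -/c mulrC; apply: cvgMr.
  by rewrite derive1E; exact: df.
by apply: DeriveDef; [apply/cvg_ex; eexists; exact: cv|exact: cvg_lim].
Qed.

Lemma continuous_coord (d : 'I_D) : continuous (fun x : 'rV[R]_D => x ord0 d).
Proof. exact: coord_continuous. Qed.

Lemma continuous_tens f : (forall d, continuous (f d)) -> continuous (tens f).
Proof.
move=> cf; rewrite /tens; elim: (index_enum _) => [|d s IH].
  rewrite (_ : (fun _ => _) = cst 1); first exact: cst_continuous.
  by apply/funext => x; rewrite big_nil.
rewrite (_ : (fun _ => _) = (fun x : 'rV[R]_D => f d (x ord0 d) * \prod_(e <- s) f e (x ord0 e))).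
  move=> x; apply: continuousM; last exact: IH.
  by apply: (@continuous_comp _ _ _ (fun x : 'rV[R]_D => x ord0 d) (f d)); [exact: coord_continuous|exact: cf].
by apply/funext => x; rewrite big_cons.
Qed.

Lemma class_C_tens m f : (forall d, Cm m (f d)) -> class_C m (tens f).
Proof.
elim: m f => [|m IH] f Cf /=; first exact: continuous_tens.
split; first by apply: continuous_tens => d; exact: (@Cm_continuous _ m.+1).
move=> d; split => [x|].
  by have [] := is_derive_tens (f := f) (d := d) (x := x) ((Cf d).1 _).
rewrite (_ : (fun _ => _) = tens (upd f d (derive1 (f d)))); last first.
  by apply/funext => x; have [_ ->] := is_derive_tens (f := f) (d := d) (x := x) ((Cf d).1 _).
apply: IH => e; rewrite /upd; case: eqP => [_|_]; first exact: (Cf d).2.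
exact: CmW.
Qed.

Definition smooth_tens f := forall d, smooth (f d).

Lemma smooth_derive1 (g : R -> R) : smooth g -> smooth (derive1 g).
Proof. by move=> sg m; exact: (sg m.+1).2. Qed.

Lemma smooth_derive1n (g : R -> R) m : smooth g -> smooth (derive1n m g).
Proof. by move=> sg; elim: m => //= m IH; exact: smooth_derive1. Qed.

Lemma smooth_derivable (g : R -> R) x : smooth g -> derivable g x 1.
Proof. by move=> sg; exact: (sg 1%N).1. Qed.

Lemma smooth_upd f d (g : R -> R) : smooth_tens f -> smooth g -> smooth_tens (upd f d g).
Proof. by move=> sf sg e; rewrite /upd; case: eqP. Qed.

Lemma iter_derive_tens f d m : smooth_tens f ->
  iter m (fun h x => 'D_(unit_vec d) h x) (tens f) = tens (upd f d (derive1n m (f d))).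
Proof.
move=> sf; elim: m => [|m IH] /=.
  by congr tens; apply/funext => e; rewrite /upd; case: eqP => // ->.
rewrite IH; apply/funext => x.
have sg : smooth_tens (upd f d (derive1n m (f d))) by apply: smooth_upd => //; exact: smooth_derive1n.
have [_ ->] := is_derive_tens (f := upd f d (derive1n m (f d))) (d := d) (x := x) (@smooth_derivable _ _ (sg d)).
congr (tens _ _); apply/funext => e; rewrite /upd; case: eqP => // _.
by rewrite eqxx.
Qed.

Lemma partial_tens (al : multi_index D) f : smooth_tens f ->
  partial al (tens f) = tens (fun d => derive1n (al d) (f d)).
Proof.
move=> sf; rewrite /partial.
have H (s : seq 'I_D) : uniq s -> foldr (fun d g => iter (al d) (fun h x => 'D_(unit_vec d) h x) g) (tens f) s =
    tens (fun d => if d \in s then derive1n (al d) (f d) else f d).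
  elim: s => [//|d s IH] /= /andP[ds us]; rewrite IH// iter_derive_tens.
    congr tens; apply/funext => e; rewrite /upd inE; case: eqP => //= ->.
    by rewrite (negbTE ds).
  by move=> e; case: ifP => // _; exact: smooth_derive1n.
by rewrite H ?enum_uniq//; congr tens; apply/funext => d; rewrite mem_enum.
Qed.

Lemma derive1_zero (g : R -> R) (a b t : R) : (forall u, ~~ (a <= u <= b) -> g u = 0) ->
  ~~ (a <= t <= b) -> derive1 g t = 0.
Proof.
move=> g0 nt; rewrite derive1E.
have E : \near t, g t = (cst 0 : R -> R) t.
  move: nt; rewrite negb_and -!ltNge => /orP[ta|tb].
    near=> u; apply: g0; rewrite negb_and -!ltNge; apply/orP; left.
    by near: u; exact: lt_nbhsl.
  near=> u; apply: g0; rewrite negb_and -!ltNge; apply/orP; right.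
  by near: u; exact: lt_nbhsr.
by rewrite (near_eq_derive _ E) ?derive_cst.
Unshelve. all: by end_near. Qed.

Definition supp_in (f : 'I_D -> R -> R) (a b : 'rV[R]_D) :=
  forall d t, ~~ (a ord0 d <= t <= b ord0 d) -> f d t = 0.

Lemma tens_supp f a b (x : 'rV[R]_D) : supp_in f a b -> ~ cbox a b x -> tens f x = 0.
Proof.
move=> sf nx; have [d nd] : exists d, ~~ (a ord0 d <= x ord0 d <= b ord0 d).
  apply: contrapT => H; apply: nx => d; apply: contrapT => /negP nd; apply: H; by exists d.
by rewrite (tensD1 _ d) sf// mul0r.
Qed.

Lemma test_function_tens (Om : set 'rV[R]_D) f a b : smooth_tens f -> supp_in f a b ->
  cbox a b `<=` Om -> test_function Om (tens f).
Proof.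
move=> sf supp ab; have cl : closure [set x | tens f x != 0] `<=` cbox a b.
  rewrite [X in _ `<=` X]((closure_id _).1 (closed_cbox (a := a) (b := b))).
  apply: closureS => x /= fx; apply: contrapT => nx; move: fx.
  by rewrite (tens_supp supp nx) eqxx.
split; first by move=> m; apply: class_C_tens => d; exact: sf.
  by apply: (subclosed_compact _ (compact_cbox (a := a) (b := b)) cl); exact: closed_closure.
exact: subset_trans cl ab.
Qed.

End Tens.

(** * Fundamental lemma of the calculus of variations on boxes *)

Section Fundamental.
Context {R : realType} (D : nat).
Notation mu := (lebesgue_rV D).
Notation V := ('rV[R]_D).
Open Scope ereal_scope.

Definition oboxes : set (set V) := [set A | exists a b : V, A = obox a b].

Lemma obox_setI (a b a' b' : V) : obox a b `&` obox a' b' =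
  obox (\row_d Num.max (a ord0 d) (a' ord0 d))%R (\row_d Num.min (b ord0 d) (b' ord0 d))%R.
Proof.
apply/seteqP; split => [x [abx abx'] d|x abx]; last first.
  by split => d; have := abx d; rewrite !mxE gt_max lt_min => /andP[/andP[h1 h2] /andP[h3 h4]]; apply/andP.
by rewrite !mxE gt_max lt_min; have /andP[-> ->] := abx d; have /andP[-> ->] := abx' d.
Qed.

Lemma setI_closed_oboxes : setI_closed oboxes.
Proof. by move=> _ _ [a [b ->]] [a' [b' ->]]; rewrite obox_setI; do 2 eexists. Qed.

Lemma rV_norm_bound (x : V) : exists N : nat, forall d, (`|x ord0 d| < N%:R)%R.
Proof.
exists (Num.truncn (\sum_d `|x ord0 d|)%R).+1 => d.
apply: le_lt_trans (truncnS_gt _).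
by rewrite (bigD1 d)//= lerDl sumr_ge0.
Qed.

(** The preimage of an interval under one coordinate is the union of boxes that grow in the other
    directions. *)
Lemma measurable_oboxes : @measurable _ V = <<s oboxes >>.
Proof.
apply/seteqP; split; last first.
  apply: smallest_sub; first exact: sigma_algebra_measurable.
  by move=> _ [a [b ->]]; exact: measurable_obox.
apply: smallest_sub; first exact: smallest_sigma_algebra.
suff H (i : 'I_D) : preimage_set_system setT (fun x : V => x ord0 i) measurable `<=` <<s oboxes>>.
  by rewrite -bigcup_seq; apply: bigcup_sub => i _; exact: H.
have mi : measurable_fun (setT : set (g_sigma_algebraType oboxes)) (fun x : V => x ord0 i).
  apply: (measurability _ (RGenOpens.measurableE R)).
  move=> _ [_ [u [v ->]] <-].
  rewrite (_ : _ `&` _ = \bigcup_(N : nat)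
      obox (\row_d if d == i then u else (- N%:R)%R) (\row_d if d == i then v else (N%:R)%R)).
    by apply: bigcup_measurable => N _; apply: sub_sigma_algebra; do 2 eexists.
  apply/seteqP; split => [x [_]|x [N _ xN]]; last first.
    by split => //=; have := xN i; rewrite !mxE eqxx in_itv.
  rewrite /= in_itv/= => uv; have [N HN] := rV_norm_bound x; exists N => // d.
  rewrite !mxE; case: eqP => [->//|_]; have := HN d.
  by rewrite ltr_norml.
by move=> _ [Y mY <-]; exact: mi.
Qed.

(** Open boxes are closed under intersection and the sets on which the charge with density [h]
    vanishes form a Dynkin system. The whole space belongs to it because [h] is zero outside one
    box. *)
Lemma integral_oboxes_eq0 (h : V -> R) (u v : V) : mu.-integrable setT (EFin \o h) ->
  (forall x, ~ obox u v x -> h x = 0%R) ->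
  (forall a b : V, \int[mu]_(x in obox a b) (h x)%:E = 0) ->
  {ae mu, forall x, h x = 0%R}.
Proof.
move=> ih huv H.
pose nu := induced_charge ih.
have nuE A : nu A = \int[mu]_(x in A) (h x)%:E by [].
have nuT : nu setT = 0.
  rewrite nuE -(H u v) [RHS]integral_mkcond; apply: eq_integral => x _.
  by rewrite /patch; case: ifPn => // /negP xu; rewrite huv// => /mem_set.
have all0 (S : set V) : measurable S -> nu S = 0.
  move=> mS; have : <<s oboxes >> S by rewrite -measurable_oboxes.
  apply: (dynkin_induction measurable_oboxes setI_closed_oboxes (P := fun S => nu S = 0)) => //.
  - by move=> _ [a [b ->]]; exact: H.
  - move=> A mA A0; have := chargeD nu measurableT mA; rewrite setTD setTI => E.
    have E' : nu (~` A) = nu setT - nu A := E.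
    by rewrite E' nuT A0 sube0.
  - move=> F mF tF F0.
    have := @charge_semi_sigma_additive _ _ _ nu F mF tF (bigcup_measurable (fun k _ => mF k)).
    under eq_fun do rewrite big1//.
    move=> /(cvg_unique _) => /(_ (@ereal_hausdorff _)) /(_ 0 (cvg_cst _)) E.
    exact: E.
have := @integral_ae_eq _ V R mu setT measurableT (cst 0) _ ih (@measurable_cst _ _ _ _ setT 0).
have H0 : forall E : set V, E `<=` setT -> measurable E -> \int[mu]_(x in E) (EFin \o h) x = \int[mu]_(x in E) cst 0 x.
  by move=> E _ mE; rewrite integral0; exact: all0.
by move=> /(_ H0); apply: filterS => x /(_ I) [].
Qed.

Lemma compact_integrable_bounded (a b : V) (f : V -> R) (C : R) : measurable_fun setT f ->
  (forall x, cbox a b x -> `|f x| <= C)%R -> mu (cbox a b) < +oo -> mu.-integrable (cbox a b) (EFin \o f).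
Proof.
move=> mf fC fin; apply: measurable_bounded_integrable => //; [exact: measurable_cbox|exact: measurable_funTS|].
by exists C; split; [exact: num_real|move=> M CM x /fC /le_trans; apply; exact: ltW].
Qed.

(* Tensor products of bumps converge boundedly to indicators of boxes. *)
Lemma fundamental_box (a b : V) (h : V -> R) : mu.-integrable setT (EFin \o h \_ (obox a b)) ->
  (forall f, smooth_tens f -> (forall d t, ~~ (a ord0 d < t < b ord0 d)%R -> f d t = 0%R) ->
    \int[mu]_(x in obox a b) (h x * tens f x)%:E = 0) ->
  {ae mu, forall x, obox a b x -> h x = 0%R}.
Proof.
move=> ih H; pose hB := h \_ (obox a b).
have mhB : measurable_fun setT hB by apply/measurable_EFinP; case/integrableP: ih.
suff : {ae mu, forall x, hB x = 0%R}.
  by apply: filterS => x; rewrite /hB /patch => + abx; rewrite mem_set.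
apply: (@integral_oboxes_eq0 _ a b ih).
  by move=> x nx; rewrite /hB /patch memNset.
move=> a' b'.
(* The box [a', b'] is intersected with the support box, so that the bumps are admissible in [H]. *)
pose a2 : V := (\row_d Num.max (a ord0 d) (a' ord0 d))%R.
pose b2 : V := (\row_d Num.min (b ord0 d) (b' ord0 d))%R.
pose phi m (d : 'I_D) := bump (a2 ord0 d) (b2 ord0 d) m.
have phi0 m : \int[mu]_x (hB x * tens (phi m) x)%:E = 0.
  rewrite -(H (phi m)).
  - rewrite [RHS]integral_mkcond; apply: eq_integral => x _.
    by rewrite /hB /patch; case: ifPn => // _; rewrite mul0r.
  - by move=> d; exact: smooth_bump.
  - move=> d t nt; apply: bump_out; apply: contra nt; rewrite /a2 /b2 !mxE gt_max lt_min.
    by move=> /andP[/andP[-> _] /andP[-> _]].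
have phi01 m x : (0 <= tens (phi m) x <= 1)%R.
  rewrite prodr_ge0/= ?prodr_ile1// => d _; have /andP[] := bump_ge0_le1 (a2 ord0 d) (b2 ord0 d) m (x ord0 d) => //.
  by move=> -> ->.
have mphi m : measurable_fun setT (tens (phi m)).
  apply: continuous_measurable_rV; apply: continuous_tens => d; exact: (@Cm_continuous _ 0%N _ (smooth_bump _ _ _ 0%N)).
have cvphi x : tens (phi m) x @[m --> \oo] --> ((\1_(obox a2 b2) x)%R : R).
  rewrite indicE.
  have -> : ((x \in obox a2 b2)%:R = \prod_d (nat_of_bool (a2 ord0 d < x ord0 d < b2 ord0 d)%R)%:R :> R)%R.
    have [|nx] := boolP (x \in obox a2 b2).
      by move=> /set_mem xab; rewrite big1// => d _; rewrite xab.
    have [d nd] : exists d, ~~ (a2 ord0 d < x ord0 d < b2 ord0 d)%R.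
      apply: contrapT => K; move/negP: nx; apply; apply/mem_set => d.
      by apply: contrapT => /negP nd; apply: K; exists d.
    by rewrite (bigD1 d)//= (negbTE nd) mul0r.
  rewrite /tens; elim: (index_enum _) => [|d s IH].
    by under eq_fun do rewrite big_nil; rewrite big_nil; exact: cvg_cst.
  under eq_fun do rewrite big_cons; rewrite big_cons.
  by apply: cvgM => //; exact: bump_cvg.
have m1 m : measurable_fun setT (fun x => (hB x * tens (phi m) x)%:E).
  by apply/measurable_EFinP; exact: measurable_funM.
have m2 : measurable_fun setT (fun x => (hB x * \1_(obox a2 b2) x)%:E).
  by apply/measurable_EFinP; apply: measurable_funM => //; apply: measurable_indic; exact: measurable_obox.
have c1 : {ae mu, forall x, setT x -> (hB x * tens (phi m) x)%:E @[m --> \oo] --> (hB x * \1_(obox a2 b2) x)%:E}.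
  apply/nearW => x _; apply: cvg_EFin; first exact: nearW.
  by apply: cvgMr; exact: cvphi.
have d1 : {ae mu, forall x, forall m, setT x -> `|(hB x * tens (phi m) x)%:E| <= `|(hB x)%:E|}.
  apply/nearW => x m _; rewrite /= lee_fin normrM ler_piMr//.
  by have /andP[p0 p1] := phi01 m x; rewrite ger0_norm.
have [_ _] := dominated_convergence measurableT m1 m2 c1 (integrable_abse ih) d1.
under eq_fun do rewrite phi0.
move=> /(cvg_unique _) => /(_ (@ereal_hausdorff _)) /(_ 0 (cvg_cst _)) E.
rewrite -E [LHS]integral_mkcond; apply: eq_integral => x _.
rewrite /patch indicE -obox_setI in_setI; case: ifPn => xa'; last first.
  by rewrite andbF mulr0.
by rewrite andbT /hB /patch; case: ifPn; rewrite ?mulr1 ?mul0r.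
Qed.

End Fundamental.

(** * Translations of weakly differentiable functions *)

Section ACL.
Context {R : realType} (D : nat).
Notation mu := (lebesgue_rV D).
Notation leb := (@lebesgue_measure R).
Notation V := ('rV[R]_D).
Open Scope ereal_scope.

Definition locint (h : V -> R) :=
  measurable_fun setT h /\ forall a b : V, mu.-integrable (cbox a b) (EFin \o h).

(** Weak derivative of first order on the whole space, tested by smooth tensor products with support
    in a box. This weak form of the definition is all that the estimates along lines require. *)
Definition wpart (d : 'I_D) (h hd : V -> R) := forall f (a b : V),
  smooth_tens f -> supp_in f a b ->
  \int[mu]_x (h x * tens (upd f d (derive1 (f d))) x)%:E = - \int[mu]_x (hd x * tens f x)%:E.

Lemma integrable_prod2 d1 d2 (T1 : measurableType d1) (T2 : measurableType d2)
   (m1 : {sigma_finite_measure set T1 -> \bar R}) (m2 : {sigma_finite_measure set T2 -> \bar R})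
   (f : T1 -> R) (g : T2 -> R) : m1.-integrable setT (EFin \o f) -> m2.-integrable setT (EFin \o g) ->
  (m1 \x m2).-integrable setT (fun z => (f z.1 * g z.2)%:E).
Proof.
move=> /integrableP[mf fi] /integrableP[mg gi].
have mf' : measurable_fun setT f by apply/measurable_EFinP.
have mg' : measurable_fun setT g by apply/measurable_EFinP.
apply/integrable12ltyP.
  apply/measurable_EFinP; apply: measurable_funM.
    exact: measurableT_comp mf' measurable_fst.
  exact: measurableT_comp mg' measurable_snd.
have E t : \int[m2]_y `|(f t * g y)%:E| = `|f t|%:E * \int[m2]_y `|(g y)%:E|.
  rewrite -ge0_integralZl//; last exact: measurableT_comp.
  by apply: eq_integral => y _; rewrite /= normrM EFinM.
under eq_integral do rewrite E.
have m0 : measurable_fun setT (fun t => `|f t|%:E).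
  by apply/measurable_EFinP; exact: measurableT_comp.
have c0 : 0 <= \int[m2]_y `|(g y)%:E| by exact: integral_ge0.
rewrite (ge0_integralZr _ measurableT m0)//.
by apply: lte_mul_pinfty => //; [exact: integral_ge0|rewrite ge0_fin_numE//; exact: integral_ge0].
Qed.

Lemma integrable_dom d0 (T : measurableType d0) (m : {measure set T -> \bar R}) (f g : T -> R) :
  measurable_fun setT f -> m.-integrable setT (EFin \o g) -> (forall x, `|f x| <= `|g x|)%R ->
  m.-integrable setT (EFin \o f).
Proof.
move=> mf ig fg; apply: (le_integrable measurableT _ _ ig); first exact/measurable_EFinP.
by move=> x _; rewrite /= lee_fin fg.
Qed.

Lemma locint_patch (h : V -> R) (a b : V) : locint h ->
  mu.-integrable setT (EFin \o (fun x => \1_(cbox a b) x * h x)%R).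
Proof.
move=> [mh ih]; have /integrable_mkcond := ih a b => /(_ (measurable_cbox a b)).
congr (integrable _ _ _); apply/funext => x; rewrite /patch /= indicE.
by case: ifPn => _; rewrite ?mul1r ?mul0r.
Qed.

Lemma locint_mul (h g : V -> R) (a b : V) (C : R) : locint h -> measurable_fun setT g ->
  (forall x, `|g x| <= C)%R -> (forall x, ~ cbox a b x -> g x = 0%R) ->
  mu.-integrable setT (fun x => (h x * g x)%:E).
Proof.
move=> lh mg gC g0; have := @integrableZl _ _ _ mu _ measurableT C _ (locint_patch a b lh).
rewrite (_ : (fun _ => _) = EFin \o (fun x => C * (\1_(cbox a b) x * h x))%R)//.
move=> ig; apply: (integrable_dom (f := fun x => (h x * g x)%R) _ ig).
  by apply: measurable_funM => //; exact: lh.1.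
move=> x; rewrite indicE; have [/set_mem xab|/negP xab] := boolP (x \in _).
  rewrite mul1r mulrC !normrM ler_wpM2r//.
  by rewrite (le_trans (gC x))// ler_norm.
by rewrite g0 ?mulr0 ?normr0// => /mem_set.
Qed.

Lemma measurable_translatel (v : V) : measurable_fun setT (fun x : V => (v + x)%R).
Proof. by rewrite (_ : (fun _ => _) = fun x => x + v)%R; [exact: measurable_translate|apply/funext => x; rewrite addrC]. Qed.

Lemma integral_translate_int (v : V) (f : V -> \bar R) : measurable_fun setT f ->
  \int[mu]_x f (x + v)%R = \int[mu]_x f x.
Proof.
move=> mf; rewrite integralE [RHS]integralE.
rewrite -(integral_translate v (measurable_funepos mf) (fun x => funepos_ge0 f x)).
rewrite -(integral_translate v (measurable_funeneg mf) (fun x => funeneg_ge0 f x)).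
by congr (_ - _); apply: eq_integral => x _; rewrite ?funeposE ?funenegE.
Qed.

Lemma FTC_shift (g : R -> R) (u t : R) : smooth g -> (0 < t)%R ->
  \int[leb]_(s in [set` `[0%R, t]]) (derive1 g (u - s))%:E = (g u - g (u - t))%:E.
Proof.
move=> sg t0.
pose G (s : R) := (- g (u - s))%R.
have dG (s : R) : is_derive s 1%R G (derive1 g (u - s))%R.
  have := @derive_affine _ g (-1)%R u s (@smooth_derivable _ _ _ sg).
  rewrite (_ : (fun y => g (-1 * y + u))%R = fun y => g (u - y)%R); last first.
    by apply/funext => y; rewrite mulN1r addrC.
  move=> H; have H2 : is_derive s 1%R G (- (-1 * derive1 g (-1 * s + u)))%R := is_deriveN H.
  by apply: (is_derive_eq H2); rewrite !mulN1r opprK addrC.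
have cg : continuous (fun s => derive1 g (u - s)%R).
  move=> s; apply: (@continuous_comp _ _ _ (fun s => u - s)%R (derive1 g)).
    by apply: continuousB; [exact: cst_continuous|move=> ?; exact: cvg_id].
  exact: (Cm_continuous (smooth_derive1 sg 0%N)).
rewrite (@continuous_FTC2 _ (fun s => derive1 g (u - s)%R) G 0 t t0).
- by rewrite /G subr0 -EFinB; congr EFin; ring.
- exact: continuous_subspaceT.
- have cG s : {for s, continuous G} by apply: differentiable_continuous; apply/derivable1_diffP; case: (dG s).
  split.
  + by move=> s _; case: (dG s).
  + by apply: cvg_at_right_filter; exact: cG.
  + by apply: cvg_at_left_filter; exact: cG.
- by move=> s _; rewrite derive1E; have [_ ->] := dG s.
Qed.

Lemma continuous_bounded_cbox (f : V -> R) (a b : V) : continuous f ->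
  exists C : R, forall x, cbox a b x -> (`|f x| <= C)%R.
Proof.
move=> cf; have /compact_bounded[N [_ NP]] : compact (f @` cbox a b).
  by apply: continuous_compact (@compact_cbox _ _ a b); exact: continuous_subspaceT.
by exists (N + 1)%R => x xab; apply: (NP (N + 1)%R); [rewrite ltrDl|exists x].
Qed.

Lemma bounded_cbox_supp (phi : V -> R) (a b : V) : continuous phi -> (forall x, ~ cbox a b x -> phi x = 0%R) ->
  exists2 C : R, (0 <= C)%R & forall x, (`|phi x| <= C)%R.
Proof.
move=> cphi s; have [C CP] := continuous_bounded_cbox a b cphi.
exists (Num.max C 0)%R; first by rewrite le_max lexx orbT.
move=> x; have [xab|nx] := pselect (cbox a b x); first by rewrite le_max CP.
by rewrite s// normr0 le_max lexx orbT.
Qed.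

Lemma tens_bounded f (a b : V) : (forall d, continuous (f d)) -> supp_in f a b ->
  exists2 C : R, (0 <= C)%R & forall x : V, (`|tens f x| <= C)%R.
Proof. by move=> cf sf; exact: bounded_cbox_supp (continuous_tens cf) (fun x => tens_supp sf). Qed.

Lemma measurable_line (d : 'I_D) (c : R) :
  measurable_fun setT (fun z : V * measurableTypeR R => ((c * z.2) *: unit_vec d + z.1)%R).
Proof.
apply: measurable_rV => e; under eq_fun do rewrite unit_vecE.
apply: measurable_funD; last exact: (measurableT_comp (measurable_coor e)).
case: (e == d); last exact: measurable_cst.
by apply: measurable_funM => //; exact: measurable_snd.
Qed.

Definition shift_tens (d : 'I_D) (f : 'I_D -> R -> R) (s : R) := upd f d (fun u => f d (u - s)%R).

Lemma tens_shift d f s x : tens (shift_tens d f s) x = tens f (- s *: unit_vec d + x)%R.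
Proof. by rewrite /shift_tens tens_upd tens_line addrC. Qed.

Lemma smooth_shift (g : R -> R) s : smooth g -> smooth (fun u => g (u - s)%R).
Proof.
move=> sg m; rewrite (_ : (fun _ => _) = fun u => g (1 * u + - s)%R); first exact: Cm_affine.
by apply/funext => u; rewrite mul1r.
Qed.

Lemma derive1_shift (g : R -> R) s : smooth g -> derive1 (fun u => g (u - s)%R) = fun u => derive1 g (u - s)%R.
Proof.
move=> sg; apply/funext => x; rewrite derive1E.
have := @derive_affine _ g 1%R (- s)%R x (@smooth_derivable _ _ _ sg).
rewrite (_ : (fun y => g (1 * y + - s))%R = fun y => g (y - s)%R); last first.
  by apply/funext => y; rewrite mul1r.
by move=> [_ ->]; rewrite !mul1r.
Qed.

(** The increment of the test function is the integral of its derivative along a segment. After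
    Fubini the weak derivative is taken against each translate of the test function, and the
    translation is moved to [hd]. *)
Lemma line_integral_fubini (h hd : V -> R) (d : 'I_D) (t : R) f (a b : V) :
  locint h -> locint hd -> wpart d h hd -> (0 < t)%R -> smooth_tens f -> supp_in f a b ->
  \int[mu]_x (h x * (tens f (- t *: unit_vec d + x) - tens f x))%:E =
  \int[leb]_(s in [set` `[0%R, t]]) \int[mu]_x (hd (s *: unit_vec d + x)%R * tens f x)%:E.
Proof.
move=> lh lhd wp t0 sf suf.
pose f' := upd f d (derive1 (f d)).
have sf' : smooth_tens f' by apply: smooth_upd => //; exact: smooth_derive1.
have suf' : supp_in f' a b.
  move=> e u nu; rewrite /f' /upd; case: eqP => [E|_]; last exact: suf.
  by rewrite E in nu; exact: (derive1_zero (fun v => suf d v) nu).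
have cf' e : continuous (f' e) := Cm_continuous (sf' e 0%N).
have [C C0 HC] := tens_bounded cf' suf'.
pose b2 : V := (\row_e (b ord0 e + t))%R.
(* Integrated first in [s], this gives the increment of the test function ([E1]); integrated first
   in [x], it gives the translated weak derivative ([E2]). The box [b2] contains the supports of all
   translates. *)
pose A (z : V * measurableTypeR R) := (- h z.1 * tens f' (- z.2 *: unit_vec d + z.1) * \1_[set` `[0%R, t]] z.2)%R.
have mA : measurable_fun setT A.
  apply: measurable_funM; last by apply: measurableT_comp => //; exact: measurable_snd.
  apply: measurable_funM; first by apply: measurableT_comp => //; exact: (measurableT_comp lh.1 measurable_fst).
  apply: measurableT_comp; first by apply: continuous_measurable_rV; exact: continuous_tens.
  by have := measurable_line d (-1); under eq_fun do rewrite mulN1r.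
have iA : (mu \x leb).-integrable setT (EFin \o A).
  have i1 : leb.-integrable setT (EFin \o (\1_[set` `[0%R, t]] : R -> R)).
    apply/integrableP; split; first by apply/measurable_EFinP; exact: measurable_indic.
    under eq_integral do rewrite /= ger0_norm//.
    have L : leb [set` `[0%R, t]] = t%:E by rewrite lebesgue_measure_itv/= lte_fin t0 oppr0 adde0.
    by rewrite integral_indic// setIT -[X in X < _]/(leb _) L ltry.
  have := integrableZl measurableT C (integrable_prod2 (locint_patch a b2 lh) i1).
  move=> ip; apply: (@integrable_dom _ (V * measurableTypeR R)%type (mu \x leb) A
    (fun z => C * ((\1_(cbox a b2) z.1 * h z.1) * \1_[set` `[0%R, t]] z.2))%R mA); first exact: ip.
  move=> [x s]; rewrite /A /= !indicE; have [|] := boolP (s \in _); last by rewrite !mulr0.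
  rewrite inE/= in_itv/= !mulr1 => /andP[s0 st].
  have [/set_mem xab|/negP xab] := boolP (x \in _).
    rewrite mul1r mulrC !normrM normrN ler_wpM2r//.
    by rewrite (le_trans (HC _))// ler_norm.
  rewrite (tens_supp suf') ?mulr0 ?normr0// => abx; apply: xab; apply/mem_set => e.
  have := abx e; rewrite unit_vecE mxE; case: eqP => _ /andP[? ?]; and_lra.
have E1 x : \int[leb]_s (A (x, s))%:E = (h x * (tens f (- t *: unit_vec d + x) - tens f x))%:E.
  transitivity (\int[leb]_(s in [set` `[0%R, t]]) ((- h x * \prod_(e | e != d) f e (x ord0 e))%:E * (derive1 (f d) (x ord0 d - s))%:E)).
    rewrite [RHS]integral_mkcond; apply: eq_integral => s _; rewrite /A /patch indicE /=.
    case: ifPn => _; last by rewrite mulr0.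
    rewrite mulr1 -EFinM; congr EFin; rewrite tens_line /f' {1}/upd eqxx [(- s + _)%R]addrC.
    rewrite -[RHS]mulrA; congr (_ * _)%R; rewrite [RHS]mulrC; congr (_ * _)%R.
    by apply: eq_bigr => e /negbTE ed; rewrite /upd ed.
  have cg : continuous (fun s => derive1 (f d) (x ord0 d - s)%R).
    move=> s; apply: (@continuous_comp _ _ _ (fun s => x ord0 d - s)%R (derive1 (f d))).
      by apply: continuousB; [exact: cst_continuous|move=> ?; exact: cvg_id].
    exact: (Cm_continuous (smooth_derive1 (sf d) 0%N)).
  rewrite integralZl//; last first.
    by apply: continuous_compact_integrable; [exact: segment_compact|exact: continuous_subspaceT].
  rewrite FTC_shift// -EFinM tens_line (tensD1 _ d) [(- t + _)%R]addrC; congr EFin; ring.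
have E2 s : \int[mu]_x (A (x, s))%:E = ((fun s => \int[mu]_x (hd (s *: unit_vec d + x)%R * tens f x)%:E) \_ [set` `[0%R, t]]) s.
  rewrite /patch; have [|ns] := boolP (s \in _); last first.
    by rewrite integral0_eq// => x _; rewrite /A indicE/= (negbTE ns) mulr0.
  move=> sin; move: (sin); rewrite inE/= in_itv/= => /andP[s0 st].
  have ss : smooth_tens (shift_tens d f s) by apply: smooth_upd => //; exact: smooth_shift.
  have sus : supp_in (shift_tens d f s) a b2.
    move=> e u; rewrite /b2 mxE => nu; rewrite /shift_tens /upd; case: eqP => [E|_]; apply: suf; apply: contra nu.
      by rewrite E => /andP[? ?]; and_lra.
    by move=> /andP[? ?]; and_lra.
  have := wp _ _ _ ss sus.
  have -> : upd (shift_tens d f s) d (derive1 (shift_tens d f s d)) = shift_tens d f' s.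
    apply/funext => e; rewrite /shift_tens /f' /upd; case: eqP => // _.
    by rewrite eqxx derive1_shift.
  have cs' e : continuous (shift_tens d f' s e).
    by apply: (@Cm_continuous _ 0%N); move: e 0%N; apply: smooth_upd => //; exact: smooth_shift.
  have sus' : supp_in (shift_tens d f' s) a b2.
    move=> e u; rewrite /b2 mxE => nu; rewrite /shift_tens {1}/upd; case: eqP => [E|_]; apply: suf'; apply: contra nu.
      by rewrite E => /andP[? ?]; and_lra.
    by move=> /andP[? ?]; and_lra.
  have [C' C'0 HC'] := tens_bounded cs' sus'.
  have ih := locint_mul lh (continuous_measurable_rV (continuous_tens cs')) HC' (fun x => tens_supp sus').
  move=> E; have E' : \int[mu]_x (A (x, s))%:E = - \int[mu]_x (h x * tens (shift_tens d f' s) x)%:E.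
    rewrite -[RHS]mulN1e -integralZl//; apply: eq_integral => x _.
    by rewrite /A /= indicE sin mulr1 -EFinM tens_shift mulN1r mulNr.
  rewrite E' E oppeK.
  have mg : measurable_fun setT (fun x : V => (hd x * tens f (- s *: unit_vec d + x))%:E).
    apply/measurable_EFinP; apply: measurable_funM; first exact: lhd.1.
    apply: (measurableT_comp (f := tens f)).
      by apply: continuous_measurable_rV; apply: continuous_tens => e; exact: (Cm_continuous (sf e 0%N)).
    exact: measurable_translatel.
  under [LHS]eq_integral do rewrite tens_shift.
  rewrite -[LHS](integral_translate_int (s *: unit_vec d) mg).
  by apply: eq_integral => x _; rewrite [(x + _)%R]addrC addrA scaleNr addNr add0r.
rewrite [RHS]integral_mkcond.
transitivity (\int[mu]_x \int[leb]_s (A (x, s))%:E); first by apply: eq_integral => x _; rewrite E1.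
transitivity (\int[leb]_s \int[mu]_x (A (x, s))%:E); first exact: (Fubini iA).
by apply: eq_integral => s _; exact: E2.
Qed.

(** The increment of [h] minus the line integral of [hd] vanishes against all tensor products of
    bumps by [line_integral_fubini], hence almost everywhere by the fundamental lemma; the estimate
    follows from this identity. *)
Lemma ACL (h hd : V -> R) (d : 'I_D) (t : R) : locint h -> locint hd -> wpart d h hd -> (0 < t)%R ->
  {ae mu, forall x, `|h (t *: unit_vec d + x) - h x|%:E <=
    \int[leb]_(s in [set` `[0%R, t]]) `|hd (s *: unit_vec d + x)|%:E}.
Proof.
move=> lh lhd wp t0.
suff H (N : nat) : {ae mu, forall x, obox (\row_e - N%:R)%R (\row_e N%:R)%R x -> `|h (t *: unit_vec d + x) - h x|%:E <=
    \int[leb]_(s in [set` `[0%R, t]]) `|hd (s *: unit_vec d + x)|%:E}.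
  have := ae_foralln H; apply: filterS => x Hx; have [N HN] := rV_norm_bound x.
  by apply: (Hx N) => e; rewrite !mxE -ltr_norml.
set a : V := (\row_e - N%:R)%R; set b : V := (\row_e N%:R)%R.
pose b2 : V := (\row_e (b ord0 e + t))%R.
pose k (z : V * measurableTypeR R) := (\1_(cbox a b) z.1 * hd (z.2 *: unit_vec d + z.1) * \1_[set` `[0%R, t]] z.2)%R.
have mk : measurable_fun setT k.
  apply: measurable_funM; last by apply: measurableT_comp => //; exact: measurable_snd.
  apply: measurable_funM.
    apply: measurableT_comp; last exact: measurable_fst.
    by apply: measurable_indic; exact: measurable_cbox.
  apply: (measurableT_comp lhd.1).
  by have := measurable_line d 1; under eq_fun do rewrite mul1r.
have ab2 x s : cbox a b x -> (0 <= s <= t)%R -> cbox a b2 (s *: unit_vec d + x)%R.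
  move=> abx /andP[s0 st] e; have /andP[? ?] := abx e; rewrite unit_vecE [b2 _ _]mxE.
  by case: eqP => _; and_lra.
have ihd := locint_patch a b2 lhd.
set hd2 := fun x => _ in ihd.
pose c0 := \int[mu]_x `|(hd2 x)%:E|.
have c0fin : c0 < +oo by case/integrableP: ihd.
have c00 : 0 <= c0 by exact: integral_ge0.
have mhd2 : measurable_fun setT (fun x : V => `|(hd2 x)%:E|).
  by apply: measurableT_comp => //; case/integrableP: ihd.
have kle x s : (`|k (x, s)| <= `|hd2 (x + s *: unit_vec d)| * \1_[set` `[0%R, t]] s)%R.
  rewrite /k /hd2 !indicE; have [sin|_] := boolP (s \in _); last by rewrite !mulr0 normr0.
  rewrite !mulr1 addrC; have [/set_mem xab|_] := boolP (x \in _); last by rewrite mul0r normr0.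
  by rewrite mul1r mem_set ?mul1r//= addrC; apply: ab2 => //; move: sin; rewrite inE/= in_itv.
have ik : (mu \x leb).-integrable setT (EFin \o k).
  apply/integrable21ltyP; first exact/measurable_EFinP.
  apply: (@le_lt_trans _ _ (\int[leb]_s (c0 * (\1_[set` `[0%R, t]] s)%:E))).
    apply: ge0_le_integral => //.
    - by move=> s _; exact: integral_ge0.
    - apply: (@measurable_fun_fubini_tonelli_G _ _ _ _ _ mu (fun z => `|(k z)%:E|)) => //.
      by apply: measurableT_comp => //; exact/measurable_EFinP.
    - by apply: measurable_funeM; apply/measurable_EFinP; exact: measurable_indic.
    move=> s _; rewrite muleC /c0 -(integral_translate (s *: unit_vec d) mhd2)//.
    have m3 : measurable_fun setT (fun x : V => `|(hd2 (x + s *: unit_vec d)%R)%:E|).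
      exact: (measurableT_comp mhd2 (measurable_translate _)).
    rewrite -ge0_integralZl//.
    apply: ge0_le_integral => //.
    - apply: measurableT_comp => //; apply/measurable_EFinP.
      exact: (measurableT_comp mk (measurable_pair2 s)).
    - exact: measurable_funeM.
    - by move=> x _; rewrite -EFinM lee_fin mulrC; exact: kle.
  rewrite ge0_integralZl//; last by apply/measurable_EFinP; exact: measurable_indic.
  have L : leb [set` `[0%R, t]] = t%:E by rewrite lebesgue_measure_itv/= lte_fin t0 oppr0 adde0.
  rewrite integral_indic// setIT -[X in _ * X]/(leb _) L.
  by rewrite lte_mul_pinfty// ?ge0_fin_numE// ltry.
pose I (x : V) := \int[leb]_s (k (x, s))%:E.
have iI : mu.-integrable setT I := integrable_fubini_F ik.
have mI : measurable_fun setT I by case/integrableP: iI.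
have mfI : measurable_fun setT (fun x => fine (I x)) by exact: measurableT_comp.
have ifI : mu.-integrable setT (EFin \o (fine \o I)).
  apply: (le_integrable measurableT _ _ iI); first exact/measurable_EFinP.
  by move=> x _ /=; case: (I x) => [r| |] //=; rewrite ?normr0 leey.
have lht : locint (fun x => h (t *: unit_vec d + x)%R).
  have mht : measurable_fun setT (fun x : V => h (t *: unit_vec d + x)%R).
    by apply: (measurableT_comp lh.1); exact: measurable_translatel.
  split => // u v; pose w := (t *: unit_vec d : V).
  apply/integrable_mkcond; first exact: measurable_cbox.
  have /integrableP[mp fp] := locint_patch (u + w) (v + w) lh.
  have mp' : measurable_fun setT (fun x : V => (\1_(cbox (u + w) (v + w)) (x + w) * h (x + w))%:E)%R.
    exact: (measurableT_comp mp (measurable_translate w)).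
  have ip : mu.-integrable setT (fun x : V => (\1_(cbox (u + w) (v + w)) (x + w) * h (x + w))%:E)%R.
    apply/integrableP; split => //.
    have ma : measurable_fun setT (fun x : V => `|(\1_(cbox (u + w) (v + w))%R x * h x)%R%:E|).
      exact: measurableT_comp.
    by rewrite (integral_translate w ma).
  move: ip; congr (integrable _ _ _); apply/funext => x; rewrite /patch indicE /= [(w + x)%R]addrC.
  have -> : (x + w \in cbox (u + w) (v + w))%R = (x \in cbox u v).
    by apply/idP/idP; rewrite !inE => xuv e; have := xuv e; rewrite !mxE => /andP[? ?]; and_lra.
  by case: ifP; rewrite ?mul1r ?mul0r.
(* [fine] replaces an infinite line integral by 0; by Fubini this happens only on a null set, since
   [k] is integrable on the product. *)
pose F x := (h (t *: unit_vec d + x) - h x - fine (I x))%R.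
have mF : measurable_fun setT F.
  by apply: measurable_funB => //; apply: measurable_funB; [exact: lht.1|exact: lh.1].
have : {ae mu, forall x, obox a b x -> F x = 0%R}.
  apply: fundamental_box.
    have i1 := locint_patch a b lht; have i2 := locint_patch a b lh.
    have i3 := integrableB measurableT (integrableB measurableT i1 i2) ifI.
    have := integrable_abse i3.
    apply: le_integrable => //.
      apply/measurable_EFinP; apply/(measurable_restrictT _ _).1; first exact: measurable_obox.
      exact: measurable_funTS.
    move=> x _ /=; rewrite /patch; case: ifPn => [/set_mem xab|_]; last by rewrite normr0 !lee_fin.
    by rewrite lee_fin normr_id !indicE mem_set ?mul1r//; exact: obox_cbox.
  move=> f sf suf'.
  have suf : supp_in f a b.
    by move=> e u nu; apply: suf'; apply: contra nu => /andP[? ?]; rewrite !ltW.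
  have cf e : continuous (f e) := Cm_continuous (sf e 0%N).
  have mf : measurable_fun setT (tens f) by apply: continuous_measurable_rV; exact: continuous_tens.
  have [C C0 HC] := tens_bounded cf suf.
  have f0 x : ~ cbox a b x -> tens f x = 0%R by exact: tens_supp.
  have i1 := locint_mul lht mf HC f0; have i2 := locint_mul lh mf HC f0.
  transitivity (\int[mu]_x ((h (t *: unit_vec d + x)%R * tens f x)%:E - (h x * tens f x)%:E - (fine (I x) * tens f x)%:E)).
    rewrite [LHS]integral_mkcond; apply: eq_integral => x _; rewrite /patch /F.
    case: ifPn => [_|/negP nx]; first by rewrite -!EFinB; congr EFin; ring.
    have [e ne] : exists e, ~~ (a ord0 e < x ord0 e < b ord0 e)%R.
      apply: contrapT => K; apply: nx; apply/mem_set => e.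
      by apply: contrapT => /negP ne; apply: K; exists e.
    by rewrite (tensD1 _ e) suf'// mul0r !mulr0 -!EFinB !subr0.
  have i3 : mu.-integrable setT (fun x => (fine (I x) * tens f x)%:E).
    apply: (@integrable_dom _ _ mu _ (fun x => C * fine (I x))%R).
    - exact: measurable_funM.
    - exact: (integrableZl measurableT C ifI).
    - by move=> x; rewrite mulrC !normrM ler_wpM2r// (le_trans (HC x))// ler_norm.
  rewrite integralB//; last exact: integrableB.
  rewrite integralB//.
  have mg : measurable_fun setT (fun x : V => (h x * tens f (- t *: unit_vec d + x))%:E).
    apply/measurable_EFinP; apply: measurable_funM; first exact: lh.1.
    apply: (measurableT_comp mf).
    exact: measurable_translatel.
  have -> : \int[mu]_x (h (t *: unit_vec d + x)%R * tens f x)%:E = \int[mu]_x (h x * tens f (- t *: unit_vec d + x))%:E.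
    rewrite -[RHS](integral_translate_int (t *: unit_vec d) mg).
    by apply: eq_integral => x _; rewrite [(x + _)%R]addrC addrA scaleNr addNr add0r.
  have i1' : mu.-integrable setT (fun x => (h x * tens f (- t *: unit_vec d + x))%:E).
    apply: (@integrable_dom _ _ mu _ (fun x => C * (\1_(cbox a b2) x * h x))%R).
    - by apply/measurable_EFinP.
    - exact: (integrableZl measurableT C (locint_patch a b2 lh)).
    - move=> x; rewrite indicE; have [_|/negP nx] := boolP (x \in _).
        by rewrite mul1r mulrC !normrM ler_wpM2r// (le_trans (HC _))// ler_norm.
      rewrite f0 ?mulr0 ?normr0// => abx; apply: nx; apply/mem_set.
      have := @ab2 _ t abx; rewrite addrA scaleNr addrN add0r; apply.
      by rewrite ltW//= lexx.
  rewrite -integralB//.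
  under eq_integral do rewrite -EFinB -mulrBr.
  rewrite (line_integral_fubini lh lhd wp t0 sf suf).
  have ikf : (mu \x leb).-integrable setT (fun z => (k z * tens f z.1)%:E).
    apply: (@integrable_dom _ (V * measurableTypeR R)%type (mu \x leb) (fun z => k z * tens f z.1)%R (fun z => C * k z)%R).
    - by apply: measurable_funM => //; exact: (measurableT_comp mf measurable_fst).
    - exact: (integrableZl measurableT C ik).
    - by move=> z; rewrite mulrC !normrM ler_wpM2r// (le_trans (HC _))// ler_norm.
  have -> : \int[leb]_(s in [set` `[0%R, t]]) \int[mu]_x (hd (s *: unit_vec d + x)%R * tens f x)%:E =
     \int[leb]_s \int[mu]_x (k (x, s) * tens f x)%:E.
    rewrite [LHS]integral_mkcond; apply: eq_integral => s _; rewrite /patch /k /=.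
    case: ifPn => sin; last by rewrite integral0_eq// => x _; rewrite !indicE (negbTE sin) mulr0 mul0r.
    apply: eq_integral => x _; rewrite !indicE sin mulr1.
    have [_|/negP nx] := boolP (x \in _); first by rewrite mul1r.
    by rewrite f0 ?mulr0// => abx; apply: nx; exact/mem_set.
  have -> : \int[leb]_s \int[mu]_x (k (x, s) * tens f x)%:E = \int[mu]_x (fine (I x) * tens f x)%:E.
    rewrite -(Fubini ikf).
    have /integrableP[mJ _] := integrable_fubini_F ikf.
    apply: ae_eq_integral => //; first by case/integrableP: i3.
    apply: filterS (ae_integrable1 ik) => x ikx _ /=.
    under eq_integral do rewrite EFinM.
    rewrite integralZr// EFinM fineK//; exact: (integrable_fin_num measurableT ikx).
  by rewrite subee//; exact: (integrable_fin_num measurableT i3).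
apply: filterS2 (ae_integrable1 ik) => x ikx Fx abx.
have -> : (h (t *: unit_vec d + x) - h x)%R = fine (I x) by apply/eqP; rewrite -subr_eq0; apply/eqP; exact: Fx.
have Ifin : I x \is a fin_num by exact: (integrable_fin_num measurableT ikx).
rewrite -[_%:E]/(`|(fine (I x))%:E|) fineK//.
apply: (le_trans (le_abse_integral leb measurableT _)); first by case/integrableP: ikx.
rewrite [leRHS]integral_mkcond; apply: ge0_le_integral => //.
- by apply: measurableT_comp => //; case/integrableP: ikx.
- apply/(measurable_restrictT _ _).1; first exact: measurable_itv.
  apply: measurable_funTS.
  have ml : measurable_fun setT (fun s : measurableTypeR R => (s *: unit_vec d + x)%R).
    have := measurableT_comp (measurable_line d 1) (measurable_pair1 x).
    by under eq_fun do rewrite /= mul1r.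
  by apply/measurable_EFinP; apply: measurableT_comp => //; exact: (measurableT_comp lhd.1 ml).
- move=> s _; rewrite /k /patch !indicE /=; case: ifPn => _; last by rewrite mulr0 normr0.
  by rewrite mulr1 mem_set ?mul1r//; exact: obox_cbox.
Qed.

End ACL.

(** * B-splines *)

Section BsplinePieces.
Context {R : realType}.
Implicit Types (n m i : nat) (p q : {poly R}).

(** The coefficients of the [n]-th backward difference, which are also the jumps of the derivative
    of order [n - 1] of the B-spline at its knots. *)
Definition nbl n i : R := (-1) ^+ i * 'C(n, i)%:R.

(* [bp n m] is the polynomial [s |-> B(m + s)], 0 < s < 1, where B is the cardinal
   B-spline of order n, written with truncated powers. *)
Definition bp n m : {poly R} :=
  \sum_(i < m.+1) (nbl n i / n.-1`!%:R) *: ('X + (m - i)%:R%:P) ^+ n.-1.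

Lemma bp0 n : bp n 0 = n.-1`!%:R^-1 *: 'X^(n.-1).
Proof. by rewrite /bp big_ord1 /nbl expr0 bin0 mul1r div1r subnn addr0. Qed.

(** Moving to the next knot interval shifts the variable by 1 and switches on one more truncated
    power. *)
Lemma bpS n m : bp n m.+1 = (bp n m) \Po ('X + 1) + (nbl n m.+1 / n.-1`!%:R) *: 'X^(n.-1).
Proof.
rewrite {1}/bp big_ord_recr/= subnn addr0; congr (_ + _).
rewrite /bp raddf_sum/=; apply: eq_bigr => i _.
rewrite comp_polyZ rmorphXn/= comp_polyD comp_polyX comp_polyC; congr (_ *: _ ^+ _).
rewrite -addrA; congr (_ + _).
by rewrite subSn ?leq_ord// -addn1 natrD polyCD addrC.
Qed.

(** Pascal's rule turns the sum of order [n.+1] into one of order [n] over a first difference, which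
    has lower degree. *)
Lemma nbl_diff n k : (k < n)%N -> forall p,
  \sum_(i < n.+1) nbl n i *: (p + (n - i)%:R%:P) ^+ k = 0.
Proof.
elim: n k => [//|n IH] k kn p.
have -> : \sum_(i < n.+2) nbl n.+1 i *: (p + (n.+1 - i)%:R%:P) ^+ k =
   \sum_(i < n.+1) nbl n i *: ((p + (n - i)%:R%:P + 1) ^+ k - (p + (n - i)%:R%:P) ^+ k).
  under [RHS]eq_bigr do rewrite scalerBr.
  rewrite sumrB big_ord_recl big_ord_recr/= [X in _ = X - _]big_ord_recl/=.
  rewrite [X in _ = _ - X]big_ord_recr/= -!addrA; congr (_ + _).
    by rewrite /nbl !bin0 !subn0 -[n.+1]addn1 natrD polyCD addrA.
  rewrite opprD addrA -sumrB; congr (_ + _).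
    apply: eq_bigr => i _; rewrite /fintype.bump/= !add1n subSS.
    have -> : nbl n.+1 i.+1 = nbl n i.+1 - nbl n i.
      by rewrite /nbl binS natrD exprS; ring.
    rewrite scalerBl; congr (_ - _); congr (_ *: _ ^+ _).
    rewrite -addrA; congr (_ + _); rewrite -polyCD -[1]/(1%:R) -natrD addn1 -subSn ?subSS//.
  by rewrite subnn /nbl !binn exprS subnn mulN1r -scaleNr mulNr.
transitivity (\sum_(j < k) \sum_(i < n.+1) 'C(k, j)%:R *: (nbl n i *: (p + (n - i)%:R%:P) ^+ j)).
  rewrite exchange_big/=; apply: eq_bigr => i _.
  rewrite exprD1n big_ord_recr/= binn mulr1n addrK scaler_sumr.
  by apply: eq_bigr => j _; rewrite -scaler_nat !scalerA mulrC.
rewrite big1// => j _; rewrite -scaler_sumr IH ?scaler0//.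
exact: leq_trans (ltn_ord j) kn.
Qed.

(** The support of the B-spline ends at [n]: there all truncated powers are active and form an
    [n]-th difference of a power [n - 1]; later terms have binomial coefficient 0. *)
Lemma bp_eq0 n m : (0 < n)%N -> (n <= m)%N -> bp n m = 0.
Proof.
move=> n0 /subnKC <-; elim: (m - n)%N => [|k IH].
  have := @nbl_diff n n.-1; rewrite prednK// => /(_ (leqnn _) 'X) H.
  rewrite addn0 /bp; transitivity (n.-1`!%:R^-1 *: \sum_(i < n.+1) nbl n i *: ('X + (n - i)%:R%:P) ^+ n.-1); last by rewrite H scaler0.
  rewrite scaler_sumr.
  by apply: eq_bigr => i _; rewrite scalerA mulrC.
by rewrite addnS bpS IH comp_poly0 add0r /nbl bin_small ?mulr0 ?mul0r ?scale0r// ltnS leq_addr.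
Qed.

Lemma size_bp n m : (0 < n)%N -> (size (bp n m) <= n)%N.
Proof.
move=> n0; rewrite /bp; apply: (leq_trans (size_sum _ _ _)); apply/bigmax_leqP => i _.
apply: (leq_trans (size_scale_leq _ _)); by rewrite -[_%:P]opprK -polyCN size_exp_XsubC prednK.
Qed.

(* [Lq q] maps [(X + r)^(n-1)] to [q(r)]. *)
Definition Lq n q p : R := \sum_(j < n) q`_j * p`_(n.-1 - j) / 'C(n.-1, j)%:R.

Lemma Lq_linear n q (I : finType) (a : I -> R) (f : I -> {poly R}) :
  Lq n q (\sum_i a i *: f i) = \sum_i a i * Lq n q (f i).
Proof.
rewrite /Lq; under [RHS]eq_bigr do rewrite mulr_sumr.
rewrite exchange_big/=; apply: eq_bigr => j _.
rewrite coef_sum mulr_sumr mulr_suml; apply: eq_bigr => i _.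
by rewrite coefZ; ring.
Qed.

Lemma Lq_exp n q (r : R) : (0 < n)%N -> (size q <= n)%N -> Lq n q (('X + r%:P) ^+ n.-1) = q.[r].
Proof.
move=> n0 sq; rewrite (horner_coef_wide _ sq) /Lq; apply: eq_bigr => j _.
have jn : (j <= n.-1)%N by rewrite -ltnS prednK.
have -> : (('X + r%:P) ^+ n.-1)`_(n.-1 - j) = r ^+ j * 'C(n.-1, j)%:R.
  rewrite addrC exprDn coef_sum.
  have nj : (n.-1 - j < n.-1.+1)%N by rewrite ltnS leq_subr.
  rewrite (bigD1 (Ordinal nj))//= big1 ?addr0; last first.
    move=> i /negbTE ij; rewrite coefMn -polyC_exp mul_polyC coefZ coefXn.
    by move: ij; rewrite eq_sym -val_eqE/= => ->; rewrite mulr0 mul0rn.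
  rewrite coefMn -polyC_exp mul_polyC coefZ coefXn eqxx mulr1 subKn//.
  by rewrite bin_sub// mulr_natr.
rewrite mulrA mulfK// pnatr_eq0 -lt0n bin_gt0//.
Qed.

(** Triangularity: [bp n j] combines the powers [(X + r)^(n-1)] with [r <= j], so the functional
    [Lq q] with roots [0, ..., m - 1] kills every piece below [m] but not the piece [m]. The
    coefficients vanish one after another from the top. *)
Lemma bp_free n (a : 'I_n -> R) : \sum_(m < n) a m *: bp n m = 0 -> forall k, a k = 0.
Proof.
move=> S0.
suff H k : forall m : 'I_n, (n - k <= m)%N -> a m = 0 by move=> m; apply: (H n); rewrite subnn.
elim: k => [|k IH] m; first by rewrite subn0 leqNgt ltn_ord.
rewrite leq_eqVlt => /orP[/eqP mE|]; last first.
  by move=> h; apply: IH; move: h; clear; lia.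
have n0 : (0 < n)%N by apply: leq_ltn_trans (ltn_ord m).
pose q : {poly R} := \prod_(s < m) ('X - (s : nat)%:R%:P).
have sq : (size q <= n)%N by rewrite size_prod_XsubC /index_enum -enumT size_enum_ord.
have := Lq_linear n q a (fun m : 'I_n => bp n m); rewrite S0.
have -> : Lq n q 0 = 0 by rewrite /Lq big1// => j _; rewrite coef0 mulr0 mul0r.
have Lbp (j : nat) : Lq n q (bp n j) = \sum_(i < j.+1) nbl n i / n.-1`!%:R * q.[(j - i)%:R].
  by rewrite /bp Lq_linear; apply: eq_bigr => i _; rewrite Lq_exp.
rewrite (bigD1 m)//= [X in _ = _ + X]big1 ?addr0; last first.
  move=> j /negP jm; have [jm'|jm'] := leqP j m; last first.
    by rewrite IH ?mul0r//; move: jm' mE; clear; lia.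
  have {}jm' : (j < m)%N by rewrite ltn_neqAle jm' andbT; apply/negP => /eqP/val_inj/eqP.
  rewrite Lbp big1 ?mulr0// => i _.
  have ji : (j - i < m)%N by apply: leq_ltn_trans jm'; exact: leq_subr.
  by rewrite /q horner_prod (bigD1 (Ordinal ji))//= hornerXsubC subrr mul0r mulr0.
rewrite Lbp big_ord_recl/= subn0 big1 ?addr0; last first.
  move=> i _; have ji : (m - fintype.bump 0 i < m)%N by rewrite /fintype.bump/=; case: (m : nat) i => [[]//|m'] i; rewrite add1n subSS ltnS leq_subr.
  by rewrite /q horner_prod (bigD1 (Ordinal ji))//= hornerXsubC subrr mul0r mulr0.
move=> /esym/eqP; rewrite mulf_eq0 => /orP[/eqP//|].
rewrite mulf_eq0 => /orP[|].
  by rewrite /nbl expr0 bin0 mul1r mul1r invr_eq0 pnatr_eq0 eqn0Ngt fact_gt0.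
rewrite /q horner_prod => /prodf_eq0[s _]; rewrite hornerXsubC subr_eq0 eqr_nat => /eqP sm.
by have := ltn_ord s; rewrite -sm ltnn.
Qed.

Definition prim p : {poly R} := \sum_(i < size p) (p`_i / i.+1%:R) *: 'X^(i.+1).
(** The integral over the unit interval, kept algebraic so that it can be computed on
    polynomials. *)
Definition IP p : R := (prim p).[1].

Lemma prim_deriv p : (prim p)^`() = p.
Proof.
rewrite /prim raddf_sum/= -[RHS]coefK poly_def; apply: eq_bigr => i _.
rewrite derivZ derivXn -scalerMnr scalerMnl/=; congr (_ *: _).
by rewrite -mulr_natr divfK// pnatr_eq0.
Qed.

Lemma prim0 p : (prim p).[0] = 0.
Proof. by rewrite /prim horner_sum big1// => i _; rewrite hornerZ hornerXn expr0n mulr0. Qed.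

Lemma deriv_eq0 p : p^`() = 0 -> p = (p.[0])%:P.
Proof.
move=> dp; apply/polyP => i; rewrite coefC horner_coef0; case: i => [//|i] /=.
by have := congr1 (fun q => q`_i) dp; rewrite coef_deriv coef0 => /eqP; rewrite mulrn_eq0/= => /eqP.
Qed.

Lemma prim_unique p q : q^`() = p -> q.[0] = 0 -> q = prim p.
Proof.
move=> dq q0; apply/eqP; rewrite -subr_eq0; apply/eqP.
rewrite (@deriv_eq0 (q - prim p)); last by rewrite derivB dq prim_deriv subrr.
by rewrite hornerD hornerN q0 prim0 subrr.
Qed.

Lemma IP_linear (I : finType) (a : I -> R) (f : I -> {poly R}) :
  IP (\sum_i a i *: f i) = \sum_i a i * IP (f i).
Proof.
rewrite /IP -(@prim_unique _ (\sum_i a i *: prim (f i))).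
- by rewrite horner_sum; apply: eq_bigr => i _; rewrite hornerZ.
- by rewrite raddf_sum/=; apply: eq_bigr => i _; rewrite derivZ prim_deriv.
- by rewrite horner_sum big1// => i _; rewrite hornerZ prim0 mulr0.
Qed.

Lemma poly_zero_itv p : (forall t : R, 0 < t < 1 -> p.[t] = 0) -> p = 0.
Proof.
move=> H; apply/eqP; apply/negP => /negP p0.
pose rs := [seq (i.+2%:R^-1 : R) | i <- iota 0 (size p)].
have := @max_poly_roots _ p rs p0; rewrite size_map size_iota => H2.
suff : (size p < size p)%N by rewrite ltnn.
apply: H2.
- apply/allP => _ /mapP[i _ ->]; apply/eqP/H; rewrite invr_gt0 ltr0n/=.
  by rewrite invf_lt1 ?ltr0n// ltr1n.
- rewrite map_inj_uniq ?iota_uniq// => i j /invr_inj/eqP; rewrite eqr_nat => /eqP.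
  by move=> [].
Qed.

(** The primitive of a square is monotone, so it vanishes on the unit interval if its value at 1 is
    at most 0; a polynomial with infinitely many zeros is zero. *)
Lemma IP_sqr_eq0 p : IP (p ^+ 2) <= 0 -> p = 0.
Proof.
move=> I0; set Q := prim (p ^+ 2).
have mono (x y : R) : x <= y -> Q.[x] <= Q.[y].
  move=> xy; have [c _ E] := @MVT_segment _ (horner Q) (horner Q^`()) x y xy
      (fun z _ => is_derive_poly Q z) (continuous_subspaceT (@continuous_horner _ Q)).
  by rewrite -subr_ge0 E prim_deriv mulr_ge0 ?subr_ge0// hornerE sqr_ge0.
have Q0 (t : R) : 0 < t < 1 -> Q.[t] = 0.
  move=> /andP[t0 t1]; apply/eqP; rewrite eq_le; apply/andP; split.
    by apply: le_trans I0; apply: mono; exact: ltW.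
  by rewrite -(prim0 (p ^+ 2)); apply: mono; exact: ltW.
have /eqP : p ^+ 2 = 0 by rewrite -[LHS]prim_deriv -/Q (poly_zero_itv Q0) deriv0.
by rewrite expf_eq0/= => /eqP.
Qed.

Lemma unitmx_ker n (A : 'M[R]_n) : (forall b : 'rV_n, b *m A = 0 -> b = 0) -> A \in unitmx.
Proof.
move=> A0; rewrite -row_free_unit -kermx_eq0; apply/eqP/row_matrixP => k; rewrite row0.
by apply: A0; apply/sub_kermxP; exact: row_sub.
Qed.

Definition gram n : 'M[R]_n := \matrix_(i, j) IP (bp n i * bp n j).

(** A vector in the kernel is a combination of the pieces with vanishing [L^2] norm, hence zero by
    independence. *)
Lemma gram_unit n : gram n \in unitmx.
Proof.
apply: unitmx_ker => a ag.
have S0 : \sum_i a 0 i *: bp n i = 0.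
  apply: IP_sqr_eq0; rewrite expr2 mulr_sumr.
  have -> : \sum_i (\sum_j a 0 j *: bp n j) * (a 0 i *: bp n i) = \sum_i a 0 i *: ((\sum_j a 0 j *: bp n j) * bp n i).
    by apply: eq_bigr => i _; rewrite scalerAr.
  rewrite IP_linear big1// => i _.
  have -> : (\sum_j a 0 j *: bp n j) * bp n i = \sum_j a 0 j *: (bp n j * bp n i).
    by rewrite mulr_suml; apply: eq_bigr => j _; rewrite scalerAl.
  rewrite IP_linear; have := congr1 (fun M : 'rV[R]_n => M 0 i) ag; rewrite [in LHS]mxE [in RHS]mxE.
  by under eq_bigr do rewrite [gram n _ _]mxE; move=> ->; rewrite mulr0.
by apply/rowP => i; rewrite (bp_free S0) mxE.
Qed.

(** The basis dual to the pieces with respect to the integral over one cell; it reads off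
    coefficients from the values on a single cell. *)
Definition dualp n (m : 'I_n) : {poly R} := \sum_(j < n) invmx (gram n) j m *: bp n j.

Lemma dualpE n (m m' : 'I_n) : IP (bp n m * dualp m') = (m == m')%:R.
Proof.
rewrite /dualp mulr_sumr.
under eq_bigr do rewrite -scalerAr.
rewrite IP_linear.
have := congr1 (fun M : 'M[R]_n => M m m') (mulmxV (gram_unit n)); rewrite !mxE => <-.
by apply: eq_bigr => j _; rewrite !mxE mulrC.
Qed.

Lemma big_ord_cut k K (F : nat -> R) : (k <= K)%N -> (forall i, (k <= i)%N -> F i = 0) ->
  \sum_(i < K) F i = \sum_(i < k) F i.
Proof.
move=> kK F0; rewrite (big_ord_widen K F kK) [LHS](bigID (fun i : 'I_K => i < k)%N)/=.
by rewrite [X in _ + X]big1 ?addr0// => i; rewrite -leqNgt; exact: F0.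
Qed.

Lemma derivn_XaddC N a (c : R) : (('X + c%:P) ^+ N)^`(a) = (N ^_ a)%:R *: ('X + c%:P) ^+ (N - a).
Proof.
elim: a => [|a IH]; first by rewrite derivn0 ffactn0 subn0 scale1r.
rewrite derivnS IH derivZ deriv_exp derivD derivX derivC addr0 mul1r.
by rewrite -[_ *+ (N - a)]scaler_nat scalerA -natrM ffactnSr subnS.
Qed.

(** Normalized truncated power, continuous from the right: [tpow 0 0] is 1. *)
Definition tpow m (t : R) : R := if 0 <= t then t ^+ m / m`!%:R else 0.

(** The derivative of order [a] of the cardinal B-spline of order [n], with values at the knots
    taken from the right, and 0 for [a >= n]. *)
Definition bspl n a (t : R) : R :=
  if (a < n)%N then \sum_(i < n.+1) nbl n i * tpow (n.-1 - a) (t - i%:R) else 0.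

Lemma derivn_bp n m a s : (0 < n)%N -> ((bp n m)^`(a)).[s] =
  if (a < n)%N then \sum_(i < m.+1) nbl n i * ((s + (m - i)%:R) ^+ (n.-1 - a) / (n.-1 - a)`!%:R) else 0.
Proof.
move=> n0; rewrite /bp linear_sum/= horner_sum.
transitivity (\sum_(i < m.+1) nbl n i / (n.-1)`!%:R * ((n.-1 ^_ a)%:R * (s + (m - i)%:R) ^+ (n.-1 - a))).
  apply: eq_bigr => i _; rewrite linearZ/= derivn_XaddC !hornerZ horner_exp hornerD hornerX hornerC//.
case: ifPn => an; last first.
  by rewrite big1// => i _; rewrite ffact_small ?mul0r ?mulr0// prednK// leqNgt.
have an' : (a <= n.-1)%N by rewrite -ltnS prednK.
apply: eq_bigr => i _; rewrite -(ffact_fact an') natrM; field.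
by rewrite !pnatr_eq0 -!lt0n fact_gt0 ffact_gt0 an'.
Qed.

(** Before their knot the truncated powers vanish, after it they are polynomials; binomial
    coefficients beyond [n] are zero, which reconciles the two ranges of summation. *)
Lemma bspl_cell n a m s : (0 < n)%N -> 0 <= s < 1 -> bspl n a (m%:R + s) = ((bp n m)^`(a)).[s].
Proof.
move=> n0 /andP[s0 s1]; rewrite derivn_bp// /bspl; case: ifP => // an.
pose F i := nbl n i * tpow (n.-1 - a) (m%:R + s - i%:R).
pose G i := nbl n i * ((s + (m - i)%:R) ^+ (n.-1 - a) / (n.-1 - a)`!%:R).
have FG i : (i <= m)%N -> F i = G i.
  move=> im; rewrite /F /G /tpow natrB// ifT.
    by congr (_ * (_ ^+ _ / _)); ring.
  by rewrite addrAC -natrB// addr_ge0.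
have Fm i : (m < i)%N -> F i = 0.
  move=> mi; rewrite /F /tpow ifF ?mulr0//; apply/negbTE; rewrite -ltNge.
  rewrite subr_lt0; apply: lt_le_trans (_ : m%:R + 1 <= _); first by rewrite ltrD2l.
  by rewrite natr1 ler_nat.
have Fn i : (n < i)%N -> F i = 0 by move=> ni; rewrite /F /nbl bin_small// mulr0 mul0r.
have Gn i : (n < i)%N -> G i = 0 by move=> ni; rewrite /G /nbl bin_small// mulr0 mul0r.
rewrite -[LHS]/(\sum_(i < n.+1) F i) -[RHS]/(\sum_(i < m.+1) G i).
have [mn|nm] := leqP m n.
  by rewrite (@big_ord_cut m.+1 n.+1 F)//; apply: eq_bigr => i _; apply: FG; rewrite -ltnS.
rewrite (@big_ord_cut n.+1 m.+1 G)//; last exact: ltnW.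
apply: eq_bigr => i _; apply: FG; apply: ltnW; apply: leq_ltn_trans nm; by rewrite -ltnS.
Qed.

Lemma bspl_neg n a t : t < 0 -> bspl n a t = 0.
Proof.
move=> t0; rewrite /bspl; case: ifP => // _; rewrite big1// => i _.
rewrite /tpow ifF ?mulr0//; apply/negbTE; rewrite -ltNge subr_lt0.
by rewrite (lt_le_trans t0).
Qed.

Lemma bspl_out n a t : (0 < n)%N -> n%:R <= t -> bspl n a t = 0.
Proof.
move=> n0 nt; have t0 : 0 <= t by rewrite (le_trans _ nt).
have /andP[h1 h2] := truncn_itv t0.
have -> : t = (Num.truncn t)%:R + (t - (Num.truncn t)%:R) by ring.
rewrite bspl_cell//.
  rewrite bp_eq0 ?linear0 ?horner0//.
  by rewrite -ltnS -(ltr_nat R) (le_lt_trans nt).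
by rewrite subr_ge0 h1/= ltrBlDl natr1.
Qed.

Lemma tpow_maxE m t : tpow m.+1 t = Num.max t 0 ^+ m.+1 / m.+1`!%:R.
Proof.
by rewrite /tpow; case: (leP 0 t) => t0; rewrite ?exprS ?mul0r.
Qed.

Lemma tpow_derive_gt m (t : R) : 0 < t -> is_derive t 1 (tpow m) (if m is m'.+1 then tpow m' t else 0).
Proof.
move=> t0; pose p : {poly R} := m`!%:R^-1 *: 'X^m.
have E : \near t, tpow m t = p.[t].
  near=> u; rewrite /tpow ifT; first by rewrite hornerZ hornerXn mulrC.
  by apply: ltW; near: u; exact: lt_nbhsr.
have -> : (if m is m'.+1 then tpow m' t else 0) = p^`().[t].
  rewrite /p derivZ derivXn hornerZ hornerMn hornerXn; case: m p E => [|m] p _.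
    by rewrite mulr0n mulr0.
  rewrite /tpow ltW//= factS natrM -mulr_natr; field.
  by rewrite nat1r !pnatr_eq0 -lt0n fact_gt0.
apply: (@near_eq_is_derive _ _ _ (horner p)) => //.
by apply: filterS E => u ->.
Unshelve. all: by end_near. Qed.

Lemma tpow_derive_lt m (t : R) : t < 0 -> is_derive t 1 (tpow m) (if m is m'.+1 then tpow m' t else 0).
Proof.
move=> t0; have E : \near t, tpow m t = (cst 0 : R -> R) t.
  near=> u; rewrite /tpow ifF//; apply/negbTE; rewrite -ltNge.
  by near: u; exact: lt_nbhsl.
have -> : (if m is m'.+1 then tpow m' t else 0) = 0.
  by case: m {E} => // m; rewrite /tpow leNgt t0.
apply: (@near_eq_is_derive _ _ _ (cst 0)) => //.
by apply: filterS E => u ->.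
Unshelve. all: by end_near. Qed.

Lemma tpow_derive0 m : is_derive (0 : R) 1 (tpow m.+2) (0 : R).
Proof.
have f0 : tpow m.+2 0 = 0 by rewrite /tpow lexx expr0n mul0r.
have cv : (fun h : R => h^-1 *: ((tpow m.+2 \o shift 0) (h *: 1) - tpow m.+2 0)) @ 0^' --> (0 : R).
  apply/cvgr0Pnorm_le => e e0; near=> h.
  rewrite /= f0 subr0 addr0 [h *: 1]mulr1 /GRing.scale /= normrM normfV.
  have h0 : h != 0 by near: h; exact: nbhs_dnbhs_neq.
  rewrite ler_pdivrMl ?normr_gt0// /tpow; case: ifP => hp; last by rewrite normr0 mulr_ge0// ltW.
  have h1 : `|h| <= 1 by near: h; apply: dnbhs0_le.
  have he : `|h| <= e by near: h; apply: dnbhs0_le.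
  rewrite normrM normfV normrX (@le_trans _ _ (`|h| ^+ m.+2))//.
    by rewrite ler_piMr ?exprn_ge0// invf_le1 ?normr_gt0 ?pnatr_eq0 -?lt0n ?fact_gt0// ger0_norm// ler1n fact_gt0.
  rewrite exprS ler_wpM2l// exprS (le_trans _ he)// ler_piMr//.
  by rewrite exprn_ile1.
by apply: DeriveDef; [apply/cvg_ex; exists 0|exact: cvg_lim].
Unshelve. all: by end_near. Qed.

Lemma tpow_derive m (t : R) : is_derive t 1 (tpow m.+2) (tpow m.+1 t).
Proof.
have [t0|t0|->] := ltgtP t 0.
- exact: tpow_derive_lt.
- exact: tpow_derive_gt.
- by have -> : tpow m.+1 0 = 0; [rewrite /tpow lexx expr0n mul0r|exact: tpow_derive0].
Qed.

(** The [n] independent pieces fill the [n]-dimensional space of polynomials of degree below [n];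
    the dual polynomials then identify the coefficients. *)
Lemma bp_basis n p : (size p <= n)%N -> p = \sum_(m < n) IP (p * dualp m) *: bp n m.
Proof.
move=> sp; have [n0|n0] := posnP n.
  by rewrite n0 big_ord0; apply/eqP; rewrite -size_poly_eq0 -leqn0 -n0.
pose X : 'M[R]_n := \matrix_(m < n) poly_rV (bp n m).
have bpc (b : 'rV[R]_n) : (\sum_m b 0 m *: bp n m) = rVpoly (b *m X).
  rewrite mulmx_sum_row linear_sum/=; apply: eq_bigr => m _.
  rewrite rowK linearZ/=; congr (_ *: _); by rewrite poly_rV_K// size_bp.
have u : X \in unitmx.
  apply: unitmx_ker => b bg; have := bpc b; rewrite bg linear0 => S0.
  by apply/rowP => i; rewrite (bp_free S0) mxE.
pose b := poly_rV p *m invmx X.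
have pE : p = \sum_m b 0 m *: bp n m by rewrite bpc mulmxKV// poly_rV_K.
rewrite {1}pE; apply: eq_bigr => m _; congr (_ *: _).
rewrite pE mulr_suml.
under eq_bigr do rewrite -scalerAl.
rewrite IP_linear (bigD1 m)//= dualpE eqxx mulr1 big1 ?addr0// => j /negbTE jm.
by rewrite dualpE jm mulr0.
Qed.

(** In the variable of the next cell a piece becomes the next piece up to a multiple of [bp n 0], by
    [bpS]; the coefficient of [bp n 0] collects these multiples. *)
Lemma bp_shift n (A A' : nat -> R) : (0 < n)%N ->
  \sum_(m < n) A' m *: bp n m - ((\sum_(m < n) A m *: bp n m) \Po ('X + 1)) =
  \sum_(m < n) (if m : nat is m'.+1 then A' m'.+1 - A m' else A' 0%N + \sum_(a < n) A a * nbl n a.+1) *: bp n m.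
Proof.
case: n => // n _; rewrite raddf_sum/=.
have sh (m : nat) : bp n.+1 m \Po ('X + 1) = bp n.+1 m.+1 - nbl n.+1 m.+1 *: bp n.+1 0.
  by rewrite bpS bp0 scalerA addrK.
have -> : \sum_(i < n.+1) ((A i *: bp n.+1 i) \Po ('X + 1)) =
   \sum_(i < n.+1) A i *: bp n.+1 i.+1 - (\sum_(a < n.+1) A a * nbl n.+1 a.+1) *: bp n.+1 0.
  rewrite scaler_suml -sumrB; apply: eq_bigr => i _.
  by rewrite comp_polyZ sh scalerBr scalerA.
rewrite [X in _ - (X - _)]big_ord_recr/= bp_eq0// scaler0 addr0.
rewrite [X in X - _]big_ord_recl [RHS]big_ord_recl/= scalerDl.
have -> : \sum_(i < n) (A' (fintype.bump 0 i) - A i) *: bp n.+1 (fintype.bump 0 i) =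
   \sum_(i < n) A' (fintype.bump 0 i) *: bp n.+1 (fintype.bump 0 i) - \sum_(i < n) A i *: bp n.+1 i.+1.
  by rewrite -sumrB; apply: eq_bigr => i _; rewrite scalerBl.
by rewrite opprB -!addrA; congr (_ + _); rewrite addrCA.
Qed.

(** By independence of the pieces, a mismatch proportional to [bp n 0] forces all coefficients but
    one to be carried over with a shift of index, and equals an [n]-th difference of coefficients.
    The first half makes coefficients global, the second computes jumps. *)
Lemma bp_glue n (A A' : nat -> R) (g : R) : (0 < n)%N ->
  \sum_(m < n) A' m *: bp n m - ((\sum_(m < n) A m *: bp n m) \Po ('X + 1)) = g *: bp n 0 ->
  (forall m, (m.+1 < n)%N -> A' m.+1 = A m) /\ A' 0%N + \sum_(a < n) A a * nbl n a.+1 = g.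
Proof.
move=> n0; rewrite bp_shift// => E.
pose B (m : 'I_n) := (if m : nat is m'.+1 then A' m'.+1 - A m' else A' 0%N + \sum_(a < n) A a * nbl n a.+1) - (m == 0%N :> nat)%:R * g.
have /bp_free B0 : \sum_(m < n) B m *: bp n m = 0.
  rewrite -[RHS](subrr (g *: bp n 0)) -{1}E.
  have -> : g *: bp n 0 = \sum_(m < n) ((m == 0%N :> nat)%:R * g) *: bp n m.
    rewrite (bigD1 (Ordinal n0))//= mul1r big1 ?addr0// => i.
    by rewrite -val_eqE/= => /negbTE ->; rewrite mul0r scale0r.
  by rewrite -sumrB; apply: eq_bigr => m _; rewrite -scalerBl.
split=> [m mn|].
  by have := B0 (Ordinal mn); rewrite /B/= mul0r subr0 => /eqP; rewrite subr_eq0 => /eqP.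
by have := B0 (Ordinal n0); rewrite /B/= mul1r => /eqP; rewrite subr_eq0 => /eqP.
Qed.

Lemma derive1n_itv m (f : R -> R) p (k e x y : R) :
  (forall t, x < t < y -> f t = p.[k * t + e]) ->
  forall t, x < t < y -> derive1n m f t = k ^+ m * (p^`(m)).[k * t + e].
Proof.
move=> fE; elim: m => [|m IH] t txy; first by rewrite derive1n0 mul1r derivn0 fE.
rewrite derive1nS derive1E.
have d : is_derive t 1 (fun s => k ^+ m * (p^`(m)).[k * s + e]) (k ^+ m.+1 * (p^`(m.+1)).[k * t + e]).
  have := @derive_affine R (horner (p^`(m))) k e t _ => /(_ (ex_derive (is_derive := is_derive_poly _ _))) D1.
  have -> : k ^+ m.+1 * (p^`(m.+1)).[k * t + e] = k ^+ m *: (k * derive1 (horner (p^`(m))) (k * t + e)).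
    by rewrite derive1E derive_val derivnS exprSr /GRing.scale/= mulrA.
  exact: is_deriveZ.
have nE : \near t, derive1n m f t = k ^+ m * (p^`(m)).[k * t + e].
  near=> s; apply: IH; near: s.
  have : open [set` `]x, y[] by exact: itv_open.
  by move/(_ t); rewrite /= in_itv/= => /(_ txy).
by rewrite (near_eq_derive _ nE) ?derive_val// oner_eq0.
Unshelve. all: by end_near. Qed.

Lemma derive1n_right m (f : R -> R) p (k e x y : R) : x < y ->
  (forall t, x < t < y -> f t = p.[k * t + e]) ->
  derive1n m f t @[t --> x^'+] --> k ^+ m * (p^`(m)).[k * x + e].
Proof.
move=> xy fE; have E : \forall t \near x^'+, k ^+ m * (p^`(m)).[k * t + e] = derive1n m f t.
  near=> t; rewrite (@derive1n_itv _ _ p k e x y)//.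
  by apply/andP; split; near: t; [exact: nbhs_right_gt|exact: nbhs_right_lt].
apply: cvg_trans (near_eq_cvg E) _.
apply: cvg_at_right_filter; have /Cm_continuous := Cm_mul (Cm_cst 0 (k ^+ m)) (Cm_affine k e (Cm_horner 0 (p^`(m)))).
exact.
Unshelve. all: by end_near. Qed.

Lemma derive1n_left m (f : R -> R) p (k e x y : R) : x < y ->
  (forall t, x < t < y -> f t = p.[k * t + e]) ->
  derive1n m f t @[t --> y^'-] --> k ^+ m * (p^`(m)).[k * y + e].
Proof.
move=> xy fE; have E : \forall t \near y^'-, k ^+ m * (p^`(m)).[k * t + e] = derive1n m f t.
  near=> t; rewrite (@derive1n_itv _ _ p k e x y)//.
  by apply/andP; split; near: t; [exact: nbhs_left_gt|exact: nbhs_left_lt].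
apply: cvg_trans (near_eq_cvg E) _.
apply: cvg_at_left_filter; have /Cm_continuous := Cm_mul (Cm_cst 0 (k ^+ m)) (Cm_affine k e (Cm_horner 0 (p^`(m)))).
exact.
Unshelve. all: by end_near. Qed.

Lemma Cm_derive1n k m (f : R -> R) : (k <= m)%N -> Cm m f -> continuous (derive1n k f).
Proof.
elim: k m f => [|k IH] m f km Cf; first by rewrite derive1n0; exact: Cm_continuous Cf.
case: m km Cf => // m km [_ Cf]; rewrite derive1Sn; exact: IH Cf.
Qed.

(** Regularity [C^(n-2)] at [c] matches the derivatives of the two pieces below order [n - 1], so
    only the top coefficient of the difference survives. The local variable of the left cell is
    larger by 1, whence the composition with ['X + 1]. *)
Lemma jet_glue n (f : R -> R) (pl pr : {poly R}) (c s : R) : (0 < n)%N -> 0 < s ->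
  (size pl <= n)%N -> (size pr <= n)%N -> ((1 < n)%N -> Cm (n - 2) f) ->
  (forall t, c - s < t < c -> f t = pl.[s^-1 * t + (1 - s^-1 * c)]) ->
  (forall t, c < t < c + s -> f t = pr.[s^-1 * t - s^-1 * c]) ->
  exists g, pr - (pl \Po ('X + 1)) = g *: bp n 0.
Proof.
move=> n0 s0 spl spr Cf fl fr; set q := pr - _.
have sq : (size q <= n)%N.
  apply: (leq_trans (size_polyD _ _)); rewrite geq_max spr size_polyN.
  have -> : 'X + 1 = 'X - (-1)%:P :> {poly R} by rewrite polyCN opprK.
  by rewrite size_comp_poly2// size_XsubC.
have jet j : (j.+1 < n)%N -> q`_j = 0.
  move=> jn; have cf : continuous (derive1n j f) by apply: Cm_derive1n (Cf _); move: jn; clear; lia.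
  have R1 := @derive1n_right j f pr s^-1 (- (s^-1 * c)) c (c + s) _ fr.
  have L1 := @derive1n_left j f pl s^-1 (1 - s^-1 * c) (c - s) c _ fl.
  rewrite ltrDl in R1; rewrite gtrBl in L1; move: (R1 s0) (L1 s0) => {}R1 {}L1.
  have R2 := cvg_at_right_filter (cf c); have L2 := cvg_at_left_filter (cf c).
  have : s^-1 ^+ j * (pr^`(j)).[s^-1 * c - s^-1 * c] = s^-1 ^+ j * (pl^`(j)).[s^-1 * c + (1 - s^-1 * c)].
    transitivity (derive1n j f c).
      by apply: (@cvg_unique _ (@Rhausdorff R) _ _ _ _ R1 R2).
    by apply/esym; apply: (@cvg_unique _ (@Rhausdorff R) _ _ _ _ L1 L2).
  rewrite subrr addrCA subrr addr0 => /mulfI; rewrite expf_neq0 ?invr_eq0 ?gt_eqF// => /(_ isT) E.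
  have : (q^`(j)).[0] = 0.
    rewrite /q derivnB hornerD hornerN E.
    suff -> : (pl \Po ('X + 1))^`(j) = (pl^`(j)) \Po ('X + 1).
      by rewrite horner_comp hornerD hornerX hornerC add0r subrr.
    elim: (j) => [|i IH]; first by rewrite !derivn0.
    by rewrite derivnS IH deriv_comp -derivnS derivD derivX derivC addr0 mulr1.
  rewrite horner_coef0 coef_derivn addn0 ffactnn => /eqP; rewrite mulrn_eq0 => /orP[|/eqP//].
  by rewrite eqn0Ngt fact_gt0.
(* [bp n 0] is the power [n - 1] divided by [(n-1)!], so the factor is the top coefficient times
   this factorial. *)
exists (q`_n.-1 * n.-1`!%:R); rewrite bp0 scalerA mulfK ?pnatr_eq0 -?lt0n ?fact_gt0//.
apply/polyP => i; rewrite coefZ coefXn; have [->|/negbTE ni] := eqVneq i n.-1; first by rewrite mulr1.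
rewrite mulr0; have [iln|nli] := ltnP i n.-1; first by apply: jet; move: iln n0; clear; lia.
by rewrite nth_default// (leq_trans sq)//; move: ni nli n0; clear; lia.
Qed.

End BsplinePieces.

(** * Locally Lipschitz functions of one variable *)

Section LocLip.
Context {R : realType}.
Implicit Types f g : R -> R.

Definition loclip f := forall M : R, exists L : R, forall x y, `|x| <= M -> `|y| <= M ->
  `|f x - f y| <= L * `|x - y|.

Definition locbd f := forall M : R, exists B : R, forall x, `|x| <= M -> `|f x| <= B.

Lemma loclip_locbd f : loclip f -> locbd f.
Proof.
move=> lf M; have [L LP] := lf M; exists (`|f 0| + `|L| * M) => x xM.
have M0 : 0 <= M by apply: le_trans xM.
have := LP x 0 xM; rewrite normr0 subr0 => /(_ M0) h.
rewrite -[f x](subrK (f 0)) (le_trans (ler_normD _ _))// addrC lerD2l (le_trans h)//.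
by rewrite (@le_trans _ _ (`|L| * `|x|))// ?ler_wpM2r ?ler_wpM2l// ler_norm.
Qed.

Lemma loclip_cst c : loclip (fun=> c).
Proof. by move=> M; exists 0 => x y _ _; rewrite subrr normr0 mul0r. Qed.

Lemma loclip_add f g : loclip f -> loclip g -> loclip (fun x => f x + g x).
Proof.
move=> lf lg M; have [L LP] := lf M; have [K KP] := lg M; exists (L + K) => x y xM yM.
rewrite opprD addrACA mulrDl (le_trans (ler_normD _ _))// lerD//; [exact: LP|exact: KP].
Qed.

Lemma loclip_mul f g : loclip f -> loclip g -> loclip (fun x => f x * g x).
Proof.
move=> lf lg M; have [L LP] := lf M; have [K KP] := lg M.
have [B BP] := loclip_locbd lf M; have [C CP] := loclip_locbd lg M.
exists (B * K + L * C) => x y xM yM.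
have -> : f x * g x - f y * g y = f x * (g x - g y) + (f x - f y) * g y by ring.
rewrite (le_trans (ler_normD _ _))// !normrM mulrDl lerD//.
  by rewrite -mulrA ler_pM//; [exact: BP|exact: KP].
by rewrite mulrAC ler_pM//; [exact: LP|exact: CP].
Qed.

Lemma loclip_horner (p : {poly R}) : loclip (horner p).
Proof.
elim/poly_ind: p => [|p c IH].
  by rewrite (_ : horner 0 = fun=> 0); [exact: loclip_cst|apply/funext => x; rewrite horner0].
rewrite (_ : horner _ = fun x => p.[x] * x + c); last by apply/funext => x; rewrite hornerMXaddC.
apply: loclip_add (loclip_cst c); apply: loclip_mul => //.
by move=> M; exists 1 => x y _ _; rewrite mul1r.
Qed.

Lemma loclip_max0 : loclip (fun t => Num.max t 0).
Proof.
move=> M; exists 1 => x y _ _; rewrite mul1r.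
case: (leP x 0) => x0; case: (leP y 0) => y0.
- by rewrite subrr normr0.
- by rewrite sub0r normrN gtr0_norm// ler0_norm; lra.
- by rewrite subr0 !gtr0_norm; lra.
- by [].
Qed.

Lemma loclip_affine f (k e : R) : loclip f -> loclip (fun x => f (k * x + e)).
Proof.
move=> lf M; have [L LP] := lf (`|k| * M + `|e|); exists (L * `|k|) => x y xM yM.
have h z : `|z| <= M -> `|k * z + e| <= `|k| * M + `|e|.
  by move=> zM; rewrite (le_trans (ler_normD _ _))// lerD2r normrM ler_wpM2l.
rewrite -mulrA -normrM (_ : k * (x - y) = k * x + e - (k * y + e)); first exact: LP (h x xM) (h y yM).
ring.
Qed.

(** The derivative may fail to exist at finitely many points and need only be locally bounded, which
    admits the step function obtained as the last derivative of a B-spline. *)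
Definition wd1 f f' := [/\ loclip f, locbd f', measurable_fun setT f' &
  exists s : seq R, forall x : R, x \notin s -> is_derive x 1 f (f' x)].

Lemma loclip_continuous f : loclip f -> continuous f.
Proof.
move=> lf x; have [L LP] := lf (`|x| + 1).
apply/cvgrPdist_le => e e0; near=> y.
have xy : `|x - y| <= 1 by near: y; apply: cvgr_dist_le.
have yM : `|y| <= `|x| + 1.
  by rewrite -[y](subrK x) addrC (le_trans (ler_normD _ _))// lerD2l distrC.
have xM : `|x| <= `|x| + 1 by rewrite lerDl.
rewrite (le_trans (LP _ _ xM yM))// (@le_trans _ _ (`|L| * `|x - y|))//.
  by rewrite ler_wpM2r// ler_norm.
rewrite (@le_trans _ _ ((`|L| + 1) * `|x - y|))// ?ler_wpM2r ?lerDl//.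
rewrite -ler_pdivlMl ?ltr_wpDl// mulrC; near: y; apply: cvgr_dist_le => //.
by rewrite divr_gt0// ltr_wpDl.
Unshelve. all: by end_near. Qed.

Lemma wd1_measurable f f' : wd1 f f' -> measurable_fun setT f.
Proof. by move=> [lf _ _ _]; apply: continuous_measurable_fun; exact: loclip_continuous. Qed.

Lemma wd1_cst : wd1 (fun=> 0) (fun=> 0).
Proof.
split; [exact: loclip_cst|by move=> M; exists 0 => x _; rewrite normr0|exact: measurable_cst|].
by exists [::] => x _; exact: is_derive_cst.
Qed.

Lemma wd1_add f f' g g' : wd1 f f' -> wd1 g g' -> wd1 (fun x => f x + g x) (fun x => f' x + g' x).
Proof.
move=> [lf bf mf [s sP]] [lg bg mg [r rP]]; split.
- exact: loclip_add.
- move=> M; have [B BP] := bf M; have [C CP] := bg M; exists (B + C) => x xM.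
  by rewrite (le_trans (ler_normD _ _))// lerD//; [exact: BP|exact: CP].
- exact: measurable_funD.
- exists (s ++ r) => x; rewrite mem_cat negb_or => /andP[xs xr].
  by have := sP x xs; have := rP x xr => h1 h2; exact: is_deriveD.
Qed.

Lemma wd1_scale c f f' : wd1 f f' -> wd1 (fun x => c * f x) (fun x => c * f' x).
Proof.
move=> [lf bf mf [s sP]]; split.
- exact: loclip_mul (loclip_cst c) lf.
- move=> M; have [B BP] := bf M; exists (`|c| * B) => x xM.
  by rewrite normrM ler_wpM2l// BP.
- by apply: measurable_funM.
- by exists s => x xs; have := sP x xs => h; exact: is_deriveZ.
Qed.

Lemma wd1_affine f f' (k e : R) : k != 0 -> wd1 f f' ->
  wd1 (fun x => f (k * x + e)) (fun x => k * f' (k * x + e)).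
Proof.
move=> k0 [lf bf mf [s sP]]; split.
- exact: loclip_affine.
- move=> M; have [B BP] := bf (`|k| * M + `|e|); exists (`|k| * B) => x xM.
  rewrite normrM ler_wpM2l// BP// (le_trans (ler_normD _ _))// lerD2r normrM ler_wpM2l//.
- apply: measurable_funM => //; apply: (measurableT_comp mf).
  by apply: measurable_funD => //; apply: measurable_funM.
- exists [seq k^-1 * (z - e) | z <- s] => x xs.
  have /sP d : k * x + e \notin s.
    apply: contra xs => xs; apply/mapP; exists (k * x + e) => //.
    by rewrite addrK mulKf.
  have := @derive_affine R f k e x (@ex_derive _ _ _ _ _ _ _ d).
  by rewrite derive1E (@derive_val _ _ _ _ _ _ _ d).
Qed.

Lemma wd1_horner (p : {poly R}) : wd1 (horner p) (horner (p^`())).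
Proof.
split; [exact: loclip_horner|exact/loclip_locbd/loclip_horner| |].
  by apply: continuous_measurable_fun; exact: continuous_horner.
by exists [::] => x _; exact: is_derive_poly.
Qed.

Lemma measurable_tpow m : measurable_fun setT (@tpow R m).
Proof.
rewrite (_ : tpow m = fun t => (\1_[set x : R | 0 <= x] t : R) * (t ^+ m / m`!%:R)).
  apply: measurable_funM; last by apply: measurable_funM => //; exact: exprn_measurable.
  apply: measurable_indic; rewrite (_ : [set x : R | 0 <= x] = [set` `[0, +oo[]); first exact: measurable_itv.
  by apply/seteqP; split => x; rewrite /= in_itv/= andbT.
apply/funext => t; rewrite /tpow indicE (_ : (t \in _) = (0 <= t)); last by apply/idP/idP; rewrite inE.
by case: ifP => _; rewrite ?mul1r ?mul0r.
Qed.

Lemma loclip_tpow m : loclip (@tpow R m.+1).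
Proof.
have -> : @tpow R m.+1 = fun t => Num.max t 0 ^+ m.+1 * m.+1`!%:R^-1 by apply/funext => t; rewrite tpow_maxE.
apply: loclip_mul; last exact: loclip_cst.
elim: m => [|m IH]; first exact: loclip_max0.
rewrite (_ : (fun t => _) = fun t : R => Num.max t 0 * Num.max t 0 ^+ m.+1); last by apply/funext => t; rewrite exprS.
by apply: loclip_mul => //; exact: loclip_max0.
Qed.

Lemma wd1_tpow m : wd1 (@tpow R m.+1) (@tpow R m).
Proof.
split; [exact: loclip_tpow| |exact: measurable_tpow|].
- case: m => [|m]; last exact/loclip_locbd/loclip_tpow.
  by move=> M; exists 1 => x _; rewrite /tpow; case: ifP => _; rewrite ?normr0// expr0 fact0 divr1 normr1.
- exists [:: 0] => x; rewrite inE => x0; have [h|h|h] := ltgtP x 0.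
  + exact: (tpow_derive_lt m.+1 h).
  + exact: (tpow_derive_gt m.+1 h).
  + by rewrite h eqxx in x0.
Qed.

Lemma wd1_bspl n a : (a.+1 < n)%N -> wd1 (@bspl R n a) (@bspl R n a.+1).
Proof.
move=> an.
have bE b : (b < n)%N -> @bspl R n b = fun t => \sum_(i < n.+1) nbl n i * tpow (n.-1 - b) (t - i%:R).
  by move=> bn; apply/funext => t; rewrite /bspl bn.
rewrite !bE//; last exact: ltnW.
have -> : (n.-1 - a)%N = (n.-1 - a.+1).+1 by move: an; clear; lia.
move: (n.-1 - a.+1)%N => m; move: n.+1 => N; elim: N => [|N IH].
  rewrite (_ : (fun t => _) = fun=> 0); last by apply/funext => t; rewrite big_ord0.
  rewrite [X in wd1 _ X](_ : _ = fun=> 0); last by apply/funext => t; rewrite big_ord0.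
  exact: wd1_cst.
rewrite (_ : (fun t => _) = fun t => \sum_(i < N) nbl n i * tpow m.+1 (t - i%:R) + nbl n N * tpow m.+1 (t - N%:R)); last by apply/funext => t; rewrite big_ord_recr.
rewrite [X in wd1 _ X](_ : _ = fun t => \sum_(i < N) nbl n i * tpow m (t - i%:R) + nbl n N * tpow m (t - N%:R)); last by apply/funext => t; rewrite big_ord_recr.
apply: wd1_add => //; apply: wd1_scale.
have := @wd1_affine _ _ 1 (- N%:R) (oner_neq0 _) (wd1_tpow m).
rewrite (_ : (fun x => _) = fun t => tpow m.+1 (t - N%:R)); last by apply/funext => t; rewrite mul1r.
by rewrite [X in wd1 _ X](_ : _ = fun t => tpow m (t - N%:R)); last by apply/funext => t; rewrite !mul1r.
Qed.

Lemma Cm_tpow m : Cm m (@tpow R m.+1).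
Proof.
elim: m => [|m IH] /=; first exact/loclip_continuous/loclip_tpow.
have E : derive1 (@tpow R m.+2) = tpow m.+1.
  by apply/funext => t; rewrite derive1E (@derive_val _ _ _ _ _ _ _ (tpow_derive m t)).
by rewrite E; split => // x; exact: (@ex_derive _ _ _ _ _ _ _ (tpow_derive m x)).
Qed.

Lemma Cm_bspl n : (1 < n)%N -> Cm (n - 2) (@bspl R n 0).
Proof.
move=> n1; rewrite (_ : bspl n 0 = fun t => \sum_(i < n.+1) nbl n i * tpow (n - 2).+1 (t - i%:R)).
  elim: n.+1 => [|N IH].
    by rewrite (_ : (fun t => _) = fun=> 0); [exact: Cm_cst|apply/funext => t; rewrite big_ord0].
  rewrite (_ : (fun t => _) = fun t => \sum_(i < N) nbl n i * tpow (n - 2).+1 (t - i%:R) + nbl n N * tpow (n - 2).+1 (t - N%:R)); last by apply/funext => t; rewrite big_ord_recr.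
  apply: Cm_add => //; apply: Cm_mul; first exact: Cm_cst.
  have := Cm_affine 1 (- N%:R) (@Cm_tpow (n - 2)%N).
  by rewrite (_ : (fun x => _) = fun t => tpow (n - 2).+1 (t - N%:R)) //; apply/funext => t; rewrite mul1r.
apply/funext => t; rewrite /bspl (ltn_trans _ n1)//; apply: eq_bigr => i _.
by congr (_ * tpow _ _); move: n1; clear; lia.
Qed.

End LocLip.

(** * Measures of product sets and integrability on boxes *)

Section Boxes.
Context {R : realType} (D : nat).
Notation mu := (lebesgue_rV D).
Notation leb := (@lebesgue_measure R).
Notation V := ('rV[R]_D).

Lemma indic_tens (A : 'I_D -> set R) (x : V) :
  \1_[set x : V | forall d, A d (x ord0 d)] x = tens (fun d => \1_(A d)) x :> R.
Proof.
rewrite /tens indicE; have [/set_mem xA|/negP xA] := boolP (x \in _).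
  by rewrite big1// => d _; rewrite indicE mem_set//; exact: xA.
have [d nd] : exists d, ~ A d (x ord0 d) by apply/existsNP => h; apply: xA; exact/mem_set.
by rewrite (bigD1 d)//= indicE memNset// mul0r.
Qed.

Lemma measurable_prodset (A : 'I_D -> set R) : (forall d, measurable (A d)) ->
  measurable [set x : V | forall d, A d (x ord0 d)].
Proof.
move=> mA; have -> : [set x : V | forall d, A d (x ord0 d)] = \bigcap_(d in setT) [set x : V | A d (x ord0 d)].
  by apply/seteqP; split => x h d; [move=> _; exact: h|exact: h].
by apply: fin_bigcap_measurable => [|d _]; [exact: finite_finset|exact: measurable_coord_preim].
Qed.

Lemma measure_prodset (A : 'I_D -> set R) (m : 'I_D -> R) : (forall d, measurable (A d)) ->
  (forall d, leb (A d) = (m d)%:E) -> mu [set x : V | forall d, A d (x ord0 d)] = (\prod_d m d)%:E.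
Proof.
move=> mA Am.
have i1 d : leb.-integrable setT (EFin \o (\1_(A d) : measurableTypeR R -> R)).
  apply/integrableP; split; first by apply/measurable_EFinP; apply: measurable_indic; exact: mA.
  under eq_integral do rewrite /= ger0_norm//.
  rewrite integral_indic//; last exact: mA.
  by rewrite setIT; move: (ltry (m d)); rewrite -Am.
have [_] := integrable_tens i1.
have -> : (\prod_d \int[leb]_t (\1_(A d) : measurableTypeR R -> R) t)%R = \prod_d m d.
  apply: eq_bigr => d _; rewrite /Rintegral (_ : (\int[leb]_t (\1_(A d) t)%:E)%E = (m d)%:E)//.
  by rewrite integral_indic//; first [by rewrite setIT; exact: Am | exact: mA].
move=> <-; under eq_integral do rewrite -indic_tens.
by rewrite integral_indic ?setIT//; exact: measurable_prodset.
Qed.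

Lemma cbox_prodset (a b : V) : cbox a b = [set x : V | forall d, [set` `[a ord0 d, b ord0 d]] (x ord0 d)].
Proof. by apply/seteqP; split => x h d; have := h d; rewrite /= in_itv. Qed.

Lemma obox_prodset (a b : V) : obox a b = [set x : V | forall d, [set` `]a ord0 d, b ord0 d[] (x ord0 d)].
Proof. by apply/seteqP; split => x h d; have := h d; rewrite /= in_itv. Qed.

Lemma measure_obox (a b : V) : (forall d, a ord0 d <= b ord0 d) ->
  mu (obox a b) = (\prod_d (b ord0 d - a ord0 d))%:E.
Proof.
move=> ab; rewrite obox_prodset; apply: (@measure_prodset (fun d => [set` `]a ord0 d, (b ord0 d)[]) (fun d => b ord0 d - a ord0 d)) => d; first exact: measurable_itv.
rewrite lebesgue_measure_itv/= lte_fin lt_neqAle ab andbT EFinB; case: eqVneq => //= ->.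
by rewrite subee.
Qed.

Lemma cbox_lty (a b : V) : (mu (cbox a b) < +oo)%E.
Proof.
rewrite cbox_prodset (@measure_prodset (fun d => [set` `[a ord0 d, b ord0 d]]) (fun d => fine (leb [set` `[a ord0 d, b ord0 d]]))) ?ltry// => d.
rewrite fineK// lebesgue_measure_itv/=; case: ifP => // _; by rewrite fin_numB.
Qed.

Lemma integrable_bsupp (a b : V) (f : V -> R) (C : R) : measurable_fun setT f ->
  (forall x, cbox a b x -> `|f x| <= C) -> (forall x, ~ cbox a b x -> f x = 0) ->
  mu.-integrable setT (EFin \o f).
Proof.
move=> mf fC f0.
apply: (integrable_dom (g := fun x => C * \1_(cbox a b) x)) => //.
  have := @integrableZl _ _ _ mu _ measurableT C (EFin \o \1_(cbox a b)).
  rewrite (_ : (fun _ => _) = EFin \o (fun x => C * \1_(cbox a b) x)) //; apply.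
  have mc := measurable_cbox a b; apply/integrableP; split; first by apply/measurable_EFinP; exact: measurable_indic.
  under eq_integral do rewrite /= ger0_norm//.
  by rewrite integral_indic// setIT cbox_lty.
move=> x; rewrite indicE; have [/set_mem xab|/negP xab] := boolP (x \in _).
  by rewrite mulr1 (le_trans (fC _ xab))// ler_norm.
by rewrite f0 ?normr0// => h; apply: xab; exact/mem_set.
Qed.

Lemma itv_norm_le (u v t : R) : u <= t <= v -> `|t| <= `|u| + `|v|.
Proof.
have := ler_norm v; have := ler_norm (- u); have := normr_ge0 u; have := normr_ge0 v.
by rewrite normrN ler_norml => ? ? ? ? /andP[? ?]; and_lra.
Qed.

Lemma locbd_tens (f : 'I_D -> R -> R) (a b : V) : (forall d, locbd (f d)) ->
  exists C : R, forall x, cbox a b x -> `|tens f x| <= C.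
Proof.
move=> lf; have H d : exists B : R, forall t, a ord0 d <= t <= b ord0 d -> `|f d t| <= B.
  have [B BP] := lf d (`|a ord0 d| + `|b ord0 d|); exists B => t h; apply: BP; exact: itv_norm_le.
have {}H := choice H; have [B BP] := H.
exists (\prod_d B d) => x xab; rewrite /tens normr_prod; apply: ler_prod => d _.
by rewrite normr_ge0/=; exact: BP.
Qed.

End Boxes.

(** * Integration by parts for tensor products *)

Section IBP.
Context {R : realType} (D : nat).
Notation mu := (lebesgue_rV D).
Notation V := ('rV[R]_D).

Definition bsmooth (a b : V) (phi : V -> R) :=
  (forall m, class_C m phi) /\ (forall x, ~ cbox a b x -> phi x = 0).

Lemma class_C_continuous m (phi : V -> R) : class_C m phi -> continuous phi.
Proof. by case: m => [//|m] []. Qed.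

Lemma derive_supp (S : set V) (phi : V -> R) d : closed S -> (forall x, ~ S x -> phi x = 0) ->
  forall x, ~ S x -> 'D_(unit_vec d) phi x = 0.
Proof.
move=> cS s x nx; rewrite (@near_eq_derive _ _ _ _ (cst 0)) ?derive_cst//.
have : open (~` S) by exact/closed_openC.
by rewrite openE => /(_ x nx); apply: filterS => y; exact: s.
Qed.

Lemma partial_supp (S : set V) (phi : V -> R) al : closed S -> (forall x, ~ S x -> phi x = 0) ->
  forall x, ~ S x -> partial al phi x = 0.
Proof.
move=> cS s; rewrite /partial; elim: (enum _) => [//|d l IH] /=.
by elim: (al d) => [//|m IHm] /=; exact: derive_supp.
Qed.

Lemma bsmooth_derive a b phi d : bsmooth a b phi -> bsmooth a b (fun x => 'D_(unit_vec d) phi x).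
Proof.
move=> [C s]; split=> [m|]; first by have [_ /(_ d)[]] := C m.+1.
exact: derive_supp (@closed_cbox _ _ a b) s.
Qed.

Lemma bsmooth_iter a b phi d m : bsmooth a b phi ->
  bsmooth a b (iter m (fun h x => 'D_(unit_vec d) h x) phi).
Proof. by move=> h; elim: m => //= m IH; exact: bsmooth_derive. Qed.

Lemma line_derive (phi : V -> R) d (x : V) (t : R) : derivable phi (t *: unit_vec d + x) (unit_vec d) ->
  is_derive t 1 (fun s : R => phi (s *: unit_vec d + x)) ('D_(unit_vec d) phi (t *: unit_vec d + x)).
Proof.
move=> dphi.
have E : (fun h : R => h^-1 *: (((fun s : R => phi (s *: unit_vec d + x)) \o shift t) (h *: 1) - phi (t *: unit_vec d + x)))
  = (fun h : R => h^-1 *: ((phi \o shift (t *: unit_vec d + x)) (h *: unit_vec d) - phi (t *: unit_vec d + x))).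
  by apply/funext => h; rewrite /= [h *: 1]mulr1 scalerDl addrA.
by apply: DeriveDef; rewrite /derivable /derive E.
Qed.

Lemma diff_quot_bound a b phi d (C t : R) (x : V) : bsmooth a b phi ->
  (forall y, `|'D_(unit_vec d) phi y| <= C) -> 0 < t ->
  `|phi (- t *: unit_vec d + x) - phi x| <= C * t.
Proof.
move=> [sm _] dC t0; have [_ /(_ d)[dv _]] := sm 1%N.
have tt : - t <= 0 by rewrite oppr_le0 ltW.
have cl : {within `[- t, 0], continuous (fun s : R => phi (s *: unit_vec d + x))}.
  apply: continuous_subspaceT => s; apply: differentiable_continuous; apply/derivable1_diffP.
  by have [] := line_derive (dv (s *: unit_vec d + x)).
have [c _] := MVT_segment tt (fun s _ => line_derive (dv (s *: unit_vec d + x))) cl.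
rewrite scale0r add0r sub0r opprK distrC => ->.
by rewrite normrM (gtr0_norm t0) ler_wpM2r// ltW.
Qed.

Lemma bsmooth_bounded a b phi : bsmooth a b phi -> exists2 C : R, 0 <= C & forall x, `|phi x| <= C.
Proof.
by move=> [sm s]; exact: bounded_cbox_supp (class_C_continuous (sm 0%N)) s.
Qed.

Lemma bsmooth_measurable a b phi : bsmooth a b phi -> measurable_fun setT phi.
Proof. by move=> [sm _]; exact: continuous_measurable_rV (class_C_continuous (sm 0%N)). Qed.

Lemma tens_bsmooth_integrable f a b phi : (forall e, locbd (f e)) -> (forall e, measurable_fun setT (f e)) ->
  bsmooth a b phi -> mu.-integrable setT (EFin \o (fun x => tens f x * phi x)).
Proof.
move=> lf mf bp; have [C CP] := locbd_tens a b lf; have [B B0 BP] := bsmooth_bounded bp.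
apply: (@integrable_bsupp _ _ a b _ (C * B)).
- by apply: measurable_funM; [exact: measurable_tens|exact: bsmooth_measurable bp].
- by move=> x xab; rewrite normrM ler_pM//; exact: CP.
- by move=> x nx; rewrite (bp.2 _ nx) mulr0.
Qed.

Lemma locbd_upd (f : 'I_D -> R -> R) d (g : R -> R) : (forall e, locbd (f e)) -> locbd g -> forall e, locbd (upd f d g e).
Proof. by move=> lf lg e; rewrite /upd; case: eqP. Qed.

Lemma measurable_upd (f : 'I_D -> R -> R) d (g : R -> R) : (forall e, measurable_fun setT (f e)) -> measurable_fun setT g ->
  forall e, measurable_fun setT (upd f d g e).
Proof. by move=> lf lg e; rewrite /upd; case: eqP. Qed.

Lemma cvg_diff_quot (h : R -> R) (x l : R) (t : nat -> R) : is_derive x 1 h l ->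
  t @ \oo --> (0 : R) -> (forall m, t m != 0) ->
  (fun m => (t m)^-1 * (h (t m + x) - h x)) @ \oo --> l.
Proof.
move=> hd t0 tn; have [dh E] := hd; have := @ex_derive _ _ _ _ _ _ _ hd.
move=> /cvg_ex[l' cl]; have El : l' = l by rewrite -E; apply/esym/cvg_lim.
rewrite -El; have h1 := (cvgr_dnbhsP _ _ _).1 cl t (conj tn t0).
 apply: cvg_trans h1; apply: near_eq_cvg; near=> m.
by rewrite /= [_ *: 1]mulr1.
Unshelve. all: by end_near. Qed.

Lemma ae_coord_notin d (s : seq R) : {ae mu, forall x : V, x ord0 d \notin s}.
Proof.
elim: s => [|c s IH]; first exact: nearW.
have N : {ae mu, forall x : V, x ord0 d != c}.
  exists [set x : V | x ord0 d = c]; split; last by move=> x /= /negP/negPn/eqP.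
    exact: (@measurable_coord_preim R D d [set c] (measurable_set1 c)).
  exact: hyperplane_null.
by near=> x; rewrite inE negb_or; apply/andP; split; near: x.
Unshelve. all: by end_near. Qed.

(* Difference quotients are moved from one factor to the other by translation invariance; both sides
   converge dominatedly. *)
Lemma tens_ibp f d f' a b phi : (forall e, locbd (f e)) -> (forall e, measurable_fun setT (f e)) ->
  wd1 (f d) f' -> bsmooth a b phi ->
  \int[mu]_x (tens f x * 'D_(unit_vec d) phi x) = - \int[mu]_x (tens (upd f d f') x * phi x).
Proof.
move=> lf mf [lip bf' mf' [s sP]] bphi; pose t (m : nat) : R := m.+1%:R^-1.
have t0 m : 0 < t m by rewrite invr_gt0.
have t1 m : t m <= 1 by rewrite invf_le1 ?ler1n.
have tcv : t @ \oo --> (0 : R) by exact: cvg_harmonic.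
pose u : V := unit_vec d.
have uE (c : R) (x : V) e : (c *: u + x) ord0 e = (if e == d then c else 0) + x ord0 e by rewrite unit_vecE.
pose q m x := (t m)^-1 * (tens f (t m *: u + x) - tens f x) * phi x.
pose r m x := tens f x * ((t m)^-1 * (phi (- t m *: u + x) - phi x)).
have mphi := bsmooth_measurable bphi; have mF := measurable_tens mf.
have mq m : measurable_fun setT (q m).
  apply: measurable_funM => //; apply: measurable_funM => //; apply: measurable_funB => //.
  exact: measurableT_comp mF (measurable_translatel _).
have mr m : measurable_fun setT (r m).
  apply: measurable_funM => //; apply: measurable_funM => //; apply: measurable_funB => //.
  exact: measurableT_comp mphi (measurable_translatel _).
have [B B0 BP] := bsmooth_bounded bphi.
have [Bd Bd0 BdP] := bsmooth_bounded (bsmooth_derive d bphi).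
(* The support box is enlarged by 1 on each side because the steps [t m] are at most 1. *)
pose a' : V := \row_e (a ord0 e - 1); pose b' : V := \row_e (b ord0 e + 1).
have aa' x : cbox a b x -> cbox a' b' x by move=> h e; have := h e; rewrite !mxE => /andP[*]; and_lra.
have at' m x : cbox a b (- t m *: u + x) -> cbox a' b' x.
  move=> h e; have := h e; rewrite uE !mxE; have := t0 m; have := t1 m => h1 h2.
  by case: (e == d) => /andP[*]; and_lra.
have [CF CFP] := locbd_tens a' b' lf.
have phi0 x : ~ cbox a' b' x -> phi x = 0 by move=> nx; apply: bphi.2 => /aa'.
have phit0 m x : ~ cbox a' b' x -> phi (- t m *: u + x) = 0 by move=> nx; apply: bphi.2 => /at'.
have iG m : mu.-integrable setT (EFin \o (fun x => tens f x * phi (- t m *: u + x))).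
  apply: (@integrable_bsupp _ _ a' b' _ (CF * B)).
  - by apply: measurable_funM => //; exact: measurableT_comp mphi (measurable_translatel _).
  - by move=> x xab; rewrite normrM ler_pM//; exact: CFP.
  - by move=> x nx; rewrite phit0// mulr0.
have iF := tens_bsmooth_integrable lf mf bphi.
have shiftE m x : tens f (t m *: u + x) = tens (upd f d (fun y => f d (1 * y + t m))) x.
  by rewrite tens_line tens_upd mul1r addrC.
have iS m : mu.-integrable setT (EFin \o (fun x => tens f (t m *: u + x) * phi x)).
  under eq_fun do rewrite /= shiftE; apply: tens_bsmooth_integrable bphi.
    by apply: locbd_upd => //; apply: loclip_locbd; exact: loclip_affine.
  apply: measurable_upd => //; apply: measurableT_comp (mf d) _.
  by apply: measurable_funD => //; apply: measurable_funM.
have qr m : (\int[mu]_x (q m x)%:E = \int[mu]_x (r m x)%:E)%E.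
  rewrite (_ : (fun x => (q m x)%:E) = (fun x => (t m)^-1%:E * ((tens f (t m *: u + x) * phi x)%:E - (tens f x * phi x)%:E))%E); last first.
    by apply/funext => x; rewrite -EFinB -EFinM; congr (_%:E); rewrite /q; ring.
  rewrite (_ : (fun x => (r m x)%:E) = (fun x => (t m)^-1%:E * ((tens f x * phi (- t m *: u + x))%:E - (tens f x * phi x)%:E))%E); last first.
    by apply/funext => x; rewrite -EFinB -EFinM; congr (_%:E); rewrite /r; ring.
  rewrite !integralZl//.
  congr (_ * _)%E.
  have B1 := integralB measurableT (iS m) iF; have B2 := integralB measurableT (iG m) iF.
  etransitivity; first exact: B1.
  etransitivity; last by apply/esym; exact: B2.
  suff -> : (\int[mu]_x (tens f (t m *: u + x) * phi x)%:E = \int[mu]_x (tens f x * phi (- t m *: u + x))%:E)%E by [].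
  rewrite -[RHS](integral_translate_int (t m *: u)); last by case/integrableP: (iG m).
    by apply: eq_integral => x _; rewrite [x + _]addrC scaleNr addKr.
  exact: (integrableB measurableT (iG m) iF).
  exact: (integrableB measurableT (iS m) iF).
have rl x : (fun m => (r m x)%:E) @ \oo --> (- (tens f x * 'D_u phi x))%:E.
  apply/cvg_EFin; first exact: nearW.
  have dphi : derivable phi (0 *: u + x) u by have [_ /(_ d)[]] := bphi.1 1%N.
  have D0 := line_derive dphi; rewrite scale0r add0r in D0.
  have tn m : - t m != 0 by rewrite oppr_eq0 gt_eqF.
  have tcv' : (fun m => - t m) @ \oo --> (0 : R) by rewrite -oppr0; exact: cvgN.
  have := cvg_diff_quot D0 tcv' tn; rewrite scale0r add0r => cv.
  have -> : fine \o (fun m => (r m x)%:E) = (fun m => - tens f x * ((- t m)^-1 * (phi ((- t m + 0) *: unit_vec d + x) - phi x))).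
    apply/funext => m; rewrite /r /= addr0; field.
    by rewrite gt_eqF.
  by rewrite -mulNr; exact: (cvgM (cvg_cst _) cv).
(* The finitely many points at which [f d] may fail to be differentiable give null hyperplanes. *)
have ql : {ae mu, forall x, setT x -> (fun m => (q m x)%:E) @ \oo --> (tens (upd f d f') x * phi x)%:E}.
  apply: filterS (ae_coord_notin d s) => x /sP dx _.
  apply/cvg_EFin; first exact: nearW.
  have tn m : t m != 0 by rewrite gt_eqF.
  have := cvg_diff_quot dx tcv tn => cv.
  have -> : fine \o (fun m => (q m x)%:E) = (fun m => (t m)^-1 * (f d (t m + x ord0 d) - f d (x ord0 d)) * ((\prod_(e | e != d) f e (x ord0 e)) * phi x)).
    by apply/funext => m; rewrite /q /= tens_line (tensD1 _ d); ring.
  by rewrite tens_upd -mulrA; exact: (cvgM cv (cvg_cst _)).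
have dom_r m x : `|r m x| <= `|CF| * Bd * \1_(cbox a' b') x.
  rewrite indicE; have [/set_mem xab|/negP xab] := boolP (x \in _); last first.
    by rewrite /r phit0 ?phi0 ?subrr ?mulr0 ?normr0// => h; apply: xab; exact/mem_set.
  rewrite mulr1 /r normrM ler_pM//; first by rewrite (le_trans (CFP _ xab))// ler_norm.
  rewrite normrM ger0_norm ?invr_ge0 ?(ltW (t0 m))// ler_pdivrMl// mulrC.
  exact: diff_quot_bound bphi BdP (t0 m).
have [L LP] := lip (`|a ord0 d| + `|b ord0 d| + 1).
have l1 : forall e, locbd (upd f d (fun=> 1) e).
  by apply: locbd_upd => // M; exists 1 => x _; rewrite normr1.
have [C1 C1P] := locbd_tens a b l1.
have dom_q m x : `|q m x| <= `|L| * `|C1| * B * \1_(cbox a b) x.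
  rewrite indicE; have [/set_mem xab|/negP xab] := boolP (x \in _); last first.
    by rewrite /q bphi.2 ?mulr0 ?normr0// => h; apply: xab; exact/mem_set.
  have -> : q m x = ((t m)^-1 * (f d (t m + x ord0 d) - f d (x ord0 d))) * tens (upd f d (fun=> 1)) x * phi x.
    by rewrite /q tens_line (tensD1 _ d) tens_upd; ring.
  have C1x : `|tens (upd f d (fun=> 1)) x| <= `|C1| by rewrite (le_trans (C1P _ xab))// ler_norm.
  rewrite mulr1 normrM; apply: ler_pM => //; rewrite normrM; apply: ler_pM => //; rewrite normrM.
  have xM := itv_norm_le (xab d).
  have tn := t0 m; have tl := t1 m.
  rewrite ger0_norm ?invr_ge0 ?(ltW (t0 m))// ler_pdivrMl//.
  apply: (le_trans (LP _ _ _ _)).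
  - by rewrite (le_trans (ler_normD _ _))// (gtr0_norm (t0 m)); lra.
  - lra.
  - by rewrite addrK (gtr0_norm (t0 m)) mulrC ler_wpM2l ?ler_norm// ltW.
have idom (K : R) (v w : V) : mu.-integrable setT (fun x => (K * \1_(cbox v w) x)%:E).
  apply: (@integrable_bsupp _ _ v w (fun x => K * \1_(cbox v w) x) `|K|).
  - by apply: measurable_funM => //; apply: measurable_indic; exact: measurable_cbox.
  - by move=> x xvw; rewrite indicE mem_set// mulr1.
  - by move=> x nx; rewrite indicE memNset// mulr0.
have mE (h : V -> R) : measurable_fun setT h -> measurable_fun setT (fun x => (h x)%:E) by move=> mh; exact/measurable_EFinP.
have mq' : measurable_fun setT (fun x => (tens (upd f d f') x * phi x)%:E).
  by apply: mE; apply: (measurable_funM _ mphi); apply: measurable_tens; exact: measurable_upd.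
have mr' : measurable_fun setT (fun x => (- (tens f x * 'D_u phi x))%:E).
  have md := bsmooth_measurable (bsmooth_derive d bphi).
  exact: mE (measurableT_comp (@oppr_measurable R setT) (measurable_funM mF md)).
have [_ _ Cq] := dominated_convergence measurableT (fun m => mE _ (mq m)) mq' ql (idom (`|L| * `|C1| * B) a b)
   (nearW _ (fun x m _ => dom_q m x)).
have [_ _ Cr] := dominated_convergence measurableT (fun m => mE _ (mr m)) mr' (nearW _ (fun x _ => rl x)) (idom (`|CF| * Bd) a' b')
   (nearW _ (fun x m _ => dom_r m x)).
have E : (\int[mu]_x (tens (upd f d f') x * phi x)%:E = \int[mu]_x (- (tens f x * 'D_u phi x))%:E)%E.
  apply: (@cvg_unique _ (@ereal_hausdorff R) _ _ _ _ Cq).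
  move: Cr; rewrite /=; have -> // : (fun n => \int[mu]_x (r n x)%:E)%E = (fun n => \int[mu]_x (q n x)%:E)%E.
  by apply/funext => m; rewrite qr.
rewrite [X in _ = - X]/Rintegral E.
rewrite (_ : (fun x => (- (tens f x * 'D_u phi x))%:E) = (fun x => - (tens f x * 'D_u phi x)%:E)%E)//.
rewrite integralN/=; first by rewrite fineN opprK.
exact: (integrable_add_def measurableT (tens_bsmooth_integrable lf mf (bsmooth_derive d bphi))).
Qed.

(** For each coordinate a sequence of successive derivatives up to order [A d]. The last one need
    only be locally bounded and measurable. *)
Definition wchain (f : 'I_D -> nat -> R -> R) (A : 'I_D -> nat) :=
  (forall d a, (a < A d)%N -> wd1 (f d a) (f d a.+1)) /\
  (forall d a, (a <= A d)%N -> locbd (f d a) /\ measurable_fun setT (f d a)).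

Definition ctens (f : 'I_D -> nat -> R -> R) (al : 'I_D -> nat) : V -> R := tens (fun d => f d (al d)).

Lemma iter_ibp f A (ga : 'I_D -> nat) d m a b phi : wchain f A ->
  (forall e, ga e + (if e == d then m else 0) <= A e)%N -> bsmooth a b phi ->
  \int[mu]_x (ctens f ga x * iter m (fun h x => 'D_(unit_vec d) h x) phi x) =
  (-1) ^+ m * \int[mu]_x (ctens f (fun e => ga e + (if e == d then m else 0))%N x * phi x).
Proof.
move=> [w1 w2]; elim: m ga => [|m IH] ga gA bphi.
  rewrite mul1r /=; congr (Rintegral _ _ _); apply/funext => x; congr (ctens _ _ x * _).
  by apply/funext => e; case: ifP; rewrite addn0.
have gd : (ga d < A d)%N by have := gA d; rewrite eqxx; lia.
have ge e : (ga e <= A e)%N by have := gA e; lia.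
rewrite iterS (@tens_ibp _ d (f d (ga d).+1) a b).
- rewrite exprS mulN1r mulNr; congr (- _).
  pose ga' e := (ga e + (e == d))%N.
  have := IH ga' _ bphi.
  rewrite (_ : (fun e => (ga' e + (if e == d then m else 0))%N) = (fun e => (ga e + (if e == d then m.+1 else 0))%N)).
    move=> <-.
      congr (Rintegral _ _ _); apply/funext => x; congr (_ * _); congr (tens _ x).
      apply/funext => e; rewrite /upd /ga'; case: eqP => [->|_]; by rewrite ?addn1 ?addn0.
    by move=> e; have := gA e; rewrite /ga'; case: eqP => _; lia.
  by apply/funext => e; rewrite /ga'; case: eqP => _; lia.
- by move=> e; exact: (w2 _ _ (ge e)).1.
- by move=> e; exact: (w2 _ _ (ge e)).2.
- exact: w1.
- exact: bsmooth_iter.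
Qed.

Lemma ctens_weak f A (al : multi_index D) a b phi : wchain f A -> (forall d, al d <= A d)%N ->
  bsmooth a b phi ->
  \int[mu]_x (ctens f (fun=> 0%N) x * partial al phi x) =
  (-1) ^+ mi_order al * \int[mu]_x (ctens f al x * phi x).
Proof.
move=> wf alA bphi.
have H s (ga : 'I_D -> nat) : uniq s -> (forall e, ga e + (if e \in s then al e else 0) <= A e)%N ->
  \int[mu]_x (ctens f ga x * foldr (fun d g => iter (al d) (fun h x => 'D_(unit_vec d) h x) g) phi s x) =
  (-1) ^+ (\sum_(d <- s) al d) * \int[mu]_x (ctens f (fun e => ga e + (if e \in s then al e else 0))%N x * phi x).
  elim: s ga => [|d s IH] ga /=.
    move=> _ _; rewrite big_nil mul1r; congr (Rintegral _ _ _); apply/funext => x; congr (ctens _ _ x * _).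
    by apply/funext => e; rewrite addn0.
  move=> /andP[ds us] gA; rewrite (@iter_ibp f A ga d _ a b)//; last 2 first.
  - by move=> e; have := gA e; rewrite inE; case: eqP => [->|_] //=; lia.
  - elim: (s) => [//|e l IHl] /=; exact: bsmooth_iter.
  rewrite IH//; last first.
    move=> e; have := gA e; rewrite inE; case: eqP => [->|_] /=; first by rewrite (negbTE ds); lia.
    by rewrite addn0.
  rewrite big_cons exprD mulrA; congr (_ * _); congr (Rintegral _ _ _); apply/funext => x; congr (ctens _ _ x * _).
  apply/funext => e; rewrite inE; case: eqP => [->|_] /=; first by rewrite (negbTE ds) addn0.
  by rewrite addn0.
have := H (enum 'I_D) (fun=> 0%N) (enum_uniq _); rewrite /partial => ->.
  congr ((-1) ^+ _ * _); first by rewrite /mi_order big_enum.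
  congr (Rintegral _ _ _); apply/funext => x; congr (ctens _ _ x * _).
  by apply/funext => e; rewrite mem_enum.
by move=> e; rewrite mem_enum; exact: alA.
Qed.

Lemma ctens_bounded f A (al : 'I_D -> nat) a b : wchain f A -> (forall d, al d <= A d)%N ->
  exists C : R, forall x, cbox a b x -> `|ctens f al x| <= C.
Proof. by move=> [_ w2] alA; apply: locbd_tens => d; exact: (w2 _ _ (alA d)).1. Qed.

Lemma measurable_ctens f A (al : 'I_D -> nat) : wchain f A -> (forall d, al d <= A d)%N ->
  measurable_fun setT (ctens f al).
Proof. by move=> [_ w2] alA; apply: measurable_tens => d; exact: (w2 _ _ (alA d)).2. Qed.

Lemma integrable_Rsum (J : Type) (s : seq J) (c : J -> R) (h : J -> V -> R) :
  (forall j, mu.-integrable setT (EFin \o h j)) ->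
  mu.-integrable setT (EFin \o (fun x => \sum_(j <- s) c j * h j x)) /\
  \int[mu]_x (\sum_(j <- s) c j * h j x) = \sum_(j <- s) c j * \int[mu]_x h j x.
Proof.
move=> ih; elim: s => [|j s [IH1 IH2]].
  rewrite (_ : (fun x => _) = fun=> 0); last by apply/funext => x; rewrite big_nil.
  by rewrite big_nil /Rintegral integral0; split => //; exact: integrable0.
have ij : mu.-integrable setT (EFin \o (fun x => c j * h j x)).
  rewrite (_ : EFin \o _ = fun x => ((c j)%:E * (EFin \o h j) x)%E)//; exact: (integrableZl measurableT (c j) (ih j)).
have -> : (fun x => \sum_(j <- j :: s) c j * h j x) = (fun x => c j * h j x + \sum_(j <- s) c j * h j x).
  by apply/funext => x; rewrite big_cons.
split.
  rewrite (_ : EFin \o _ = (EFin \o (fun x => (c j * h j x)%R)) \+ (EFin \o (fun x => (\sum_(j <- s) c j * h j x)%R)))%E//.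
  exact: integrableD.
by rewrite RintegralD// RintegralZl// IH2 big_cons.
Qed.

Lemma compact_cbox_bound (K : set V) : compact K -> exists a b : V, K `<=` cbox a b.
Proof.
move=> cK; have H d : exists M : R, forall x, K x -> `|x ord0 d| <= M.
  have /compact_bounded[N [_ NP]] : compact ((fun x : V => x ord0 d) @` K).
    by apply: continuous_compact cK; apply: continuous_subspaceT; exact: continuous_coord.
  by exists (N + 1) => x Kx; apply: (NP (N + 1)); [rewrite ltrDl|exists x].
have [M MP] := choice H.
exists (\row_d - M d), (\row_d M d) => x Kx d; rewrite !mxE -ler_norml; exact: MP.
Qed.

Lemma test_bsmooth U phi : test_function U phi -> exists a b, bsmooth a b phi.
Proof.
move=> [sm cp _]; have [a [b ab]] := compact_cbox_bound cp; exists a, b; split => // x nx.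
by apply/eqP; apply: contra_notT nx => /= px; apply: ab; exact: subset_closure.
Qed.

Lemma loc_integrable_ext (U : set V) (u g : V -> R) : measurable U -> measurable_fun setT g ->
  (forall a b, exists C : R, forall x, cbox a b x -> `|g x| <= C) -> (forall x, U x -> u x = g x) ->
  locally_integrable_on U u.
Proof.
move=> mU mg bg ug; split.
  by apply: eq_measurable_fun (measurable_funTS mg) => x /set_mem/ug.
move=> K cK KU; have [a [b Kab]] := compact_cbox_bound cK; have [C CP] := bg a b.
have mK := compact_measurable_rV cK.
have ig : mu.-integrable K (EFin \o g).
  apply: (integrableS (measurable_cbox a b)) => //.
  exact: (compact_integrable_bounded mg CP (cbox_lty a b)).
apply: eq_integrable ig => // x /set_mem Kx /=; by rewrite ug//; exact: KU.
Qed.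

(** Test functions are supported in [U], so the integrals extend to the whole space, where
    [ctens_weak] integrates each tensor product by parts coordinate by coordinate. *)
Lemma comb_weak_partial (U : set V) (J : Type) (s : seq J) (c : J -> R) f A (al : multi_index D) u g :
  open U -> (forall j, wchain (f j) A) -> (forall d, al d <= A d)%N ->
  (forall x, U x -> u x = \sum_(j <- s) c j * ctens (f j) (fun=> 0%N) x) ->
  (forall x, U x -> g x = \sum_(j <- s) c j * ctens (f j) al x) ->
  is_weak_partial U u al g.
Proof.
move=> oU wf alA uE gE; have mU := open_measurable_rV oU.
have mS (be : 'I_D -> nat) : (forall d, be d <= A d)%N -> measurable_fun setT (fun x => \sum_(j <- s) c j * ctens (f j) be x).
  by move=> beA; apply: measurable_sum => j; apply: measurable_funM => //; exact: measurable_ctens (wf j) beA.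
have bS (be : 'I_D -> nat) a b : (forall d, be d <= A d)%N -> exists C : R, forall x, cbox a b x -> `|\sum_(j <- s) c j * ctens (f j) be x| <= C.
  move=> beA; elim: s {uE gE mS} => [|j r [C CP]]; first by exists 0 => x _; rewrite big_nil normr0.
  have [B BP] := ctens_bounded a b (wf j) beA; exists (`|c j| * B + C) => x xab.
  rewrite big_cons (le_trans (ler_normD _ _))// lerD ?CP// normrM ler_wpM2l// BP//.
split.
- by apply: loc_integrable_ext uE => //; [exact: mS|move=> a b; exact: bS].
- by apply: loc_integrable_ext gE => //; [exact: mS|move=> a b; exact: bS].
move=> phi tphi; have [a [b bphi]] := test_bsmooth tphi; have [sm _ sU] := tphi.
have zphi x : ~ closure [set x | phi x != 0] x -> phi x = 0.
  by move=> nx; apply/eqP; apply: contra_notT nx => /= px; exact: subset_closure.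
have E (v w : V -> R) (be : 'I_D -> nat) (ps : V -> R) : (forall x, U x -> v x = \sum_(j <- s) c j * ctens (f j) be x) ->
   (forall x, ~ U x -> ps x = 0) ->
   \int[mu]_(x in U) (v x * ps x) = \int[mu]_x (\sum_(j <- s) c j * (ctens (f j) be x * ps x)).
  move=> vE ps0; rewrite Rintegral_mkcond; congr (Rintegral _ _ _); apply/funext => x.
  rewrite /patch; case: ifPn => [/set_mem Ux|/negP nU].
    by rewrite vE// mulr_suml; apply: eq_bigr => j _; rewrite mulrA.
  rewrite big1// => j _; rewrite ps0 ?mulr0// => Ux; apply: nU; exact: mem_set.
rewrite (E u u (fun=> 0%N))//; last first.
  by move=> x nU; apply: partial_supp zphi _ _ => [|/sU//]; exact: closed_closure.
rewrite (E g g al)//; last by move=> x nU; apply: zphi => /sU.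
have bpar : bsmooth a b (partial al phi).
  by rewrite /partial; elim: (enum _) => [//|d l IH] /=; exact: bsmooth_iter.
have lm (be : 'I_D -> nat) ps j : (forall d, be d <= A d)%N -> bsmooth a b ps -> mu.-integrable setT (EFin \o (fun x => ctens (f j) be x * ps x)).
  move=> beA; apply: tens_bsmooth_integrable => d; first exact: ((wf j).2 _ _ (beA d)).1.
  exact: ((wf j).2 _ _ (beA d)).2.
have [_ ->] := integrable_Rsum s c (fun j => lm (fun=> 0%N) _ j (fun d => leq0n _) bpar).
have [_ ->] := integrable_Rsum s c (fun j => lm al _ j alA bphi).
by rewrite mulr_sumr; apply: eq_bigr => j _; rewrite (ctens_weak (wf j) alA bphi) mulrCA.
Qed.

End IBP.

(** * Exponential decay of inverses *)

Section Decay.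
Context {R : realType} (D : nat) (L : finType).
Notation Z := ('rV[int]_D).
Implicit Types (x y f : Z -> R) (i j : Z) (s : seq Z).

(** [t] to the power of the [l^1] norm of [j]. *)
Definition expw (t : R) (j : Z) : R := \prod_d t ^+ `|j ord0 d|%N.

Lemma expw_ge0 t j : 0 <= t -> 0 <= expw t j.
Proof. by move=> t0; apply: prodr_ge0 => d _; exact: exprn_ge0. Qed.

Lemma expw0 t : expw t 0 = 1.
Proof. by rewrite /expw big1// => d _; rewrite mxE. Qed.

Lemma expw_ratio t n j j' : 0 < t <= 1 -> (forall d, `|j ord0 d - j' ord0 d| <= n)%N ->
  t ^+ (n * D) * expw t j <= expw t j'.
Proof.
move=> /andP[t0 t1] h; have -> : t ^+ (n * D) = \prod_(d < D) t ^+ n.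
  by rewrite prodr_const card_ord exprM.
rewrite /expw -big_split/=; have t0' := ltW t0; apply: ler_prod => d _; rewrite mulr_ge0 ?exprn_ge0//= -exprD; apply: ler_wiXn2l => //.
by have := h d; lia.
Qed.

Lemma geom_abs (t : R) (N : nat) : 0 <= t < 1 ->
  \sum_(k < N.*2.+1) t ^+ `|((k : nat)%:Z - N%:Z)%R|%N <= 2 / (1 - t).
Proof.
move=> /andP[t0 t1]; have gs M : \sum_(k < M) t ^+ k <= 1 / (1 - t).
  rewrite ler_pdivlMr ?subr_gt0//; have := subrXX 1 t M.
  rewrite expr1n => /esym E; rewrite mulrC.
  have -> : (1 - t) * (\sum_(i < M) t ^+ i) = 1 - t ^+ M.
    by rewrite -E; congr (_ * _); apply: eq_bigr => i _; rewrite expr1n mul1r.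
  by rewrite gerBl exprn_ge0.
rewrite (_ : 2 / (1 - t) = 1 / (1 - t) + 1 / (1 - t)); last by rewrite -mulrDl.
have -> : N.*2.+1 = (N + N.+1)%N by rewrite -addnn addnS.
rewrite big_split_ord/= lerD//.
  rewrite (reindex_inj rev_ord_inj)/=; apply: le_trans (_ : \sum_(k < N) t ^+ k <= _) => //.
  apply: ler_sum => i _; apply: ler_wiXn2l => //; first exact: ltW.
  by have := ltn_ord i; lia.
apply: le_trans (gs N.+1); apply: ler_sum => i _; apply: ler_wiXn2l => //; first exact: ltW.
by lia.
Qed.

(** Encoding the indices in a large cube bounds the sum by a product of [D] two-sided geometric
    series, each at most [2 / (1 - t)]. The bound does not see the length of [s]. *)
Lemma sum_expw t s : 0 <= t < 1 -> uniq s -> \sum_(j <- s) expw t j <= (2 / (1 - t)) ^+ D.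
Proof.
move=> t01 us; have /andP[t0 t1] := t01.
have [N NP] : exists N, forall j, j \in s -> forall d, (`|j ord0 d| <= N)%N.
  exists (\max_(j <- s) \max_d `|j ord0 d|)%N => j js d.
  by apply: leq_trans (leq_bigmax_seq _ js isT); apply: (leq_bigmax d).
pose code (j : Z) : {ffun 'I_D -> 'I_N.*2.+1} := [ffun d => inord `|(j ord0 d + N%:Z)%R|%N].
have codeE j d : j \in s -> (code j d : nat)%:Z = j ord0 d + N%:Z.
  by move=> js; rewrite ffunE inordK; have := NP j js d; lia.
have uc : uniq [seq code j | j <- s].
  rewrite map_inj_in_uniq// => j j' js js' E; apply/rowP => d.
  have : (code j d : nat)%:Z = (code j' d : nat)%:Z by rewrite E.
  by rewrite !codeE// => /addIr.
have -> : \sum_(j <- s) expw t j = \sum_(c <- [seq code j | j <- s]) \prod_d t ^+ `|((c d : nat)%:Z - N%:Z)%R|%N.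
  rewrite big_map big_seq [RHS]big_seq; apply: eq_bigr => j js; apply: eq_bigr => d _.
  by rewrite codeE// addrK.
rewrite big_uniq//=; apply: (@le_trans _ _ (\sum_(c : {ffun 'I_D -> 'I_N.*2.+1}) \prod_d t ^+ `|((c d : nat)%:Z - N%:Z)%R|%N)).
  rewrite [leRHS](bigID (fun c => c \in [seq code j | j <- s]))/= lerDl sumr_ge0// => c _.
  by apply: prodr_ge0 => d _; exact: exprn_ge0.
rewrite -(bigA_distr_bigA (fun (d : 'I_D) (k : 'I_N.*2.+1) => t ^+ `|((k : nat)%:Z - N%:Z)%R|%N)).
rewrite -[X in _ ^+ X]card_ord -prodr_const; apply: ler_prod => d _.
by rewrite geom_abs// sumr_ge0// => k _; exact: exprn_ge0.
Qed.

Variable (off : L -> Z).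

(** A bilinear form assembled from element matrices: [i - off m] is the global index of the local
    coefficient [m] of cell [i]. *)
Definition Aloc (I : seq Z) (a : Z -> L -> L -> R) x y : R :=
  \sum_(i <- I) \sum_m \sum_m' a i m m' * (x (i - off m) * y (i - off m')).

Lemma sum_shift_le (I J : seq Z) x m : uniq I -> uniq J -> (forall j, j \notin J -> x j = 0) ->
  \sum_(i <- I) x (i - off m) ^+ 2 <= \sum_(j <- J) x j ^+ 2.
Proof.
move=> uI uJ x0.
have -> : \sum_(i <- I) x (i - off m) ^+ 2 = \sum_(j <- [seq i - off m | i <- I]) x j ^+ 2 by rewrite big_map.
have u' : uniq [seq i - off m | i <- I] by rewrite map_inj_uniq// => i j /addIr.
rewrite (bigID (fun j => j \in J))/= [X in _ + X]big1 ?addr0; last by move=> j /x0 ->; rewrite expr0n.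
rewrite -big_filter; set T := [seq _ <- _ | _].
have uT : uniq T by rewrite filter_uniq.
have -> : \sum_(j <- J) x j ^+ 2 = \sum_(j <- T) x j ^+ 2 + \sum_(j <- J | j \notin T) x j ^+ 2.
  rewrite (bigID (fun j => j \in T))/=; congr (_ + _); rewrite -big_filter; apply: perm_big.
  apply: uniq_perm => //; first by rewrite filter_uniq.
  move=> j; rewrite mem_filter; case jT : (j \in T) => //=.
  by move: jT; rewrite mem_filter => /andP[].
by rewrite lerDl sumr_ge0// => j _; exact: sqr_ge0.
Qed.

(** Bernoulli's inequality. The rate [t] is chosen so close to 1 that the weights attached to one
    cell differ by a factor of at most [1 + dl]. *)
Lemma expw_weight n (dl : R) : 0 < dl -> exists2 t : R, 0 < t < 1 & (1 + dl)^-1 <= t ^+ (n * D).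
Proof.
move=> d0; set M := (n * D)%N.
have d1 : 0 < 1 + dl by rewrite addr_gt0.
(* Division by [M.+2] rather than [M] keeps [e] below 1/2, also when [M = 0]. *)
pose e := dl / (1 + dl) / M.+2%:R.
have e0 : 0 < e by rewrite !divr_gt0.
have eM : M.+2%:R * e = dl / (1 + dl) by rewrite /e mulrC divfK.
have q1 : dl / (1 + dl) < 1 by rewrite ltr_pdivrMr// mul1r ltrDr.
have h2 : 2 * e < 1.
  by apply: le_lt_trans q1; rewrite -eM ler_pM2r// ler_nat.
exists (1 - e); first by and_lra.
have bern m : 1 - m%:R * e <= (1 - e) ^+ m.
  elim: m => [|m IH]; first by rewrite mul0r subr0.
  have e1 : 0 <= 1 - e by lra.
  rewrite exprS; apply: le_trans (ler_wpM2l e1 IH).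
  have -> : (1 - e) * (1 - m%:R * e) = 1 - m.+1%:R * e + m%:R * e ^+ 2 by rewrite -natr1; ring.
  by rewrite lerDl mulr_ge0// sqr_ge0.
apply: le_trans (bern M); have -> : (1 + dl)^-1 = 1 - M.+2%:R * e by rewrite eM; field; rewrite gt_eqF.
by rewrite lerD2l lerN2 ler_pM2r// ler_nat -addn2 leq_addr.
Qed.

(** [t] and [C] are fixed before the index sets and the element matrices, which is what makes the
    later estimates uniform in the mesh and in the position of the boundary. *)
Definition decay_bound (c0 La t C : R) := forall (I J : seq Z) a, uniq I -> uniq J ->
  (forall i m m', `|a i m m'| <= La) ->
  (forall x, (forall j, j \notin J -> x j = 0) -> c0 * \sum_(j <- J) x j ^+ 2 <= Aloc I a x x) ->
  forall x f, (forall j, j \notin J -> x j = 0) ->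
  (forall y, (forall j, j \notin J -> y j = 0) -> Aloc I a x y = \sum_(j <- J) f j * y j) ->
  forall i, `|x i| <= C * \sum_(j <- J) expw t (j - i) * `|f j|.

(* Testing with the exponentially weighted solution: as the weight varies slowly, coercivity
   survives up to a small relative error. *)
Lemma decay n (c0 La : R) : (forall m m' d, `|off m ord0 d - off m' ord0 d| <= n)%N ->
  0 < c0 -> 0 <= La -> exists t C : R, [/\ 0 < t < 1, 0 <= C & decay_bound c0 La t C].
Proof.
move=> offn c00 La0; pose B := La * #|L|%:R ^+ 2.
have B0 : 0 <= B by rewrite mulr_ge0// sqr_ge0.
(* Chosen so that the error [dl * B] caused by the weights is at most [c0 / 4]. *)
pose dl := c0 / (4 * (B + 1)).
have B1 : 0 < B + 1 by rewrite ltr_wpDl.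
have dl0 : 0 < dl by rewrite divr_gt0// mulr_gt0.
have [t t01 tM] := expw_weight n dl0; have /andP[t0 t1] := t01.
exists t, (2 / c0); split => //; first exact/ltW/divr_gt0.
move=> I J a uI uJ aL coer x f xJ xf i0.
have S0 : 0 <= \sum_(j <- J) expw t (j - i0) * `|f j|.
  by apply: sumr_ge0 => j _; rewrite mulr_ge0// expw_ge0// ltW.
have [i0J|i0J] := boolP (i0 \in J); last first.
  by rewrite xJ// normr0 mulr_ge0// divr_ge0// ltW.
pose w j := expw t (j - i0).
have w0 j : 0 <= w j by rewrite expw_ge0// ltW.
pose y j := w j * x j.
have yJ j : j \notin J -> y j = 0 by move=> jJ; rewrite /y xJ// mulr0.
have vJ j : j \notin J -> w j * y j = 0 by move=> jJ; rewrite yJ// mulr0.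
set Y := \sum_(j <- J) y j ^+ 2.
have main := coer y yJ; have test := xf _ vJ.
(* Bound for the commutator of the form with the weight: testing [x] with [w * y] differs from
   testing [y] with itself by these factors. *)
have wr i m m' : `|w (i - off m') * (w (i - off m') - w (i - off m))| <= dl * (w (i - off m) * w (i - off m')).
  have r (p q : L) : w (i - off p) <= (1 + dl) * w (i - off q).
    rewrite -ler_pdivrMl ?addr_gt0// (@le_trans _ _ (t ^+ (n * D) * w (i - off p)))//.
      by rewrite ler_wpM2r.
    apply: expw_ratio; first by rewrite t0 ltW.
    move=> d; move: (offn q p d); rewrite !mxE.
    by congr (`|_| <= _)%N; ring.
  rewrite normrM ger0_norm// [X in dl * X]mulrC mulrCA ler_wpM2l//.
  have r1 := r m' m; have r2 := r m m'.
  by rewrite ler_norml; apply/andP; split; nra.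
have err : Aloc I a y y - Aloc I a x (fun j => w j * y j) <= dl * B * Y.
  rewrite /Aloc -sumrB.
  apply: (@le_trans _ _ (\sum_(i <- I) \sum_m \sum_m' La * dl * ((y (i - off m) ^+ 2 + y (i - off m') ^+ 2) / 2))).
    apply: ler_sum => i _; rewrite -sumrB; apply: ler_sum => m _; rewrite -sumrB; apply: ler_sum => m' _.
    have := wr i m m'; set p := w (i - off m); set q := w (i - off m') => pq.
    have -> : a i m m' * (y (i - off m) * y (i - off m')) - a i m m' * (x (i - off m) * (w (i - off m') * y (i - off m'))) =
       - (a i m m' * ((q * (q - p)) * (x (i - off m) * x (i - off m')))) by rewrite /y -/p -/q; ring.
    rewrite (le_trans (ler_norm _))// normrN normrM -[leRHS]mulrA ler_pM//.
    rewrite normrM (@le_trans _ _ (dl * (p * q) * `|x (i - off m) * x (i - off m')|))// ?ler_wpM2r//.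
    rewrite -mulrA ler_pM2l//.
    have -> : p * q * `|x (i - off m) * x (i - off m')| = `|y (i - off m)| * `|y (i - off m')|.
      by rewrite /y !normrM !(ger0_norm (w0 _)) -/p -/q; ring.
    rewrite -(real_normK (num_real (y (i - off m)))) -(real_normK (num_real (y (i - off m')))).
    have := sqr_ge0 (`|y (i - off m)| - `|y (i - off m')|).
    by rewrite ler_pdivlMr//; nra.
  have -> : \sum_(i <- I) \sum_m \sum_m' La * dl * ((y (i - off m) ^+ 2 + y (i - off m') ^+ 2) / 2) =
     La * dl * #|L|%:R * \sum_m \sum_(i <- I) y (i - off m) ^+ 2.
    rewrite [in RHS]exchange_big/= mulr_sumr; apply: eq_bigr => i _.
    under eq_bigr do rewrite -mulr_sumr.
    rewrite -mulr_sumr -[RHS]mulrA; congr (_ * _).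
    pose u l := y (i - off l) ^+ 2.
    transitivity (\sum_(l : L) (#|L|%:R * u l + \sum_l' u l') / 2).
      by apply: eq_bigr => l _; rewrite -(big_distrl 2^-1)/= big_split/= sumr_const -[_ *+ #|_|]mulr_natl.
    by rewrite -(big_distrl 2^-1)/= big_split/= sumr_const -mulr_sumr -[_ *+ #|_|]mulr_natl; field.
  apply: (@le_trans _ _ (La * dl * #|L|%:R * \sum_(m : L) Y)).
    have dl0' := ltW dl0; apply: ler_wpM2l; first by apply: mulr_ge0 (ler0n _ _); exact: mulr_ge0.
    by apply: ler_sum => m _; exact: sum_shift_le.
  by rewrite sumr_const -mulr_natl /B; rewrite le_eqVlt; apply/orP; left; apply/eqP; ring.
(* Young's inequality with the small factor [c0 / 4]; together with the weight error it leaves half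
   of the coercivity. *)
have rhs : \sum_(j <- J) f j * (w j * y j) <= c0 / 4 * Y + c0^-1 * \sum_(j <- J) (w j * `|f j|) ^+ 2.
  rewrite /Y !mulr_sumr -big_split/=; apply: ler_sum => j _.
  have -> : (w j * `|f j|) ^+ 2 = (w j * f j) ^+ 2 by rewrite !exprMn real_normK// num_real.
  have := sqr_ge0 (c0 / 2 * y j - w j * f j) => sq.
  rewrite -subr_ge0 -(pmulr_rge0 _ c00).
  have -> : c0 * (c0 / 4 * y j ^+ 2 + c0^-1 * (w j * f j) ^+ 2 - f j * (w j * y j)) = (c0 / 2 * y j - w j * f j) ^+ 2; last by [].
  by field; rewrite gt_eqF.
have Y0 : 0 <= Y by apply: sumr_ge0 => j _; exact: sqr_ge0.
have dlB : dl * B <= c0 / 4.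
  rewrite /dl; have -> : c0 / (4 * (B + 1)) * B = c0 / 4 * (B / (B + 1)) by field; rewrite gt_eqF.
  apply: ler_piMr; first exact/ltW/divr_gt0.
  by rewrite ler_pdivrMr// mul1r lerDl.
(* The terms are nonnegative, so the sum of squares is at most the square of the sum; this produces
   the weighted [l^1] sum of the claim. *)
have sqs : \sum_(j <- J) (w j * `|f j|) ^+ 2 <= (\sum_(j <- J) w j * `|f j|) ^+ 2.
  elim: (J) => [|j s IH]; first by rewrite !big_nil expr0n.
  rewrite !big_cons; have : 0 <= w j * `|f j| by rewrite mulr_ge0.
  have : 0 <= \sum_(j0 <- s) w j0 * `|f j0| by apply: sumr_ge0 => k _; rewrite mulr_ge0.
  move: IH; set u := \sum_(j <- s) _ ^+ 2; set v := \sum_(j <- s) _; set z := w j * _ => h v0 z0; nra.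
have yx : y i0 = x i0 by rewrite /y /w subrr expw0 mul1r.
have xY : x i0 ^+ 2 <= Y.
  by rewrite /Y (big_rem i0)//= yx lerDl sumr_ge0// => j _; exact: sqr_ge0.
set S := \sum_(j <- J) w j * `|f j| in sqs *.
have h1 : c0 * Y <= dl * B * Y + (c0 / 4 * Y + c0^-1 * S ^+ 2).
  rewrite -test in rhs; have h : c0^-1 * \sum_(j <- J) (w j * `|f j|) ^+ 2 <= c0^-1 * S ^+ 2 by rewrite ler_wpM2l// invr_ge0 ltW.
  apply: le_trans main _; rewrite lerBlDr in err; apply: (le_trans err); rewrite lerD2l.
  by apply: (le_trans rhs); rewrite lerD2l.
have h2 : dl * B * Y <= c0 / 4 * Y by rewrite ler_wpM2r.
have h3 : c0 / 2 * Y <= c0^-1 * S ^+ 2 by lra.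
have h4 : Y <= (2 / c0 * S) ^+ 2.
  have c20 : 0 < c0 / 2 by rewrite divr_gt0.
  rewrite -(ler_pM2l c20); apply: (le_trans h3).
  have -> : c0 / 2 * (2 / c0 * S) ^+ 2 = 2 * (c0^-1 * S ^+ 2) by field; rewrite gt_eqF.
  have : 0 <= c0^-1 * S ^+ 2 by apply: mulr_ge0 (sqr_ge0 _); rewrite invr_ge0 ltW.
  by lra.
have S2 : 0 <= 2 / c0 * S by apply: mulr_ge0 => //; exact/ltW/divr_gt0.
rewrite -[2 / c0 * _]/(2 / c0 * S).
rewrite -(ler_pXn2r (n := 2))// ?nnegrE// real_normK ?num_real//.
exact: le_trans h4.
Qed.

Ltac pull_sum := under [RHS]eq_bigr do rewrite mulr_sumr; rewrite [RHS]exchange_big/=; apply: eq_bigr => ? _.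

Lemma Aloc_suml I a (J : seq Z) (b : Z -> R) (X : Z -> Z -> R) y :
  Aloc I a (fun z => \sum_(j <- J) b j * X j z) y = \sum_(j <- J) b j * Aloc I a (X j) y.
Proof.
rewrite /Aloc; do 3!pull_sum.
rewrite mulr_suml mulr_sumr; apply: eq_bigr => j _; ring.
Qed.

Lemma Aloc_sumr I a (J : seq Z) (b : Z -> R) x (X : Z -> Z -> R) :
  Aloc I a x (fun z => \sum_(j <- J) b j * X j z) = \sum_(j <- J) b j * Aloc I a x (X j).
Proof.
rewrite /Aloc; do 3!pull_sum.
rewrite !mulr_sumr; apply: eq_bigr => j _; ring.
Qed.

Lemma supp_expand (J : seq Z) x : uniq J -> (forall j, j \notin J -> x j = 0) ->
  x = fun z => \sum_(j <- J) x j * (z == j)%:R.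
Proof.
move=> uJ xJ; apply/funext => z; have [zJ|zJ] := boolP (z \in J).
  rewrite (big_rem z)//= eqxx mulr1 big_seq big1 ?addr0// => j.
  rewrite (rem_filter _ uJ) mem_filter => /andP[/= /negbTE jz _].
  by rewrite eq_sym jz mulr0.
rewrite xJ// big_seq big1// => j jJ.
by case: eqP => [zj|]; [rewrite zj jJ in zJ|rewrite mulr0].
Qed.

(** Coercivity makes the square matrix of the form on [J] injective, hence invertible. *)
Lemma Aloc_solve I a (J : seq Z) (c0 : R) f : uniq J -> 0 < c0 ->
  (forall x, (forall j, j \notin J -> x j = 0) -> c0 * \sum_(j <- J) x j ^+ 2 <= Aloc I a x x) ->
  exists2 x, (forall j, j \notin J -> x j = 0) &
    forall y, (forall j, j \notin J -> y j = 0) -> Aloc I a x y = \sum_(j <- J) f j * y j.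
Proof.
move=> uJ c00 coer; pose N := size J.
pose e (j z : Z) : R := (z == j)%:R.
pose jn (k : nat) := nth 0 J k.
pose M : 'M[R]_N := \matrix_(k, l) Aloc I a (e (jn k)) (e (jn l)).
pose X (b : 'rV[R]_N) z : R := \sum_(k < N) b 0 k * e (jn k) z.
have XJ b j : j \notin J -> X b j = 0.
  move=> jJ; rewrite /X big1// => k _; rewrite /e; case: eqP => [jk|]; last by rewrite mulr0.
  by rewrite jk mem_nth in jJ.
have Xn b (k : 'I_N) : X b (jn k) = b 0 k.
  rewrite /X (bigD1 k)//= /e eqxx mulr1 big1 ?addr0// => l lk.
  by rewrite nth_uniq// eq_sym (negbTE lk : (l == k :> nat) = false) mulr0.
have AX b (l : 'I_N) : Aloc I a (X b) (e (jn l)) = (b *m M) 0 l.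
  rewrite mxE /X.
  pose b' (z : Z) : R := oapp (fun k => b 0 k) 0 (insub (index z J)).
  have b'E (k : 'I_N) : b' (jn k) = b 0 k by rewrite /b' index_uniq// valK.
  rewrite (_ : (fun z => _) = fun z => \sum_(j <- J) b' j * e j z).
    rewrite Aloc_suml (big_nth 0) big_mkord; apply: eq_bigr => k _.
    by rewrite -/(jn k) b'E mxE.
  apply/funext => z; rewrite (big_nth 0) big_mkord; apply: eq_bigr => k _.
  by rewrite -/(jn k) b'E.
have AXy b y : (forall j, j \notin J -> y j = 0) -> Aloc I a (X b) y = \sum_(l < N) y (jn l) * (b *m M) 0 l.
  move=> yJ; rewrite {1}(supp_expand uJ yJ) Aloc_sumr (big_nth 0) big_mkord.
  by apply: eq_bigr => l _; rewrite -AX.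
have uM : M \in unitmx.
  apply: unitmx_ker => b bM; have := coer (X b) (XJ b); rewrite AXy; last exact: XJ.
  rewrite bM [X in _ <= X]big1 => [|l _]; last by rewrite mxE mulr0.
  rewrite pmulr_rle0// => S0; apply/rowP => l; rewrite [RHS]mxE.
  have : X b (jn l) ^+ 2 <= 0.
    by apply: le_trans S0; rewrite (big_rem (jn l)) ?mem_nth//= lerDl sumr_ge0// => j _; exact: sqr_ge0.
  by rewrite Xn => h; apply/eqP; rewrite -sqrf_eq0 eq_le h sqr_ge0.
pose b := (\row_(l < N) f (jn l)) *m invmx M.
exists (X b) => [|y yJ]; first exact: XJ.
rewrite AXy// mulmxKV// (big_nth 0) big_mkord; apply: eq_bigr => l _.
by rewrite mxE mulrC.
Qed.

End Decay.

(** * Almost everywhere statements on products and translates *)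

Section AE.
Context {R : realType}.
Open Scope ereal_scope.

Lemma measure_cbox D (a b : 'rV[R]_D) : (forall d, a ord0 d <= b ord0 d)%R ->
  lebesgue_rV D (cbox a b) = (\prod_d (b ord0 d - a ord0 d))%:E.
Proof.
move=> ab; rewrite cbox_prodset.
apply: (@measure_prodset _ _ (fun d => [set` `[a ord0 d, b ord0 d]]) (fun d => b ord0 d - a ord0 d)%R) => d; first exact: measurable_itv.
rewrite lebesgue_measure_itv/= lte_fin lt_neqAle ab andbT EFinB; case: eqVneq => //= ->.
by rewrite subee.
Qed.

Lemma measure_cube D (z0 : 'rV[R]_D) (r : R) : (0 <= r)%R ->
  lebesgue_rV D (cbox z0 (\row_e (z0 ord0 e + r))%R) = (r ^+ D)%:E.
Proof.
move=> r0; rewrite measure_cbox => [|d]; last by rewrite !mxE lerDl.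
rewrite (eq_bigr (fun=> r)) => [|d _]; last by rewrite !mxE addrAC subrr add0r.
by rewrite prodr_const card_ord.
Qed.

Lemma measurable_linefix D (d : 'I_D) (x : 'rV[R]_D) :
  measurable_fun setT (fun s : measurableTypeR R => (s *: unit_vec d + x)%R).
Proof.
apply: measurable_rV => e; under eq_fun do rewrite unit_vecE.
by apply: measurable_funD => //; case: (e == d).
Qed.

Lemma integral_indicM d (T : measurableType d) (m : {measure set T -> \bar R}) (W : set T) (F : T -> \bar R) :
  \int[m]_(t in W) F t = \int[m]_t (F t * (\1_W t)%:E).
Proof.
rewrite integral_mkcond; apply: eq_integral => t _.
by rewrite /patch indicE /=; case: ifPn; rewrite ?mule1 ?mule0.
Qed.

Lemma null_integral_indic d (T : measurableType d) (m : {measure set T -> \bar R}) (A : set T) : measurable A ->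
  \int[m]_t (\1_A t : R)%:E = m A.
Proof. by move=> mA; rewrite integral_indic// setIT. Qed.

(** By Tonelli a measurable set with null slices in one variable is null. It serves to turn a
    property valid for each [t] and almost every [x] into one valid for almost every [x] and almost
    every [t]. *)
Lemma ae_swap d1 d2 (T1 : measurableType d1) (T2 : measurableType d2)
   (m1 : {sigma_finite_measure set T1 -> \bar R}) (m2 : {sigma_finite_measure set T2 -> \bar R})
   (A : set (T1 * T2)) : measurable A -> (forall t, m1 [set x | A (x, t)] = 0) ->
  {ae m1, forall x, {ae m2, forall t, ~ A (x, t)}}.
Proof.
move=> mA A0.
have mf : measurable_fun setT (fun z : T1 * T2 => (\1_A z : R)%:E) by apply/measurable_EFinP; exact: measurable_indic.
have f0 z : 0 <= (\1_A z : R)%:E by [].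
have mx x : measurable [set t | A (x, t)].
  by have := measurable_pair1 x measurableT mA; rewrite setTI.
have my t : measurable [set x | A (x, t)].
  by have := measurable_pair2 t measurableT mA; rewrite setTI.
have E1 x : \int[m2]_t (\1_A (x, t) : R)%:E = m2 [set t | A (x, t)].
  by rewrite -(null_integral_indic m2 (mx x)).
have E2 t : \int[m1]_x (\1_A (x, t) : R)%:E = 0.
  by rewrite -(A0 t) -(null_integral_indic m1 (my t)).
have := @fubini_tonelli _ _ _ _ _ m1 m2 _ mf f0.
under [X in _ = X -> _]eq_integral do rewrite E2.
rewrite integral0 => I0.
have mF := @measurable_fun_fubini_tonelli_F _ _ _ _ _ m2 _ mf f0.
have [+ _] := ae_eq_integral_abs m1 measurableT mF.
have -> : \int[m1]_x `|\int[m2]_t (\1_A (x, t) : R)%:E| = 0.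
  by rewrite -I0; apply: eq_integral => x _; rewrite gee0_abs// integral_ge0.
move=> /(_ erefl); apply: filterS => x /(_ I); rewrite /fubini_F/= E1 => mx0.
by exists [set t | A (x, t)]; split => // t /= /contrapT.
Qed.

End AE.

Section Translation.
Context {R : realType} (D : nat).
Notation mu := (lebesgue_rV D).
Notation V := ('rV[R]_D).
Open Scope ereal_scope.

Lemma null_translate (v : V) (N : set V) : measurable N -> mu N = 0 -> mu [set x | N (v + x)%R] = 0.
Proof.
move=> mN N0; have mN' : measurable [set x | N (v + x)%R].
  by have := measurable_translatel v measurableT mN; rewrite setTI.
rewrite -(null_integral_indic mu mN') -N0 -(null_integral_indic mu mN).
rewrite -[RHS](integral_translate v)//; last by apply/measurable_EFinP; exact: measurable_indic.
by apply: eq_integral => x _; rewrite addrC.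
Qed.

Lemma ae_translate (v : V) (P : V -> Prop) : {ae mu, forall x, P x} -> {ae mu, forall x, P (v + x)%R}.
Proof.
move=> [N [mN N0 PN]]; exists [set x | N (v + x)%R]; split.
- by have := measurable_translatel v measurableT mN; rewrite setTI.
- exact: null_translate.
- by move=> x /= nP; exact: PN.
Qed.

(** Every translate of a null set is null; [ae_swap] then exchanges the two quantifiers. *)
Lemma ae_avg d (T : measurableType d) (nu : {sigma_finite_measure set T -> \bar R}) (tau : T -> V)
   (P : V -> Prop) : measurable_fun setT tau -> {ae mu, forall x, P x} ->
  {ae mu, forall x, {ae nu, forall t, P (x + tau t)%R}}.
Proof.
move=> mt [N [mN N0 PN]].
have mA : measurable [set z : V * T | N (z.1 + tau z.2)%R].
  by have := measurable_add_rV mt measurableT mN; rewrite setTI.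
have A0 t : mu [set x | N (x + tau t)%R] = 0.
  by under eq_set do rewrite addrC; exact: null_translate.
have := ae_swap nu mA A0; apply: filterS => x; apply: filterS => t nN.
by apply: contrapT => nP; apply: nN; exact: PN.
Qed.

End Translation.

(** * Poincare and Bramble-Hilbert inequalities *)

Section Poincare.
Context {R : realType} (D : nat).
Notation mu := (lebesgue_rV D).
Notation leb := (@lebesgue_measure R).
Notation V := ('rV[R]_D).
Open Scope ereal_scope.

Definition convs (t : R) : set R := [set` `[Num.min 0 t, Num.max 0 t]%R].

(** A negative increment is a positive one started from the other end of the segment; a translation
    of the null set and of the integration variable reduces it to [ACL]. *)
Lemma ACL_conv (h hd : V -> R) (d : 'I_D) (t : R) : locint h -> locint hd -> wpart d h hd ->
  {ae mu, forall x, `|h (t *: unit_vec d + x) - h x|%:E <=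
    \int[leb]_s (`|hd (s *: unit_vec d + x)| * \1_(convs t) s)%:E}.
Proof.
move=> lh lhd wp.
have E0 x (u : R) : \int[leb]_(s in [set` `[0%R, u]%R]) `|hd (s *: unit_vec d + x)|%:E =
   \int[leb]_s (`|hd (s *: unit_vec d + x)| * \1_[set` `[0%R, u]%R] s)%:E.
  by rewrite integral_indicM.
case: (ltgtP 0%R t) => [t0|t0|<-].
- have := ACL lh lhd wp t0; apply: filterS => x; rewrite E0.
  by rewrite /convs min_l ?max_r ?(ltW t0).
- have t0' : (0 < - t)%R by rewrite oppr_gt0.
  have := ae_translate (t *: unit_vec d) (ACL lh lhd wp t0'); apply: filterS => x.
  rewrite addrA -scalerDl addNr scale0r add0r distrC => /le_trans; apply.
  rewrite E0 /convs min_r ?max_l ?(ltW t0)// -(integral_translate1 (- t)%R (f := fun s : measurableTypeR R => (`|hd (s *: unit_vec d + (t *: unit_vec d + x))| * \1_[set` `[0%R, (- t)%R]%R] s)%:E)).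
  rewrite le_eqVlt; apply/orP; left; apply/eqP; apply: eq_integral => s _.
    congr (_%:E); congr (`|hd _| * _)%R.
      by rewrite addrA -scalerDl subrK.
    rewrite !indicE; congr (nat_of_bool _)%:R; apply/idP/idP; rewrite !inE/= !in_itv/= => /andP[? ?]; and_lra.
  apply/measurable_EFinP; apply: measurable_funM; last by apply: measurable_indic; exact: measurable_itv.
  exact: (measurableT_comp (@normr_measurable R setT) (measurableT_comp lhd.1 (measurable_linefix d _))).
  by move=> s; rewrite lee_fin mulr_ge0.
- rewrite scale0r; apply: nearW => x; rewrite add0r subrr normr0.
  by apply: integral_ge0 => s _; rewrite lee_fin mulr_ge0.
Qed.

(** Keeps the first [d] coordinates: [x + pv d v] are the vertices of the path from [x] to [x + v]
    parallel to the axes. *)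
Definition pv (d : nat) (v : V) : V := (\row_e (if (e < d)%N then v ord0 e else 0))%R.

Lemma pv0 v : pv 0 v = 0%R.
Proof. by apply/rowP => e; rewrite !mxE. Qed.

Lemma pvD v : pv D v = v.
Proof. by apply/rowP => e; rewrite !mxE ltn_ord. Qed.

Lemma pvS (d : 'I_D) v : pv d.+1 v = (v ord0 d *: unit_vec d + pv d v)%R.
Proof.
apply/rowP => e; rewrite unit_vecE !mxE ltnS.
case: eqP => [->|ed]; first by rewrite leqnn ltnn addr0.
by rewrite add0r leq_eqVlt; have -> : (e == d :> nat) = false by apply/negP => /eqP/val_inj.
Qed.

Lemma measurable_pv d : measurable_fun setT (pv d).
Proof.
apply: measurable_rV => e; under eq_fun do rewrite mxE.
by case: (e < d)%N; [exact: measurable_coor|exact: measurable_cst].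
Qed.

Variable rho : R.
Hypothesis rho0 : (0 < rho)%R.

(** Contains all differences of two points of a cube of side [rho], as [pint] does for each
    coordinate. *)
Definition pcube : set V := cbox (\row_e (- rho))%R (\row_e rho)%R.
Definition pint : set (measurableTypeR R) := [set` `[(- rho)%R, rho]%R].
Lemma measure_pcube : mu pcube = ((2 * rho) ^+ D)%:E.
Proof.
rewrite measure_cbox => [|d]; last by rewrite !mxE; have := rho0; lra.
rewrite (eq_bigr (fun=> 2 * rho)%R) => [|d _]; last by rewrite !mxE; ring.
by rewrite prodr_const card_ord.
Qed.

Lemma measure_pint : leb pint = (2 * rho)%:E.
Proof.
rewrite lebesgue_measure_itv/= lte_fin ifT; last by have := rho0; lra.
by rewrite -EFinD opprK; congr (_%:E); ring.
Qed.

Definition line_avg (d : 'I_D) (G : V -> \bar R) (y : V) : \bar R :=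
  \int[leb]_(s in pint) G (y + s *: unit_vec d)%R.

(** The right-hand side of the Poincare inequality: line integrals in each direction, averaged over
    the vertices of the path. It is built from translates only, so that [Lnorm_avg] bounds it for
    every [p]. *)
Definition TT (G : V -> \bar R) (x : V) : \bar R :=
  (rho^-1 ^+ D)%:E * \sum_(d < D) \int[mu]_(v in pcube) line_avg d G (x + pv d v)%R.

Lemma measurable_unit_line (d : 'I_D) : measurable_fun setT (fun s : measurableTypeR R => (s *: unit_vec d : V)%R).
Proof.
have := measurable_linefix d (0 : V)%R.
by rewrite (_ : (fun s => _) = (fun s : measurableTypeR R => (s *: unit_vec d : V)%R))//; apply/funext => s; rewrite addr0.
Qed.

Lemma line_avg_ge0 d G y : (forall x, 0 <= G x) -> 0 <= line_avg d G y.
Proof. by move=> G0; apply: integral_ge0. Qed.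

Lemma measurable_line_avg d G : measurable_fun setT G -> (forall x, 0 <= G x) ->
  measurable_fun setT (line_avg d G).
Proof.
move=> mG G0; have mp : measurable pint by exact: measurable_itv.
by have := @measurable_avg R D _ _ leb pint (fun s => s *: unit_vec d)%R G mp (measurable_unit_line d) mG G0 id; apply.
Qed.

Lemma TT_ge0 G x : (forall x, 0 <= G x) -> 0 <= TT G x.
Proof.
move=> G0; apply: mule_ge0; first by rewrite lee_fin exprn_ge0// invr_ge0 ltW.
by apply: sume_ge0 => d _; apply: integral_ge0 => v _; exact: line_avg_ge0.
Qed.

Lemma measurable_TT1 d G : measurable_fun setT G -> (forall x, 0 <= G x) ->
  measurable_fun setT (fun x : V => \int[mu]_(v in pcube) line_avg d G (x + pv d v)%R).
Proof.
move=> mG G0; have mp : measurable pcube by exact: measurable_cbox.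
have := @measurable_avg R D _ _ mu pcube (pv d) _ mp (measurable_pv d) (measurable_line_avg d mG G0) (fun y => line_avg_ge0 d y G0) id.
by apply.
Qed.

Lemma measurable_TT G : measurable_fun setT G -> (forall x, 0 <= G x) -> measurable_fun setT (TT G).
Proof.
move=> mG G0; apply: measurable_funeM; apply: emeasurable_sum => d.
exact: measurable_TT1.
Qed.

(** Each of the [D] terms is a double average of masses [(2 rho)^D] and [2 rho], and the prefactor
    removes [rho^D]; one power of [rho] is gained. *)
Lemma Lnorm_TT (p : \bar R) G : 1 <= p -> measurable_fun setT G -> (forall x, 0 <= G x) ->
  'N[mu]_p[TT G] <= (D%:R * 2 ^+ D.+1 * rho)%:E * 'N[mu]_p[G].
Proof.
move=> p1 mG G0; have r0 : (0 <= rho^-1 ^+ D)%R by rewrite exprn_ge0// invr_ge0 ltW.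
have r1 : (0 <= 2 * rho)%R by rewrite mulr_ge0// ltW.
have m1 d := measurable_TT1 d mG G0.
rewrite /TT Lnorm_scale//; last exact: emeasurable_sum.
apply: (@le_trans _ _ ((rho^-1 ^+ D)%:E * \sum_(d < D) ((2 * rho) ^+ D.+1)%:E * 'N[mu]_p[G])).
  apply: lee_wpmul2l; first by rewrite lee_fin.
  apply: le_trans (Lnorm_sum _ _ p1 m1 _) _.
    by move=> d x; apply: integral_ge0 => v _; exact: line_avg_ge0.
  apply: lee_sum => d _.
  have mp : measurable pcube by exact: measurable_cbox.
  have mi : measurable pint by exact: measurable_itv.
  have h1 := Lnorm_avg mp (exprn_ge0 D r1) measure_pcube (measurable_pv d) (measurable_line_avg d mG G0)
     (fun y => line_avg_ge0 d y G0) p1.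
  have h2 := Lnorm_avg mi r1 measure_pint (measurable_unit_line d) mG G0 p1.
  apply: (le_trans h1); rewrite exprSr EFinM -muleA; apply: lee_wpmul2l => //.
  by rewrite lee_fin exprn_ge0.
rewrite -ge0_sume_distrl => [|d _]; last by rewrite lee_fin exprn_ge0.
rewrite sumEFin sumr_const card_ord muleA -EFinM le_eqVlt; apply/orP; left; apply/eqP; congr (_%:E * _).
by rewrite -mulr_natl exprMn (exprSr rho) exprVn; field; rewrite expf_neq0 ?gt_eqF.
Qed.

(* Average [|h(x) - h(z)|] over [z] in the cube and bound it by line integrals along a polygonal
   path parallel to the axes, which stays in the cube. *)
Lemma poincare h (hd : 'I_D -> V -> R) (G : V -> \bar R) (z0 : V) :
  let om := cbox z0 (\row_e (z0 ord0 e + rho))%R in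
  locint h -> (forall d, locint (hd d)) -> (forall d, wpart d h (hd d)) ->
  measurable_fun setT G -> (forall x, 0 <= G x) ->
  (forall d, {ae mu, forall x, om x -> `|hd d x|%:E <= G x}) ->
  \int[mu]_(x in om) (h x)%:E = 0 ->
  {ae mu, forall x, om x -> `|h x|%:E <= TT G x}.
Proof.
move=> om lh lhd wp mG G0 hdG h0.
have mom : measurable om by exact: measurable_cbox.
(* The derivatives are bounded by [G] only on the cube, so they are cut off there. *)
pose Gd d x := (`|hd d x| * \1_om x)%R.
have mGd d : measurable_fun setT (Gd d).
  apply: measurable_funM; last exact: measurable_indic.
  by apply: measurableT_comp => //; exact: (lhd d).1.
have Gd0 d x : (0 <= Gd d x)%R by rewrite mulr_ge0.
have GdG d : {ae mu, forall x, (Gd d x)%:E <= G x}.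
  apply: filterS (hdG d) => x; rewrite /Gd indicE; have [/set_mem omx /(_ omx)|_ _] := boolP (x \in om).
    by rewrite mulr1.
  by rewrite mulr0.
pose Fd d (zs : (V * V) * measurableTypeR R) : \bar R :=
  (Gd d (zs.1.1 + pv d zs.1.2 + zs.2 *: unit_vec d) * \1_pint zs.2)%:E.
have mFd d : measurable_fun setT (Fd d).
  apply/measurable_EFinP; apply: measurable_funM; last first.
    by apply: (measurableT_comp _ measurable_snd); apply: measurable_indic; exact: measurable_itv.
  apply: (measurableT_comp (mGd d)).
  apply: measurable_rV => e; under eq_fun do rewrite addrC unit_vecE mxE.
  apply: measurable_funD; first by case: (e == d); [exact: measurable_snd|exact: measurable_cst].
  apply: measurable_funD.
    exact: (measurableT_comp (measurable_coor e) (measurableT_comp measurable_fst measurable_fst)).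
  exact: (measurableT_comp (measurable_coor e) (measurableT_comp (measurable_pv d) (measurableT_comp measurable_snd measurable_fst))).
have Fd0 d zs : 0 <= Fd d zs by rewrite lee_fin mulr_ge0.
pose B (xv : V * V) : \bar R := \sum_(d < D) \int[leb]_s Fd d (xv, s).
have mB : measurable_fun setT B.
  by apply: emeasurable_sum => d; exact: (@measurable_fun_fubini_tonelli_F _ _ _ _ _ leb _ (mFd d) (Fd0 d)).
have B0 xv : 0 <= B xv by apply: sume_ge0 => d _; exact: integral_ge0.
pose A := [set xv : V * V | [/\ om xv.1, om (xv.2 + xv.1)%R & B xv < `|h (xv.2 + xv.1)%R - h xv.1|%:E]].
have mswap : measurable_fun setT (fun xv : V * V => (xv.2 + xv.1)%R).
  apply: measurable_rV => e; under eq_fun do rewrite mxE.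
  by apply: measurable_funD; [exact: (measurableT_comp (measurable_coor e) measurable_snd)|exact: (measurableT_comp (measurable_coor e) measurable_fst)].
have mA : measurable A.
  rewrite (_ : A = (fst @^-1` om) `&` ((fun xv : V * V => (xv.2 + xv.1)%R) @^-1` om) `&` [set xv | B xv < `|h (xv.2 + xv.1)%R - h xv.1|%:E]); last first.
    by apply/seteqP; split => xv /=; [move=> [] *|move=> [[]] *].
  apply: measurableI; first apply: measurableI.
  - by rewrite -[X in measurable X]setTI; exact: measurable_fst.
  - by rewrite -[X in measurable X]setTI; exact: mswap.
  - rewrite -[X in measurable X]setTI; apply: measurable_lte => //.
    apply/measurable_EFinP; apply: measurableT_comp => //; apply: measurable_funB.
      exact: (measurableT_comp lh.1 mswap).
    exact: (measurableT_comp lh.1 measurable_fst).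
(* Each coordinate of a vertex is a coordinate of [x] or of [v + x], so the path stays in the
   cube. *)
have pvom x v (d : nat) : (d <= D)%N -> om x -> om (v + x)%R -> om (pv d v + x)%R.
  move=> _ ox ov e; rewrite !mxE; have := ox e; have := ov e; rewrite !mxE.
  by case: ifP => _ //; rewrite add0r.
have A0 v : mu [set x | A (x, v)] = 0.
  have H (d : 'I_D) : {ae mu, forall x, om x -> om (v + x)%R ->
      `|h (pv d.+1 v + x) - h (pv d v + x)|%:E <= \int[leb]_s Fd d ((x, v), s)}.
    have := ae_translate (pv d v) (ACL_conv (v ord0 d) lh (lhd d) (wp d)).
    apply: filterS => x; rewrite addrA -pvS => /le_trans + ox ov; apply.
    apply: ge0_le_integral => //.
    - apply/measurable_EFinP; apply: measurable_funM; last by apply: measurable_indic; exact: measurable_itv.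
      exact: (measurableT_comp (@normr_measurable R setT) (measurableT_comp (lhd d).1 (measurable_linefix d _))).
    - exact: (measurableT_comp (mFd d) (measurable_pair1 (x, v))).
    move=> s _; rewrite lee_fin /Fd /Gd /= !indicE.
    have [/set_mem sv|_] := boolP (s \in convs _); last by rewrite mulr0 mulr_ge0// mulr_ge0.
    move: sv; rewrite /convs/= in_itv/= => /andP[s1 s2].
    have vr : (- rho <= v ord0 d <= rho)%R.
      have := ox d; have := ov d; rewrite !mxE => /andP[? ?] /andP[? ?]; and_lra.
    have sr : (- rho <= s <= rho)%R.
      move/andP : vr => [? ?]; move: s1 s2; rewrite ge_min le_max => /orP[] ? /orP[] ?; and_lra.
    have omt : om (s *: unit_vec d + (pv d v + x))%R.
      move=> e; have := ox e; have := ov e; rewrite unit_vecE !mxE => /andP[a1 a2] /andP[a3 a4].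
      case: eqP => [ed|_]; last by rewrite add0r; case: ifP => _; and_lra.
      rewrite ed ltnn add0r; rewrite ed in a1 a2 a3 a4.
      by move: s1 s2; rewrite ge_min le_max => /orP[] ? /orP[] ?; and_lra.
    have -> : (x + pv d v + s *: unit_vec d = s *: unit_vec d + (pv d v + x))%R by rewrite addrC; congr (_ + _)%R; rewrite addrC.
    by rewrite (mem_set omt) mem_set ?mulr1//= in_itv.
  have {}H : {ae mu, forall x (d : 'I_D), om x -> om (v + x)%R ->
      `|h (pv d.+1 v + x) - h (pv d v + x)|%:E <= \int[leb]_s Fd d ((x, v), s)}.
    exact: filter_forall H.
  have [N [mN N0 HN]] := H.
  have mAv : measurable [set x | A (x, v)] by have := measurable_pair2 v measurableT mA; rewrite setTI.
  apply/eqP; rewrite -measure_le0 -N0; apply: le_measure; rewrite ?inE//.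
  move=> x [/= ox ov Bx]; apply: HN => /= K.
  suff : `|h (v + x) - h x|%:E <= B (x, v) by rewrite leNgt Bx.
  have -> : (h (v + x) - h x = \sum_(d < D) (h (pv d.+1 v + x) - h (pv d v + x)))%R.
    by rewrite -(big_mkord xpredT (fun d => h (pv d.+1 v + x) - h (pv d v + x))%R) telescope_sumr// pv0 pvD add0r.
  apply: (@le_trans _ _ (\sum_(d < D) `|h (pv d.+1 v + x) - h (pv d v + x)|%:E)).
    by rewrite sumEFin lee_fin ler_norm_sum.
  by apply: lee_sum => d _; exact: K.
have mp : measurable pcube by exact: measurable_cbox.
have vol : mu om = (rho ^+ D)%:E by exact: measure_cube (ltW rho0).
have := ae_swap mu mA A0.
have GA : {ae mu, forall x, forall d : 'I_D, {ae mu, forall v, {ae leb, forall s,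
    (Gd d (x + pv d v + s *: unit_vec d)%R)%:E <= G (x + pv d v + s *: unit_vec d)%R}}}.
  apply: filter_forall => d.
  exact: (ae_avg mu (measurable_pv d) (ae_avg leb (measurable_unit_line d) (GdG d))).
apply: filterS2 GA => x GAx Ax ox.
have rD : (0 < rho ^+ D)%R by rewrite exprn_gt0.
suff K : (rho ^+ D)%:E * `|h x|%:E <= \sum_(d < D) \int[mu]_(v in pcube) line_avg d G (x + pv d v)%R.
  rewrite /TT -[leLHS]mul1e -(_ : (rho^-1 ^+ D)%:E * (rho ^+ D)%:E = 1); last by rewrite -EFinM exprVn mulVf ?gt_eqF.
  by rewrite -muleA; apply: lee_wpmul2l => //; rewrite lee_fin exprn_ge0// invr_ge0 ltW.
apply: (@le_trans _ _ (\int[mu]_(v in pcube) B (x, v))); last first.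
  rewrite ge0_integral_sum//; last 2 first.
  - move=> d; apply: measurable_funTS; have := @measurable_fun_fubini_tonelli_F _ _ _ _ _ leb _ (mFd d) (Fd0 d).
    by move=> mm; exact: (measurableT_comp mm (measurable_pair1 x)).
  - by move=> d v _; apply: integral_ge0.
  apply: lee_sum => d _.
  have mline y : measurable_fun setT (fun s : measurableTypeR R => (y + s *: unit_vec d)%R).
    by under eq_fun do rewrite addrC; exact: measurable_linefix.
  apply: ae_ge0_le_integral => //.
  - by move=> v _; exact: integral_ge0.
  - apply: measurable_funTS; have mm := @measurable_fun_fubini_tonelli_F _ _ _ _ _ leb _ (mFd d) (Fd0 d).
    exact: (measurableT_comp mm (measurable_pair1 x)).
  - by move=> v _; exact: line_avg_ge0.
  - apply: measurable_funTS.
    exact: (measurableT_comp (measurable_line_avg d mG G0) (measurableT_comp (measurable_translatel x) (measurable_pv d))).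
  apply: filterS (GAx d) => v Gv _; rewrite /line_avg [leRHS]integral_indicM.
  apply: ae_ge0_le_integral => //.
  - exact: (measurableT_comp (mFd d) (measurable_pair1 (x, v))).
  - by move=> s _; rewrite mule_ge0// lee_fin.
  - apply: emeasurable_funM; first exact: (measurableT_comp mG (mline _)).
    by apply/measurable_EFinP; apply: measurable_indic; exact: measurable_itv.
  - have [N [mN N0 GN]] := Gv; exists N; split => // s nH; apply: GN => Gs; apply: nH => _.
    by rewrite /Fd EFinM; apply: lee_wpmul2r; rewrite ?lee_fin.
have iom : mu.-integrable om (EFin \o h) by exact: lh.2.
have icst : mu.-integrable om (EFin \o cst (h x)).
  apply: (@compact_integrable_bounded _ _ _ _ _ `|h x|%R) => //; exact: cbox_lty.
(* As [h] has mean zero on the cube, integrating [h z - h x] over [z] leaves only the constant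
   [h x]. *)
have -> : (rho ^+ D)%:E * `|h x|%:E = `| \int[mu]_(z in om) ((h z)%:E - (h x)%:E) |.
  have IB := integralB mom iom icst; rewrite [X in `|X|](_ : _ = - (h x * rho ^+ D)%:E).
    by rewrite abseN /= normrM (gtr0_norm rD) mulrC.
  have IC := integral_cst mu mom (h x)%:E; rewrite -[X in _ * X]/(mu om) vol -EFinM in IC.
  etransitivity; first exact: IB.
  rewrite [X in X - _](_ : _ = 0); last exact: h0.
  by rewrite sub0e; congr (- _); exact: IC.
apply: le_trans (le_abse_integral mu mom _) _.
  by apply: emeasurable_funB; apply/measurable_EFinP => //; apply: measurable_funTS; exact: lh.1.
rewrite [leLHS]integral_indicM [leRHS]integral_indicM.
have mint : measurable_fun setT (fun z => `|(h z)%:E - (h x)%:E| * (\1_om z : R)%:E).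
  apply: emeasurable_funM; last by apply/measurable_EFinP; exact: measurable_indic.
  apply: measurableT_comp => //; apply: emeasurable_funB => //.
  by apply/measurable_EFinP; exact: lh.1.
rewrite -(integral_translate x mint); last by move=> z; rewrite mule_ge0// lee_fin.
apply: ae_ge0_le_integral => //.
- exact: (measurableT_comp mint (measurable_translate x)).
- by move=> v _; rewrite mule_ge0// lee_fin.
- apply: emeasurable_funM; first exact: (measurableT_comp mB (measurable_pair1 x)).
  by apply/measurable_EFinP; apply: measurable_indic; exact: measurable_cbox.
apply: filterS Ax => v nA _.
rewrite indicE; have [/set_mem ov|_] := boolP ((v + x)%R \in om); last by rewrite mule0 mule_ge0// lee_fin.
rewrite mule1 indicE mem_set ?mule1.
  by rewrite leNgt; apply/negP => lt; apply: nA; split.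
move=> d; have := ox d; have := ov d; rewrite !mxE => /andP[? ?] /andP[? ?]; and_lra.
Qed.

End Poincare.

(** * Multi-indices *)

Section MultiIndex.
Context {D : nat}.
Implicit Types (al be : multi_index D).

Definition minc al (d : 'I_D) : multi_index D := [ffun e => (al e + (e == d))%N].

Lemma mi_order_minc al d : mi_order (minc al d) = (mi_order al).+1.
Proof.
rewrite /mi_order (eq_bigr (fun e => al e + (e == d))%N) => [|e _]; last by rewrite ffunE.
rewrite big_split/= -addn1; congr addn; rewrite (bigD1 d)//= eqxx big1// => e.
by move=> /negbTE ->.
Qed.

(** The bound on the order is strict: sums over orders at most [k] run over [mis k.+1], and [mis k]
    indexes the polynomials of degree below [k]. *)
Definition mis k : seq (multi_index D) :=
  [seq al <- undup [seq [ffun d => (f d : nat)] | f : {ffun 'I_D -> 'I_k}] | (mi_order al < k)%N].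

Lemma leq_mi_order al d : (al d <= mi_order al)%N.
Proof. by rewrite /mi_order (bigD1 d)//= leq_addr. Qed.

Lemma mem_mis k al : (al \in mis k) = (mi_order al < k)%N.
Proof.
rewrite mem_filter mem_undup; have [alk|//] := ltnP; apply/mapP.
have H d : (al d < k)%N by exact: leq_ltn_trans (leq_mi_order al d) alk.
exists [ffun d => Ordinal (H d)]; first exact: mem_enum.
by apply/ffunP => d; rewrite !ffunE.
Qed.

Lemma mis_uniq k : uniq (mis k).
Proof. by rewrite filter_uniq// undup_uniq. Qed.

Lemma mi_order_gt al be : (mi_order be <= mi_order al)%N -> al != be -> exists d, (be d < al d)%N.
Proof.
move=> ba ab; apply/existsP; apply: contraNT ab; rewrite negb_exists => /forallP H.
have {}H d : (al d <= be d)%N by rewrite leqNgt.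
have : (\sum_d (be d - al d) = 0)%N.
  by rewrite sumnB// -/(mi_order be) -/(mi_order al); apply/eqP; rewrite subn_eq0.
move/eqP; rewrite sum_nat_eq0 => /forallP E; apply/eqP/ffunP => d.
by apply/eqP; rewrite eqn_leq H /= -subn_eq0; exact: E.
Qed.

End MultiIndex.

(** * Polynomials and their mean values *)

Section Poly.
Context {R : realType} (D : nat).
Notation mu := (lebesgue_rV D).
Notation V := ('rV[R]_D).
Implicit Types (al be : multi_index D) (h hd u phi : V -> R) (f : 'I_D -> R -> R).

(** The derivative of order [a] of [X^b / b!]; with this normalization differentiation only shifts
    the index. *)
Definition mpol (b a : nat) : {poly R} := if (a <= b)%N then (b - a)`!%:R^-1 *: 'X^(b - a) else 0.

Lemma mpol_deriv b a : (mpol b a)^`() = mpol b a.+1.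
Proof.
rewrite /mpol; case: (ltngtP a b) => [ab|ab|->].
- rewrite derivZ derivXn -scalerMnr scalerMnl subnS; congr (_ *: _).
  rewrite -[LHS]mulr_natr.
  case: (b - a)%N (subn_gt0 a b) => [|m]; first by rewrite ab.
  by move=> _; rewrite factS natrM invfM mulrAC mulVf ?mul1r// pnatr_eq0.
- by rewrite deriv0.
- by rewrite subnn expr0 derivZ derivC scaler0.
Qed.

Definition pchain be (d : 'I_D) a : R -> R := horner (mpol (be d) a).

Lemma wchain_pchain be A : wchain (pchain be) A.
Proof.
split=> d a _; first by rewrite /pchain -mpol_deriv; exact: wd1_horner.
split; first exact/loclip_locbd/loclip_horner.
by apply: continuous_measurable_fun; exact: continuous_horner.
Qed.

(** The derivative of order [al] of the polynomial with coefficients [c] in the normalized monomials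
    with exponents in [s]. *)
Definition pol (s : seq (multi_index D)) (c : multi_index D -> R) al : V -> R :=
  fun x => \sum_(be <- s) c be * ctens (pchain be) al x.

Lemma ctens_pchain0 be al x : (mi_order be <= mi_order al)%N -> al != be -> ctens (pchain be) al x = 0.
Proof.
move=> ba ab; have [d bd] := mi_order_gt ba ab.
by rewrite /ctens /tens (bigD1 d)//= /pchain /mpol leqNgt bd/= horner0 mul0r.
Qed.

Lemma ctens_pchain1 be x : ctens (pchain be) be x = 1.
Proof.
by rewrite /ctens /tens big1// => d _; rewrite /pchain /mpol leqnn subnn fact0 invr1 scale1r hornerXn expr0.
Qed.

Lemma pol0 k c al x : (k <= mi_order al)%N -> pol (mis k) c al x = 0.
Proof.
move=> ka; rewrite /pol big_seq big1// => be; rewrite mem_mis => bk.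
rewrite ctens_pchain0 ?mulr0//; first by apply: ltnW; exact: leq_trans ka.
by apply/eqP => E; move: bk; rewrite -E ltnNge ka.
Qed.

Lemma pol_bounded s c al (a b : V) : exists C : R, forall x, cbox a b x -> `|pol s c al x| <= C.
Proof.
rewrite /pol; elim: s => [|j r [C CP]]; first by exists 0 => x _; rewrite big_nil normr0.
have [B BP] := ctens_bounded a b (wchain_pchain j al) (fun d => leqnn _); exists (`|c j| * B + C) => x xab.
rewrite big_cons (le_trans (ler_normD _ _))// lerD ?CP// normrM ler_wpM2l// BP//.
Qed.

Lemma measurable_pol s c al : measurable_fun setT (pol s c al).
Proof.
apply: measurable_sum => j; apply: measurable_funM => //.
exact: measurable_ctens (wchain_pchain j al) (fun d => leqnn _).
Qed.

Lemma pol_locint s c al : locint (pol s c al).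
Proof.
split=> [|a b]; first exact: measurable_pol.
have [C CP] := pol_bounded s c al a b.
exact: compact_integrable_bounded (measurable_pol s c al) CP (cbox_lty a b).
Qed.

Lemma tens_bsmooth f (a b : V) : smooth_tens f -> supp_in f a b -> bsmooth a b (tens f).
Proof.
move=> sf sp; split=> [m|x]; last exact: tens_supp.
by apply: class_C_tens => d; exact: sf.
Qed.

Lemma derive_tens_smooth f d x : smooth_tens f ->
  'D_(unit_vec d) (tens f) x = tens (upd f d (derive1 (f d))) x :> R.
Proof.
by move=> sf; have D0 := is_derive_tens (smooth_derivable (x:=x ord0 d) (sf d)); rewrite derive_val.
Qed.

Lemma locint_mul_bsmooth h a b phi : locint h -> bsmooth a b phi ->
  mu.-integrable setT (EFin \o (fun x => h x * phi x)).
Proof.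
move=> lh bp; have [C C0 CP] := bsmooth_bounded bp.
exact: (locint_mul lh (bsmooth_measurable bp) CP bp.2).
Qed.

Lemma wpartP d h hd : locint h -> locint hd -> (wpart d h hd <->
  forall f (a b : V), smooth_tens f -> supp_in f a b ->
    \int[mu]_x (h x * 'D_(unit_vec d) (tens f) x) = - \int[mu]_x (hd x * tens f x)).
Proof.
move=> lh lhd.
have I f a b : smooth_tens f -> supp_in f a b ->
   (\int[mu]_x (h x * tens (upd f d (derive1 (f d))) x)%:E = (\int[mu]_x (h x * 'D_(unit_vec d) (tens f) x)%R)%:E)%E /\
    (\int[mu]_x (hd x * tens f x)%:E = (\int[mu]_x (hd x * tens f x)%R)%:E)%E.
  move=> sf sp; have bf := tens_bsmooth sf sp.
  have i1 := locint_mul_bsmooth lh (bsmooth_derive d bf); have i2 := locint_mul_bsmooth lhd bf.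
  split; last by rewrite /Rintegral fineK//; exact: integrable_fin_num i2.
  under eq_integral do rewrite -(derive_tens_smooth d _ sf).
  by rewrite /Rintegral fineK//; exact: integrable_fin_num i1.
split=> H f a b sf sp; have [E1 E2] := I f a b sf sp; have := H f a b sf sp; rewrite ?E1 ?E2 -?EFinN.
  by move=> [].
by move=> ->.
Qed.

Lemma wpart_pol d s c al : wpart d (pol s c al) (pol s c (minc al d)).
Proof.
apply/wpartP; [exact: pol_locint|exact: pol_locint|] => f a b sf sp.
have bf := tens_bsmooth sf sp.
have E ga phi : bsmooth a b phi -> \int[mu]_x (pol s c ga x * phi x) =
   \sum_(be <- s) c be * \int[mu]_x (ctens (pchain be) ga x * phi x).
  move=> bphi; have [_ <-] := integrable_Rsum s c (fun j => tens_bsmooth_integrable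
     (fun e => ((wchain_pchain j ga).2 e _ (leqnn _)).1) (fun e => ((wchain_pchain j ga).2 e _ (leqnn _)).2) bphi).
  congr (Rintegral _ _ _); apply/funext => x; rewrite /pol mulr_suml.
  by apply: eq_bigr => j _; rewrite mulrA.
rewrite (E _ _ (bsmooth_derive d bf)) (E _ _ bf) -sumrN; apply: eq_bigr => be _.
rewrite -mulrN; congr (_ * _).
have := @iter_ibp R D (pchain be) (minc al d) al d 1 a b (tens f) (wchain_pchain be _) _ bf.
rewrite /= => ->; last by move=> e; rewrite ffunE; case: (e == d).
rewrite expr1 mulN1r; congr (- Rintegral _ _ _); apply/funext => x; congr (ctens _ _ x * _).
by apply/funext => e; rewrite ffunE; case: (e == d).
Qed.

Lemma locint_sub h (h' : V -> R) : locint h -> locint h' -> locint (fun x => h x - h' x).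
Proof.
move=> [m1 i1] [m2 i2]; split=> [|a b]; first exact: measurable_funB.
exact: (integrableB (measurable_cbox a b) (i1 a b) (i2 a b)).
Qed.

Lemma wpart_sub d h hd (h' hd' : V -> R) : locint h -> locint hd -> locint h' -> locint hd' ->
  wpart d h hd -> wpart d h' hd' -> wpart d (fun x => h x - h' x) (fun x => hd x - hd' x).
Proof.
move=> l1 l2 l3 l4 /(wpartP d l1 l2) w1 /(wpartP d l3 l4) w2.
apply/wpartP; [exact: locint_sub|exact: locint_sub|] => f a b sf sp.
have bf := tens_bsmooth sf sp; have bd := bsmooth_derive d bf.
under eq_Rintegral do rewrite mulrBl.
under [in RHS]eq_Rintegral do rewrite mulrBl.
rewrite (RintegralB measurableT (locint_mul_bsmooth l1 bd) (locint_mul_bsmooth l3 bd)).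
rewrite (RintegralB measurableT (locint_mul_bsmooth l2 bf) (locint_mul_bsmooth l4 bf)).
by rewrite (w1 f a b)// (w2 f a b)// opprB opprK addrC.
Qed.

Lemma weak_locint u al (g : V -> R) : is_weak_partial setT u al g -> locint g.
Proof.
by move=> [_ [mg ig] _]; split => // a b; apply: ig => //; exact: compact_cbox.
Qed.

(** The definition for [al] is applied to the derivative of a test function and the one for
    [minc al d] to the function itself; the two differ by one sign. *)
Lemma weak_wpart u al d (g g' : V -> R) : is_weak_partial setT u al g -> is_weak_partial setT u (minc al d) g' ->
  wpart d g g'.
Proof.
move=> w1 w2; apply/(wpartP d (weak_locint w1) (weak_locint w2)) => f a b sf sp.
have bf := tens_bsmooth sf sp.
have [_ _ H1] := w1; have [_ _ H2] := w2.
have sf' : smooth_tens (upd f d (derive1 (f d))) by apply: smooth_upd => //; exact: smooth_derive1.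
have sp' : supp_in (upd f d (derive1 (f d))) a b.
  move=> e t nt; rewrite /upd; case: eqP => [ed|_]; last exact: sp.
  rewrite ed in nt; by apply: (@derive1_zero _ _ (a ord0 d) (b ord0 d)) => // v; exact: sp.
have t1 := H1 _ (test_function_tens sf' sp' (@subsetT _ _)).
have t2 := H2 _ (test_function_tens sf sp (@subsetT _ _)).
have E : partial al (tens (upd f d (derive1 (f d)))) = partial (minc al d) (tens f) :> (V -> R).
  rewrite !partial_tens//; apply/funext => x; congr (tens _ x); apply/funext => e.
  by rewrite /upd ffunE; case: eqP => [->|_]; [rewrite addn1 derive1Sn|rewrite addn0].
rewrite E t2 mi_order_minc exprS mulN1r mulNr in t1.
have /mulfI : (-1) ^+ mi_order al != 0 :> R by rewrite expf_neq0// oppr_eq0 oner_eq0.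
rewrite -mulrN in t1 => /(_ _ _ t1) ->.
by apply: eq_Rintegral => x _; rewrite derive_tens_smooth.
Qed.

(** The normalization makes the system triangular: the coefficients of top order are the means of
    the functions of that order, and the lower ones come from the induction hypothesis after the top
    part has been subtracted. *)
Lemma mean_poly (om : set V) (a b : V) (v : R) k : om = cbox a b -> mu om = v%:E -> 0 < v ->
  forall g : multi_index D -> V -> R, (forall al, (mi_order al < k)%N -> locint (g al)) ->
  exists c, forall al, (mi_order al < k)%N -> \int[mu]_(x in om) (g al x - pol (mis k) c al x) = 0.
Proof.
move=> omE volE v0; have mom : measurable om by rewrite omE; exact: measurable_cbox.
have lom h : locint h -> mu.-integrable om (EFin \o h) by move=> [_ ih]; rewrite omE; exact: ih.
have polS m c c1 al x : pol (mis m.+1) (fun be => if mi_order be == m then c1 be else c be) al x =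
    pol (mis m.+1) (fun be => if mi_order be == m then c1 be else 0) al x + pol (mis m) c al x.
  rewrite /pol (_ : \sum_(be <- mis m) _ = \sum_(be <- mis m.+1) (if mi_order be == m then 0 else c be) * ctens (pchain be) al x).
    by rewrite -big_split/=; apply: eq_bigr => be _; case: eqP; rewrite ?mul0r ?addr0 ?add0r.
  rewrite [RHS](bigID (fun be => mi_order be == m))/= [X in _ = X + _]big1 ?add0r => [|be bm]; last by rewrite bm mul0r.
  rewrite [RHS](eq_bigr (fun be => c be * ctens (pchain be) al x)) => [|be /negbTE ->//].
  rewrite -[RHS]big_filter; apply: perm_big; apply: uniq_perm; [exact: mis_uniq|by rewrite filter_uniq// mis_uniq|].
  by move=> be; rewrite mem_mis [RHS]mem_filter mem_mis ltnS ltn_neqAle.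
elim: k => [|k IH] g lg; first by exists (fun=> 0).
pose c1 be := if mi_order be == k then v^-1 * \int[mu]_(x in om) g be x else 0.
have [c cP] := IH (fun al x => g al x - pol (mis k.+1) c1 al x)
  (fun al alk => locint_sub (lg al (ltnW alk : mi_order al < k.+1)%N) (pol_locint _ _ _)).
exists (fun be => if mi_order be == k then v^-1 * \int[mu]_(x in om) g be x else c be) => al.
rewrite ltnS leq_eqVlt => /orP[/eqP alk|alk]; last first.
  rewrite -(cP al alk); apply: eq_Rintegral => x _; rewrite polS opprD addrA.
  by congr (_ - pol _ _ _ _ - _); apply/funext => be; rewrite /c1.
have polE x : pol (mis k.+1) (fun be => if mi_order be == k then v^-1 * \int[mu]_(x in om) g be x else c be) al x =
   v^-1 * \int[mu]_(x in om) g al x.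
  rewrite polS [X in _ + X]pol0 ?alk// addr0 /pol (bigD1_seq al)/= ?mis_uniq//; last by rewrite mem_mis alk.
  rewrite alk eqxx ctens_pchain1 mulr1 big1 ?addr0// => be bal.
  case: eqP => [bk|_]; last by rewrite mul0r.
  by rewrite ctens_pchain0 ?mulr0// ?alk ?bk// eq_sym.
under eq_Rintegral do rewrite polE.
have lal : locint (g al) by apply: lg; rewrite alk.
have icst : mu.-integrable om (EFin \o cst (v^-1 * \int[mu]_(x in om) g al x)).
  move: (v^-1 * _) => w; rewrite omE.
  exact: (compact_integrable_bounded (C := `|w|) (measurable_cst w) (fun x _ => lexx _) (cbox_lty a b)).
rewrite RintegralB//; last exact: lom.
have -> : \int[mu]_(x in om) (v^-1 * \int[mu]_(x in om) g al x) = (v^-1 * \int[mu]_(x in om) g al x) * fine (mu om).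
  by rewrite Rintegral_cst.
by rewrite volE/= mulrAC mulVf ?gt_eqF// mul1r subrr.
Qed.

End Poly.

(** * Pointwise Bramble-Hilbert inequality *)

Section BrambleHilbert.
Context {R : realType} (D : nat).
Notation mu := (lebesgue_rV D).
Notation V := ('rV[R]_D).
Variables (rho : R) (k : nat) (g : multi_index D -> V -> R).
Hypotheses (rho0 : 0 < rho) (lg : forall al, (mi_order al <= k)%N -> locint (g al)).
Hypotheses (wg : forall al d, (mi_order al < k)%N -> wpart d (g al) (g (minc al d))).
Open Scope ereal_scope.

(** The derivatives of order [k], averaged [r] times; this dominates derivatives of order [k - r]
    once a polynomial has been subtracted. *)
Fixpoint HS (r : nat) : V -> \bar R :=
  if r is r'.+1 then TT rho (HS r')
  else fun x => \sum_(be <- mis k.+1 | mi_order be == k) `|g be x|%:E.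

Lemma HS_ge0 r x : 0 <= HS r x.
Proof.
elim: r x => [|r IH] x /=; first by apply: sume_ge0 => be _; rewrite lee_fin.
exact: TT_ge0.
Qed.

Lemma measurable_HS r : measurable_fun setT (HS r).
Proof.
have H (s : seq (multi_index D)) : (forall be, be \in s -> locint (g be)) -> measurable_fun setT (fun x => \sum_(be <- s) `|g be x|%:E).
  elim: s => [|be s IH] ls; first by under eq_fun do rewrite big_nil; exact: measurable_cst.
  under eq_fun do rewrite big_cons; apply: emeasurable_funD.
    apply/measurable_EFinP; apply: measurableT_comp => //.
    by have [] := ls be (mem_head _ _).
  by apply: IH => j js; apply: ls; rewrite inE js orbT.
elim: r => [|r IH] /=; last by apply: measurable_TT => // x; exact: HS_ge0.
under eq_fun do rewrite -big_filter; apply: H => be; rewrite mem_filter => /andP[/eqP bk _].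
by apply: lg; rewrite bk.
Qed.

(** Induction on [k - mi_order al]: after subtraction of the polynomial of [mean_poly] every
    derivative of order below [k] has mean zero, and its first derivatives are dominated by the
    induction hypothesis, so [poincare] applies. One polynomial serves all orders, and it does not
    depend on an exponent [p]. *)
Lemma bramble_hilbert (z0 : V) : exists c, forall al, (mi_order al <= k)%N ->
  {ae mu, forall x, cbox z0 (\row_e (z0 ord0 e + rho))%R x ->
    `|g al x - pol (mis k) c al x|%:E <= HS (k - mi_order al) x}.
Proof.
set om := cbox z0 _.
have vol : mu om = (rho ^+ D)%:E by exact: measure_cube (ltW rho0).
have [c cP] := mean_poly (erefl om) vol (exprn_gt0 D rho0) (fun al alk => lg (ltnW alk)).
exists c => al; move: {2}(k - mi_order al)%N (erefl (k - mi_order al)%N) => r.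
elim: r al => [|r IH] al E alk.
  have {}E : mi_order al = k by apply/eqP; rewrite eqn_leq alk -subn_eq0 E eqxx.
  apply: nearW => x _; rewrite pol0 ?E// subr0 subnn /= -big_filter (bigD1_seq al)/=.
  - by rewrite -[leLHS]adde0; apply: leeD => //; apply: sume_ge0 => be _; rewrite lee_fin.
  - by rewrite mem_filter mem_mis E eqxx ltnSn.
  - by rewrite filter_uniq// mis_uniq.
have alk' : (mi_order al < k)%N by rewrite -subn_gt0 E.
have Er d : (k - mi_order (minc al d) = r)%N by rewrite mi_order_minc subnS E.
rewrite E; apply: (@poincare R D rho rho0 _ (fun d x => g (minc al d) x - pol (mis k) c (minc al d) x)%R).
- by apply: locint_sub; [exact: lg|exact: pol_locint].
- by move=> d; apply: locint_sub; [apply: lg; rewrite mi_order_minc|exact: pol_locint].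
- move=> d; apply: wpart_sub; try exact: pol_locint; try exact: wpart_pol; try exact: wg.
    exact: lg.
  by apply: lg; rewrite mi_order_minc.
- exact: measurable_HS.
- by move=> x; exact: HS_ge0.
- by move=> d; have := IH (minc al d) (Er d); rewrite Er mi_order_minc; apply.
have fin := integrable_fin_num (measurable_cbox _ _) ((locint_sub (lg alk) (pol_locint (mis k) c al)).2 z0 (\row_e (z0 ord0 e + rho))%R).
by rewrite -(fineK fin); congr EFin; exact: cP.
Qed.

Lemma Lnorm_HS (p : \bar R) r : 1 <= p ->
  'N[mu]_p[HS r] <= ((D%:R * 2 ^+ D.+1 * rho) ^+ r)%:E * \sum_(be <- mis k.+1 | mi_order be == k) 'N[mu]_p[EFin \o g be].
Proof.
move=> p1; have c0 : (0 <= D%:R * 2 ^+ D.+1 * rho)%R by rewrite !mulr_ge0// ?ltW// exprn_ge0.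
elim: r => [|r IH] /=.
  rewrite expr0 mul1e -big_filter; set s := [seq _ <- _ | _].
  have ls be : be \in s -> measurable_fun setT (g be).
    by rewrite mem_filter => /andP[/eqP bk _]; have [] := lg (eq_leq bk).
  pose h be : V -> \bar R := if be \in s then fun x => `|g be x|%:E else cst 0.
  have mh be : measurable_fun setT (h be).
    rewrite /h; case: ifP => // /ls mb; apply/measurable_EFinP; exact: measurableT_comp.
  have h0 be x : 0 <= h be x by rewrite /h; case: ifP.
  have -> : (fun x => \sum_(be <- mis k.+1 | mi_order be == k) `|g be x|%:E) = (fun x => \sum_(be <- s) h be x).
    by apply/funext => x; rewrite -big_filter big_seq [RHS]big_seq; apply: eq_bigr => be bs; rewrite /h bs.
  apply: (le_trans (Lnorm_sum _ s p1 mh h0)); rewrite big_seq [leRHS]big_seq; apply: lee_sum => be bs.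
  have mb := ls be bs; rewrite /h bs; apply: Lnorm_le_ae => //.
  - by apply/measurable_EFinP; exact: (measurableT_comp (@normr_measurable R setT) mb).
  - exact/measurable_EFinP.
  by apply: nearW => x; rewrite /= normr_id.
apply: (le_trans (Lnorm_TT rho0 p1 (measurable_HS r) (HS_ge0 r))).
by move: (D%:R * _ * rho)%R c0 IH => c c0 IH; rewrite exprS EFinM -muleA; apply: lee_wpmul2l; rewrite ?lee_fin.
Qed.

End BrambleHilbert.

Lemma integrable_patch {R : realType} d (T : measurableType d) (m : {measure set T -> \bar R}) (W : set T) (f : T -> R) :
  measurable W -> m.-integrable W (EFin \o f) <-> m.-integrable setT (EFin \o (f \_ W)).
Proof. by move=> mW; rewrite -restrict_EFin; exact: integrable_mkcond. Qed.

Lemma integrable_bdd_mul d (T : measurableType d) {R : realType} (m : {measure set T -> \bar R}) (W : set T)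
  (g phi : T -> R) (C : R) : measurable W -> m.-integrable W (EFin \o g) -> measurable_fun W phi ->
  (forall x, W x -> `|phi x| <= C) -> m.-integrable W (EFin \o (fun x => g x * phi x)).
Proof.
move=> mW ig mphi bphi; have mg := (integrableP _ _ _ ig).1.
have iC : m.-integrable W (EFin \o (fun x => C * g x)) by exact: (integrableZl mW C ig).
apply: le_integrable iC => //.
  by apply/measurable_EFinP; apply: measurable_funM => //; exact/measurable_EFinP.
move=> x Wx; rewrite /= lee_fin !normrM mulrC ler_wpM2r//; apply: le_trans (bphi x Wx) _; exact: ler_norm.
Qed.

(** * Splines on the grid *)

Section Cells.
Context {R : realType} (D : nat) (sigma : R) (a : 'rV[R]_D.+1).
Notation mu := (lebesgue_rV D.+1).
Notation leb := (@lebesgue_measure R).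
Notation V := ('rV[R]_D.+1).
Notation Z := ('rV[int]_D.+1).
Hypothesis s0 : 0 < sigma.

(** The coordinate of [t] relative to cell [i], running from 0 to 1 across the cell; it is written
    as an affine function to fit the rules for affine substitution. *)
Definition lc (i : Z) (d : 'I_D.+1) (t : R) : R := sigma^-1 * t + (- (sigma^-1 * a ord0 d) - (i ord0 d)%:~R).

Let sn0 : sigma != 0. Proof. by rewrite gt_eqF. Qed.

Lemma lcE (i : Z) d (t : R) : t = a ord0 d + ((i ord0 d)%:~R + lc i d t) * sigma.
Proof. by rewrite /lc; field. Qed.

Lemma lc_itv i d t : (0 < lc i d t < 1) = (grid_coord sigma a d (i ord0 d) < t < grid_coord sigma a d (i ord0 d + 1)).
Proof.
rewrite /grid_coord intrD [in RHS](lcE i d t); move: (lc i d t) (i ord0 d)%:~R => u z.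
rewrite !ltrD2l !ltr_pM2r// ltrDl ltrD2l.
by rewrite mulr1z.
Qed.

Lemma cellP i (x : V) : cell sigma a i x <-> forall d, 0 < lc i d (x ord0 d) < 1.
Proof. by split=> h d; have := h d; rewrite lc_itv. Qed.

Definition corner (i : Z) : V := \row_d grid_coord sigma a d (i ord0 d).

Lemma cell_obox i : cell sigma a i = obox (corner i) (\row_d grid_coord sigma a d (i ord0 d + 1)).
Proof. by apply/seteqP; split => x h d; have := h d; rewrite !mxE. Qed.

Lemma open_cell i : open (cell sigma a i).
Proof. by rewrite cell_obox; exact: open_obox. Qed.

Lemma measurable_cell i : measurable (cell sigma a i).
Proof. by rewrite cell_obox; exact: measurable_obox. Qed.

Lemma measure_cell i : mu (cell sigma a i) = (sigma ^+ D.+1)%:E.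
Proof.
rewrite cell_obox measure_obox => [|d]; last first.
  by rewrite !mxE /grid_coord lerD2l ler_pM2r// ler_int lerDl.
congr (_%:E); rewrite -[in RHS](card_ord D.+1) -prodr_const; apply: eq_bigr => d _.
by rewrite !mxE /grid_coord intrD; ring.
Qed.

Definition citv (i : Z) d : set R := [set` `]grid_coord sigma a d (i ord0 d), grid_coord sigma a d (i ord0 d + 1)[].

Lemma integral1 (p : {poly R}) i d :
  leb.-integrable setT (EFin \o (fun t => p.[lc i d t] * \1_(citv i d) t) : measurableTypeR R -> _) /\
  \int[leb]_t (p.[lc i d t] * \1_(citv i d) t) = sigma * IP p.
Proof.
set g := grid_coord sigma a d (i ord0 d); set g' := grid_coord sigma a d (i ord0 d + 1).
have gg : g < g' by rewrite ltrD2l ltr_pM2r// ltr_int ltrDl.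
pose f t : R := p.[lc i d t].
have cf : continuous f by exact: (Cm_continuous (Cm_affine sigma^-1 (- (sigma^-1 * a ord0 d) - (i ord0 d)%:~R) (Cm_horner 0 p))).
have mf : measurable_fun setT f by exact: continuous_measurable_fun.
have icl : leb.-integrable [set` `[g, g']] (EFin \o f).
  by apply: continuous_compact_integrable; [exact: segment_compact|exact: continuous_subspaceT].
have iop : leb.-integrable (citv i d) (EFin \o f).
  apply: integrableS icl => //; first exact: measurable_itv.
  by move=> t; rewrite /citv/= !in_itv/= => /andP[/ltW -> /ltW ->].
have E : (fun t => f t * \1_(citv i d) t) = f \_ (citv i d).
  by apply/funext => t; rewrite /patch indicE; case: ifP => _; rewrite ?mulr1 ?mulr0.
split.
  have mI : measurable (citv i d) by exact: measurable_itv.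
  by rewrite -/f E; exact: (integrable_patch leb f mI).1.
rewrite -/f E -Rintegral_mkcond /citv -/g -/g'.
rewrite Rintegral_itv_obnd_cbnd; last exact: iop.
rewrite Rintegral_itv_bndo_bndc; last first.
  apply: integrableS icl => //.
  by move=> t; rewrite /= !in_itv/= => /andP[-> /ltW ->].
pose G t : R := sigma * (prim p).[lc i d t].
have dG t : is_derive (t : R) 1 G (f t).
  have := @derive_affine R (horner (prim p)) sigma^-1 (- (sigma^-1 * a ord0 d) - (i ord0 d)%:~R) t
    (ex_derive (is_derive := is_derive_poly _ _)).
  rewrite derive1E derive_val prim_deriv => h.
  have -> : f t = sigma *: (sigma^-1 * p.[lc i d t]) by rewrite /GRing.scale/= mulrA mulfV// mul1r.
  exact: is_deriveZ.
have cG s : {for s, continuous G} by apply: differentiable_continuous; apply/derivable1_diffP; case: (dG s).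
rewrite /Rintegral (@continuous_FTC2 _ f G g g' gg).
- rewrite /= /G /IP.
  have -> : lc i d g' = 1 by rewrite /lc /g' /grid_coord intrD; field.
  have -> : lc i d g = 0 by rewrite /lc /g /grid_coord; field.
  by rewrite prim0 mulr0 subr0.
- exact: continuous_subspaceT.
- split.
  + by move=> s _; case: (dG s).
  + by apply: cvg_at_right_filter; exact: cG.
  + by apply: cvg_at_left_filter; exact: cG.
- by move=> s _; rewrite derive1E; have [_ ->] := dG s.
Qed.

Definition cpoly (P : 'I_D.+1 -> {poly R}) (i : Z) : V -> R := tens (fun d t => (P d).[lc i d t]).

Lemma cell_integral P i : mu.-integrable (cell sigma a i) (EFin \o cpoly P i) /\
  \int[mu]_(x in cell sigma a i) cpoly P i x = sigma ^+ D.+1 * \prod_d IP (P d).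
Proof.
have [ii EI] := integrable_tens (fun d => (integral1 (P d) i d).1).
have E : (cpoly P i) \_ (cell sigma a i) = tens (fun d t => (P d).[lc i d t] * \1_(citv i d) t).
  apply/funext => x; rewrite /tens big_split/= -/(tens (fun d => \1_(citv i d)) x) -indic_tens.
  rewrite /patch indicE; have -> : cell sigma a i = [set y : V | forall d, citv i d (y ord0 d)].
    by apply/seteqP; split => y h d; have := h d; rewrite /citv/= in_itv.
  by case: ifP => _; rewrite ?mulr1 ?mulr0.
have mc := measurable_cell i; split.
  by apply/(integrable_patch _ _ mc); rewrite E.
rewrite Rintegral_mkcond E /Rintegral EI/=.
rewrite (eq_bigr (fun d => sigma * IP (P d))) => [|d _]; last exact: (integral1 (P d) i d).2.
by rewrite big_split/= prodr_const card_ord.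
Qed.

Lemma cpolyM P Q i x : cpoly P i x * cpoly Q i x = cpoly (fun d => P d * Q d) i x.
Proof. by rewrite /cpoly /tens -big_split/=; apply: eq_bigr => d _; rewrite hornerM. Qed.

Variable n : nat.
Hypothesis n0 : (0 < n)%N.
(** Local indices run up to [n], although only [n] pieces per direction live on a cell. The piece of
    index [n] is zero, but a jump across a face involves [n.+1] coefficients. *)
Definition Lx := {ffun 'I_D.+1 -> 'I_n.+1}.

Definition off (m : Lx) : Z := \row_d (m d : nat)%:Z.

(** The common shape of the value, the derivatives and the normal jump of a spline on a cell,
    according to the family [P]. *)
Definition gsum (P : 'I_D.+1 -> nat -> {poly R}) (b : Lx -> R) (i : Z) (x : V) : R :=
  \sum_m b m * cpoly (fun d => P d (m d)) i x.

Definition bpP (d : 'I_D.+1) : nat -> {poly R} := bp n.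

Lemma Rint_sum (I : finType) (W : set V) (c : I -> R) (h : I -> V -> R) : measurable W ->
  (forall j, mu.-integrable W (EFin \o h j)) ->
  mu.-integrable W (EFin \o (fun x => \sum_j c j * h j x)) /\
  \int[mu]_(x in W) (\sum_j c j * h j x) = \sum_j c j * \int[mu]_(x in W) h j x.
Proof.
move=> mW ih; have ih' j : mu.-integrable setT (EFin \o (h j) \_ W).
  by apply/(integrable_patch _ _ mW).
have [i1 i2] := integrable_Rsum (index_enum I) c ih'.
have E : (fun x => \sum_j c j * h j x) \_ W = fun x => \sum_j c j * ((h j) \_ W) x.
  apply/funext => x; rewrite /patch; case: ifP => // _.
  by rewrite big1// => j _; rewrite mulr0.
split; first by apply/(integrable_patch _ _ mW); rewrite E.
rewrite Rintegral_mkcond E i2; apply: eq_bigr => j _; by rewrite -Rintegral_mkcond.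
Qed.

Lemma cell_test P b i Q : 
  \int[mu]_(x in cell sigma a i) (gsum P b i x * cpoly Q i x) =
  sigma ^+ D.+1 * \sum_m b m * \prod_d IP (P d (m d) * Q d).
Proof.
rewrite /gsum; under eq_Rintegral.
  move=> x _; rewrite mulr_suml.
  under eq_bigr do rewrite -mulrA cpolyM.
  over.
have [_ ->] := Rint_sum b (measurable_cell i) (fun m : Lx => (cell_integral (fun d => P d (m d) * Q d) i).1).
by rewrite mulr_sumr; apply: eq_bigr => m _; rewrite (cell_integral _ i).2 mulrCA.
Qed.

(** Index [n] has no dual polynomial, since its piece is zero; the default is 0. *)
Definition dualn (m : nat) : {poly R} := if insub m is Some k then dualp (k : 'I_n) else 0.

Lemma dualnE (m m' : nat) : (m <= n)%N -> (m' < n)%N -> IP (bp n m * dualn m') = (m == m')%:R.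
Proof.
move=> mn mn'; rewrite /dualn insubT; move: mn; rewrite leq_eqVlt => /orP[/eqP ->|mn].
  by rewrite bp_eq0// mul0r (gtn_eqF mn') /IP /prim size_poly0 big_ord0 horner0.
by rewrite (dualpE (Ordinal mn)).
Qed.

(** The functional that reads off coefficient [m] on cell [i]. Division by the cell volume makes its
    bounds free of [sigma], in terms of cell averages. *)
Definition lam (i : Z) (m : Lx) (u : V -> R) : R :=
  (sigma ^+ D.+1)^-1 * \int[mu]_(x in cell sigma a i) (u x * cpoly (fun d => dualn (m d)) i x).

(** The indices whose pieces do not vanish on the cell. *)
Definition inL (m : Lx) := forall d, (m d < n)%N.

Lemma lam_gsum i m u b : inL m -> (forall x, cell sigma a i x -> u x = gsum bpP b i x) -> lam i m u = b m.
Proof.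
move=> Lm uE; rewrite /lam.
have -> : \int[mu]_(x in cell sigma a i) (u x * cpoly (fun d => dualn (m d)) i x) =
   \int[mu]_(x in cell sigma a i) (gsum bpP b i x * cpoly (fun d => dualn (m d)) i x).
  by apply: eq_Rintegral => x /set_mem cx; rewrite uE.
rewrite cell_test mulKf ?expf_neq0// (bigD1 m)//= [X in _ + X]big1 => [|m' mm].
  rewrite addr0 big1 ?mulr1// => d _; rewrite /bpP dualnE ?eqxx//; exact/ltnW/Lm.
have [d md] : exists d, m' d != m d.
  apply/existsP; apply: contraNT mm; rewrite negb_exists => /forallP h.
  by apply/eqP/ffunP => d; apply/eqP; have := h d; rewrite negbK.
have m'n : (m' d <= n)%N by rewrite -ltnS.
by rewrite (bigD1 d)//= /bpP dualnE// (negbTE md : (m' d == m d :> nat) = false) mul0r mulr0.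
Qed.

(** Each monomial in one variable is expanded in the pieces by [bp_basis], in the local coordinate,
    and the product of the expansions is multiplied out. *)
Lemma cell_poly_expand (c : {ffun 'I_D.+1 -> 'I_n} -> R) i : exists b, forall x : V,
  \sum_al c al * \prod_d x ord0 d ^+ al d = gsum bpP b i x.
Proof.
pose q d k : {poly R} := (sigma *: 'X + (a ord0 d + (i ord0 d)%:~R * sigma)%:P) ^+ k.
have qE d k (t : R) : (q d k).[lc i d t] = t ^+ k.
  by rewrite /q horner_exp hornerD hornerZ hornerX hornerC; congr (_ ^+ k); rewrite [RHS](lcE i d t); ring.
have sq d k : (k < n)%N -> (size (q d k) <= n)%N.
  move=> kn; apply: leq_trans kn; apply: leq_trans (size_poly_exp_leq _ _) _; rewrite ltnS.
  have : (size (sigma *: 'X + (a ord0 d + (i ord0 d)%:~R * sigma)%:P : {poly R})%R <= 2)%N.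
    apply: leq_trans (size_polyD _ _) _; rewrite geq_max (leq_trans (size_scale_leq _ _)) ?size_polyX//.
    by rewrite (leq_trans (size_polyC_leq1 _)).
  by case: (size _) => [|[|[|]]]//= _; rewrite ?mul0n ?mul1n.
pose e d k m := IP (q d k * dualn m).
have qB d (k : 'I_n) : q d k = \sum_(m < n.+1) e d k m *: bp n m.
  rewrite big_ord_recr/= bp_eq0// scaler0 addr0 {1}(bp_basis (sq d k (ltn_ord k))).
  by apply: eq_bigr => m _; rewrite /e /dualn valK.
exists (fun m : Lx => \sum_al c al * \prod_d e d (al d) (m d)) => x.
rewrite /gsum; under [RHS]eq_bigr do rewrite mulr_suml.
rewrite exchange_big/=; apply: eq_bigr => al _.
under [RHS]eq_bigr do rewrite -mulrA -big_split/=.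
rewrite -mulr_sumr; congr (_ * _).
rewrite -(bigA_distr_bigA (fun d (m : 'I_n.+1) => e d (al d) m * (bpP d m).[lc i d (x ord0 d)])).
apply: eq_bigr => d _; rewrite -(qE d (al d)) qB horner_sum; apply: eq_bigr => m _.
by rewrite hornerZ.
Qed.

Lemma gsum_ext P b b' i x : (forall m, (exists d, m d = n :> nat) -> cpoly (fun d => P d (m d)) i x = 0) ->
  (forall m, inL m -> b m = b' m) -> gsum P b i x = gsum P b' i x.
Proof.
move=> P0 bb; apply: eq_bigr => m _; have [mL|nL] := pselect (inL m); first by rewrite bb.
rewrite P0 ?mulr0//; have [d nd] : exists d, ~ (m d < n)%N by apply/existsNP.
by exists d; apply/eqP; rewrite eqn_leq -ltnS ltn_ord/= leqNgt; apply/negP.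
Qed.

Lemma cpoly_bp0 (m : 'I_D.+1 -> nat) i x : (exists d, m d = n :> nat) -> cpoly (fun d => bpP d (m d)) i x = 0.
Proof. by move=> [d md]; rewrite /cpoly /tens (bigD1 d)//= /bpP md bp_eq0// horner0 mul0r. Qed.

(** The coefficient of the piece [bp n m1] along a line in direction [d], as a function of the other
    coordinates. *)
Definition Asl (b : Lx -> R) (i : Z) (d : 'I_D.+1) (m1 : nat) (x : V) : R :=
  \sum_(m : Lx | m d == m1 :> nat) b m * \prod_(e | e != d) (bp n (m e)).[lc i e (x ord0 e)].

Lemma gsum_line P b i d (t : R) (x : V) : gsum P b i (x + t *: unit_vec d) =
  \sum_(m1 < n.+1) (P d m1).[lc i d (x ord0 d + t)] *
    \sum_(m : Lx | m d == m1 :> nat) b m * \prod_(e | e != d) (P e (m e)).[lc i e (x ord0 e)].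
Proof.
rewrite /gsum (partition_big (fun m : Lx => m d) xpredT)//=; apply: eq_bigr => m1 _.
rewrite mulr_sumr; apply: eq_bigr => m /eqP md.
rewrite /cpoly addrC tens_line md mulrCA; congr (_ * (_ * _)); by rewrite addrC.
Qed.

Lemma gsum_bp_line b i d (t : R) (x : V) : gsum bpP b i (x + t *: unit_vec d) =
  (\sum_(m1 < n) Asl b i d m1 x *: bp n m1).[lc i d (x ord0 d + t)].
Proof.
rewrite gsum_line big_ord_recr/= /bpP bp_eq0// horner0 mul0r addr0 horner_sum.
by apply: eq_bigr => m1 _; rewrite hornerZ mulrC.
Qed.

Definition ed (d : 'I_D.+1) : Z := delta_mx ord0 d.

Lemma lc_ed i d e (t : R) : e != d -> lc (i - ed d) e t = lc i e t.
Proof. by move=> /negbTE h; rewrite /lc !mxE eqxx h subr0. Qed.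

Lemma lc_edd i d (t : R) : lc (i - ed d) d t = lc i d t + 1.
Proof.
rewrite /lc (_ : (i - ed d) ord0 d = i ord0 d - 1); last by rewrite !mxE !eqxx.
by rewrite rmorphB rmorph1; ring.
Qed.

Lemma class_C_line k (u : V -> R) (x : V) d : class_C k u -> Cm k (fun t : R => u (x + t *: unit_vec d)).
Proof.
elim: k u => [|k IH] u /=.
  move=> cu t; apply: (@continuous_comp _ _ _ (fun t : R => x + t *: unit_vec d) u); last exact: cu.
  by apply: continuousD; [exact: cst_continuous|exact: scalel_continuous].
move=> [cu /(_ d)[du Cu]].
have L (t : R) : is_derive t 1 (fun t : R => u (x + t *: unit_vec d)) ('D_(unit_vec d) u (x + t *: unit_vec d)).
  rewrite (_ : (fun t => _) = fun t : R => u (t *: unit_vec d + x)); last by apply/funext => s; rewrite addrC.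
  by rewrite addrC; exact: line_derive.
split; first by move=> t; case: (L t).
rewrite (_ : derive1 _ = fun t : R => 'D_(unit_vec d) u (x + t *: unit_vec d)); first exact: (IH _ Cu).
by apply/funext => t; rewrite derive1E; have [_ ->] := L t.
Qed.

Section Glue.
Variables (u : V -> R) (cc : Z -> Lx -> R).
Hypotheses (Cu : (1 < n)%N -> class_C (n - 2) u).
Hypotheses (uE : forall j x, cell sigma a j x -> u x = gsum bpP (cc j) j x).

(** On the line through [x] normal to the face both pieces are polynomials of one variable and
    [jet_glue] applies. The power of [sigma] comes from differentiating in the local coordinate. *)
Lemma glue (i : Z) d (x : V) : face_set sigma a (d, i) x -> exists g,
  \sum_(m1 < n) Asl (cc i) i d m1 x *: bp n m1 -
    ((\sum_(m1 < n) Asl (cc (i - ed d)) (i - ed d) d m1 x *: bp n m1) \Po ('X + 1)) = g *: bp n 0 /\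
  normal_jump d (n - 1) u x = sigma^-1 ^+ (n - 1) * g.
Proof.
move=> [/= xd xe]; set PR := \sum_(m1 < n) _; set PL := \sum_(m1 < n) _.
pose f t := u (x + t *: unit_vec d).
have lx : lc i d (x ord0 d) = 0 by rewrite xd /lc /grid_coord; field.
have lt t : lc i d (x ord0 d + t) = sigma^-1 * t.
  by rewrite -[RHS]addr0 -lx /lc; ring.
have inc e (t : R) : e != d -> (x + t *: unit_vec d) ord0 e = x ord0 e by move=> /negbTE h; rewrite !mxE eqxx h mulr0 addr0.
have incd (t : R) : (x + t *: unit_vec d) ord0 d = x ord0 d + t by rewrite !mxE !eqxx mulr1.
have cR t : 0 < t < sigma -> cell sigma a i (x + t *: unit_vec d).
  move=> /andP[t0 ts]; apply/cellP => e; have [->|ne] := eqVneq e d.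
    by rewrite incd lt mulrC divr_gt0//= ltr_pdivrMr// mul1r.
  by rewrite inc// lc_itv; exact: xe.
have cL t : - sigma < t < 0 -> cell sigma a (i - ed d) (x + t *: unit_vec d).
  move=> /andP[t0 ts]; apply/cellP => e; have [->|ne] := eqVneq e d.
    rewrite incd lc_edd lt; have si : 0 < sigma^-1 by rewrite invr_gt0.
    have h1 : -1 < sigma^-1 * t by rewrite (_ : -1 = sigma^-1 * - sigma) ?ltr_pM2l//; field.
    have h2 : sigma^-1 * t < 0 by rewrite pmulr_rlt0.
    by and_lra.
  by rewrite inc// lc_ed// lc_itv; exact: xe.
have fR t : 0 < t < 0 + sigma -> f t = PR.[sigma^-1 * t - sigma^-1 * 0].
  by rewrite add0r => h; rewrite /f (uE (cR t h)) gsum_bp_line lt mulr0 subr0.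
have fL t : 0 - sigma < t < 0 -> f t = PL.[sigma^-1 * t + (1 - sigma^-1 * 0)].
  by rewrite sub0r => h; rewrite /f (uE (cL t h)) gsum_bp_line lc_edd lt mulr0 subr0.
have sP (A : nat -> R) : (size (\sum_(m1 < n) A m1 *: bp n m1 : {poly R})%R <= n)%N.
  apply: (leq_trans (size_sum _ _ _)); apply/bigmax_leqP => m _.
  by apply: (leq_trans (size_scale_leq _ _)); exact: size_bp.
have Cf : (1 < n)%N -> Cm (n - 2) f by move=> n1; exact: class_C_line (Cu n1).
have [g gE] := jet_glue n0 s0 (sP (fun m1 => Asl (cc (i - ed d)) (i - ed d) d m1 x)) (sP (fun m1 => Asl (cc i) i d m1 x)) Cf fL fR.
exists g; split => //.
have R1 := @derive1n_right _ (n - 1) f PR sigma^-1 (- (sigma^-1 * 0)) 0 (0 + sigma) _ fR.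
have L1 := @derive1n_left _ (n - 1) f PL sigma^-1 (1 - sigma^-1 * 0) (0 - sigma) 0 _ fL.
rewrite add0r s0 in R1; rewrite sub0r oppr_lt0 s0 in L1.
rewrite /normal_jump -/f (cvg_lim (@Rhausdorff R) (R1 isT)) (cvg_lim (@Rhausdorff R) (L1 isT)) -mulrBr.
congr (_ * _); rewrite !mulr0 !subr0 !add0r.
have <- : ((PL \Po ('X + 1))^`(n - 1)).[0] = (PL^`(n - 1)).[1].
  have -> : (PL \Po ('X + 1))^`(n - 1) = (PL^`(n - 1)) \Po ('X + 1).
    elim: (n - 1)%N => [|k IH]; first by rewrite !derivn0.
    by rewrite derivnS IH deriv_comp -derivnS derivD derivX derivC addr0 mulr1.
  by rewrite horner_comp hornerD hornerX hornerC add0r.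
rewrite -hornerN -hornerD -derivnB gE derivnZ hornerZ bp0 derivnZ hornerZ -subn1 derivnXn.
by rewrite subnn expr0 ffactnn hornerMn hornerC mulVf ?mulr1// pnatr_eq0 -lt0n fact_gt0.
Qed.

End Glue.

End Cells.

(** * Global coefficients of splines and of their jumps *)

Section Splines.
Context {R : realType} (D : nat) (sigma : R) (a : 'rV[R]_D.+1) (n : nat).
Notation V := ('rV[R]_D.+1).
Notation Z := ('rV[int]_D.+1).
Notation Lx := (Lx D n).
Notation lc := (lc sigma a).
Notation cell := (cell sigma a).
Notation bpP := (@bpP R D n).
Hypotheses (s0 : 0 < sigma) (n0 : (0 < n)%N).

Definition sh (d : 'I_D.+1) (m : Lx) : Lx := [ffun e => if e == d then inord (m d).+1 else m e].
Definition unsh (d : 'I_D.+1) (m : Lx) : Lx := [ffun e => if e == d then inord (m d).-1 else m e].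

Lemma sh_d d (m : Lx) : (m d < n)%N -> sh d m d = (m d).+1 :> nat.
Proof. by move=> md; rewrite ffunE eqxx inordK. Qed.

Lemma sh_e d e (m : Lx) : e != d -> sh d m e = m e.
Proof. by move=> /negbTE h; rewrite ffunE h. Qed.

Lemma shK d (m : Lx) : (0 < m d)%N -> sh d (unsh d m) = m.
Proof.
move=> m0; apply/ffunP => e; rewrite !ffunE; case: eqP => // ->; rewrite eqxx; apply: val_inj.
rewrite /= inordK; first by rewrite inordK ?prednK// ltnW// ltnS prednK.
by rewrite inordK ?prednK// ltnW.
Qed.

Lemma unshK d (m : Lx) : (m d < n)%N -> unsh d (sh d m) = m.
Proof.
move=> mn; apply/ffunP => e; rewrite !ffunE; case: eqP => // ->; rewrite eqxx; apply: val_inj.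
by rewrite /= inordK ?inordK//= ltnS ltnW.
Qed.

Lemma sum_shift d k (F : Lx -> R) : (k < n)%N ->
  \sum_(m : Lx | m d == k.+1 :> nat) F m = \sum_(m : Lx | m d == k :> nat) F (sh d m).
Proof.
move=> kn; rewrite (reindex_onto (sh d) (unsh d))/=; last first.
  by move=> m /eqP md; apply: shK; rewrite md.
apply: eq_bigl => m; apply/andP/eqP => [[/eqP md /eqP E]|md].
  have := congr1 (fun f : Lx => (f d : nat)) E; rewrite ffunE eqxx md /= inordK => [->//|].
  by rewrite ltnS ltnW.
by rewrite sh_d ?md// unshK ?md.
Qed.

Lemma off_sh d (m : Lx) : (m d < n)%N -> off (sh d m) = off m + ed d.
Proof.
move=> md; apply/rowP => e; rewrite !mxE eqxx /=; case: eqVneq => [->|ne].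
  by rewrite sh_d// -addn1 PoszD.
by rewrite sh_e// addr0.
Qed.

Definition to_face (d : 'I_D.+1) (i : Z) (y : V) : V :=
  \row_e if e == d then grid_coord sigma a d (i ord0 d) else y ord0 e.

Lemma to_faceP d i y : cell i y -> face_set sigma a (d, i) (to_face d i y).
Proof.
by move=> cy; split=> [|e /negbTE ne] /=; rewrite !mxE ?eqxx ?ne//; exact: cy.
Qed.

Lemma Asl_to_face (b : Lx -> R) j d k i y : Asl sigma a b j d k (to_face d i y) = Asl sigma a b j d k y.
Proof.
apply: eq_bigr => m _; congr (_ * _); apply: eq_bigr => e /negbTE ne; by rewrite mxE ne.
Qed.

Lemma Asl_ed (b : Lx -> R) i d k y : Asl sigma a b (i - ed d) d k y = Asl sigma a b i d k y.
Proof. by apply: eq_bigr => m _; congr (_ * _); apply: eq_bigr => e ne; rewrite lc_ed. Qed.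

Lemma Asl_shift (b : Lx -> R) i d k y : (k < n)%N -> Asl sigma a b i d k.+1 y = Asl sigma a (fun m => b (sh d m)) i d k y.
Proof.
move=> kn; rewrite /Asl sum_shift//; apply: eq_bigr => m _; congr (_ * _).
by apply: eq_bigr => e ne; rewrite sh_e.
Qed.

Section Coefficients.
Variables (u : V -> R) (cc : Z -> Lx -> R).
Hypotheses (Cu : (1 < n)%N -> class_C (n - 2) u).
Hypotheses (uE : forall j x, cell j x -> u x = gsum sigma a bpP (cc j) j x).

(** By [glue] and [bp_glue] the slice coefficients of adjacent cells agree for all tangential
    coordinates. Their difference, written as a function on the cell with coefficients [b],
    therefore vanishes, and the dual functional of [m] gives the equality. *)
Lemma cc_step i d (m : Lx) : inL m -> ((m d).+1 < n)%N -> cc i (sh d m) = cc (i - ed d) m.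
Proof.
move=> mL mdn; have md : (m d < n)%N by exact: ltnW.
pose b (m' : Lx) := if m' d == m d then cc i (sh d m') - cc (i - ed d) m' else 0.
have b0 y : cell i y -> (fun=> 0 : R) y = gsum sigma a bpP b i y.
  move=> cy; have [g [gE _]] := glue s0 n0 Cu uE (to_faceP d cy).
  have [/(_ _ mdn) + _] := @bp_glue R n (fun k => Asl sigma a (cc (i - ed d)) (i - ed d) d k (to_face d i y)) (fun k => Asl sigma a (cc i) i d k (to_face d i y)) g n0 gE.
  rewrite !Asl_to_face Asl_ed Asl_shift// => E.
  have := gsum_line sigma a bpP b i d 0 y; rewrite scale0r addr0 => ->.
  rewrite (bigD1 (m d))//= [X in _ + X]big1 => [|k km]; last first.
    rewrite big1 ?mulr0// => m' /eqP m'k; rewrite /b -val_eqE/= m'k.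
    by rewrite (negbTE km : (k == m d :> nat) = false) mul0r.
  rewrite addr0 [X in _ * X](_ : _ = 0) ?mulr0//.
  transitivity (Asl sigma a (fun m => cc i (sh d m)) i d (m d) y - Asl sigma a (cc (i - ed d)) i d (m d) y); last by rewrite E subrr.
  rewrite /Asl -sumrB; apply: eq_bigr => m' m'd; rewrite /b -val_eqE/= m'd.
  by rewrite mulrBl.
have := lam_gsum s0 n0 mL b0; rewrite /b eqxx.
have z0 y : cell i y -> (fun=> 0 : R) y = gsum sigma a bpP (fun _ : Lx => 0 : R) i y.
  by move=> _; rewrite /gsum big1// => m' _; rewrite mul0r.
rewrite (lam_gsum s0 n0 mL z0) => /esym/eqP.
by rewrite subr_eq0 => /eqP.
Qed.

Definition zeroL : Lx := [ffun=> ord0].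

(** [cc_step] lowers one index by 1 and moves to the neighbouring cell below, which preserves
    [i - off m]; after finitely many steps all indices are 0. *)
Lemma cc_global i (m : Lx) : inL m -> cc i m = lam sigma a (i - off m) zeroL u.
Proof.
have [s] := ubnP (\sum_d m d)%N; elim: s i m => // s IH i m ms mL.
have [/existsP[d md]|] := boolP [exists d, 0 < m d]%N; last first.
  rewrite negb_exists => /forallP m0; have -> : m = zeroL.
    by apply/ffunP => d; apply: val_inj; rewrite ffunE /=; apply/eqP; rewrite -leqn0 leqNgt.
  have -> : i - off zeroL = i by apply/rowP => d; rewrite !mxE ffunE subr0.
  by rewrite (lam_gsum s0 n0 _ (@uE i))// => d; rewrite ffunE.
have ud : unsh d m d = (m d).-1 :> nat by rewrite ffunE eqxx inordK// ltnS (leq_trans (leq_pred _))// -ltnS.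
have uL : inL (unsh d m).
  move=> e; have [->|ne] := eqVneq e d; first by rewrite ud (leq_ltn_trans (leq_pred _)).
  by rewrite ffunE (negbTE ne).
have -> : cc i m = cc (i - ed d) (unsh d m).
  by rewrite -{1}(shK md) cc_step// ud prednK.
rewrite IH; last exact: uL.
  have oE : off m = off (unsh d m) + ed d.
    by rewrite -{1}(shK md) off_sh// ud (leq_ltn_trans (leq_pred _))//; exact: mL.
  by rewrite oE opprD addrA [i - ed d - _]addrAC.
rewrite -ltnS (leq_trans _ ms)// ltnS (bigD1 d)//= [X in (_ < X)%N](bigD1 d)//= ud -addSn prednK// leq_add2l.
by apply: leq_sum => e ne; rewrite ffunE (negbTE ne).
Qed.

End Coefficients.

Definition hasc (u : V -> R) (c : Z -> R) :=
  forall i x, cell i x -> u x = gsum sigma a bpP (fun m : Lx => c (i - off m)) i x.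

Lemma spline_coefs u : ((1 < n)%N -> class_C (n - 2) u) ->
  (forall i, exists c : {ffun 'I_D.+1 -> 'I_n} -> R, forall x, cell i x ->
        u x = \sum_alpha c alpha * \prod_d x ord0 d ^+ alpha d) ->
  hasc u (fun j => lam sigma a j zeroL u).
Proof.
move=> Cu up; have H i : exists b : Lx -> R, forall x, cell i x -> u x = gsum sigma a bpP b i x.
  have [c cE] := up i; have [b bE] := cell_poly_expand a s0 n0 c i.
  by exists b => x cx; rewrite cE// bE.
have [cc ccE] := choice H => i x cx; rewrite (ccE i x cx).
apply: gsum_ext => m h; last exact: (cc_global Cu ccE).
exact: cpoly_bp0.
Qed.

(** In the normal direction the piece is replaced by a constant, the jump of the derivative of order
    [n - 1] of the B-spline at its knot [k]. *)
Definition jP (d e : 'I_D.+1) (k : nat) : {poly R} := if e == d then (nbl n k)%:P else bp n k.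

(** The factor [g] of [glue] is an [n]-th difference of coefficients by [bp_glue]. All its terms
    except the one of index 0 belong to the lower cell, whose indices are shifted by 1. *)
Lemma jump_coefs u c : ((1 < n)%N -> class_C (n - 2) u) -> hasc u c ->
  forall d i x, face_set sigma a (d, i) x ->
  normal_jump d (n - 1) u x = sigma^-1 ^+ (n - 1) * gsum sigma a (jP d) (fun m : Lx => c (i - off m)) i x.
Proof.
move=> Cu uc d i x fx; have [g [gE ->]] := glue s0 n0 Cu uc fx; congr (_ * _).
have [_ <-] := @bp_glue R n (fun k => Asl sigma a (fun m : Lx => c (i - ed d - off m)) (i - ed d) d k x) (fun k => Asl sigma a (fun m : Lx => c (i - off m)) i d k x) g n0 gE.
have := gsum_line sigma a (jP d) (fun m : Lx => c (i - off m)) i d 0 x; rewrite scale0r addr0 => ->.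
have E k : (jP d d k).[lc i d (x ord0 d + 0)] * (\sum_(m : Lx | m d == k :> nat) c (i - off m) * \prod_(e | e != d) (jP d e (m e)).[lc i e (x ord0 e)])
   = nbl n k * Asl sigma a (fun m : Lx => c (i - off m)) i d k x.
  rewrite /jP eqxx hornerC; congr (_ * _); apply: eq_bigr => m _; congr (_ * _).
  by apply: eq_bigr => e /negbTE ->.
under [RHS]eq_bigr => k _ do rewrite E.
rewrite [RHS]big_ord_recl /= [nbl n 0](_ : _ = 1) ?mul1r; last by rewrite /nbl expr0 bin0 mul1r.
congr (_ + _); apply: eq_bigr => k _.
rewrite mulrC /fintype.bump add1n Asl_shift// Asl_ed; congr (_ * _).
apply: eq_bigr => m /eqP mk; congr (_ * _); congr (c _); rewrite off_sh ?mk//.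
by rewrite opprD [- off m - _]addrC addrA.
Qed.

End Splines.

(** * The spline space and its B-spline sums *)

Lemma class_C_add {R : realType} (D m : nat) (f g : 'rV[R]_D -> R) :
  class_C m f -> class_C m g -> class_C m (fun x => f x + g x).
Proof.
elim: m f g => [|m IH] f g /=; first by move=> cf cg x; apply: continuousD; [exact: cf|exact: cg].
move=> [cf df] [cg dg]; split; first by move=> x; apply: continuousD; [exact: cf|exact: cg].
move=> d; have [d1 c1] := df d; have [d2 c2] := dg d; split=> [x|]; first exact: derivableD.
have -> : (fun x => 'D_(unit_vec d) (fun y => f y + g y) x) = (fun x => 'D_(unit_vec d) f x + 'D_(unit_vec d) g x).
  by apply/funext => x; rewrite deriveD.
exact: IH.
Qed.

Lemma class_C_scale {R : realType} (D m : nat) (c : R) (f : 'rV[R]_D -> R) :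
  class_C m f -> class_C m (fun x => c * f x).
Proof.
elim: m f => [|m IH] f /=; first by move=> cf x; exact: (cvgM (cvg_cst _) (cf x)).
move=> [cf df]; split; first by move=> x; exact: (cvgM (cvg_cst _) (cf x)).
move=> d; have [d1 c1] := df d; split=> [x|]; first exact: derivableZ.
have -> : (fun x => 'D_(unit_vec d) (fun y => c * f y) x) = (fun x => c * 'D_(unit_vec d) f x).
  by apply/funext => x; rewrite (deriveZ c (d1 x)).
exact: IH.
Qed.

Lemma class_C_cst0 {R : realType} (D m : nat) : class_C m (fun _ : 'rV[R]_D => 0).
Proof.
elim: m => [|m IH] /=; first exact: cst_continuous.
split; first exact: cst_continuous.
move=> d; split=> [x|]; first exact: derivable_cst.
have -> : (fun x : 'rV[R]_D => 'D_(unit_vec d) (fun _ : 'rV[R]_D => 0 : R) x) = (fun=> 0); last exact: IH.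
by apply/funext => x; rewrite derive_cst.
Qed.

Lemma class_C_sum {R : realType} (D m : nat) (J : Type) (s : seq J) (c : J -> R) (f : J -> 'rV[R]_D -> R) :
  (forall j, class_C m (f j)) -> class_C m (fun x => \sum_(j <- s) c j * f j x).
Proof.
move=> cf; elim: s => [|j s IH].
  by have -> : (fun x => \sum_(j <- [::]) c j * f j x) = fun=> 0; [apply/funext => x; rewrite big_nil|exact: class_C_cst0].
have -> : (fun x => \sum_(i <- j :: s) c i * f i x) = (fun x => c j * f j x + \sum_(i <- s) c i * f i x).
  by apply/funext => x; rewrite big_cons.
by apply: class_C_add => //; exact: class_C_scale.
Qed.

Section SplineSpace.
Context {R : realType} (D : nat) (sigma : R) (a : 'rV[R]_D.+1) (n : nat).
Notation V := ('rV[R]_D.+1).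
Notation Z := ('rV[int]_D.+1).
Notation Lx := (Lx D n).
Notation lc := (lc sigma a).
Notation cell := (cell sigma a).
Hypotheses (s0 : 0 < sigma) (n0 : (0 < n)%N).

Lemma locbd_bspl aa : locbd (@bspl R n aa).
Proof.
rewrite /bspl; case: ltnP => h; last by move=> M; exists 0 => x _; rewrite normr0.
have tb m : locbd (@tpow R m).
  case: m => [|m]; last exact/loclip_locbd/loclip_tpow.
  move=> M; exists 1 => x _; rewrite /tpow; case: ifP => _; rewrite ?normr0// expr0 divr1 normr1//.
move=> M; have [B BE] := tb (n.-1 - aa)%N (`|M| + n%:R).
exists (\sum_(i < n.+1) `|nbl n i| * B) => x xM.
apply: le_trans (ler_norm_sum _ _ _) _; apply: ler_sum => i _; rewrite normrM ler_wpM2l//.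
apply: BE; apply: le_trans (ler_normB _ _) _; rewrite normr_nat lerD//.
  by apply: le_trans xM _; exact: ler_norm.
by rewrite ler_nat -ltnS.
Qed.

Lemma measurable_bspl aa : measurable_fun setT (@bspl R n aa).
Proof.
rewrite /bspl; case: ltnP => h; last exact: measurable_cst.
apply: measurable_sum => i; apply: measurable_funM; first exact: measurable_cst.
apply: (measurableT_comp (measurable_tpow _)); apply: measurable_funB => //.
Qed.

(** The derivative of order [aa] of the B-spline whose support starts at node [j]; the power of
    [sigma] is due to the chain rule. *)
Definition Bch (j : Z) (d : 'I_D.+1) (aa : nat) (t : R) : R := sigma^-1 ^+ aa * bspl n aa (lc j d t).

Lemma wchain_Bch j : wchain (Bch j) (fun=> n.-1).
Proof.
have sV : sigma^-1 != 0 by rewrite invr_eq0 gt_eqF.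
split=> d aa h.
  have := wd1_scale (sigma^-1 ^+ aa) (wd1_affine (- (sigma^-1 * a ord0 d) - (j ord0 d)%:~R) sV (@wd1_bspl R n aa _)).
  have -> : Bch j d aa.+1 = fun x => sigma^-1 ^+ aa * (sigma^-1 * bspl n aa.+1 (sigma^-1 * x + (- (sigma^-1 * a ord0 d) - (j ord0 d)%:~R))).
    by apply/funext => t; rewrite /Bch exprSr mulrA.
  by apply; rewrite -ltn_predRL.
split.
  move=> M; have [B BE] := @locbd_bspl aa (`|sigma^-1| * `|M| + `|- (sigma^-1 * a ord0 d) - (j ord0 d)%:~R|).
  exists (`|sigma^-1 ^+ aa| * B) => x xM; rewrite /Bch normrM ler_wpM2l//; apply: BE.
  apply: le_trans (ler_normD _ _) _; rewrite lerD2r normrM ler_wpM2l//.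
  by apply: le_trans xM _; exact: ler_norm.
apply: measurable_funM; first exact: measurable_cst.
apply: (measurableT_comp (measurable_bspl _)).
by apply: measurable_funD; first exact: measurable_funM.
Qed.

Lemma lc_shift i j d (t : R) : lc j d t = lc i d t + (i ord0 d - j ord0 d)%:~R.
Proof. by rewrite /Submission.lc intrB; ring. Qed.

Lemma bspl_lc i j d aa (t : R) : 0 <= lc i d t < 1 ->
  bspl n aa (lc j d t) =
  if (j ord0 d <= i ord0 d)%R then ((bp n `|i ord0 d - j ord0 d|%N)^`(aa)).[lc i d t] else 0.
Proof.
move=> h; rewrite (lc_shift i); case: ifPn => ji.
  rewrite -(bspl_cell _ _ n0 h); congr bspl; rewrite [RHS]addrC; congr (_ + _).
  by rewrite -{1}(@gez0_abs (i ord0 d - j ord0 d)) ?subr_ge0// -pmulrn.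
apply: bspl_neg; move: ji; rewrite -ltNge => ji.
have : i ord0 d - j ord0 d <= -1 by lia.
by rewrite -(ler_int R) => h2; case/andP: h => h3 h4; rewrite -[(-1)%:~R]/(-1 : R) in h2; lra.
Qed.

Definition dP (al : 'I_D.+1 -> nat) (d : 'I_D.+1) (k : nat) : {poly R} :=
  sigma^-1 ^+ al d *: (bp n k)^`(al d).

Lemma dP0 (al : 'I_D.+1 -> nat) : (forall d, al d = 0%N) -> dP al = @bpP R D n.
Proof. by move=> al0; apply/funext => d; apply/funext => k; rewrite /dP al0 derivn0 expr0 scale1r. Qed.

Lemma dP_top al d : dP al d n = 0.
Proof. by rewrite /dP bp_eq0// linear0 scaler0. Qed.

(** At most one [m] satisfies [j = i - off m]; summing over [m] avoids a distinction of cases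
    according to whether the support of the B-spline meets the cell. *)
Lemma ctens_cell i j al (x : V) : cell i x ->
  ctens (Bch j) al x = \sum_(m : Lx) (j == i - off m)%:R * cpoly sigma a (fun d => dP al d (m d)) i x.
Proof.
move=> /(cellP _ s0) cx.
have lx d : 0 <= lc i d (x ord0 d) < 1 by have /andP[/ltW-> ->] := cx d.
have [|] := boolP [forall d, (j ord0 d <= i ord0 d)%R && (i ord0 d - j ord0 d <= n%:Z)%R].
  move=> /forallP h; pose m : Lx := [ffun d => inord `|i ord0 d - j ord0 d|%N].
  have mE d : m d = `|i ord0 d - j ord0 d|%N :> nat.
    by rewrite ffunE inordK//; have /andP[h1 h2] := h d; lia.
  rewrite (bigD1 m)//= [X in _ + X]big1 ?addr0; last first.
    move=> m' mm'; case: eqVneq => [E|]; last by rewrite mul0r.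
    by case/negP: mm'; apply/eqP/ffunP => d; apply: val_inj; rewrite /= mE E !mxE opprB addrCA subrr addr0 absz_nat.
  have -> : j == i - off m.
    by apply/eqP/rowP => d; have /andP[h1 _] := h d; rewrite !mxE mE gez0_abs ?subr_ge0// opprB addrCA subrr addr0.
  rewrite mul1r; apply: eq_bigr => d _; rewrite /Bch (bspl_lc _ _ (lx d)) /dP mE hornerZ.
  by have /andP[-> _] := h d.
rewrite negb_forall => /existsP[d hd]; rewrite big1; last first.
  move=> m _; case: eqVneq => [E|]; last by rewrite mul0r.
  case/negP: hd; by rewrite E !mxE opprB [i ord0 d + _]addrCA subrr addr0 lez_nat -ltnS ltn_ord andbT gerDl oppr_le0.
rewrite /ctens /tens (bigD1 d)//= /Bch (bspl_lc _ _ (lx d)); case: ifPn => ji; last by rewrite mulr0 mul0r.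
rewrite bp_eq0 ?linear0 ?horner0 ?mulr0 ?mul0r//; move: hd; rewrite ji /=; lia.
Qed.

Definition spl (s : seq Z) (c : Z -> R) (al : 'I_D.+1 -> nat) (x : V) : R :=
  \sum_(j <- s) c j * ctens (Bch j) al x.

Lemma spl_cell s c al i x : uniq s -> (forall j, j \notin s -> c j = 0) -> cell i x ->
  spl s c al x = gsum sigma a (dP al) (fun m : Lx => c (i - off m)) i x.
Proof.
move=> us cs cx; rewrite /spl /gsum; under eq_bigr do rewrite (ctens_cell _ _ cx) mulr_sumr.
rewrite exchange_big/=; apply: eq_bigr => m _.
have [js|js] := boolP (i - off m \in s).
  rewrite (bigD1_seq (i - off m))//= eqxx mul1r [X in _ + X]big1 ?addr0//.
  by move=> j /negbTE ->; rewrite mul0r mulr0.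
rewrite cs// mul0r big_seq big1// => j jin; case: eqVneq => [E|]; last by rewrite mul0r mulr0.
by rewrite -E jin in js.
Qed.

Lemma hasc_spl s c : uniq s -> (forall j, j \notin s -> c j = 0) ->
  hasc sigma a n (spl s c (fun=> 0%N)) c.
Proof. by move=> us cs i x cx; rewrite (spl_cell _ us cs cx) dP0. Qed.

Lemma tens_monomials (Q : 'I_D.+1 -> {poly R}) : (forall d, size (Q d) <= n)%N ->
  exists c : {ffun 'I_D.+1 -> 'I_n} -> R, forall x : V,
  tens (fun d => horner (Q d)) x = \sum_al c al * \prod_d x ord0 d ^+ al d.
Proof.
move=> sQ; exists (fun al : {ffun 'I_D.+1 -> 'I_n} => \prod_d (Q d)`_(al d)) => x; rewrite /tens.
transitivity (\prod_d \sum_(k < n) (Q d)`_k * x ord0 d ^+ k).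
  by apply: eq_bigr => d _; rewrite -(horner_coef_wide _ (sQ d)).
by rewrite bigA_distr_bigA/=; apply: eq_bigr => al _; rewrite big_split.
Qed.

Lemma cpoly_monomials (P : 'I_D.+1 -> {poly R}) i : (forall d, size (P d) <= n)%N ->
  exists c : {ffun 'I_D.+1 -> 'I_n} -> R, forall x,
  cpoly sigma a P i x = \sum_al c al * \prod_d x ord0 d ^+ al d.
Proof.
move=> sP; pose Q d : {poly R} := P d \Po (sigma^-1 *: 'X + (- (sigma^-1 * a ord0 d) - (i ord0 d)%:~R)%:P).
have sQ d : (size (Q d) <= n)%N.
  apply: leq_trans (size_comp_poly_leq _ _) _.
  have -> : size (sigma^-1 *: 'X + (- (sigma^-1 * a ord0 d) - (i ord0 d)%:~R)%:P) = 2%N.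
    have h : sigma^-1 *: 'X + (- (sigma^-1 * a ord0 d) - (i ord0 d)%:~R)%:P != 0 :> {poly R}.
      apply/eqP => /(congr1 (fun p : {poly R} => p`_1)); rewrite coefD coefZ coefX coefC coef0/= mulr1 addr0.
      by apply/eqP; rewrite invr_eq0 gt_eqF.
    rewrite size_polyDl size_scale ?invr_eq0 ?gt_eqF// ?size_polyX// size_polyC; by case: (_ == 0).
  by rewrite muln1; case: (size (P d)) (sP d).
have [c cE] := tens_monomials sQ; exists c => x; rewrite -cE /cpoly /tens.
by apply: eq_bigr => d _; rewrite horner_comp hornerD hornerZ hornerX hornerC.
Qed.

Lemma gsum_monomials (P : 'I_D.+1 -> nat -> {poly R}) (b : Lx -> R) i : (forall d k, size (P d k) <= n)%N ->
  exists c : {ffun 'I_D.+1 -> 'I_n} -> R, forall x,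
  gsum sigma a P b i x = \sum_al c al * \prod_d x ord0 d ^+ al d.
Proof.
move=> sP; have h (m : Lx) : exists c : {ffun 'I_D.+1 -> 'I_n} -> R, forall x,
  cpoly sigma a (fun d => P d (m d)) i x = \sum_al c al * \prod_d x ord0 d ^+ al d by exact: cpoly_monomials.
have [c cE] := choice h; exists (fun al => \sum_m b m * c m al) => x.
under [RHS]eq_bigr do rewrite mulr_suml; rewrite exchange_big/=; apply: eq_bigr => m _.
by rewrite cE mulr_sumr; apply: eq_bigr => al _; rewrite mulrA.
Qed.

Lemma ctens_Bch_supp j al (x : V) : ~ cbox (corner sigma a j) (\row_d grid_coord sigma a d (j ord0 d + n%:Z)) x ->
  ctens (Bch j) al x = 0.
Proof.
move=> /existsNP[d]; rewrite !mxE => /negP h; rewrite /ctens /tens (bigD1 d)//=.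
rewrite [X in X * _](_ : _ = 0) ?mul0r// /Bch.
have E := lcE a s0 j d (x ord0 d); have [l0|l0] := ltP (lc j d (x ord0 d)) 0; first by rewrite bspl_neg ?mulr0.
have [l1|l1] := ltP (lc j d (x ord0 d)) n%:R; last by rewrite bspl_out ?mulr0.
case/negP: h; rewrite {1 2}E /grid_coord !lerD2l !ler_pM2r// lerDl l0 intrD lerD2l -pmulrn; exact: ltW.
Qed.

Lemma compact_supp_spl s c al : compact (closure [set x | spl s c al x != 0]).
Proof.
have [K [cK KE]] : exists K : set V, compact K /\ forall x, ~ K x -> spl s c al x = 0.
  rewrite /spl; elim: s => [|j s [K [cK KE]]].
    by exists set0; split=> [|x _]; [exact: compact0|rewrite big_nil].
  exists (cbox (corner sigma a j) (\row_d grid_coord sigma a d (j ord0 d + n%:Z)) `|` K); split.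
    by apply: compactU => //; exact: compact_cbox.
  by move=> x /not_orP[h1 h2]; rewrite big_cons KE// ctens_Bch_supp// mulr0 addr0.
apply: (subclosed_compact _ cK); first exact: closed_closure.
have cl : closed K by apply: compact_closed => //; exact: norm_hausdorff.
move/closure_id: cl => ->; apply: closureS => x /eqP h; apply: contrapT => Kx; exact/h/KE.
Qed.

Lemma measurable_spl s c al : (forall d, al d <= n.-1)%N -> measurable_fun setT (spl s c al).
Proof.
move=> aln; apply: measurable_sum => j; apply: measurable_funM; first exact: measurable_cst.
exact: (measurable_ctens (wchain_Bch j)).
Qed.

Lemma spline_spl s c : uniq s -> (forall j, j \notin s -> c j = 0) ->
  spline sigma a n (spl s c (fun=> 0%N)).
Proof.
move=> us cs; split.
- exact: measurable_spl.
- exact: compact_supp_spl.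
- move=> n1; apply: class_C_sum => j; apply: class_C_tens => d.
  have -> : Bch j d 0 = fun t => bspl n 0 (lc j d t) by apply/funext => t; rewrite /Bch expr0 mul1r.
  exact/Cm_affine/Cm_bspl.
move=> i; have [cc ccE] := @gsum_monomials (@bpP R D n) (fun m : Lx => c (i - off m)) i (fun d k => size_bp k n0).
by exists cc => x cx; rewrite -ccE (hasc_spl us cs cx).
Qed.

Lemma spl_weak (U : set V) u s c (al : multi_index D.+1) : open U -> (forall d, al d <= n.-1)%N ->
  (forall x, U x -> u x = spl s c (fun=> 0%N) x) -> is_weak_partial U u al (spl s c al).
Proof. by move=> oU aln uE; apply: (comb_weak_partial (A := fun=> n.-1) oU (fun j => wchain_Bch j) aln uE). Qed.

(** On one open cell the pieces are polynomials and have derivatives of every order, whereas the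
    B-splines themselves are differentiated only up to [n - 1]. This is what covers the order [n] in
    the broken norms. *)
Definition Pch (i : Z) (m : Lx) (d : 'I_D.+1) (aa : nat) (t : R) : R :=
  sigma^-1 ^+ aa * ((bp n (m d))^`(aa)).[lc i d t].

Lemma wchain_Pch i m A : wchain (Pch i m) A.
Proof.
have sV : sigma^-1 != 0 by rewrite invr_eq0 gt_eqF.
have W d aa : wd1 (Pch i m d aa) (Pch i m d aa.+1).
  have := wd1_scale (sigma^-1 ^+ aa) (wd1_affine (- (sigma^-1 * a ord0 d) - (i ord0 d)%:~R) sV (wd1_horner ((bp n (m d))^`(aa)))).
  have -> : Pch i m d aa.+1 = fun x => sigma^-1 ^+ aa * (sigma^-1 * (((bp n (m d))^`(aa))^`()).[sigma^-1 * x + (- (sigma^-1 * a ord0 d) - (i ord0 d)%:~R)]).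
    by apply/funext => t; rewrite /Pch exprSr mulrA derivnS.
  by apply.
split=> d aa _; first exact: W.
split; last exact: (wd1_measurable (W d aa)).
by have [/loclip_locbd] := W d aa.
Qed.

Lemma cell_weak i u (b : Lx -> R) (al : multi_index D.+1) :
  (forall x, cell i x -> u x = gsum sigma a (@bpP R D n) b i x) ->
  is_weak_partial (cell i) u al (gsum sigma a (dP al) b i).
Proof.
move=> uE; apply: (comb_weak_partial (f := Pch i) (s := index_enum _) (c := b) (A := al)) => //.
- exact: open_cell.
- by move=> m; exact: wchain_Pch.
- move=> x cx; rewrite uE//; apply: eq_bigr => m _; congr (_ * _); apply: eq_bigr => d _.
  by rewrite /Pch expr0 mul1r derivn0.
- move=> x cx; apply: eq_bigr => m _; congr (_ * _); apply: eq_bigr => d _.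
  by rewrite /Pch /dP hornerZ.
Qed.

End SplineSpace.

(** * Cells, faces and the grid domain *)

Lemma open_positive {R : realType} (D : nat) (U : set 'rV[R]_D) x : open U -> U x -> (0 < lebesgue_rV D U)%E.
Proof.
move=> oU Ux; have /nbhs_ballP[e /= e0 xe] : nbhs x U by exact: open_nbhs_nbhs.
pose a : 'rV[R]_D := \row_d (x ord0 d - e / 2); pose b : 'rV[R]_D := \row_d (x ord0 d + e / 2).
have sub : obox a b `<=` U.
  move=> y yab; apply: xe; apply/(coord_ball _ _ e0) => d; have := yab d; rewrite !mxE ltr_norml => /andP[h1 h2].
  and_lra.
apply: lt_le_trans (_ : lebesgue_rV D (obox a b) <= _)%E; last first.
  apply: le_measure => //; rewrite ?inE; [exact: measurable_obox|exact: open_measurable_rV].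
rewrite measure_obox; last by move=> d; rewrite !mxE; lra.
by rewrite lte_fin; apply: prodr_gt0 => d _; rewrite !mxE; lra.
Qed.

Lemma open_sub_interior (T : topologicalType) (U B : set T) : open U -> U `<=` B -> U `<=` interior B.
Proof. by move=> oU UB x Ux; apply: filterS UB _; exact: open_nbhs_nbhs. Qed.

Section Geometry.
Context {R : realType} (D : nat) (sigma : R) (a : 'rV[R]_D.+1) (Om : set 'rV[R]_D.+1).
Notation mu := (lebesgue_rV D.+1).
Notation V := ('rV[R]_D.+1).
Notation Z := ('rV[int]_D.+1).
Notation lc := (lc sigma a).
Notation cell := (cell sigma a).
Notation elements := (elements sigma a Om).
Notation gd := (grid_domain sigma a Om).
Hypotheses (s0 : 0 < sigma) (oOm : open Om).

Lemma cell_inj i j x : cell i x -> cell j x -> i = j.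
Proof.
move=> /(cellP _ s0) ci /(cellP _ s0) cj; apply/rowP => d.
have /andP[h1 h2] := ci d; have /andP[h3 h4] := cj d.
have E := lc_shift sigma a i j d (x ord0 d); rewrite E in h3, h4.
have l1 : (-1 : R) < (i ord0 d - j ord0 d)%:~R by lra.
have l2 : (i ord0 d - j ord0 d)%:~R < (1 : R) by lra.
have m1 : (-1 : int) < i ord0 d - j ord0 d by rewrite -(ltr_int R).
have m2 : i ord0 d - j ord0 d < (1 : int) by rewrite -(ltr_int R).
suff -> : i ord0 d = j ord0 d by [].
by move: m1 m2; move: (i ord0 d) (j ord0 d) => x' y'; lia.
Qed.

Lemma elementsP i : elements i <-> exists2 x, cell i x & Om x.
Proof.
split=> [h|[x cx ox]].
  apply: contrapT => h2; move: h; rewrite /Submission.lc /Defs.elements/= (_ : _ `&` _ = set0) ?measure0 ?ltxx//.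
  by apply/seteqP; split => // x [cx ox]; apply: h2; exists x.
by apply: (@open_positive _ _ _ x) => //; apply: openI => //; exact: open_cell.
Qed.

Lemma cell_domain i : elements i -> cell i `<=` gd.
Proof.
move=> ei; apply: open_sub_interior (@open_cell R D sigma a i) _ => x cx; exists i => //; exact: subset_closure.
Qed.

(** A small move towards the centre of the cell takes a point of the closed cell into the open
    one. *)
Lemma cell_closure i (x : V) : (forall d, 0 <= lc i d (x ord0 d) <= 1) -> closure (cell i) x.
Proof.
move=> h B /nbhs_ballP[e /= e0 xe].
pose t := Num.min 1 (e / (sigma * 2)); have t0 : 0 < t by rewrite lt_min ltr01 divr_gt0// mulr_gt0.
have t1 : t <= 1 by rewrite ge_min lexx.
have te : t * sigma <= e / 2.
  apply: le_trans (ler_wpM2r (ltW s0) (_ : t <= e / (sigma * 2))) _; first by rewrite ge_min lexx orbT.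
  by rewrite [leLHS](_ : _ = e / 2)//; field; rewrite gt_eqF//.
pose y : V := \row_d (x ord0 d + t * sigma * (2^-1 - lc i d (x ord0 d))).
have E d : lc i d (y ord0 d) = lc i d (x ord0 d) + t * (2^-1 - lc i d (x ord0 d)).
  rewrite mxE /Submission.lc; field; rewrite gt_eqF//.
exists y; split.
  apply/(cellP _ s0) => d; rewrite E; have /andP[h1 h2] := h d; set l := lc _ _ _ in h1 h2 *.
  apply/andP; split; nra.
apply: xe; apply/(coord_ball _ _ e0) => d; rewrite mxE opprD addNKr normrN.
have /andP[h1 h2] := h d; set l := lc _ _ _ in h1 h2 *.
rewrite normrM gtr0_norm ?mulr_gt0//; apply: le_lt_trans (_ : t * sigma * 2^-1 < e).
  by rewrite ler_wpM2l// ?mulr_ge0 ?(ltW t0) ?(ltW s0)// ler_norml; and_lra.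
by lra.
Qed.

Lemma cell_of_domain j y : cell j y -> gd y -> elements j.
Proof.
move=> cj gy; have := interior_subset gy => -[i ei ci].
have [z [zi zj]] := ci (cell j) (open_nbhs_nbhs (conj (@open_cell R D sigma a j) cj)).
by rewrite (cell_inj zj zi).
Qed.

(** The points outside all open cells lie on countably many hyperplanes. *)
Lemma ae_cell : {ae mu, forall x : V, exists i, cell i x}.
Proof.
have N (d : 'I_D.+1) (z : int) : mu.-negligible [set x : V | x ord0 d = grid_coord sigma a d z].
  apply/negligibleP; last exact: hyperplane_null.
  exact: (measurable_coord_preim d (measurable_set1 _)).
have N2 d : {ae mu, forall x : V, forall z, x ord0 d <> grid_coord sigma a d z}.
  have : mu.-negligible (\bigcup_k [set x : V | x ord0 d = grid_coord sigma a d (odflt 0 (unpickle k))]).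
    by apply: negligible_bigcup => k; exact: N.
  apply: negligibleS => x /= /existsNP[z /contrapT xz].
  by exists (pickle z) => //=; rewrite pickleK.
have : {ae mu, forall x : V, forall d z, x ord0 d <> grid_coord sigma a d z} by exact: filter_forall.
apply: filterS => x h.
exists (\row_d Num.floor ((x ord0 d - a ord0 d) / sigma)) => d; rewrite mxE.
set t := (x ord0 d - a ord0 d) / sigma; have xt : x ord0 d = a ord0 d + t * sigma.
  by rewrite /t divfK ?gt_eqF// addrC subrK.
rewrite /grid_coord xt !ltrD2l !ltr_pM2r//; have /andP[f1 f2] := floor_itv t.
rewrite f2 andbT lt_neqAle f1 andbT; apply/negP => /eqP E; apply: (h d (Num.floor t)).
by rewrite /grid_coord E xt.
Qed.

Lemma ae_domain_cell : {ae mu, forall x, gd x -> exists2 i, elements i & cell i x}.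
Proof.
by apply: filterS ae_cell => x [i ci] gx; exists i => //; exact: cell_of_domain gx.
Qed.

Lemma ae_Om_cell : {ae mu, forall x, Om x -> exists2 i, elements i & cell i x}.
Proof.
by apply: filterS ae_cell => x [i ci] ox; exists i => //; apply/elementsP; exists x.
Qed.

Lemma face_closure d i x : face_set sigma a (d, i) x -> closure (cell i) x /\ closure (cell (i - ed d)) x.
Proof.
move=> [/= fd fe]; have l0 : lc i d (x ord0 d) = 0.
  by rewrite fd /Submission.lc /grid_coord; field; rewrite gt_eqF//.
split; apply: cell_closure => e; have [->|ne] := eqVneq e d.
- by rewrite l0 lexx ler01.
- by have := fe e ne; rewrite -(lc_itv a s0) => /andP[/ltW -> /ltW ->].
- by rewrite lc_edd l0 add0r lexx ler01.
- by rewrite lc_ed//; have := fe e ne; rewrite -(lc_itv a s0) => /andP[/ltW -> /ltW ->].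
Qed.

(** The two cells and the face between them fill an open box inside the union of the closed
    elements. *)
Lemma face_domain d i : elements i -> elements (i - ed d) -> face_set sigma a (d, i) `<=` gd.
Proof.
move=> e1 e2 x [/= fd fe]; have l0 : lc i d (x ord0 d) = 0.
  by rewrite fd /Submission.lc /grid_coord; field; rewrite gt_eqF//.
pose U := obox (\row_e (if e == d then grid_coord sigma a d (i ord0 d - 1) else grid_coord sigma a e (i ord0 e))) (\row_e grid_coord sigma a e (i ord0 e + 1)).
have oU : open U by exact: open_obox.
have gc z : grid_coord sigma a d (z - 1) < grid_coord sigma a d z.
  by rewrite ltrD2l ltr_pM2r// ltr_int gtrDl.
have gc1 z : grid_coord sigma a d z < grid_coord sigma a d (z + 1).
  by rewrite ltrD2l ltr_pM2r// ltr_int ltrDl.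
have Ux : U x.
  by move=> e; rewrite !mxE; case: eqVneq => [->|ne]; [rewrite fd gc gc1|exact: fe].
have sub : U `<=` \bigcup_(i in elements) closure (cell i).
  move=> y Uy; have l1 : lc i d (y ord0 d) < 1 by have /andP[_] := Uy d; rewrite mxE {1}(lcE a s0 i d (y ord0 d)) /grid_coord ltrD2l ltr_pM2r// intrD ltrD2l.
  have l2 : -1 < lc i d (y ord0 d).
    have /andP[+ _] := Uy d; rewrite mxE eqxx {1}(lcE a s0 i d (y ord0 d)) /grid_coord ltrD2l ltr_pM2r// intrB; lra.
  have le e : e != d -> 0 <= lc i e (y ord0 e) <= 1.
    move=> ne; have := Uy e; rewrite !mxE (negbTE ne) -(lc_itv a s0) => /andP[/ltW -> /ltW ->] //.
  have [l3|l3] := leP 0 (lc i d (y ord0 d)).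
    exists i => //; apply: cell_closure => e; have [->|/le//] := eqVneq e d; by rewrite l3 ltW.
  exists (i - ed d) => //; apply: cell_closure => e; have [->|ne] := eqVneq e d.
    by rewrite lc_edd; and_lra.
  by rewrite lc_ed//; exact: le.
exact: (open_sub_interior oU sub).
Qed.

(** A face that is not contained in the boundary has a point in the interior of the grid domain;
    both adjacent cells come arbitrarily close to this point, hence meet the grid domain and are
    elements. *)
Lemma ghost_elements d i : ghost_faces sigma a Om (d, i) -> elements i /\ elements (i - ed d).
Proof.
move=> [[j [ej _] fj] nb].
have K j1 j2 : elements j1 -> (forall x, face_set sigma a (d, i) x -> closure (cell j1) x /\ closure (cell j2) x) -> elements j2.
  move=> e1 h; apply: contrapT => ne2; apply: nb => x fx; have [c1 c2] := h x fx; split.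
    exact: (closureS (cell_domain e1)).
  move=> gx; have oi : open gd by exact: open_interior.
  have gx' : nbhs x gd := gx.
  by have [z [z1 z2]] := c2 _ gx'; apply: ne2; exact: cell_of_domain z1 z2.
case: fj => /= [E|E].
  have ei : elements i by rewrite E.
  by split => //; apply: K ei _ => x fx; have [] := face_closure fx.
have ei : elements (i - ed d) by rewrite E addrK.
by split => //; apply: K ei _ => x fx; have [] := face_closure fx.
Qed.

Lemma finite_elements : bounded_set Om -> exists s : seq Z, uniq s /\ forall i, (i \in s) <-> elements i.
Proof.
move=> /= [M [_ bM]]; have {}bM : forall x, Om x -> `|x| <= M + 1 by apply: bM; rewrite ltrDl.
have [B BE] : exists B : nat, forall i, elements i -> forall d, (`|i ord0 d| <= B)%N.
  pose C d : R := ((M + 1) + `|a ord0 d|) / sigma + 1.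
  exists (\sum_d Num.trunc (C d)).+1 => i /elementsP[x cx ox] d.
  have xd : `|x ord0 d| <= M + 1.
    by apply: le_trans (bM x ox); rewrite [leRHS]mx_normrE; apply: (le_trans _ (le_bigmax _ _ (ord0, d))).
  have /andP[l0 l1] := (cellP _ s0 _ _).1 cx d.
  have E := lcE a s0 i d (x ord0 d); set l := lc _ _ _ in l0 l1 E.
  have iE : (i ord0 d)%:~R = (x ord0 d - a ord0 d) / sigma - l.
    by rewrite {1}E; field; rewrite gt_eqF//.
  have iC : `|(i ord0 d)%:~R : R| < C d.
    rewrite iE /C; apply: le_lt_trans (ler_normB _ _) _; rewrite (gtr0_norm l0); apply: ler_ltD => //.
    rewrite normrM normfV (gtr0_norm s0) ler_pM2r ?invr_gt0//; apply: le_trans (ler_normB _ _) _; exact: lerD.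
  have := le_lt_trans (ltW iC) (real_truncnS_gt (num_real (C d))).
  rewrite -intr_norm -[(Num.trunc _).+1%:R]/((Num.trunc (C d)).+1%:~R) ltr_int => h.
  have h2 : (`|i ord0 d| < (Num.trunc (C d)).+1)%N by rewrite -ltz_nat; rewrite abszE.
  apply: leq_trans (ltnW h2) _; rewrite ltnS (bigD1 d)//=; exact: leq_addr.
pose S := [seq (\row_d ((f d : nat)%:Z - B%:Z) : Z) | f : {ffun 'I_D.+1 -> 'I_(B.*2.+1)} <- enum {ffun 'I_D.+1 -> 'I_(B.*2.+1)}].
exists [seq i <- undup S | `[< elements i >]]; split; first by rewrite filter_uniq// undup_uniq.
move=> i; rewrite mem_filter mem_undup; split=> [/andP[/asboolP]//|ei]; apply/andP; split; first exact/asboolP.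
apply/mapP; exists [ffun d => inord (absz (i ord0 d + B%:Z))]; first by rewrite mem_enum.
have K (z : int) : (`|z| <= B)%N -> z = (absz (z + B%:Z))%:Z - B%:Z by lia.
apply/rowP => d; rewrite mxE ffunE; have h := BE i ei d; rewrite inordK; last by rewrite -addnn; lia.
exact: K.
Qed.

End Geometry.

(** * Locality of normal jumps *)

Section NormalJump.
Context {R : realType} (D : nat).
Notation V := ('rV[R]_D.+1).

Lemma derive1n_near (m : nat) (f g : R -> R) (e : R) : (forall t, `|t| < e -> f t = g t) ->
  forall t, `|t| < e -> derive1n m f t = derive1n m g t.
Proof.
move=> fg; elim: m => [|m IH] t te; first by rewrite !derive1n0 fg.
rewrite !derive1nS !derive1E; apply: near_eq_derive; near=> s; apply: IH.
near: s; have o : open [set s : R | `|s| < e].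
  have -> : [set s : R | `|s| < e] = [set` `]-e, e[] by apply/seteqP; split=> x; rewrite /= in_itv/= ltr_norml.
  exact: itv_open.
by apply: open_nbhs_nbhs.
Unshelve. all: by end_near. Qed.

Lemma normal_jump_near d m (u w : V -> R) (G : set V) x : open G -> G x -> (forall y, G y -> u y = w y) ->
  normal_jump d m u x = normal_jump d m w x.
Proof.
move=> oG Gx uw; have /nbhs_ballP[e /= e0 xe] : nbhs x G by exact: open_nbhs_nbhs.
have E (t : R) : `|t| < e -> u (x + t *: unit_vec d) = w (x + t *: unit_vec d).
  move=> te; apply/uw/xe/(coord_ball _ _ e0) => d'; rewrite [x + _]addrC unit_vecE opprD addrCA subrr addr0 normrN.
  by case: ifP => _; rewrite ?normr0.
have E2 := derive1n_near m E.
have nr : \forall t \near (0 : R)^'+, `|t| < e.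
  near=> t; have t0 : 0 < t by near: t; exact: nbhs_right_gt.
  by rewrite gtr0_norm//; near: t; exact: nbhs_right_lt.
have nl : \forall t \near (0 : R)^'-, `|t| < e.
  near=> t; have t0 : t < 0 by near: t; exact: nbhs_left_lt.
  by rewrite ltr0_norm// ltrNl; near: t; apply: nbhs_left_gt; rewrite oppr_lt0.
have L (F : set_system R) (f g : R -> R) : Filter F -> (\forall t \near F, f t = g t) -> lim (f @ F) = lim (g @ F).
  move=> FF fg; congr lim; rewrite eqEsubset; split; apply: near_eq_cvg; by apply: filterS fg => t ->.
by rewrite /normal_jump; congr (_ - _); apply: L; [apply: filterS nr|apply: filterS nl] => t te; exact: E2.
Unshelve. all: by end_near. Qed.

End NormalJump.

(** * Constants of the coercivity estimate *)

Section Constants.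
Context {R : realType} (D n : nat).
Notation Lx := (Lx D n).

Definition setm (d : 'I_D.+1) (k : 'I_n.+1) (m : Lx) : Lx := [ffun e => if e == d then k else m e].

Definition celldual (m : Lx) (e : 'I_D.+1) : {poly R} := dualn n (m e).
(** The factor is 1 in the normal direction because the jump polynomials are constant there. *)
Definition facedual (d : 'I_D.+1) (m : Lx) (e : 'I_D.+1) : {poly R} := if e == d then 1 else dualn n (m e).

(** Bounds the squared [L^2] norms, on the unit cell, of all test polynomials used for cells and for
    faces. *)
Definition dual_cst : R := 1 + \sum_m `|\prod_e IP (celldual m e ^+ 2)| +
  \sum_d \sum_m `|\prod_e IP (facedual d m e ^+ 2)|.

Lemma dual_cst_ge1 : 1 <= dual_cst.
Proof. by rewrite /dual_cst -addrA lerDl addr_ge0// ?sumr_ge0// => d _; rewrite sumr_ge0. Qed.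

Lemma dual_cst_cell m : `|\prod_e IP (celldual m e ^+ 2)| <= dual_cst.
Proof.
rewrite /dual_cst (bigD1 m)//= -addrA addrCA -addrA lerDl !addr_ge0// ?sumr_ge0// => d _; rewrite sumr_ge0//.
Qed.

Lemma dual_cst_face d m : `|\prod_e IP (facedual d m e ^+ 2)| <= dual_cst.
Proof.
have h1 : `|\prod_e IP (facedual d m e ^+ 2)| <= \sum_m `|\prod_e IP (facedual d m e ^+ 2)|.
  by rewrite (bigD1 m)//= lerDl sumr_ge0.
have h2 : \sum_m `|\prod_e IP (facedual d m e ^+ 2)| <= \sum_d \sum_m `|\prod_e IP (facedual d m e ^+ 2)|.
  by rewrite [leRHS](bigD1 d)//= lerDl sumr_ge0// => e _; rewrite sumr_ge0.
by apply: le_trans h1 (le_trans h2 _); rewrite /dual_cst lerDr addr_ge0// sumr_ge0.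
Qed.

Definition cross_cst : R := 1 + \sum_(k < n.+1) `|nbl n k|.

Lemma cross_cst_ge1 : 1 <= cross_cst.
Proof. by rewrite lerDl sumr_ge0. Qed.

(** Growth of a coefficient bound when one face is crossed: [cross_cst] comes from solving the jump
    for an end coefficient, [2 ^+ D.+1] from comparing the weighted energies of neighbouring
    cells. *)
Definition step_cst (c : R) : R := c + cross_cst * (c + Num.sqrt dual_cst) * 2 ^+ D.+1.

Definition chain_cst (K : nat) : R := iter K step_cst (step_cst (Num.sqrt dual_cst)).

(** The number of local indices, the squared bound along a chain of at most [K] faces, and the total
    mass [4 ^+ D.+1] of the weights of rate 1/2. *)
Definition coer_cst (K : nat) : R :=
  ((#|{: Lx}|)%:R * chain_cst K ^+ 2 * 4 ^+ D.+1)^-1.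

Lemma step_cst_ge c : 0 <= c -> c <= step_cst c.
Proof.
move=> c0; rewrite lerDl !mulr_ge0 ?exprn_ge0//; last by rewrite addr_ge0// sqrtr_ge0.
by apply: le_trans cross_cst_ge1.
Qed.

Lemma iter_step K c : 0 <= c -> c <= iter K step_cst c.
Proof.
move=> c0; elim: K => //= K IH; apply: le_trans (IH) (step_cst_ge _); exact: le_trans c0 IH.
Qed.

Lemma iter_step_le j K : (j <= K)%N -> iter j step_cst (step_cst (Num.sqrt dual_cst)) <= chain_cst K.
Proof.
move=> jK; rewrite /chain_cst -(subnK jK) iterD; apply: iter_step.
apply: le_trans (iter_step _ _); apply: le_trans (step_cst_ge _); exact: sqrtr_ge0.
Qed.

Lemma chain_cst_gt0 K : 0 < chain_cst K.
Proof.
have d0 : 0 < Num.sqrt dual_cst by rewrite sqrtr_gt0 (lt_le_trans ltr01 dual_cst_ge1).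
apply: lt_le_trans (iter_step_le (leq0n K)); apply: lt_le_trans d0 _; apply: step_cst_ge; exact: sqrtr_ge0.
Qed.

Lemma coer_cst_gt0 K : 0 < coer_cst K.
Proof.
rewrite invr_gt0 !mulr_gt0 ?exprn_gt0 ?chain_cst_gt0// ltr0n.
by apply/card_gt0P; exists [ffun=> ord0].
Qed.

End Constants.

(** * Uniform bounds of the polynomials on the unit interval *)

Section Bounds.
Context {R : realType} (n : nat).

Definition poly_bounds (B : R) :=
  [/\ 1 <= B, forall k aa (t : R), (k <= n)%N -> (aa <= n)%N -> 0 <= t <= 1 -> `|((bp n k)^`(aa)).[t]| <= B,
      forall m (t : R), (m <= n)%N -> 0 <= t <= 1 -> `|(dualn n m).[t]| <= B &
      forall k, (k <= n)%N -> `|nbl n k : R| <= B].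

Lemma family_bound (I : finType) (P : I -> {poly R}) : exists2 B : R, 0 <= B &
  forall i t, 0 <= t <= 1 -> `|(P i).[t]| <= B.
Proof.
have h i : exists B : R, forall t, `|t| <= 1 -> `|(P i).[t]| <= B.
  by have /loclip_locbd/(_ 1) := loclip_horner (P i).
have [B BE] := choice h; exists (\sum_i `|B i|); first exact: sumr_ge0.
move=> i t /andP[t0 t1]; apply: (@le_trans _ _ (B i)); first by apply: BE; rewrite ger0_norm.
by rewrite (bigD1 i)//= -[leLHS]addr0 lerD ?ler_norm ?sumr_ge0.
Qed.

Lemma poly_bounds_exists : exists B, poly_bounds B.
Proof.
have [B1 B10 h1] := family_bound (fun ka : 'I_n.+1 * 'I_n.+1 => (bp n ka.1)^`(ka.2)).
have [B2 B20 h2] := family_bound (fun m : 'I_n.+1 => dualn n m).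
pose B3 : R := \sum_(k < n.+1) `|nbl n k|; have B30 : 0 <= B3 by rewrite sumr_ge0.
exists (1 + B1 + B2 + B3); split; first by rewrite -!addrA lerDl !addr_ge0.
- move=> k aa t kn an t01; have := h1 (Ordinal (kn : (k < n.+1)%N), Ordinal (an : (aa < n.+1)%N)) t t01; rewrite /=.
  lra.
- move=> m t mn t01; have := h2 (Ordinal (mn : (m < n.+1)%N)) t t01; rewrite /=; lra.
- move=> k kn; have : `|nbl n k : R| <= B3.
    by rewrite /B3 (bigD1 (Ordinal (kn : (k < n.+1)%N)))//= lerDl sumr_ge0.
  lra.
Qed.

End Bounds.

Section Lin.
Context {R : realType} (D : nat) (L : finType) (off : L -> 'rV[int]_D).

Lemma Aloc_sub I a (x y z : ('rV[int]_D) -> R) : Aloc off I a (fun j => x j - y j) z = Aloc off I a x z - Aloc off I a y z.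
Proof.
rewrite /Aloc -sumrB; apply: eq_bigr => i _; rewrite -sumrB; apply: eq_bigr => m _.
by rewrite -sumrB; apply: eq_bigr => m' _; ring.
Qed.

End Lin.

Section Bounded.
Context {R : realType} (D : nat) (sigma : R) (a : 'rV[R]_D.+1) (n : nat).
Notation mu := (lebesgue_rV D.+1).
Notation Lx := (Lx D n).
Notation cell := (cell sigma a).
Notation cpoly := (cpoly sigma a).
Notation bpP := (@bpP R D n).
Notation jP := (@jP R D n).
Hypothesis s0 : 0 < sigma.
Variable B : R.
Hypothesis hB : poly_bounds n B.

Lemma B1 : 1 <= B. Proof. by case: hB. Qed.
Lemma B0 : 0 <= B. Proof. exact: le_trans B1. Qed.

Lemma cpoly_bound (P : 'I_D.+1 -> {poly R}) C i x : (forall d t, 0 <= t <= 1 -> `|(P d).[t]| <= C) ->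
  cell i x -> `|cpoly P i x| <= C ^+ D.+1.
Proof.
move=> hP /(cellP _ s0) cx; rewrite /Submission.cpoly /tens normr_prod.
apply: le_trans (_ : \prod_(d < D.+1) C <= _); last by rewrite prodr_const card_ord.
by apply: ler_prod => d _; rewrite normr_ge0/= hP//; have /andP[/ltW -> /ltW ->] := cx d.
Qed.

Lemma cpoly_int_bound W (P : 'I_D.+1 -> {poly R}) C i : measurable W -> W `<=` cell i ->
  (forall d t, 0 <= t <= 1 -> `|(P d).[t]| <= C) -> `|\int[mu]_(x in W) cpoly P i x| <= C ^+ D.+1 * sigma ^+ D.+1.
Proof.
move=> mW sW hP; have C0 : 0 <= C by apply: le_trans (hP ord0 0 _); rewrite ?lexx ?ler01.
have iW : mu.-integrable W (EFin \o cpoly P i).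
  by apply: integrableS (cell_integral a s0 P i).1 => //; exact: measurable_cell.
apply: le_trans (le_normr_Rintegral mW iW) _.
have muWle : (mu W <= (sigma ^+ D.+1)%:E)%E.
  by rewrite -(measure_cell a s0 i) le_measure// inE//; exact: measurable_cell.
have fW : mu W \is a fin_num by rewrite ge0_fin_numE// (le_lt_trans muWle) ?ltry.
apply: (@le_trans _ _ (\int[mu]_(x in W) (cst (C ^+ D.+1)) x)).
  apply: le_Rintegral => //.
  - by have := integrable_abse iW; apply: eq_integrable.
  - apply/integrableP; split; first by apply/measurable_EFinP; exact: measurable_cst.
    by rewrite (eq_integral (cst `|C ^+ D.+1|%:E))// integral_cst// lte_mul_pinfty// -ge0_fin_numE.
  - by move=> x Wx; exact: (cpoly_bound hP (sW x Wx)).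
rewrite Rintegral_cst// ler_wpM2l ?exprn_ge0//.
by rewrite -lee_fin fineK.
Qed.

Lemma bp_le k t : (k <= n)%N -> 0 <= t <= 1 -> `|(bp n k).[t]| <= B.
Proof. by move=> kn t01; have [_ h _ _] := hB; have := h k 0%N t kn (leq0n _) t01; rewrite derivn0. Qed.

Lemma jP_le d e k t : (k <= n)%N -> 0 <= t <= 1 -> `|(jP d e k).[t]| <= B.
Proof.
move=> kn t01; rewrite /Submission.jP; case: ifP => _; last exact: bp_le.
by rewrite hornerC; case: hB => _ _ _; exact.
Qed.

Lemma lam_bound i (m : Lx) u : mu.-integrable (cell i) (EFin \o u) ->
  (`|lam sigma a i m u|%:E <= (B ^+ D.+1 * (sigma ^+ D.+1)^-1)%:E * \int[mu]_(x in cell i) `|(u x)%:E|)%E.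
Proof.
move=> iu; have mc := measurable_cell sigma a i; have sN : 0 < sigma ^+ D.+1 by rewrite exprn_gt0.
have BN : 0 <= B ^+ D.+1 by rewrite exprn_ge0// B0.
have hd x : cell i x -> `|cpoly (fun d => dualn n (m d)) i x| <= B ^+ D.+1.
  by move=> cx; apply: cpoly_bound cx => d t t01; have [_ _ h _] := hB; apply: h => //; rewrite -ltnS.
have [mu_ iu2] := integrableP _ _ _ iu; have mp := (integrableP _ _ _ (cell_integral a s0 (fun d => dualn n (m d)) i).1).1.
have mup : measurable_fun (cell i) (fun x => u x * cpoly (fun d => dualn n (m d)) i x).
  by apply: measurable_funM; exact/measurable_EFinP.
have le : (\int[mu]_(x in cell i) `|(u x * cpoly (fun d => dualn n (m d)) i x)%:E| <= (B ^+ D.+1)%:E * \int[mu]_(x in cell i) `|(u x)%:E|)%E.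
  rewrite -ge0_integralZl//; last exact: measurableT_comp.
  apply: ge0_le_integral => //.
  - by apply: measurableT_comp => //; exact/measurable_EFinP.
  - by apply: emeasurable_funM; [exact: measurable_cst|exact: measurableT_comp].
  - by move=> x cx; rewrite -EFinM lee_fin normrM mulrC ler_wpM2r// hd.
have ip : mu.-integrable (cell i) (EFin \o (fun x => u x * cpoly (fun d => dualn n (m d)) i x)).
  apply/integrableP; split; first exact/measurable_EFinP.
  by apply: le_lt_trans le _; rewrite lte_mul_pinfty.
rewrite /lam normrM normfV (gtr0_norm sN) EFinM (EFin_normr_Rintegral mc ip) [(B ^+ _ / _)%R]mulrC EFinM -muleA.
rewrite lee_pmul2l//; last by rewrite lte_fin invr_gt0.
exact: le_trans (le_abse_integral mu mc (integrableP _ _ _ ip).1) le.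
Qed.

End Bounded.

(** * Weak derivatives *)

Section WeakUnique.
Context {R : realType} (D : nat).
Notation mu := (lebesgue_rV D).
Notation V := ('rV[R]_D).

Lemma ae_obox_exhaust (a b : V) (P : V -> Prop) :
  (forall N : nat, {ae mu, forall x, obox (a + const_mx N.+1%:R^-1) (b - const_mx N.+1%:R^-1) x -> P x}) ->
  {ae mu, forall x, obox a b x -> P x}.
Proof.
move=> h; have : {ae mu, forall x, forall N, obox (a + const_mx N.+1%:R^-1) (b - const_mx N.+1%:R^-1) x -> P x}.
  have N0 : mu.-negligible (\bigcup_N ~` [set x | obox (a + const_mx N.+1%:R^-1) (b - const_mx N.+1%:R^-1) x -> P x]).
    by apply: negligible_bigcup => N; exact: h.
  apply: negligibleS N0 => x /= /existsNP[N hN]; by exists N.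
apply: filterS => x hx xab.
pose e : R := \big[Num.min/1]_(d < D) Num.min (x ord0 d - a ord0 d) (b ord0 d - x ord0 d).
have e0 : 0 < e.
  rewrite /e; elim/big_ind: _ => // [y z y0 z0|d _]; first by rewrite lt_min y0.
  by have /andP[h1 h2] := xab d; rewrite lt_min !subr_gt0 h1.
have ed d : e <= x ord0 d - a ord0 d /\ e <= b ord0 d - x ord0 d.
  have : e <= Num.min (x ord0 d - a ord0 d) (b ord0 d - x ord0 d) by apply: bigmin_le_cond.
  by rewrite le_min => /andP.
pose N := Num.truncn e^-1.
have Ne : N.+1%:R^-1 < e.
  by rewrite -[ltRHS]invrK ltf_pV2 ?posrE ?invr_gt0//; apply: truncnS_gt.
apply: (hx N) => d; rewrite !mxE; have [h1 h2] := ed d.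
have K (y : R) : y < e -> a ord0 d + y < x ord0 d < b ord0 d - y by move=> ye; and_lra.
exact: K.
Qed.

Lemma tens_supp_open f (a b : V) x : (forall d t, ~~ (a ord0 d < t < b ord0 d) -> f d t = 0) ->
  ~ obox a b x -> tens f x = 0 :> R.
Proof.
move=> f0 /existsNP[d /negP h]; rewrite /tens (bigD1 d)//= f0 ?mul0r//.
Qed.

(** Tensor products of bumps supported in the box are admissible test functions for [U], so
    [fundamental_box] applies to the difference. *)
Lemma weak_unique (U : set V) u al (g g' : V -> R) (a b : V) : open U -> cbox a b `<=` U ->
  is_weak_partial U u al g -> is_weak_partial U u al g' ->
  {ae mu, forall x, obox a b x -> g x = g' x}.
Proof.
move=> oU abU [_ [mg lg] wg] [_ [mg' lg'] wg'].
have mo := measurable_obox a b; have ocb := @obox_cbox R D a b.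
have io (h : V -> R) : (forall K, compact K -> K `<=` U -> mu.-integrable K (EFin \o h)) -> mu.-integrable (obox a b) (EFin \o h).
  by move=> lh; apply: (integrableS (measurable_cbox a b) mo ocb); apply: lh => //; exact: compact_cbox.
have ig := io _ lg; have ig' := io _ lg'.
have mU := open_measurable_rV oU.
pose h x := g x - g' x.
have ih : mu.-integrable (obox a b) (EFin \o h) by exact: (integrableB mo ig ig').
have E : {ae mu, forall x, obox a b x -> h x = 0}.
  apply: fundamental_box; first exact/(integrable_patch _ _ mo).
  move=> f sf f0; have supp : supp_in f a b.
    by move=> d t h1; apply: f0; apply: contraNN h1 => /andP[/ltW -> /ltW ->].
  have tf := test_function_tens sf supp abU.
  have Ef : \int[mu]_(x in U) (g x * tens f x) = \int[mu]_(x in U) (g' x * tens f x).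
    have := wg _ tf; rewrite wg'// => /(congr1 (fun z => (-1) ^+ mi_order al * z)).
    by rewrite !mulrA -!exprD addnn -mul2n exprM sqrrN expr1n expr1n !mul1r.
  have EU (w : V -> R) : \int[mu]_(x in U) (w x * tens f x) = \int[mu]_(x in obox a b) (w x * tens f x).
    rewrite Rintegral_mkcond [RHS]Rintegral_mkcond; congr (Rintegral _ _ _); apply/funext => x; rewrite /patch.
    have [xo|xo] := boolP (x \in obox a b).
      by rewrite mem_set//; apply/abU/ocb; exact: set_mem xo.
    rewrite (tens_supp_open f0) ?mulr0 ?if_same// => h1; by rewrite mem_set in xo.
  have [C C0 bC] := tens_bounded (fun d => Cm_continuous (sf d 0%N)) supp.
  have mf : measurable_fun (obox a b) (tens f).
    by apply: measurable_funTS; apply: continuous_measurable_rV; apply: continuous_tens => d; exact: Cm_continuous (sf d 0%N).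
  have i1 := integrable_bdd_mul mo ig mf (fun x _ => bC x).
  have i2 := integrable_bdd_mul mo ig' mf (fun x _ => bC x).
  have i3 := integrable_bdd_mul mo ih mf (fun x _ => bC x).
  have F : \int[mu]_(x in obox a b) (h x * tens f x) = 0.
    transitivity (\int[mu]_(x in obox a b) (g x * tens f x - g' x * tens f x)).
      by apply: eq_Rintegral => x _; rewrite mulrBl.
    by rewrite RintegralB// -!EU Ef subrr.
  by rewrite -[LHS]fineK ?integrable_fin_num// -[fine _]/(\int[mu]_(x in obox a b) (h x * tens f x)) F.
by apply: filterS E => x hx /hx; rewrite /h => /eqP; rewrite subr_eq0 => /eqP.
Qed.

Lemma weak_unique_obox u al (g g' : V -> R) (a b : V) :
  is_weak_partial (obox a b) u al g -> is_weak_partial (obox a b) u al g' ->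
  {ae mu, forall x, obox a b x -> g x = g' x}.
Proof.
move=> wg wg'; apply: ae_obox_exhaust => N; apply: weak_unique wg wg'; first exact: open_obox.
move=> x hx d; have := hx d; rewrite !mxE => /andP[h1 h2].
have : 0 < N.+1%:R^-1 :> R by rewrite invr_gt0 ltr0n.
have K (y : R) : 0 < y -> a ord0 d + y <= x ord0 d -> x ord0 d <= b ord0 d - y -> a ord0 d < x ord0 d < b ord0 d.
  by move=> y0 h3 h4; and_lra.
by move=> h3; exact: K h3 h1 h2.
Qed.

Lemma weak_unique_setT u al (g g' : V -> R) :
  is_weak_partial setT u al g -> is_weak_partial setT u al g' -> {ae mu, forall x, g x = g' x}.
Proof.
move=> wg wg'.
have h (N : nat) := @weak_unique setT u al g g' (const_mx (- N%:R)) (const_mx N%:R) openT (@subsetT _ _) wg wg'.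
have N0 : mu.-negligible (\bigcup_N ~` [set x : V | obox (const_mx (- N%:R)) (const_mx N%:R) x -> g x = g' x]).
  by apply: negligible_bigcup => N; exact: h.
apply: negligibleS N0 => x /= gx; have [N hN] := rV_norm_bound x; exists N => //= hx; apply: gx; apply: hx => d.
by rewrite !mxE -ltr_norml.
Qed.

Lemma partial0 (phi : V -> R) : partial [ffun=> 0%N] phi = phi.
Proof. by rewrite /partial; elim: (enum _) => //= d s ->; rewrite ffunE. Qed.

Lemma weak0_self (U : set V) (u : V -> R) : locally_integrable_on U u ->
  is_weak_partial U u [ffun=> 0%N] u.
Proof.
move=> lu; split => // phi _; have -> : mi_order ([ffun=> 0%N] : multi_index D) = 0%N.
  by rewrite /mi_order big1// => d _; rewrite ffunE.
rewrite expr0 mul1r; apply: eq_Rintegral => x _; congr (_ * _).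
by rewrite partial0.
Qed.

Lemma weak0_ae u (g : V -> R) : is_weak_partial setT u [ffun=> 0%N] g -> {ae mu, forall x, u x = g x}.
Proof. by move=> wg; have [lu _ _] := wg; exact: (weak_unique_setT (weak0_self lu) wg). Qed.

End WeakUnique.

Section Pol.
Context {R : realType} (D : nat).
Notation V := ('rV[R]_D).

Lemma class_C_pol m s c (al : multi_index D) : class_C m (pol s c al : V -> R).
Proof. by apply: class_C_sum => be; apply: class_C_tens => d; exact: Cm_horner. Qed.

Lemma weak_pol (U : set V) s c (al : multi_index D) : open U -> is_weak_partial U (pol s c [ffun=> 0%N]) al (pol s c al).
Proof.
move=> oU; apply: (comb_weak_partial (f := @pchain R D) (s := s) (c := c) (A := al)) => //.
- by move=> be; exact: wchain_pchain.
- by move=> x _; apply: eq_bigr => be _; congr (_ * _); apply: eq_bigr => d _; rewrite ffunE.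
Qed.

Lemma size_mpol b aa : (size (@mpol R b aa) <= b.+1)%N.
Proof.
rewrite /mpol; case: ifP => _; last by rewrite size_poly0.
by apply: leq_trans (size_scale_leq _ _) _; rewrite size_polyXn ltnS leq_subr.
Qed.

End Pol.

(** * Polynomial approximation on the patch around a cell *)

Section Local.
Context {R : realType} (D : nat) (sigma : R) (a : 'rV[R]_D.+1) (n k : nat).
Notation mu := (lebesgue_rV D.+1).
Notation V := ('rV[R]_D.+1).
Notation Z := ('rV[int]_D.+1).
Notation Lx := (Lx D n).
Notation cell := (cell sigma a).
Notation gsum := (gsum sigma a).
Notation jP := (@jP R D n).
Notation dP := (@dP R D sigma n).
Notation lamz := (fun j (h : V -> R) => lam sigma a j (zeroL D n) h).
Hypotheses (s0 : 0 < sigma) (n0 : (0 < n)%N) (kn : (k <= n)%N).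
Variable B : R.
Hypothesis hB : poly_bounds n B.

Definition mi0 : multi_index D.+1 := [ffun=> 0%N].

Lemma mi_order0 : mi_order mi0 = 0%N.
Proof. by rewrite /mi_order big1// => d _; rewrite ffunE. Qed.

Lemma pol_monomials c : exists c' : {ffun 'I_D.+1 -> 'I_n} -> R, forall x : V,
  pol (mis k) c mi0 x = \sum_al c' al * \prod_d x ord0 d ^+ al d.
Proof.
have h be : exists c' : {ffun 'I_D.+1 -> 'I_n} -> R, be \in mis k -> forall x : V,
    ctens (@pchain R _ be) mi0 x = \sum_al c' al * \prod_d x ord0 d ^+ al d.
  have [bk|] := boolP (be \in mis k); last by exists (fun=> 0).
  have [|c' c'E] := @tens_monomials R D n (fun d => mpol (be d) (mi0 d)).
    move=> d; apply: leq_trans (size_mpol _ _) _; apply: leq_trans kn.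
    by rewrite mem_mis in bk; apply: leq_ltn_trans bk; exact: leq_mi_order.
  by exists c' => _ x; rewrite -c'E.
have [cf cfE] := choice h; exists (fun al => \sum_(be <- mis k) c be * cf be al) => x.
rewrite /pol; under [RHS]eq_bigr do rewrite mulr_suml; rewrite exchange_big/= big_seq [RHS]big_seq.
apply: eq_bigr => be bk; rewrite cfE// mulr_sumr; apply: eq_bigr => al _; exact: mulrA.
Qed.

(** A polynomial of degree below [k <= n] meets the regularity and piecewise conditions of a spline,
    so it has global coefficients although its support is not compact. *)
Lemma pol_hasc c : hasc sigma a n (pol (mis k) c mi0) (fun j => lamz j (pol (mis k) c mi0)).
Proof.
apply: (spline_coefs s0 n0) => [_|i]; first exact: class_C_pol.
by have [c' c'E] := pol_monomials c; exists c'.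
Qed.

(** Both sides are weak derivatives of the same polynomial on the cell, once as a combination of
    monomials and once of B-spline pieces; uniqueness identifies them without any computation. *)
Lemma pol_gsum c (al : multi_index D.+1) i : {ae mu, forall x, cell i x ->
  pol (mis k) c al x = gsum (dP al) (fun m : Lx => lamz (i - off m) (pol (mis k) c mi0)) i x}.
Proof.
rewrite (cell_obox sigma a i); apply: (@weak_unique_obox _ _ (pol (mis k) c mi0) al).
  by apply: weak_pol; exact: open_obox.
rewrite -(cell_obox sigma a i); apply: (cell_weak s0) => x cx.
exact: (pol_hasc c cx).
Qed.

Lemma normal_jump_smooth d m (u : V -> R) x : class_C m u -> normal_jump d m u x = 0.
Proof.
move=> cu; have cg : continuous (derive1n m (fun t : R => u (x + t *: unit_vec d))).
  by apply: (@Cm_derive1n R m m) => //; exact: class_C_line.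
have r := cvg_at_right_filter (cg 0); have l := cvg_at_left_filter (cg 0).
rewrite /normal_jump; apply/eqP; rewrite subr_eq0; apply/eqP.
by rewrite (cvg_lim _ r)// (cvg_lim _ l).
Qed.

(** A smooth function has no jump on the face below the cell. The jump polynomials do not depend on
    the normal coordinate, so the identity extends from the face to the cell. *)
Lemma pol_jump c d i x : cell i x ->
  gsum (jP d) (fun m : Lx => lamz (i - off m) (pol (mis k) c mi0)) i x = 0.
Proof.
move=> cx; have Cu m : class_C m (pol (mis k) c mi0) by exact: class_C_pol.
have := jump_coefs s0 n0 (fun _ => Cu _) (pol_hasc c) (to_faceP d cx).
rewrite normal_jump_smooth// => /esym/eqP; rewrite mulf_eq0 expf_eq0 invr_eq0 (gt_eqF s0) andbF /= => /eqP <-.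
apply: eq_bigr => m _; congr (_ * _); apply: eq_bigr => e _; rewrite /Submission.jP mxE.
by case: ifP => // _; rewrite !hornerC.
Qed.

Lemma gsum_sub (P : 'I_D.+1 -> nat -> {poly R}) (b b' : Lx -> R) i x :
  gsum P (fun m => b m - b' m) i x = gsum P b i x - gsum P b' i x.
Proof. by rewrite /Submission.gsum -sumrB; apply: eq_bigr => m _; rewrite mulrBl. Qed.

Lemma lam_sub j (u v : V -> R) : mu.-integrable (cell j) (EFin \o u) -> mu.-integrable (cell j) (EFin \o v) ->
  lamz j u - lamz j v = lamz j (fun x => u x - v x).
Proof.
move=> iu iv; rewrite /lam -mulrBr; congr (_ * _).
have mc := measurable_cell sigma a j.
have [_ _ hd _] := hB.
pose psi := (cpoly sigma a) (fun d => dualn n (zeroL D n d)) j.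
have mpsi : measurable_fun (cell j) psi by apply/measurable_EFinP; exact: (integrableP _ _ _ (cell_integral a s0 _ j).1).1.
have bpsi x : cell j x -> `|psi x| <= B ^+ D.+1.
  by move=> cx; apply: (cpoly_bound s0 _ cx) => d t t01; apply: hd => //; rewrite -ltnS.
have i1 := integrable_bdd_mul mc iu mpsi bpsi; have i2 := integrable_bdd_mul mc iv mpsi bpsi.
rewrite -RintegralB//; apply: eq_Rintegral => x _; by rewrite mulrBl.
Qed.

Section Patch.
Variable g : multi_index D.+1 -> V -> R.
Hypotheses (lg : forall al, (mi_order al <= k)%N -> locint (g al)).
Hypotheses (wg : forall al d, (mi_order al < k)%N -> wpart d (g al) (g (minc al d))).

(** The side of the patch formed by a cell and its [n] predecessors in each direction, which
    contains all cells [i - off m]. *)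
Definition rho : R := n.+1%:R * sigma.

Lemma rho_gt0 : 0 < rho. Proof. by rewrite mulr_gt0// ltr0n. Qed.

Lemma HS_ge00 r x : (0 <= HS rho k g r x)%E.
Proof. by apply: HS_ge0; exact: rho_gt0. Qed.

(** Averaging [r] times at scale [rho] gains [sigma^r]. Adding the rescaled terms gives one function
    that serves all orders of derivatives, by [HS_HH]. *)
Definition HH (x : V) : \bar R := (\sum_(r < k.+1) (sigma^-1 ^+ r)%:E * HS rho k g r x)%E.

Lemma HH_ge0 x : (0 <= HH x)%E.
Proof.
apply: sume_ge0 => r _; rewrite mule_ge0 ?lee_fin ?exprn_ge0 ?invr_ge0 ?(ltW s0)//.
exact: HS_ge00.
Qed.

Lemma measurable_HH : measurable_fun setT HH.
Proof.
apply: emeasurable_sum => r; apply: emeasurable_funM; first exact: measurable_cst.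
exact: (measurable_HS rho_gt0 lg).
Qed.

Lemma HS_HH r x : (r <= k)%N -> (HS rho k g r x <= (sigma ^+ r)%:E * HH x)%E.
Proof.
move=> rk; rewrite /HH (bigD1 (Ordinal (rk : (r < k.+1)%N)))//= ge0_muleDr.
- rewrite muleA -EFinM -exprMn divff ?gt_eqF// expr1n mul1e leeDl// mule_ge0 ?lee_fin ?exprn_ge0 ?(ltW s0)//.
  apply: sume_ge0 => s _; rewrite mule_ge0 ?lee_fin ?exprn_ge0 ?invr_ge0 ?(ltW s0)//.
  exact: HS_ge00.
- by rewrite mule_ge0 ?lee_fin ?exprn_ge0 ?invr_ge0 ?(ltW s0)//; exact: HS_ge00.
- apply: sume_ge0 => s _; rewrite mule_ge0 ?lee_fin ?exprn_ge0 ?invr_ge0 ?(ltW s0)//.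
  exact: HS_ge00.
Qed.

(** The bases are the constants of [Lnorm_TT] in dimension [D.+1] for the side [n.+1 * sigma],
    divided by [sigma]. *)
Definition HH_cst : R := \sum_(r < k.+1) (D.+1%:R * 2 ^+ D.+2 * n.+1%:R) ^+ r.

Lemma HH_cst_ge0 : 0 <= HH_cst.
Proof. by rewrite sumr_ge0// => r _; rewrite exprn_ge0// !mulr_ge0 ?exprn_ge0. Qed.

Section HHnorm.
Open Scope ereal_scope.
Variable p : \bar R.
Hypothesis p1 : 1 <= p.

Lemma Lnorm_HH : 'N[mu]_p[HH] <= HH_cst%:E * \sum_(be <- mis k.+1) 'N[mu]_p[EFin \o g be].
Proof.
have r0 := rho_gt0.
have mS r : measurable_fun setT (HS rho k g r) by exact: (measurable_HS r0 lg).
have sr0 r : (0 <= sigma^-1 ^+ r)%R by rewrite exprn_ge0// invr_ge0 ltW.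
apply: le_trans (Lnorm_sum _ _ p1 _ _) _.
- by move=> r; apply: emeasurable_funM; [exact: measurable_cst|exact: mS].
- by move=> r y; rewrite mule_ge0 ?lee_fin//; exact: HS_ge00.
rewrite /HH_cst -sumEFin ge0_sume_distrl; last by move=> r _; rewrite lee_fin exprn_ge0// !mulr_ge0 ?exprn_ge0.
apply: lee_sum => r _; rewrite (Lnorm_scale _ p1 (sr0 r) (mS r)).
apply: le_trans (lee_wpmul2l _ (Lnorm_HS r0 lg r p1)) _; first by rewrite lee_fin.
rewrite muleA -EFinM -exprMn /rho (_ : sigma^-1 * _ = D.+1%:R * 2 ^+ D.+2 * n.+1%:R)%R; last first.
  by field; rewrite gt_eqF.
apply: lee_wpmul2l; first by rewrite lee_fin exprn_ge0// !mulr_ge0 ?exprn_ge0.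
rewrite big_mkcond; apply: lee_sum => be _; case: ifPn => // _; exact: Lnorm_ge0.
Qed.

Lemma HH_lty j : (forall be, (mi_order be <= k)%N -> 'N[mu]_p[EFin \o g be] < +oo) ->
  \int[mu]_(x in cell j) HH x < +oo.
Proof.
move=> gf; apply: (Lnorm_lty_integral p1 (measurable_cell _ _ _) _ (measure_cell a s0 j) measurable_HH HH_ge0).
  by rewrite exprn_ge0// ltW.
apply: le_lt_trans Lnorm_HH _; rewrite lte_mul_pinfty ?lee_fin ?HH_cst_ge0//.
by rewrite big_seq; apply: lte_sum_pinfty => be; rewrite mem_mis ltnS; exact: gf.
Qed.

End HHnorm.

Hypothesis finH : forall j, (\int[mu]_(x in cell j) HH x < +oo)%E.

(** The average of [HH] over cell [j]; [fine] loses nothing because of [finH]. *)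
Definition hr j : R := fine ((sigma ^+ D.+1)^-1%:E * \int[mu]_(x in cell j) HH x)%E.

Lemma hrE j : ((hr j)%:E = (sigma ^+ D.+1)^-1%:E * \int[mu]_(x in cell j) HH x)%E.
Proof.
rewrite /hr fineK// fin_numM// ge0_fin_numE//; apply: integral_ge0 => x _; exact: HH_ge0.
Qed.

Lemma hr_ge0 j : 0 <= hr j.
Proof.
rewrite -lee_fin hrE mule_ge0 ?lee_fin ?invr_ge0 ?exprn_ge0 ?(ltW s0)//.
by apply: integral_ge0 => x _; exact: HH_ge0.
Qed.

Definition pcorner (i : Z) : V := \row_d grid_coord sigma a d (i ord0 d - n%:Z).

Lemma patch_cell i (m : Lx) x : cell (i - off m) x -> cbox (pcorner i) (\row_e (pcorner i ord0 e + rho)) x.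
Proof.
move=> cx d; have /andP[h1 h2] := cx d; rewrite !mxE in h1 h2 *.
have mn : (m d : nat)%:Z <= n%:Z by rewrite lez_nat -ltnS.
have G (z z' : int) : z <= z' -> grid_coord sigma a d z <= grid_coord sigma a d z'.
  by move=> zz; rewrite /grid_coord lerD2l ler_pM2r// ler_int.
apply/andP; split.
  by apply: le_trans (ltW h1); apply: G; rewrite lerD2l lerN2.
have -> : grid_coord sigma a d (i ord0 d - n%:Z) + rho = grid_coord sigma a d (i ord0 d + 1).
  rewrite /grid_coord /rho !intrD intrN -natr1 -!pmulrn; ring.
by apply: le_trans (ltW h2) _; apply: G; rewrite lerD2r gerDl oppr_le0.
Qed.

Lemma off0 : off (zeroL D n) = 0.
Proof. by apply/rowP => d; rewrite !mxE ffunE. Qed.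

Lemma locint_cell (h : V -> R) j : locint h -> mu.-integrable (cell j) (EFin \o h).
Proof.
move=> [mh ih]; rewrite (cell_obox sigma a j).
by apply: (integrableS (measurable_cbox _ _) (measurable_obox _ _) (@obox_cbox _ _ _ _)); exact: ih.
Qed.

(** [bramble_hilbert] on the patch of cell [i]. The polynomial is reproduced by B-splines and has no
    jumps, the dual functionals see its distance from [g] only through cell averages of [HH], and
    its derivatives of order at least [k] vanish. *)
Lemma local_approx i : exists (P : V -> R) (pl : Z -> R),
  [/\ measurable_fun setT P /\ forall x, cell i x -> P x = gsum (@bpP R D n) (fun m : Lx => pl (i - off m)) i x,
      forall d x, cell i x -> gsum (jP d) (fun m : Lx => pl (i - off m)) i x = 0,
      forall m : Lx, `|lamz (i - off m) (g mi0) - pl (i - off m)| <= B ^+ D.+1 * sigma ^+ k * hr (i - off m),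
      {ae mu, forall x, cell i x -> (`|g mi0 x - P x|%:E <= (sigma ^+ k)%:E * HH x)%E} &
      forall al : multi_index D.+1,
        ((mi_order al <= k)%N -> {ae mu, forall x, cell i x ->
           (`|g al x - gsum (dP al) (fun m : Lx => pl (i - off m)) i x|%:E <= (sigma ^+ k * sigma^-1 ^+ mi_order al)%:E * HH x)%E}) /\
        ((k <= mi_order al)%N -> {ae mu, forall x, cell i x -> gsum (dP al) (fun m : Lx => pl (i - off m)) i x = 0})].
Proof.
have [c cE] := bramble_hilbert rho_gt0 lg wg (pcorner i).
pose P := pol (mis k) c mi0; exists P, (fun j => lamz j P).
have l0 : locint (g mi0) by apply: lg; rewrite mi_order0.
have lP : locint P by exact: pol_locint.
have A0 : {ae mu, forall x, cbox (pcorner i) (\row_e (pcorner i ord0 e + rho)) x -> (`|g mi0 x - P x|%:E <= (sigma ^+ k)%:E * HH x)%E}.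
  have h := cE mi0; rewrite mi_order0 subn0 in h; apply: filterS (h (leq0n _)) => x hx cx.
  exact: le_trans (hx cx) (HS_HH _ (leqnn _)).
split.
- by split; [exact: lP.1|move=> x cx; exact: (pol_hasc c cx)].
- by move=> d x cx; exact: pol_jump.
- move=> m; rewrite lam_sub; [|exact: locint_cell|exact: locint_cell].
  have ld := locint_cell (i - off m) (locint_sub l0 lP).
  rewrite -lee_fin; apply: le_trans (lam_bound s0 hB (zeroL D n) ld) _.
  have mc := measurable_cell sigma a (i - off m).
  apply: (@le_trans _ _ ((B ^+ D.+1 / sigma ^+ D.+1)%:E * ((sigma ^+ k)%:E * \int[mu]_(x in cell (i - off m)) HH x))%E).
    rewrite lee_wpmul2l ?lee_fin ?mulr_ge0 ?invr_ge0 ?exprn_ge0 ?(B0 hB) ?(ltW s0)//.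
    rewrite -ge0_integralZl//.
    - apply: ae_ge0_le_integral => //.
      + by apply: measurableT_comp => //; exact: (integrableP _ _ _ ld).1.
      + by move=> x _; rewrite mule_ge0 ?lee_fin ?exprn_ge0 ?(ltW s0)// HH_ge0.
      + by apply: emeasurable_funM; [exact: measurable_cst|exact: measurable_funTS measurable_HH].
      + by apply: filterS A0 => x hx cx; apply: hx; exact: patch_cell cx.
    - exact: measurable_funTS measurable_HH.
    - by move=> x _; exact: HH_ge0.
    - by rewrite lee_fin exprn_ge0// ltW.
  rewrite [(B ^+ D.+1 * _ * _)%:E]EFinM hrE !muleA -!EFinM.
  by rewrite (_ : B ^+ D.+1 / sigma ^+ D.+1 * sigma ^+ k = B ^+ D.+1 * sigma ^+ k / sigma ^+ D.+1)//; ring.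
- apply: filterS A0 => x hx cx; apply: hx; apply: (@patch_cell i (zeroL D n)).
  by rewrite off0 subr0.
move=> al; split=> hal.
  apply: filterS2 (pol_gsum c al i) (cE al hal) => x h1 h2 cx.
  rewrite -h1//; apply: le_trans (h2 _) _.
    by apply: (@patch_cell i (zeroL D n)); rewrite off0 subr0.
  apply: le_trans (HS_HH _ (leq_subr _ _)) _.
  by rewrite exprB ?unitfE ?gt_eqF// exprVn.
by apply: filterS (pol_gsum c al i) => x h1 cx; rewrite -h1// pol0.
Qed.

End Patch.
End Local.

(** * Restriction, difference and modification of weak derivatives *)

Section WeakCalculus.
Context {R : realType} (D : nat).
Notation mu := (lebesgue_rV D).
Notation V := ('rV[R]_D).

Lemma bsmooth_partial (b c : V) (phi : V -> R) al : bsmooth b c phi -> bsmooth b c (partial al phi).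
Proof. by move=> bp; rewrite /partial; elim: (enum _) => [//|d l IH] /=; exact: bsmooth_iter. Qed.

Lemma test_supp (U : set V) (phi : V -> R) al x : test_function U phi ->
  ~ closure [set y | phi y != 0] x -> partial al phi x = 0.
Proof.
move=> tphi; apply: partial_supp; first exact: closed_closure.
by move=> y nK; apply/eqP; apply: contra_notT nK => h; exact: subset_closure.
Qed.

Lemma test_integrable (U : set V) (u phi : V -> R) al : locally_integrable_on U u -> test_function U phi ->
  mu.-integrable setT (EFin \o ((fun x => u x * partial al phi x) \_ U)).
Proof.
move=> [mu_ iu] tphi; have [_ cK KU] := tphi; have [b [c bp]] := test_bsmooth tphi.
have bpa := bsmooth_partial al bp; have [C C0 hC] := bsmooth_bounded bpa.
set K := closure _ in cK KU; have mK : measurable K := compact_measurable_rV cK.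
have i1 : mu.-integrable K (EFin \o (fun x => u x * partial al phi x)).
  apply: (integrable_bdd_mul mK (iu K cK KU) _ (fun x _ => hC x)).
  by apply: measurable_funTS; exact: bsmooth_measurable bpa.
have -> : (fun x => u x * partial al phi x) \_ U = (fun x => u x * partial al phi x) \_ K.
  apply/funext => x; rewrite /patch; have [/set_mem xK|xK] := boolP (x \in K).
    by rewrite mem_set//; exact: KU.
  by rewrite (test_supp _ tphi) ?mulr0 ?if_same// => /mem_set; exact/negP.
exact/(integrable_patch _ _ mK).
Qed.

Lemma weak_restrict (U : set V) u al (g : V -> R) : measurable U ->
  is_weak_partial setT u al g -> is_weak_partial U u al g.
Proof.
move=> mU [[mu_ iu] [mg ig] w]; split.
- by split=> [|K cK _]; [exact: measurable_funTS|exact: iu].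
- by split=> [|K cK _]; [exact: measurable_funTS|exact: ig].
move=> phi tphi; have [sm cK KU] := tphi.
have E (h : V -> R) be : \int[mu]_(x in U) (h x * partial be phi x) = \int[mu]_x (h x * partial be phi x).
  rewrite Rintegral_mkcond; congr (Rintegral _ _ _); apply/funext => x; rewrite /patch.
  by case: ifPn => // nU; rewrite (test_supp _ tphi) ?mulr0// => /KU /mem_set; exact/negP.
have := E g [ffun=> 0%N]; rewrite partial0 => ->; rewrite E; exact: w.
Qed.

Lemma weak_sub (U : set V) u1 u2 al (g1 g2 : V -> R) : measurable U ->
  is_weak_partial U u1 al g1 -> is_weak_partial U u2 al g2 ->
  is_weak_partial U (fun x => u1 x - u2 x) al (fun x => g1 x - g2 x).
Proof.
move=> mU [l1 m1 w1] [l2 m2 w2].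
have lsub (h1 h2 : V -> R) : locally_integrable_on U h1 -> locally_integrable_on U h2 ->
    locally_integrable_on U (fun x => h1 x - h2 x).
  move=> [a1 b1] [a2 b2]; split; first exact: measurable_funB.
  by move=> K cK KU; exact: (integrableB (compact_measurable_rV cK) (b1 K cK KU) (b2 K cK KU)).
split; [exact: lsub|exact: lsub|] => phi tphi.
have I (h : V -> R) be (lh : locally_integrable_on U h) :
    mu.-integrable U (EFin \o (fun x => h x * partial be phi x)).
  by apply/(integrable_patch _ _ mU); exact: test_integrable.
have E (h1 h2 : V -> R) be : locally_integrable_on U h1 -> locally_integrable_on U h2 ->
    \int[mu]_(x in U) ((h1 x - h2 x) * partial be phi x) =
    \int[mu]_(x in U) (h1 x * partial be phi x) - \int[mu]_(x in U) (h2 x * partial be phi x).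
  move=> lh1 lh2; rewrite -(RintegralB mU (I h1 be lh1) (I h2 be lh2)).
  by apply: eq_Rintegral => x _; rewrite mulrBl.
have := E g1 g2 [ffun=> 0%N] m1 m2; rewrite partial0 => ->.
by rewrite E// w1// w2// mulrBr.
Qed.

Lemma weak_ae (U : set V) u u' al (g : V -> R) : measurable U -> measurable_fun U u' ->
  {ae mu, forall x, U x -> u x = u' x} -> is_weak_partial U u al g -> is_weak_partial U u' al g.
Proof.
move=> mU mu' uu' [[mu_ iu] lg w]; split => //.
  split => // K cK KU; have mK := compact_measurable_rV cK.
  have /integrableP[m1 i1] := iu K cK KU; apply/integrableP; split.
    by apply/measurable_EFinP; exact: measurable_funS mu'.
  apply: le_lt_trans i1; rewrite le_eqVlt; apply/orP; left; apply/eqP; apply: ae_eq_integral => //.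
  - by apply: measurableT_comp => //; apply/measurable_EFinP; exact: measurable_funS mu'.
  - exact: measurableT_comp.
  - by apply: filterS uu' => x h Kx /=; rewrite h//; exact: KU.
move=> phi tphi; rewrite -w//; have [b [c bp]] := test_bsmooth tphi.
have mp : measurable_fun U (partial al phi).
  by apply: measurable_funTS; exact: (bsmooth_measurable (bsmooth_partial al bp)).
rewrite /Rintegral; congr fine; apply: ae_eq_integral => //.
- by apply/measurable_EFinP; exact: measurable_funM.
- by apply/measurable_EFinP; exact: measurable_funM.
- by apply: filterS uu' => x h Kx /=; rewrite h.
Qed.

End WeakCalculus.

(** * Finite [l^p] sums and Sobolev norms *)

Section LpSum.
Context {R : realType} (D : nat).
Notation mu := (lebesgue_rV D).
Notation V := ('rV[R]_D).
Open Scope ereal_scope.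

Lemma esum_seq (I : choiceType) (s : seq I) (S : set I) (b : I -> \bar R) : uniq s ->
  (forall i, (i \in s) <-> S i) -> (forall i, 0 <= b i) -> \esum_(i in S) b i = \sum_(i <- s) b i.
Proof.
move=> us sS b0; have -> : S = [set` s] by apply/seteqP; split => i /=; [move/sS|move/sS].
rewrite esum_fset; [by rewrite -fsbig_seq|exact: finite_seq|by move=> i _; exact: b0].
Qed.

(** The crude factor serves every exponent, since [N^(1/r) <= N] for [N >= 1] and [r >= 1]; the
    successor keeps it at least 1 for an empty list. *)
Lemma lp_sum_le (I : choiceType) (s : seq I) (S : set I) p (b : I -> \bar R) X : 1 <= p -> uniq s ->
  (forall i, (i \in s) <-> S i) -> 0 <= X -> (forall i, S i -> 0 <= b i <= X) ->
  lp_sum S p b <= (size s).+1%:R%:E * X.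
Proof.
move=> p1 us sS X0 bX; have XX : X <= (size s).+1%:R%:E * X.
  by rewrite -{1}[X]mul1e lee_wpmul2r// lee_fin ler1n.
have [->|[r -> r1]] := ge1_cases p1; rewrite /lp_sum.
  apply: le_trans XX; apply: ge_ereal_sup => _ [->//|[i Si <-]]; by have /andP[] := bX i Si.
have r0 : (0 < r)%R by exact: lt_le_trans r1.
rewrite (esum_seq us sS); last by move=> i; exact: poweR_ge0.
apply: (@le_trans _ _ (((size s).+1%:R%:E * X `^ r) `^ r^-1)).
  apply: le_poweR; [by rewrite invr_ge0 ltW|by apply: sume_ge0 => i _; exact: poweR_ge0|].
  apply: (@le_trans _ _ (\sum_(i <- s) X `^ r)).
    rewrite big_seq [leRHS]big_seq; apply: lee_sum => i /sS Si; have /andP[b0 bb] := bX i Si.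
    by apply: le_poweR => //; exact: ltW.
  rewrite big_const_seq count_predT; elim: (size s) => [|m IH]; first by rewrite mul1e poweR_ge0.
  rewrite iterS -[m.+2%:R]natr1 EFinD ge0_muleDl ?lee_fin// mul1e addrC.
  exact: leeD.
rewrite poweRM ?poweR_ge0// -poweRrM divff ?gt_eqF// poweRe1// lee_wpmul2r//.
rewrite poweR_EFin lee_fin -[leRHS]powRr1//; apply: ler_powR; first by rewrite ler1n.
by rewrite invf_le1.
Qed.

Lemma le_lp_sum (I : choiceType) (S : set I) p (b : I -> \bar R) i : 1 <= p -> S i -> 0 <= b i ->
  b i <= lp_sum S p b.
Proof.
move=> p1 Si b0; have [->|[r -> r1]] := ge1_cases p1; rewrite /lp_sum.
  by apply: ereal_sup_ubound; right; exists i.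
have r0 : (0 < r)%R by exact: lt_le_trans r1.
apply: (@le_trans _ _ ((b i `^ r) `^ r^-1)); first by rewrite -poweRrM divff ?gt_eqF// poweRe1.
apply: le_poweR; [by rewrite invr_ge0 ltW|exact: poweR_ge0|].
apply: esum_ge; exists [set i]; last by rewrite fsbig_set1.
by split; [exact: finite_set1|move=> _ ->].
Qed.

Lemma lp_sum_ge0 (I : choiceType) (S : set I) p (b : I -> \bar R) : 1 <= p -> 0 <= lp_sum S p b.
Proof.
move=> /ge1_cases[->|[r -> _]]; rewrite /lp_sum; last exact: poweR_ge0.
by apply: ereal_sup_ubound; left.
Qed.

Lemma Lnorm_restrict_le p (U : set V) (F : V -> \bar R) : 1 <= p -> measurable U ->
  measurable_fun setT F -> (forall x, 0 <= F x) -> Lnorm mu p (fun x => F x * (\1_U x)%:E) <= 'N[mu]_p[F].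
Proof.
move=> p1 mU mF F0; apply: Lnorm_le_ae => //.
  by apply: emeasurable_funM => //; apply/measurable_EFinP; apply: measurable_indic.
apply: aeW => x; rewrite !gee0_abs//; last by rewrite mule_ge0// lee_fin indicE.
by rewrite -[leRHS]mule1 lee_wpmul2l// lee_fin indicE lern1 leq_b1.
Qed.

(** The sets are disjoint, so the [r]-th powers of the local norms add up to at most that of the
    global norm; for the exponent infinity each local norm is at most the global one. *)
Lemma lp_sum_cells (I : choiceType) (s : seq I) (S : set I) p (b : I -> \bar R) (C : I -> set V) (F : V -> \bar R) :
  1 <= p -> uniq s -> (forall i, (i \in s) <-> S i) ->
  (forall i, measurable (C i)) -> (forall i j x, C i x -> C j x -> i = j) ->
  measurable_fun setT F -> (forall x, 0 <= F x) ->
  (forall i, S i -> 0 <= b i <= Lnorm mu p (fun x => F x * (\1_(C i) x)%:E)) ->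
  lp_sum S p b <= 'N[mu]_p[F].
Proof.
move=> p1 us sS mC tC mF F0 bF.
have mG i : measurable_fun setT (fun x => F x * (\1_(C i) x)%:E).
  by apply: emeasurable_funM => //; apply/measurable_EFinP; apply: measurable_indic.
have [pE|[r pE r1]] := ge1_cases p1; rewrite pE in p1 bF *; rewrite /lp_sum.
  apply: ge_ereal_sup => _ [->|[i Si <-]]; first exact: Lnorm_ge0.
  by have /andP[_ h] := bF i Si; apply: le_trans h _; exact: Lnorm_restrict_le.
have r0 : (0 < r)%R by exact: lt_le_trans r1.
rewrite (esum_seq us sS); last by move=> i; exact: poweR_ge0.
have NE (G : V -> \bar R) : 'N[mu]_r%:E[G] = (\int[mu]_x `|G x| `^ r) `^ r^-1 by rewrite unlock.
rewrite NE; apply: le_poweR; [by rewrite invr_ge0 ltW|by apply: sume_ge0 => i _; exact: poweR_ge0|].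
have mP (G : V -> \bar R) : measurable_fun setT G -> measurable_fun setT (fun x => `|G x| `^ r).
  by move=> h; apply: (measurableT_comp (measurable_poweR r)); exact: measurableT_comp.
apply: (@le_trans _ _ (\sum_(i <- s) \int[mu]_x (`|F x * (\1_(C i) x)%:E| `^ r))).
  rewrite big_seq [leRHS]big_seq; apply: lee_sum => i /sS Si; have /andP[b0 h] := bF i Si.
  have := le_poweR (ltW r0) b0 h; rewrite NE -poweRrM mulVf ?gt_eqF// poweRe1//.
  by apply: integral_ge0 => x _; exact: poweR_ge0.
rewrite -ge0_integral_sum//; [|by move=> i; exact: mP|by move=> i x _; exact: poweR_ge0].
apply: ge0_le_integral => //.
- by move=> x _; apply: sume_ge0 => i _; exact: poweR_ge0.
- by apply: emeasurable_sum => i; exact: mP.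
- exact: mP.
move=> x _; have [[i [is_ Cx]]|nC] := pselect (exists i, i \in s /\ C i x).
  rewrite (bigD1_seq i)//= big1_seq => [|j /andP[ji _]].
    by rewrite adde0 indicE mem_set// mule1.
  rewrite indicE memNset; first by rewrite mule0 abse0 poweR0r// gt_eqF.
  by move=> Cj; move: ji; rewrite (tC _ _ _ Cx Cj) eqxx.
rewrite big1_seq ?poweR_ge0// => j /andP[_ js].
by rewrite indicE memNset ?mule0 ?abse0 ?poweR0r ?gt_eqF// => Cj; apply: nC; exists j.
Qed.

Lemma sobolev_le (U : set V) l p f X : 1 <= p -> 0 <= X ->
  (forall al, (mi_order al <= l)%N -> exists2 h, is_weak_partial U f al h & Lp_norm U p h <= X) ->
  sobolev_norm U l p f <= (size (@mis D l.+1)).+1%:R%:E * X.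
Proof.
move=> p1 X0 hX.
have /choice[g gP] : forall al, exists h, (mi_order al <= l)%N -> is_weak_partial U f al h /\ Lp_norm U p h <= X.
  move=> al; have [al_l|_] := boolP (mi_order al <= l)%N; last by exists (fun=> 0%R).
  by have [h h1 h2] := hX al al_l; exists h.
apply: (@le_trans _ _ (lp_sum [set al : multi_index D | (mi_order al <= l)%N] p (fun al => Lp_norm U p (g al)))).
  by apply: ereal_inf_lbound; exists g => // al al_l; exact: (gP al al_l).1.
apply: lp_sum_le => //; [exact: mis_uniq|by move=> al; rewrite mem_mis ltnS|].
by move=> al al_l; rewrite (gP al al_l).2 Lnorm_ge0.
Qed.

Lemma Lp_norm_le (U : set V) p (h : V -> R) (F : V -> \bar R) : 1 <= p -> measurable U -> measurable_fun U h ->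
  measurable_fun setT F -> (forall x, 0 <= F x) -> {ae mu, forall x, U x -> `|h x|%:E <= F x} ->
  Lp_norm U p h <= Lnorm mu p (fun x => F x * (\1_U x)%:E).
Proof.
move=> p1 mU mh mF F0 hF; apply: Lnorm_le_ae => //.
- by apply/measurable_EFinP; apply/(measurable_restrictT _ mU).
- by apply: emeasurable_funM => //; apply/measurable_EFinP; apply: measurable_indic.
apply: filterS hF => x hx; rewrite /patch indicE/=; case: ifPn => [/set_mem Ux|_].
  by rewrite mule1 (gee0_abs (F0 x)); exact: hx.
by rewrite normr0 mule0 abse0.
Qed.

End LpSum.

Lemma ae_forall_seq d (T : measurableType d) {R : realType} (m : {measure set T -> \bar R})
  (I : eqType) (s : seq I) (P : I -> T -> Prop) :
  (forall i, i \in s -> {ae m, forall x, P i x}) -> {ae m, forall x, forall i, i \in s -> P i x}.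
Proof.
elim: s => [|j s IH] h; first exact: aeW.
have h1 := h j (mem_head _ _); have h2 : {ae m, forall x, forall i, i \in s -> P i x} by apply: IH => i is_; apply: h; rewrite in_cons is_ orbT.
by apply: filterS2 h1 h2 => x h1 h2 i; rewrite in_cons => /orP[/eqP->//|]; exact: h2.
Qed.

Lemma sobolev_ae_le {R : realType} D (U : set 'rV[R]_D) l p f (F : 'rV[R]_D -> \bar R) : (1 <= p)%E ->
  measurable U -> measurable_fun setT F -> (forall x, (0 <= F x)%E) ->
  (forall al, (mi_order al <= l)%N -> exists2 h, is_weak_partial U f al h &
     {ae lebesgue_rV D, forall x, U x -> (`|h x|%:E <= F x)%E}) ->
  (sobolev_norm U l p f <= (size (@mis D l.+1)).+1%:R%:E * Lnorm (lebesgue_rV D) p (fun x => F x * (\1_U x)%:E))%E.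
Proof.
move=> p1 mU mF F0 H; apply: sobolev_le => //; first exact: Lnorm_ge0.
move=> al al_l; have [h wh hF] := H al al_l; exists h => //.
by apply: Lp_norm_le => //; have [_ []] := wh.
Qed.

Lemma sobolev_norm_ge0 {R : realType} D (U : set 'rV[R]_D) l p f : (1 <= p)%E -> (0 <= sobolev_norm U l p f)%E.
Proof. by move=> p1; apply: le_ereal_inf_tmp => _ [g _ <-]; exact: lp_sum_ge0. Qed.

(** * Coercivity and error estimates *)

Section ApproximateExtension.
Context {R : realType} (D : nat) (sigma : R) (a : 'rV[R]_D.+1) (Om : set 'rV[R]_D.+1) (n : nat).
Notation mu := (lebesgue_rV D.+1).
Notation V := ('rV[R]_D.+1).
Notation Z := ('rV[int]_D.+1).
Notation Lx := (Lx D n).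
Notation loc c i := (fun m : Lx => c (i - off m)).
Notation cell := (cell sigma a).
Notation cpoly := (cpoly sigma a).
Notation gsum := (gsum sigma a).
Notation gd := (grid_domain sigma a Om).
Notation bpP := (@bpP R D n).
Notation jP := (@jP R D n).
Hypotheses (s0 : 0 < sigma) (n0 : (0 < n)%N) (oOm : open Om).

Lemma IP_cst (c : R) : IP c%:P = c.
Proof.
rewrite /IP -(@prim_unique R c%:P (c *: 'X)) ?hornerZ ?hornerX ?mulr1//.
  by rewrite derivZ derivX alg_polyC.
by rewrite mulr0.
Qed.

Definition fpt (d : 'I_D.+1) (i : Z) (y : 'rV[R]_D) : V := insert_coord d (grid_coord sigma a d (i ord0 d)) y.

Lemma fptE d i y : face_set sigma a (d, i) (fpt d i y) <-> forall e, citv sigma a i (lift d e) (y ord0 e).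
Proof.
split=> [[_ h] e|h].
  by have := h (lift d e); rewrite /= eq_sym neq_lift insert_coord_lift /citv/= in_itv; apply.
split=> [|e]; first by rewrite /= insert_coord_ord0.
case: (unliftP d e) => [e' ->|->]; last by rewrite eqxx.
by move=> _; have := h e'; rewrite /fpt insert_coord_lift /citv/= in_itv.
Qed.

(** A tensor polynomial that is constant in the normal direction has the same integral over the face
    as over the cell, up to one factor [sigma]. Face terms thus become cell terms. *)
Lemma face_cell d i P (c : R) : P d = c%:P ->
  (lebesgue_rV D).-integrable setT (EFin \o (fun y => cpoly P i (fpt d i y)) \_ (fpt d i @^-1` face_set sigma a (d, i))) /\
  \int[lebesgue_rV D]_(y in fpt d i @^-1` face_set sigma a (d, i)) cpoly P i (fpt d i y) =
  sigma^-1 * \int[mu]_(x in cell i) cpoly P i x.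
Proof.
move=> Pd; pose g : 'rV[R]_D -> R := tens (fun e t => (P (lift d e)).[(lc sigma a) i (lift d e) t] * \1_(citv sigma a i (lift d e)) t).
have [ig Eg] := integrable_tens (fun e => (integral1 a s0 (P (lift d e)) i (lift d e)).1).
have E : (fun y => cpoly P i (fpt d i y)) \_ (fpt d i @^-1` face_set sigma a (d, i)) = fun y => c * g y.
  apply/funext => y; rewrite /g /tens big_split/= -/(tens (fun e => \1_(citv sigma a i (lift d e))) y) -indic_tens.
  rewrite /patch indicE; have -> : (y \in fpt d i @^-1` face_set sigma a (d, i)) = (y \in [set y : 'rV[R]_D | forall e, citv sigma a i (lift d e) (y ord0 e)]).
    by apply/idP/idP; rewrite !inE => /fptE.
  case: ifP => _; rewrite ?mulr0// mulr1 /Submission.cpoly /tens (bigD1_ord d)//= Pd hornerC; congr (_ * _).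
  by apply: eq_bigr => e _; rewrite /fpt insert_coord_lift.
split; first by rewrite E; exact: (integrableZl measurableT c ig).
have CI := (cell_integral a s0 P i).2; rewrite CI Rintegral_mkcond E RintegralZl// /Rintegral Eg/=.
rewrite (eq_bigr (fun e => sigma * IP (P (lift d e)))) => [|e _]; last exact: (integral1 _ _ _ _ _).2.
rewrite (bigD1_ord d)//= Pd IP_cst big_split/= prodr_const card_ord exprS.
by field; rewrite gt_eqF.
Qed.

Lemma gsumM P (b b' : Lx -> R) i x : gsum P b i x * gsum P b' i x =
  \sum_(p : Lx * Lx) (b p.1 * b' p.2) * cpoly (fun d => P d (p.1 d) * P d (p.2 d)) i x.
Proof.
rewrite /Submission.gsum mulr_suml -(pair_bigA _ (fun m m' => b m * b' m' * cpoly (fun d => P d (m d) * P d (m' d)) i x))/=.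
apply: eq_bigr => m _; rewrite mulr_sumr; apply: eq_bigr => m' _.
by rewrite mulrACA cpolyM.
Qed.

Lemma measurable_face d i : measurable (fpt d i @^-1` face_set sigma a (d, i)).
Proof.
have -> : fpt d i @^-1` face_set sigma a (d, i) = [set y : 'rV[R]_D | forall e, citv sigma a i (lift d e) (y ord0 e)].
  by apply/seteqP; split => y /fptE.
by apply: (@measurable_prodset R D (fun e => citv sigma a i (lift d e))) => e; exact: measurable_itv.
Qed.

Lemma face_form d i (b b' : Lx -> R) :
  (lebesgue_rV D).-integrable (fpt d i @^-1` face_set sigma a (d, i))
    (EFin \o (fun y => gsum (jP d) b i (fpt d i y) * gsum (jP d) b' i (fpt d i y))) /\
  \int[lebesgue_rV D]_(y in fpt d i @^-1` face_set sigma a (d, i)) (gsum (jP d) b i (fpt d i y) * gsum (jP d) b' i (fpt d i y)) =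
  sigma^-1 * \sum_(p : Lx * Lx) (b p.1 * b' p.2) * \int[mu]_(x in cell i) cpoly (fun e => jP d e (p.1 e) * jP d e (p.2 e)) i x.
Proof.
have jPd k : (nbl n k)%:P = jP d d k by rewrite /Submission.jP eqxx.
have h (p : Lx * Lx) := @face_cell d i (fun e => jP d e (p.1 e) * jP d e (p.2 e)) (nbl n (p.1 d) * nbl n (p.2 d)).
have {}h (p : Lx * Lx) := h p (esym (etrans (polyCM _ _) (f_equal2 (@GRing.mul {poly R}) (jPd _) (jPd _)))).
pose W := fpt d i @^-1` face_set sigma a (d, i).
have [iE E] := integrable_Rsum (index_enum _) (fun p : Lx * Lx => b p.1 * b' p.2) (fun p => (h p).1).
have E2 : (fun y => gsum (jP d) b i (fpt d i y) * gsum (jP d) b' i (fpt d i y)) \_ W = (fun y => \sum_(p : Lx * Lx) b p.1 * b' p.2 *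
  ((fun y => cpoly (fun e => jP d e (p.1 e) * jP d e (p.2 e)) i (fpt d i y)) \_ W) y).
  apply/funext => y; rewrite /patch -/W; case: ifP => _; first exact: gsumM.
  by rewrite big1// => p _; rewrite mulr0.
split; first by apply/(integrable_patch _ _ (measurable_face d i)); rewrite E2.
rewrite Rintegral_mkcond E2 E mulr_sumr; apply: eq_bigr => p _.
by rewrite -Rintegral_mkcond (h p).2 mulrCA.
Qed.

Lemma measurable_cellOm i : measurable (cell i `&` Om).
Proof. by apply: measurableI; [exact: measurable_cell|exact: open_measurable_rV]. Qed.

Lemma cellOm_integrable P i : mu.-integrable (cell i `&` Om) (EFin \o cpoly P i).
Proof.
apply: integrableS (cell_integral a s0 P i).1; [exact: measurable_cell|exact: measurable_cellOm|exact: subIsetl].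
Qed.

Lemma closure_cell_cover (x : V) : exists i, closure (cell i) x.
Proof.
exists (\row_d Num.floor ((x ord0 d - a ord0 d) / sigma)); apply: (cell_closure s0) => d.
rewrite /Submission.lc mxE; have /andP[] := floor_itv ((x ord0 d - a ord0 d) / sigma).
rewrite mulrBl intrD [x ord0 d / _]mulrC [a ord0 d / _]mulrC => h1 h2; and_lra.
Qed.

Lemma Om_domain : Om `<=` gd.
Proof.
apply: open_sub_interior => // x ox; have [i ci] := closure_cell_cover x.
exists i => //; apply/elementsP => //; have [y [cy oy]] := ci Om (open_nbhs_nbhs (conj oOm ox)).
by exists y.
Qed.

Variable els : seq Z.
Hypotheses (els_uniq : uniq els) (elsP : forall i, (i \in els) <-> (elements sigma a Om) i).

(** The elements are disjoint and cover the domain up to a null set. *)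
Lemma Om_split (h : V -> R) : measurable_fun Om h ->
  (forall i, i \in els -> mu.-integrable (cell i `&` Om) (EFin \o h)) ->
  mu.-integrable Om (EFin \o h) /\ \int[mu]_(x in Om) h x = \sum_(i <- els) \int[mu]_(x in cell i `&` Om) h x.
Proof.
move=> mh ih; have mO : measurable Om by exact: open_measurable_rV.
have ih2 i : mu.-integrable setT (EFin \o h \_ (if i \in els then cell i `&` Om else set0)).
  case: ifPn => ie; last by rewrite patch_set0; exact: integrable0.
  by apply/(integrable_patch _ _ (measurable_cellOm i))/ih.
have [i1 i2] := integrable_Rsum els (fun=> 1) ih2.
have aeE : {ae mu, forall x, (h \_ Om) x = \sum_(i <- els) 1 * (h \_ (if i \in els then cell i `&` Om else set0)) x}.
  apply: filterS (ae_Om_cell a s0 oOm) => x hx; rewrite {1}/patch; case: ifPn => [|/negP]; rewrite inE => ox.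
    have [i ei cx] := hx ox; have ie : i \in els by apply/elsP.
    rewrite (bigD1_seq i)//= ie mul1r [X in _ + X]big1 ?addr0.
      by rewrite /patch mem_set.
    move=> j ji; case: ifP => _; rewrite mul1r ?patch_set0// /patch memNset// => -[cj _].
    by rewrite (cell_inj s0 cj cx) eqxx in ji.
  by rewrite big1// => i _; rewrite mul1r /patch; case: ifP => // /set_mem; case: ifP => // _ [_ /ox].
have mhO : measurable_fun setT (h \_ Om) by apply/(measurable_restrictT _ mO).
have ms : measurable_fun setT (fun x => \sum_(i <- els) 1 * (h \_ (if i \in els then cell i `&` Om else set0)) x).
  by move/integrableP: i1 => [/measurable_EFinP].
split.
  apply/(integrable_patch _ _ mO)/integrableP; split; first exact/measurable_EFinP.
  move/integrableP: i1 => [_]; apply: le_lt_trans; rewrite le_eqVlt; apply/orP; left; apply/eqP.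
  apply: ae_eq_integral => //; [by apply/measurableT_comp => //; exact/measurable_EFinP|by apply/measurableT_comp => //; exact/measurable_EFinP|].
  by apply: filterS aeE => x E _ /=; rewrite E.
rewrite Rintegral_mkcond; transitivity (\int[mu]_x \sum_(i <- els) 1 * (h \_ (if i \in els then cell i `&` Om else set0)) x).
  rewrite /Rintegral; congr fine; apply: ae_eq_integral => //; [exact/measurable_EFinP|exact/measurable_EFinP|].
  by apply: filterS aeE => x E _ /=; rewrite E.
rewrite i2 big_seq [RHS]big_seq; apply: eq_bigr => i ie; by rewrite mul1r ie -Rintegral_mkcond.
Qed.

Lemma cellOm_form P (b b' : Lx -> R) i :
  mu.-integrable (cell i `&` Om) (EFin \o (fun x => gsum P b i x * gsum P b' i x)) /\
  \int[mu]_(x in cell i `&` Om) (gsum P b i x * gsum P b' i x) =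
  \sum_(p : Lx * Lx) (b p.1 * b' p.2) * \int[mu]_(x in cell i `&` Om) cpoly (fun e => P e (p.1 e) * P e (p.2 e)) i x.
Proof.
have [i1 i2] := Rint_sum (fun p : Lx * Lx => b p.1 * b' p.2) (measurable_cellOm i)
  (fun p => cellOm_integrable (fun e => P e (p.1 e) * P e (p.2 e)) i).
have E : (fun x => gsum P b i x * gsum P b' i x) = (fun x => \sum_(p : Lx * Lx) (b p.1 * b' p.2) * cpoly (fun d => P d (p.1 d) * P d (p.2 d)) i x).
  by apply/funext => x; exact: gsumM.
by rewrite E.
Qed.

(** * Element matrices and the form on coefficients *)

Definition gh d i : bool := `[< ghost_faces sigma a Om (d, i) >].

(** The face [(d, i)] is charged to cell [i], the upper one of its two cells. After division by the
    cell volume no power of [sigma] is left. *)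
Definition acoef (eps : R) (i : Z) (m m' : Lx) : R :=
  (sigma ^+ D.+1)^-1 * (\int[mu]_(x in cell i `&` Om) cpoly (fun e => bpP e (m e) * bpP e (m' e)) i x +
    eps * \sum_d (gh d i)%:R * \int[mu]_(x in cell i) cpoly (fun e => jP d e (m e) * jP d e (m' e)) i x).

Definition local_form eps i (b b' : Lx -> R) : R :=
  \int[mu]_(x in cell i `&` Om) (gsum bpP b i x * gsum bpP b' i x) +
    eps * \sum_d (gh d i)%:R * \int[mu]_(x in cell i) (gsum (jP d) b i x * gsum (jP d) b' i x).

Lemma cell_form2 P (b b' : Lx -> R) i :
  \int[mu]_(x in cell i) (gsum P b i x * gsum P b' i x) =
  \sum_(p : Lx * Lx) (b p.1 * b' p.2) * \int[mu]_(x in cell i) cpoly (fun e => P e (p.1 e) * P e (p.2 e)) i x.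
Proof.
have [_ <-] := Rint_sum (fun p : Lx * Lx => b p.1 * b' p.2) (measurable_cell sigma a i)
  (fun p => (cell_integral a s0 (fun e => P e (p.1 e) * P e (p.2 e)) i).1).
by apply: eq_Rintegral => x _; exact: gsumM.
Qed.

Let acomb (I : finType) (s x e y : R) (g Y : I -> R) : s != 0 ->
  s * ((s^-1 * (x + e * \sum_i g i * Y i)) * y) = y * x + e * \sum_i g i * (y * Y i).
Proof.
move=> sn; have -> : \sum_i g i * (y * Y i) = y * \sum_i g i * Y i.
  by rewrite mulr_sumr; apply: eq_bigr => i _; rewrite mulrCA.
by field.
Qed.

(** The weight [sigma ^+ (2 * n - 1)] of the jump form cancels exactly: two derivatives of order
    [n - 1] and one factor from passing from the face to the cell. *)
Let powcomb (S : R) : sigma ^+ (2 * n - 1) * (sigma^-1 ^+ (n - 1) ^+ 2 * (sigma^-1 * S)) = S.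
Proof.
have sN : sigma != 0 by rewrite gt_eqF.
have E : (2 * n - 1 = ((n - 1) * 2).+1)%N by lia.
rewrite E -exprM exprVn exprS; have : sigma ^+ ((n - 1) * 2) != 0 by rewrite expf_neq0.
by move: (sigma ^+ _) => y yn; field; rewrite yn sN.
Qed.

Lemma Aloc_local eps (c c' : Z -> R) : sigma ^+ D.+1 * Aloc (@off D n) els (acoef eps) c c' =
  \sum_(i <- els) local_form eps i (loc c i) (loc c' i).
Proof.
rewrite /Aloc mulr_sumr; apply: eq_bigr => i _; rewrite pair_bigA/= /local_form (cellOm_form _ _ _ _).2.
have sN : sigma ^+ D.+1 != 0 by rewrite expf_neq0// gt_eqF.
rewrite mulr_sumr -[X in _ + X]mulr_sumr.
have -> : \sum_d (gh d i)%:R * \int[mu]_(x in cell i) (gsum (jP d) (loc c i) i x * gsum (jP d) (loc c' i) i x) =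
   \sum_(p : Lx * Lx) \sum_d (gh d i)%:R * ((c (i - off p.1) * c' (i - off p.2)) * \int[mu]_(x in cell i) cpoly (fun e => jP d e (p.1 e) * jP d e (p.2 e)) i x).
  by rewrite exchange_big/=; apply: eq_bigr => d _; rewrite cell_form2 mulr_sumr.
rewrite !mulr_sumr -big_split/=; apply: eq_bigr => p _; exact: acomb.
Qed.

(** Only the values on the grid domain are tied to [c]; coefficients of B-splines that vanish there
    remain arbitrary. *)
Definition rep (v : V -> R) (c : Z -> R) := exists w,
  [/\ spline sigma a n w, forall x, gd x -> v x = w x & hasc sigma a n w c].

Lemma rep_spline_on v c : rep v c -> spline_on sigma a Om n v.
Proof. by move=> [w [sw vw _]]; exists w. Qed.

Lemma spline_on_rep v : spline_on sigma a Om n v -> exists c, rep v c.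
Proof.
move=> [w sw vw]; exists (fun j => lam sigma a j (zeroL D n) w), w; split => //.
by case: sw => _ _ Cw pw; exact: (spline_coefs s0 n0 Cw pw).
Qed.

Lemma rep_cell v c i x : rep v c -> (elements sigma a Om) i -> cell i x -> v x = gsum bpP (loc c i) i x.
Proof. by move=> [w [_ vw hw]] ei cx; rewrite vw; [exact: hw|exact: cell_domain ei _ cx]. Qed.

Lemma rep_jump v c d i x : rep v c -> ghost_faces sigma a Om (d, i) -> face_set sigma a (d, i) x ->
  normal_jump d (n - 1) v x = sigma^-1 ^+ (n - 1) * gsum (jP d) (loc c i) i x.
Proof.
move=> [w [[_ _ Cw _] vw hw]] gdi fx; have [e1 e2] := ghost_elements s0 gdi.
rewrite (normal_jump_near _ _ _ (face_domain s0 e1 e2 fx) vw); last exact: open_interior.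
exact: jump_coefs.
Qed.

Lemma measurable_rep v c : rep v c -> measurable_fun Om v.
Proof.
move=> [w [[mw _ _ _] vw _]]; apply: (eq_measurable_fun w) => [x /set_mem ox|]; first by rewrite vw//; exact: Om_domain.
exact: measurable_funS mw.
Qed.

(** The mass form is split into elements, on which both functions are local sums. For a ghost face
    both adjacent cells are elements, so [rep_jump] expresses the jumps and [face_form] moves the
    integral to the cell above the face. *)
Lemma A_epsE eps u v c c' : rep u c -> rep v c' ->
  A_eps sigma a Om n eps u v = sigma ^+ D.+1 * Aloc (@off D n) els (acoef eps) c c'.
Proof.
move=> ru rv; rewrite Aloc_local /A_eps /local_form big_split/=; congr (_ + _).
  have mm : measurable_fun Om (fun x => u x * v x).
    by apply: measurable_funM; [exact: measurable_rep ru|exact: measurable_rep rv].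
  have ii i : i \in els -> mu.-integrable (cell i `&` Om) (EFin \o (fun x => u x * v x)).
    move=> /elsP ei; have [h _] := cellOm_form bpP (loc c i) (loc c' i) i.
    apply: eq_integrable h => [|x /set_mem[cx _]]; first exact: measurable_cellOm.
    by rewrite /= (rep_cell ru ei cx) (rep_cell rv ei cx).
  have [_ E] := Om_split mm ii.
  rewrite /mass_form E big_seq [RHS]big_seq; apply: eq_bigr => i /elsP ei.
  by apply: eq_Rintegral => x /set_mem[cx _]; rewrite (rep_cell ru ei cx) (rep_cell rv ei cx).
rewrite -mulr_sumr; congr (_ * _); rewrite /jump_form.
pose fs := [seq F <- [seq (d, i) | d <- enum 'I_D.+1, i <- els] | gh F.1 F.2].
have ufs : uniq fs.
  rewrite filter_uniq// allpairs_uniq// ?enum_uniq// => -[i d] [i' d'] _ _ /= [-> ->] //.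
have -> : ghost_faces sigma a Om = [set` fs].
  apply/seteqP; split => -[d i] /=; rewrite mem_filter /gh/=.
    move=> g; apply/andP; split; first exact/asboolP.
    apply/allpairsP; exists (d, i); split => //=; first by rewrite mem_enum.
    by apply/elsP; have [] := ghost_elements s0 g.
  by move=> /andP[/asboolP].
rewrite -fsbig_seq// big_filter big_mkcond/= big_allpairs/= exchange_big/= mulr_sumr; apply: eq_bigr => i _.
rewrite big_enum/= mulr_sumr; apply: eq_bigr => d _; rewrite -/(gh d i).
rewrite /gh; case: asboolP => g; last by rewrite mulr0 mul0r.
rewrite mul1r cell_form2 /face_integral/=.
transitivity (sigma ^+ (2 * n - 1) * \int[lebesgue_rV D]_(y in fpt d i @^-1` face_set sigma a (d, i))
  (sigma^-1 ^+ (n - 1) ^+ 2 * (gsum (jP d) (loc c i) i (fpt d i y) * gsum (jP d) (loc c' i) i (fpt d i y)))).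
  congr (_ * _); apply: eq_Rintegral => y /set_mem fy.
  by rewrite (rep_jump ru g fy) (rep_jump rv g fy) /fpt; ring.
rewrite RintegralZl; [|exact: measurable_face|exact: (face_form _ _ _ _).1].
rewrite (face_form _ _ _ _).2; exact: powcomb.
Qed.

(** Expansion of the integral of a square, the local sum minus [s] times the test polynomial. *)
Lemma energy_test (P : 'I_D.+1 -> nat -> {poly R}) (b : Lx -> R) (Q : 'I_D.+1 -> {poly R}) i (s : R) :
  2 * s * \sum_m b m * \prod_d IP (P d (m d) * Q d) - s ^+ 2 * \prod_d IP (Q d ^+ 2) <=
  (sigma ^+ D.+1)^-1 * \int[mu]_(x in cell i) (gsum P b i x * gsum P b i x).
Proof.
have mc := measurable_cell sigma a i; have sN : 0 < sigma ^+ D.+1 by rewrite exprn_gt0.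
have i1 := cellOm_integrable.
have IU : mu.-integrable (cell i) (EFin \o (fun x => gsum P b i x * gsum P b i x)).
  have [h _] := Rint_sum (fun p : Lx * Lx => b p.1 * b p.2) mc (fun p => (cell_integral a s0 (fun e => P e (p.1 e) * P e (p.2 e)) i).1).
  by apply: eq_integrable h => // x _; rewrite /= gsumM.
have IT : mu.-integrable (cell i) (EFin \o (fun x => gsum P b i x * cpoly Q i x)).
  have [h _] := Rint_sum b mc (fun m : Lx => (cell_integral a s0 (fun d => P d (m d) * Q d) i).1).
  apply: eq_integrable h => // x _; rewrite /= /Submission.gsum mulr_suml; congr (_%:E); apply: eq_bigr => m _.
  by rewrite -mulrA cpolyM.
have [IQ EQ] := cell_integral a s0 (fun d => Q d ^+ 2) i.
pose F (x : ('rV[R]_D.+1)) := gsum P b i x * gsum P b i x + (- (2 * s) * (gsum P b i x * cpoly Q i x) + s ^+ 2 * cpoly (fun d => Q d ^+ 2) i x).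
have F0 : 0 <= \int[mu]_(x in cell i) F x.
  apply: Rintegral_ge0 => x _; have -> : F x = (gsum P b i x - s * cpoly Q i x) ^+ 2.
    by rewrite /F -[cpoly (fun d => Q d ^+ 2) i x]/(cpoly (fun d => Q d * Q d) i x) -cpolyM; ring.
  exact: sqr_ge0.
have IT2 : mu.-integrable (cell i) (EFin \o (fun x => - (2 * s) * (gsum P b i x * cpoly Q i x))) by exact: (integrableZl mc (- (2 * s)) IT).
have IQ2 : mu.-integrable (cell i) (EFin \o (fun x => s ^+ 2 * cpoly (fun d => Q d ^+ 2) i x)) by exact: (integrableZl mc (s ^+ 2) IQ).
have E : \int[mu]_(x in cell i) F x = \int[mu]_(x in cell i) (gsum P b i x * gsum P b i x) +
   (- (2 * s) * (sigma ^+ D.+1 * \sum_m b m * \prod_d IP (P d (m d) * Q d)) + s ^+ 2 * (sigma ^+ D.+1 * \prod_d IP (Q d ^+ 2))).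
  rewrite /F RintegralD//; last exact: (integrableD mc IT2 IQ2).
  by rewrite RintegralD// !RintegralZl// EQ cell_test.
rewrite E in F0; rewrite ler_pdivlMl//; lra.
Qed.

(** The Cauchy-Schwarz inequality, from [energy_test] with the parameter [T / W]. *)
Lemma energy_ge (P : 'I_D.+1 -> nat -> {poly R}) (b : Lx -> R) (Q : 'I_D.+1 -> {poly R}) i W : 1 <= W -> `|\prod_d IP (Q d ^+ 2)| <= W ->
  (\sum_m b m * \prod_d IP (P d (m d) * Q d)) ^+ 2 <=
  W * ((sigma ^+ D.+1)^-1 * \int[mu]_(x in cell i) (gsum P b i x * gsum P b i x)).
Proof.
move=> W1 qW; set T := \sum_m _; have W0 : 0 < W by exact: lt_le_trans W1.
have := energy_test P b Q i (T / W); rewrite -/T; set q := \prod_d _ in qW *; set E := (sigma ^+ _)^-1 * _.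
have q2 : q <= W by apply: le_trans qW; exact: ler_norm.
have h : (T / W) ^+ 2 * q <= (T / W) ^+ 2 * W by rewrite ler_wpM2l// sqr_ge0.
have h2 : (T / W) ^+ 2 * W = T ^+ 2 / W by field; rewrite gt_eqF.
have h3 : 2 * (T / W) * T = 2 * (T ^+ 2 / W) by ring.
move=> h4; have h5 : T ^+ 2 / W <= E by lra.
by rewrite mulrC -ler_pdivrMr.
Qed.

(** * Control of the coefficients by the energy *)

Section Energy.
Variables (eps : R) (x : Z -> R).
Hypothesis eps1 : 1 <= eps.

Definition Ec i : R := (sigma ^+ D.+1)^-1 * \int[mu]_(y in cell i `&` Om) (gsum bpP (loc x i) i y * gsum bpP (loc x i) i y).
Definition Ef d i : R := (gh d i)%:R * ((sigma ^+ D.+1)^-1 * \int[mu]_(y in cell i) (gsum (jP d) (loc x i) i y * gsum (jP d) (loc x i) i y)).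
Definition Et i : R := Ec i + eps * \sum_d Ef d i.

Lemma sN_ge0 : 0 <= (sigma ^+ D.+1)^-1.
Proof. by rewrite invr_ge0 exprn_ge0// ltW. Qed.

Lemma Ec_ge0 i : 0 <= Ec i.
Proof. by rewrite mulr_ge0 ?sN_ge0//; apply: Rintegral_ge0 => y _; rewrite -expr2 sqr_ge0. Qed.

Lemma Ef_ge0 d i : 0 <= Ef d i.
Proof. by rewrite mulr_ge0// mulr_ge0 ?sN_ge0//; apply: Rintegral_ge0 => y _; rewrite -expr2 sqr_ge0. Qed.

Lemma eps_ge0 : 0 <= eps. Proof. exact: le_trans eps1. Qed.

Lemma Et_ge0 i : 0 <= Et i.
Proof. by rewrite addr_ge0 ?Ec_ge0// mulr_ge0 ?eps_ge0// sumr_ge0// => d _; exact: Ef_ge0. Qed.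

Lemma Aloc_energy : Aloc (@off D n) els (acoef eps) x x = \sum_(i <- els) Et i.
Proof.
have sN : sigma ^+ D.+1 != 0 by rewrite expf_neq0// gt_eqF.
apply: (mulfI sN); rewrite Aloc_local// mulr_sumr; apply: eq_bigr => i _.
rewrite /local_form /Et /Ec mulrDr mulrA divff// mul1r; congr (_ + _).
rewrite mulrCA; congr (_ * _); rewrite mulr_sumr; apply: eq_bigr => d _.
by rewrite /Ef mulrCA; congr (_ * _); rewrite mulrA divff// mul1r.
Qed.

Lemma Ec_le i : Ec i <= Et i.
Proof. by rewrite lerDl mulr_ge0 ?eps_ge0// sumr_ge0// => d _; exact: Ef_ge0. Qed.

Lemma Ef_le d i : Ef d i <= Et i.
Proof.
apply: le_trans (_ : eps * \sum_d Ef d i <= _); last by rewrite lerDr Ec_ge0.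
apply: le_trans (_ : \sum_d Ef d i <= _); last by rewrite ler_peMl// sumr_ge0// => e _; exact: Ef_ge0.
by rewrite (bigD1 d)//= lerDl sumr_ge0// => e _; exact: Ef_ge0.
Qed.

(** The energies of all elements, weighted with rate 1/2. It is comparable between neighbouring
    cells and dominates the energy of each, so there is no need to record which cells a chain
    visits; summation over [i] gives back the total energy up to a constant. *)
Definition G i : R := \sum_(tau <- els) expw 2^-1 (tau - i) * Et tau.

Lemma half01 : 0 <= 2^-1 :> R. Proof. by rewrite invr_ge0. Qed.

Lemma G_ge0 i : 0 <= G i.
Proof. by rewrite sumr_ge0// => tau _; rewrite mulr_ge0 ?Et_ge0// expw_ge0// half01. Qed.

Lemma Et_G i : i \in els -> Et i <= G i.
Proof.
move=> ie; rewrite /G (bigD1_seq i)//= subrr expw0 mul1r lerDl sumr_ge0// => tau _.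
by rewrite mulr_ge0 ?Et_ge0// expw_ge0// half01.
Qed.

Lemma G_near (i i' : Z) : (forall d, `|i ord0 d - i' ord0 d| <= 1)%N -> G i <= 2 ^+ D.+1 * G i'.
Proof.
move=> h; rewrite mulr_sumr; apply: ler_sum => tau _; rewrite mulrA ler_wpM2r ?Et_ge0//.
have h1 : 0 < (2^-1 : R) <= 1 by rewrite invr_gt0 ltr0n/= invf_le1// ler1n.
have h2 (d : 'I_D.+1) : (`|((tau - i)%R ord0 d : int) - ((tau - i')%R ord0 d : int)| <= 1)%N.
  rewrite !mxE (_ : _ - _ = i' ord0 d - i ord0 d); [by rewrite distnC; exact: h|ring].
by have := expw_ratio h1 h2; rewrite mul1n exprVn mulrC ler_pdivrMr ?exprn_gt0// mulrC.
Qed.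

Definition bnd i (r : R) := forall m : Lx, inL m -> `|x (i - off m)| <= r.

Lemma sqrt_bound (T W E : R) : 0 <= W -> T ^+ 2 <= W * E -> `|T| <= Num.sqrt W * Num.sqrt E.
Proof. by move=> W0 h; rewrite -sqrtrM// -sqrtr_sqr ler_wsqrtr. Qed.

Lemma IP_dual_prod (m m' : Lx) (A : pred 'I_D.+1) : inL m ->
  \prod_(e | A e) IP (bp n (m' e) * dualn n (m e)) = ([forall e, A e ==> (m' e == m e)])%:R :> R.
Proof.
move=> mL; case: forallP => [h|/existsNP[e /negP]].
  rewrite big1// => e Ae; rewrite dualnE//; first by have := h e; rewrite Ae /= => /eqP ->; rewrite eqxx.
  by rewrite -ltnS.
rewrite negb_imply => /andP[Ae ne]; rewrite (bigD1 e)//= dualnE//; last by rewrite -ltnS.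
by rewrite (_ : (m' e == m e :> nat) = false) ?mul0r//; exact: negbTE.
Qed.

Lemma bnd_uncut i : cell i `<=` Om -> i \in els -> bnd i (Num.sqrt (dual_cst D n) * Num.sqrt (G i)).
Proof.
move=> ci ie m mL; have W1 := @dual_cst_ge1 R D n.
have := energy_ge bpP (loc x i) i W1 (@dual_cst_cell R D n m).
have -> : \sum_(m0 : Lx) x (i - off m0) * \prod_d IP (bpP d (m0 d) * celldual m d) = x (i - off m).
  rewrite (bigD1 m)//= [X in _ + X]big1 ?addr0 => [|m' m'm].
    rewrite (IP_dual_prod m predT mL) (_ : [forall e, _] = true) ?mulr1//.
    by apply/forallP => e; rewrite eqxx.
  rewrite (IP_dual_prod m' predT mL) (_ : [forall e, _] = false) ?mulr0//.
  apply: contraNF m'm => /forallP h; apply/eqP/ffunP => e; exact/eqP/h.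
move=> h; apply: le_trans (sqrt_bound (le_trans ler01 W1) h) _.
rewrite ler_wpM2l ?sqrtr_ge0// ler_wsqrtr//; apply: le_trans (Et_G ie); apply: le_trans (Ec_le i).
by rewrite /Ec setIidl.
Qed.

(** Dual polynomials in the tangential directions and 1 in the normal one isolate a single row of
    coefficients across the face, of which the jump is the [n]-th difference. *)
Lemma face_test d i (m : Lx) : inL m -> gh d i ->
  `|\sum_(k < n.+1) nbl n k * x (i - off (setm d k m))| <= Num.sqrt (dual_cst D n) * Num.sqrt (Ef d i).
Proof.
move=> mL gdi; have W1 := @dual_cst_ge1 R D n.
apply: sqrt_bound; first exact: le_trans ler01 W1.
have := energy_ge (jP d) (loc x i) i W1 (@dual_cst_face R D n d m).
rewrite /Ef gdi mul1r; congr (_ ^+ 2 <= _).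
transitivity (\sum_(m' : Lx) x (i - off m') * (nbl n (m' d) * ([forall e, (e != d) ==> (m' e == m e)])%:R)).
  apply: eq_bigr => m' _; congr (_ * _); rewrite (bigD1 d)//= /Submission.jP /facedual eqxx mulr1 IP_cst; congr (_ * _).
  by rewrite -(IP_dual_prod _ _ mL); apply: eq_bigr => e /negbTE ->.
rewrite (bigID (fun m' : Lx => [forall e, (e != d) ==> (m' e == m e)]))/= [X in _ + X]big1 ?addr0; last first.
  by move=> m' /negbTE ->; rewrite !mulr0.
rewrite (reindex_onto (fun k => setm d k m) (fun m' : Lx => m' d)) /=; last first.
  move=> m' /forallP h; apply/ffunP => e; rewrite ffunE; case: eqVneq => [->//|ne].
  by have := h e; rewrite ne /= => /eqP.
have F k : [forall e, (e != d) ==> (setm d k m e == m e)].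
  by apply/forallP => e; apply/implyP => /negbTE ne; rewrite ffunE ne.
apply: eq_big => [k|k _]; first by rewrite F /= ffunE eqxx eqxx.
by rewrite F mulr1 ffunE eqxx mulrC.
Qed.

Lemma setm_ed d (k k' : 'I_n.+1) i (m : Lx) : k = k'.+1 :> nat -> i - off (setm d k m) = i - ed d - off (setm d k' m).
Proof.
move=> kk; apply/rowP => e; rewrite !mxE !ffunE eqxx /=; case: eqVneq => [_|_]; last by rewrite subr0.
by rewrite kk intS opprD addrA.
Qed.

Lemma setm_id d (m : Lx) : setm d (m d) m = m.
Proof. by apply/ffunP => e; rewrite ffunE; case: eqVneq => [->|]. Qed.

Lemma inL_setm d (k : 'I_n.+1) (m : Lx) : (k < n)%N -> inL m -> inL (setm d k m).
Proof. by move=> kn mL e; rewrite ffunE; case: ifP. Qed.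

Lemma nbl_end : `|nbl n n| = 1 :> R.
Proof. by rewrite /nbl binn mulr1 normrX normrN1 expr1n. Qed.

Lemma nbl_start : nbl n 0 = 1 :> R.
Proof. by rewrite /nbl expr0 bin0 mul1r. Qed.

(** It is applied to an end of the row: both end coefficients of the [n]-th difference have modulus
    1, so the value there is the difference minus the other terms. *)
Lemma cross_bound (f : 'I_n.+1 -> R) (T r : R) (k0 : 'I_n.+1) : `|nbl n k0| = 1 :> R ->
  0 <= r -> `|\sum_(k < n.+1) nbl n k * f k| <= T -> T <= r -> (forall k, k != k0 -> `|f k| <= r) ->
  `|f k0| <= @cross_cst R n * r.
Proof.
move=> nk r0 hT Tr hf; rewrite -[`|f k0|]mul1r -nk -normrM.
have -> : nbl n k0 * f k0 = \sum_(k < n.+1) nbl n k * f k - \sum_(k < n.+1 | k != k0) nbl n k * f k.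
  by rewrite [in RHS](bigD1 k0)//= addrK.
apply: le_trans (ler_normB _ _) _; rewrite /cross_cst mulrDl mul1r lerD//; first exact: le_trans Tr.
apply: le_trans (ler_norm_sum _ _ _) _; rewrite mulr_suml [leRHS](bigD1 k0)//= -[leLHS]add0r lerD ?mulr_ge0//.
by apply: ler_sum => k kk; rewrite normrM ler_wpM2l// hf.
Qed.

(** Among the coefficients of cell [i] only those with [m d = 0] do not belong to cell [i - ed d];
    they stand at the end of index 0 of the row. *)
Lemma cross_up d i r : gh d i -> 0 <= r -> Num.sqrt (dual_cst D n) * Num.sqrt (Ef d i) <= r ->
  bnd (i - ed d) r -> bnd i (@cross_cst R n * r).
Proof.
move=> gdi r0 Er b m mL.
have r1 : r <= @cross_cst R n * r by rewrite ler_peMl// cross_cst_ge1.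
have low (k : 'I_n.+1) : (0 < k)%N -> `|x (i - off (setm d k m))| <= r.
  move=> k0; have kn : (k.-1 < n)%N by rewrite prednK// -ltnS.
  rewrite (@setm_ed d k (inord k.-1)); first by apply/b/inL_setm; rewrite ?inordK// ltnW.
  by rewrite inordK ?prednK// ltnW.
rewrite -(setm_id d m); have [m0|m0] := posnP (m d); last by apply: le_trans r1; exact: low.
apply: (@cross_bound (fun k => x (i - off (setm d k m))) _ _ (m d) _ r0 (face_test mL gdi) Er).
  by rewrite m0 nbl_start normr1.
by move=> k; rewrite -val_eqE/= m0 -lt0n => k0; exact: low.
Qed.

(** The coefficients of cell [i - ed d] that do not belong to cell [i] have last local index
    [n - 1], which is index [n] in the row of cell [i]. This is where local indices up to [n] are
    needed. *)
Lemma cross_down d i r : gh d i -> 0 <= r -> Num.sqrt (dual_cst D n) * Num.sqrt (Ef d i) <= r ->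
  bnd i r -> bnd (i - ed d) (@cross_cst R n * r).
Proof.
move=> gdi r0 Er b m mL.
have r1 : r <= @cross_cst R n * r by rewrite ler_peMl// cross_cst_ge1.
have low (k : 'I_n.+1) : (k < n)%N -> `|x (i - off (setm d k m))| <= r.
  by move=> kn; apply/b/inL_setm.
have md := mL d.
rewrite -(setm_id d m) -(@setm_ed d (inord (m d).+1)) ?inordK// ?ltnS//.
have [m0|m0] := ltnP (m d).+1 n; first by apply: le_trans r1; apply: low; rewrite inordK// ltnS ltnW.
have mE : (m d).+1 = n by apply/eqP; rewrite eqn_leq md.
apply: (@cross_bound (fun k => x (i - off (setm d k m))) _ _ (inord (m d).+1) _ r0 (face_test mL gdi) Er).
  by rewrite inordK mE ?nbl_end.
move=> k; rewrite -val_eqE/= inordK ?mE// => kn; apply: low; rewrite ltn_neqAle kn/= -ltnS//.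
Qed.

Lemma sqrtG_near (i i' : Z) : (forall d, `|i ord0 d - i' ord0 d| <= 1)%N -> Num.sqrt (G i) <= 2 ^+ D.+1 * Num.sqrt (G i').
Proof.
move=> h; have p0 : 1 <= 2 ^+ D.+1 :> R by rewrite exprn_ege1// ler1n.
have -> : 2 ^+ D.+1 * Num.sqrt (G i') = Num.sqrt ((2 ^+ D.+1) ^+ 2 * G i').
  by rewrite sqrtrM ?sqr_ge0// sqrtr_sqr ger0_norm// (le_trans ler01).
apply: ler_wsqrtr; apply: le_trans (G_near h) _; rewrite ler_wpM2r ?G_ge0// expr2 ler_peMl// (le_trans ler01)//.
Qed.

Lemma face_near (F : 'I_D.+1 * Z) (i i' : Z) : is_face_of F i -> is_face_of F i' -> forall d, (`|i ord0 d - i' ord0 d| <= 1)%N.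
Proof.
have h (b : bool) : (`|(b%:R : int)| <= 1)%N by case: b.
case: F => d z [/= E1|/= E1] [/= E2|/= E2] e.
- by rewrite -E1 -E2 subrr.
- have -> : i = i' + delta_mx ord0 d by rewrite -E1.
  by rewrite !mxE eqxx /= addrAC subrr add0r h.
- have -> : i' = i + delta_mx ord0 d by rewrite -E2.
  by rewrite !mxE eqxx /= opprD addrA subrr add0r abszN h.
- have -> : i = i' by apply: (addIr (delta_mx ord0 d)); rewrite -E1.
  by rewrite subrr.
Qed.

(** The face may be the lower or the upper one of either cell: if the cells differ this is
    [cross_up] or [cross_down], otherwise nothing is crossed. The weighted energies at the two cells
    and at the cell of the face are compared by [sqrtG_near]. *)
Lemma cross F i m c : 0 <= c -> ghost_faces sigma a Om F -> is_face_of F i -> is_face_of F m ->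
  bnd m (c * Num.sqrt (G m)) -> bnd i (@step_cst R D n c * Num.sqrt (G i)).
Proof.
move=> c0 gF fi fm bm; have sd := sqrtr_ge0 (dual_cst D n : R).
have near := face_near fi fm.
have [d [j Fd]] : exists d j, F = (d, j) by case: F {gF fi fm near} => d j; exists d, j.
have gdj : gh d j by rewrite /gh; apply/asboolP; rewrite -Fd.
have je : j \in els by apply/elsP; rewrite Fd in gF; have [] := ghost_elements s0 gF.
have nj : forall e, (`|j ord0 e - i ord0 e| <= 1)%N.
  by apply: (@face_near F) => //; left; rewrite Fd.
pose r := (c + Num.sqrt (dual_cst D n)) * 2 ^+ D.+1 * Num.sqrt (G i).
have p0 : 0 <= 2 ^+ D.+1 :> R by rewrite exprn_ge0.
have r0 : 0 <= r by rewrite !mulr_ge0 ?sqrtr_ge0// addr_ge0.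
have Er : Num.sqrt (dual_cst D n) * Num.sqrt (Ef d j) <= r.
  rewrite /r -mulrA; apply: le_trans (_ : Num.sqrt (dual_cst D n) * (2 ^+ D.+1 * Num.sqrt (G i)) <= _).
    rewrite ler_wpM2l//; apply: le_trans (sqrtG_near nj); apply: ler_wsqrtr.
    exact: le_trans (Ef_le d j) (Et_G je).
  by rewrite ler_wpM2r ?mulr_ge0 ?sqrtr_ge0// lerDr.
have br : bnd m r.
  move=> m' mL; apply: le_trans (bm m' mL) _; rewrite /r -mulrA.
  apply: le_trans (_ : c * (2 ^+ D.+1 * Num.sqrt (G i)) <= _).
    by rewrite ler_wpM2l//; apply: sqrtG_near => e; rewrite distnC; exact: near.
  by rewrite ler_wpM2r ?mulr_ge0 ?sqrtr_ge0// lerDl.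
have rs : @cross_cst R n * r <= @step_cst R D n c * Num.sqrt (G i).
  by rewrite /r /step_cst !mulrA [leRHS]mulrDl lerDr mulr_ge0// sqrtr_ge0.
have r1 : r <= @cross_cst R n * r by rewrite ler_peMl// cross_cst_ge1.
suff : bnd i (@cross_cst R n * r) by move=> h m' mL; apply: le_trans (h m' mL) rs.
case: fi fm => [fi|fi] [fm|fm]; rewrite Fd /= in fi fm.
- by rewrite -fi fm => m' mL; apply: le_trans (br m' mL) r1.
- have mE : m = j - ed d by rewrite fm addrK.
  by rewrite -fi; apply: (cross_up gdj r0 Er); rewrite -mE.
- have -> : i = j - ed d by rewrite fi addrK.
  by apply: (cross_down gdj r0 Er); rewrite fm.
- have -> : i = m by apply: (addIr (ed d)); rewrite -fi -fm.
  by move=> m' mL; apply: le_trans (br m' mL) r1.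
Qed.

(** Induction from the end of the chain, where the uncut element is controlled by its own mass term;
    each face adds one application of [step_cst]. *)
Lemma chain_bnd F0 (s : seq ('I_D.+1 * Z)) i :
  (forall F, F \in F0 :: s -> ghost_faces sigma a Om F) -> is_face_of F0 i ->
  (forall j, (j < size s)%N -> exists m, [/\ elements sigma a Om m, is_face_of (nth F0 (F0 :: s) j) m &
                is_face_of (nth F0 (F0 :: s) j.+1) m]) ->
  (exists2 m, uncut_elements sigma a Om m & is_face_of (last F0 s) m) ->
  bnd i (iter (size s) (@step_cst R D n) (@step_cst R D n (Num.sqrt (dual_cst D n))) * Num.sqrt (G i)).
Proof.
elim: s F0 i => [|F1 s IH] F0 i gF fi ch [m um fm] /=.
  apply: (cross (sqrtr_ge0 _) (gF F0 (mem_head _ _)) fi fm).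
  by case: um => /elsP me mO; exact: bnd_uncut.
have [m' [em' f0 f1]] := ch 0%N isT.
have c0 : 0 <= iter (size s) (@step_cst R D n) (@step_cst R D n (Num.sqrt (dual_cst D n))).
  have h1 : 0 <= @step_cst R D n (Num.sqrt (dual_cst D n)) by apply: le_trans (step_cst_ge _ _ _); exact: sqrtr_ge0.
  exact: le_trans h1 (iter_step _ _ _ h1).
apply: (cross c0 (gF F0 (mem_head _ _)) fi f0); apply: (IH F1 m') => //.
- by move=> F Fin; apply: gF; rewrite inE Fin orbT.
- move=> j js; have [m2 [e2 g1 g2]] := ch j.+1 js; exists m2; split => //.
    by move: g1; rewrite /= (set_nth_default F1)// ltnW.
  by move: g2; rewrite /= (set_nth_default F1)//.
- by exists m.
Qed.

Variable K : nat.
Hypothesis chK : chain_condition sigma a Om K.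

Lemma bnd_elements i : i \in els -> bnd i (chain_cst D n K * Num.sqrt (G i)).
Proof.
move=> ie m mL; have ei : elements sigma a Om i by apply/elsP.
have [ci|ci] := pselect (cell i `<=` Om).
  apply: le_trans (bnd_uncut ci ie mL) _; rewrite ler_wpM2r ?sqrtr_ge0//.
  by apply: le_trans (iter_step_le _ _ (leq0n K)) => /=; apply: step_cst_ge; exact: sqrtr_ge0.
have [F0 [s [sK gF f0 ch lst]]] := chK (conj ei ci).
apply: le_trans (chain_bnd gF f0 ch lst mL) _; rewrite ler_wpM2r ?sqrtr_ge0//.
by apply: iter_step_le; apply: ltnW.
Qed.

End Energy.

(** * Degrees of freedom and coercivity *)

Definition inLb (m : Lx) : bool := [forall d, (m d < n)%N].

Lemma inLP m : reflect (inL m) (inLb m).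
Proof. exact: forallP. Qed.

(** The indices of the B-splines that do not vanish on some element, that is, the true degrees of
    freedom of the spline space on the grid domain. *)
Definition coefs : seq Z := undup [seq i - off m | i <- els, m <- [seq m <- enum {: Lx} | inLb m]].

Lemma coefs_uniq : uniq coefs. Proof. exact: undup_uniq. Qed.

Lemma coefsP j : reflect (exists i, exists m : Lx, [/\ i \in els, inL m & j = i - off m]) (j \in coefs).
Proof.
rewrite mem_undup; apply: (iffP allpairsP) => [[[i m] [/= ie mi ->]]|[i [m [ie mi ->]]]].
  by exists i, m; split => //; move: mi; rewrite mem_filter => /andP[/inLP].
by exists (i, m); split => //=; rewrite mem_filter mem_enum andbT; exact/inLP.
Qed.

(** The bounds of [bnd_elements] are squared and summed over the elements. After exchanging the sums
    each energy carries the sum of all weights directed at it, which is bounded independently of the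
    number of elements. *)
Lemma coercive K eps x : 1 <= eps -> chain_condition sigma a Om K ->
  coer_cst D n K * \sum_(j <- coefs) x j ^+ 2 <= Aloc (@off D n) els (acoef eps) x x.
Proof.
move=> eps1 chK; rewrite Aloc_energy.
have C0 : 0 < (#|{: Lx}|)%:R * chain_cst D n K ^+ 2 * 4 ^+ D.+1 :> R by rewrite -invr_gt0; exact: coer_cst_gt0.
rewrite /coer_cst mulrC ler_pdivrMr//.
have h1 : \sum_(j <- coefs) x j ^+ 2 <= \sum_(i <- els) \sum_(m : Lx | inLb m) x (i - off m) ^+ 2.
  apply: le_trans (_ : \sum_(j <- coefs) \sum_(i <- els) \sum_(m : Lx | inLb m) (j == i - off m)%:R * x j ^+ 2 <= _).
    rewrite big_seq [leRHS]big_seq; apply: ler_sum => j /coefsP[i [m [ie mL jE]]].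
    rewrite (bigD1_seq i)//= (bigD1 m)/=; last exact/inLP.
    rewrite jE eqxx mul1r -addrA lerDl addr_ge0//; last by rewrite !sumr_ge0// => *; rewrite !sumr_ge0// => *; rewrite mulr_ge0// sqr_ge0.
    by rewrite !sumr_ge0// => *; rewrite mulr_ge0// sqr_ge0.
  rewrite exchange_big/=; apply: ler_sum => i _; rewrite exchange_big/=; apply: ler_sum => m _.
  have [jin|jin] := boolP (i - off m \in coefs).
    rewrite (bigD1_seq (i - off m)) ?coefs_uniq//= eqxx mul1r big1 ?addr0// => j /negbTE ->.
    by rewrite mul0r.
  rewrite big_seq big1 ?sqr_ge0// => j jc; case: eqVneq => [E|]; last by rewrite mul0r.
  by rewrite -E jc in jin.
apply: le_trans h1 _.
have h2 i : i \in els -> \sum_(m : Lx | inLb m) x (i - off m) ^+ 2 <= (#|{: Lx}|)%:R * chain_cst D n K ^+ 2 * G eps x i.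
  move=> ie; apply: le_trans (_ : \sum_(m : Lx) chain_cst D n K ^+ 2 * G eps x i <= _); last first.
    have -> : \sum_(m : Lx) chain_cst D n K ^+ 2 * G eps x i = (#|{: Lx}|)%:R * chain_cst D n K ^+ 2 * G eps x i.
      by rewrite sumr_const -[LHS]mulr_natl mulrA.
    exact: lexx.
  rewrite [leRHS](bigID inLb)/= -[leLHS]addr0 lerD//; last first.
    by rewrite sumr_ge0// => m _; rewrite mulr_ge0 ?sqr_ge0// G_ge0.
  apply: ler_sum => m /inLP mL; have := bnd_elements x eps1 chK ie mL.
  rewrite -[x _ ^+ 2]real_normK ?num_real// => h.
  apply: le_trans (lerXn2r 2 _ _ h) _; rewrite ?nnegrE ?mulr_ge0 ?sqrtr_ge0//; first exact/ltW/chain_cst_gt0.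
  by rewrite exprMn sqr_sqrtr// G_ge0.
apply: le_trans (_ : \sum_(i <- els) (#|{: Lx}|)%:R * chain_cst D n K ^+ 2 * G eps x i <= _).
  by rewrite big_seq [leRHS]big_seq; apply: ler_sum.
rewrite -mulr_sumr [leRHS]mulrC -[leRHS]mulrA ler_wpM2l ?(mulr_ge0 (ler0n _ _) (sqr_ge0 _))//.
rewrite /G exchange_big/= mulr_sumr; apply: ler_sum => tau _.
rewrite -mulr_suml ler_wpM2r ?Et_ge0//.
(* The constant of [sum_expw] at rate 1/2. *)
have -> : 4 = 2 / (1 - 2^-1) :> R by field.
have -> : \sum_(i <- els) expw 2^-1 (tau - i) = \sum_(j <- [seq tau - i | i <- els]) expw 2^-1 j :> R by rewrite big_map.
apply: sum_expw; first by rewrite half01 invf_lt1// ltr1n.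
by rewrite map_inj_uniq// => i i' /addrI /oppr_inj.
Qed.

Notation spl := (spl sigma a n).

(** Coercivity controls only the coefficients in [coefs], and the others do not affect the spline on
    the grid domain, so they are set to 0. *)
Definition restr (c : Z -> R) j := if j \in coefs then c j else 0.

Lemma restr_supp c j : j \notin coefs -> restr c j = 0.
Proof. by rewrite /restr => /negbTE ->. Qed.

Lemma restr_in c i (m : Lx) : i \in els -> inL m -> restr c (i - off m) = c (i - off m).
Proof. by move=> ie mL; rewrite /restr; case: coefsP => // h; case: h; exists i, m. Qed.

Lemma gsum_restr c i x : i \in els -> gsum bpP (fun m : Lx => restr c (i - off m)) i x = gsum bpP (loc c i) i x.
Proof.
move=> ie; apply: gsum_ext => [m h|m mL]; last exact: restr_in.
exact: (@cpoly_bp0 R D sigma a n n0 m i x h).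
Qed.

(** A coefficient of index [n] in the direction [d] belongs to cell [i - ed d], which is an element
    because the face is a ghost face; index [n] in another direction contributes a zero piece. *)
Lemma gsum_jP_restr c d i x : gh d i ->
  gsum (jP d) (fun m : Lx => restr c (i - off m)) i x = gsum (jP d) (loc c i) i x.
Proof.
move=> /asboolP g; have [e1 e2] := ghost_elements s0 g; apply: eq_bigr => m _.
have [h|] := boolP [forall e, (e != d) ==> (m e < n)%N]; last first.
  rewrite negb_forall => /existsP[e]; rewrite negb_imply -leqNgt => /andP[ed nm].
  rewrite /Submission.cpoly /tens (bigD1 e)//= /Submission.jP (negbTE ed) bp_eq0// horner0 !mul0r !mulr0//.
have {}h e : e != d -> (m e < n)%N by move=> ed; have /forallP/(_ e) := h; rewrite ed.
congr (_ * _); have [md|md] := ltnP (m d) n.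
  apply: restr_in; first exact/elsP.
  by move=> e; have [->|/h] := eqVneq e d.
have mE : m d = n :> nat by apply/eqP; rewrite eqn_leq md andbT -ltnS.
have E : i - off m = i - ed d - off (setm d (inord n.-1) m).
  have kk : m d = (inord n.-1 : 'I_n.+1).+1 :> nat by rewrite inordK ?prednK.
  by rewrite -{1}(setm_id d m) (setm_ed _ _ _ kk).
rewrite E restr_in//; first exact/elsP.
by move=> e; rewrite ffunE; case: eqVneq => [_|/h//]; rewrite inordK ?prednK// ltnW.
Qed.

Lemma Aloc_restr eps c c' : Aloc (@off D n) els (acoef eps) (restr c) (restr c') = Aloc (@off D n) els (acoef eps) c c'.
Proof.
have sN : sigma ^+ D.+1 != 0 by rewrite expf_neq0// gt_eqF.
apply: (mulfI sN); rewrite !Aloc_local// big_seq [RHS]big_seq; apply: eq_bigr => i ie.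
rewrite /local_form; congr (_ + _ * _); first by apply: eq_Rintegral => x _; rewrite !gsum_restr.
apply: eq_bigr => d _; have [g|g] := boolP (gh d i); last by rewrite !mul0r.
by congr (_ * _); apply: eq_Rintegral => x _; rewrite !gsum_jP_restr.
Qed.

Lemma spline_lin (c : R) u v : spline sigma a n u -> spline sigma a n v -> spline sigma a n (fun x => c * u x + v x).
Proof.
move=> [mu1 ku Cu pu] [mv kv Cv pv]; split.
- by apply: measurable_funD => //; exact: measurable_funM.
- apply: (subclosed_compact _ (compactU ku kv)); first exact: closed_closure.
  rewrite -closureU; apply: closureS => x /= h; have [u0|u0] := eqVneq (u x) 0; last by left.
  by right; apply: contraNneq h => v0; rewrite u0 v0 mulr0 addr0.
- by move=> n1; apply: class_C_add; [exact/class_C_scale/Cu|exact: Cv].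
- move=> i; have [c1 h1] := pu i; have [c2 h2] := pv i; exists (fun al => c * c1 al + c2 al) => x cx.
  by rewrite h1// h2// mulr_sumr -big_split/=; apply: eq_bigr => al _; rewrite mulrDl mulrA.
Qed.

Lemma rep_lin (k : R) u v c c' : rep u c -> rep v c' -> rep (fun x => k * u x + v x) (fun j => k * c j + c' j).
Proof.
move=> [w [sw uw hw]] [w' [sw' vw hw']]; exists (fun x => k * w x + w' x); split.
- exact: spline_lin.
- by move=> x gx; rewrite uw// vw.
- move=> i x cx; rewrite (hw i x cx) (hw' i x cx) /Submission.gsum mulr_sumr -big_split/=; apply: eq_bigr => m _.
  by rewrite mulrDl mulrA.
Qed.

Lemma rep_spl c : (forall j, j \notin coefs -> c j = 0) -> rep (spl coefs c (fun=> 0%N)) c.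
Proof.
move=> cs; exists (spl coefs c (fun=> 0%N)); split => //.
  by apply: spline_spl => //; exact: coefs_uniq.
by apply: hasc_spl => //; exact: coefs_uniq.
Qed.

Lemma rep_spl_ae v c : rep v c -> {ae mu, forall x, gd x -> v x = spl coefs (restr c) (fun=> 0%N) x}.
Proof.
move=> rv; apply: filterS (ae_domain_cell a Om s0) => x h gx; have [i ei cx] := h gx.
have ie : i \in els by apply/elsP.
rewrite (rep_cell rv ei cx) -(gsum_restr _ _ ie).
by rewrite (hasc_spl s0 n0 coefs_uniq (@restr_supp c) cx).
Qed.

Lemma open_gd : open gd. Proof. exact: open_interior. Qed.

Lemma measurable_rep_gd v c : rep v c -> measurable_fun setT (v \_ gd).
Proof.
move=> [w [[mw _ _ _] vw _]]; have mg := open_measurable_rV open_gd.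
have -> : v \_ gd = w \_ gd by apply/funext => x; rewrite /patch; case: ifP => // /set_mem gx; rewrite vw.
by apply/(measurable_restrictT _ mg); exact: measurable_funS mw.
Qed.

(** * Functionals on the spline space and invertibility *)

Section Dual.
Variable p : \bar R.
Hypothesis p1 : (1 <= p)%E.
Notation q := (hoelder_conjugate p).

(** The difference has norm 0 on the grid domain, so a bounded functional vanishes on it. *)
Lemma dual_ae f u v : spline_dual sigma a Om n p f -> spline_on sigma a Om n u -> spline_on sigma a Om n v ->
  {ae mu, forall x, gd x -> u x = v x} -> f u = f v.
Proof.
move=> [lf [C bf]] su sv uv; have q1 := hoelder_conj_ge1 p1.
have [cu ru] := spline_on_rep su; have [cv rv] := spline_on_rep sv.
have rw := rep_lin (-1) ru rv; have := bf _ (rep_spline_on rw); rewrite lf// => h.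
have N0 : Lp_norm gd q (fun x => -1 * u x + v x) = 0%E.
  rewrite /Lp_norm (@Lnorm_eq_ae _ _ _ mu q _ (cst 0%E))//; first by rewrite Lnorm0// gt_eqF// (lt_le_trans lte01).
    by apply/measurable_EFinP; exact: measurable_rep_gd rw.
  apply: filterS uv => x h2; rewrite /= /patch; case: ifP => // /set_mem gx.
  by rewrite h2// mulN1r addNr.
move: h; rewrite N0 mule0 lee_fin normr_le0 mulN1r addrC subr_eq0 => /eqP ->//.
Qed.

Definition delta (j : Z) (z : Z) : R := (z == j)%:R.

Definition Bs j : V -> R := ctens (Bch sigma a n j) (fun=> 0%N).

Lemma rep_Bs j : j \in coefs -> rep (Bs j) (delta j).
Proof.
move=> jc; have h : forall z, z \notin coefs -> delta j z = 0.
  by move=> z zc; rewrite /delta; case: eqVneq => // E; rewrite -E (negbTE zc) in jc *.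
have := rep_spl h; congr (rep _ _); apply/funext => x; rewrite /Submission.spl.
rewrite (bigD1_seq j) ?coefs_uniq//= /delta eqxx mul1r big1 ?addr0// => z /negbTE ->.
by rewrite mul0r.
Qed.

Lemma dual_spl f c s : spline_dual sigma a Om n p f -> {subset s <= coefs} ->
  spline_on sigma a Om n (spl s c (fun=> 0%N)) /\ f (spl s c (fun=> 0%N)) = \sum_(j <- s) c j * f (Bs j).
Proof.
move=> [lf _]; elim: s => [|j s IH] sub.
  have h : spl [::] c (fun=> 0%N) = (fun=> 0) by apply/funext => x; rewrite /Submission.spl big_nil.
  have s00 : spline_on sigma a Om n (fun=> 0).
    have := rep_spline_on (rep_spl (c := fun=> 0) (fun _ _ => erefl)).
    by congr (spline_on _ _ _ _ _); apply/funext => x; rewrite /Submission.spl big1// => z _; rewrite mul0r.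
  rewrite h big_nil; split => //.
  have E0 := lf (-1) _ _ s00 s00; rewrite mulr0 addr0 in E0.
  by rewrite mulN1r addNr in E0.
have [s1 E1] := IH (fun z zs => sub z (mem_behead (s := j :: s) zs)).
have E : spl (j :: s) c (fun=> 0%N) = (fun x => c j * Bs j x + spl s c (fun=> 0%N) x).
  by apply/funext => x; rewrite /Submission.spl big_cons.
have sB := rep_spline_on (rep_Bs (sub j (mem_head _ _))).
rewrite E lf// E1 big_cons; split => //.
have [cs rs] := spline_on_rep s1.
exact: rep_spline_on (rep_lin (c j) (rep_Bs (sub j (mem_head _ _))) rs).
Qed.

Lemma dual_rep f v c : spline_dual sigma a Om n p f -> rep v c -> f v = \sum_(j <- coefs) c j * f (Bs j).
Proof.
move=> df rv; have [ss E] := dual_spl (restr c) df (fun z h => h).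
rewrite (dual_ae df (rep_spline_on rv) ss (rep_spl_ae rv)) E.
by rewrite big_seq [RHS]big_seq; apply: eq_bigr => j jc; rewrite /restr jc.
Qed.

(** A coefficient is computed from the values on one cell, where Hoelder's inequality applies. The
    constant may depend on [sigma], as it only serves to show that functionals given by coefficients
    are bounded. *)
Lemma coef_bound : exists2 K : R, 0 <= K & forall v c j, rep v c -> j \in coefs ->
  (`|c j|%:E <= K%:E * Lp_norm gd q v)%E.
Proof.
have [B hB] := @poly_bounds_exists R n; have q1 := hoelder_conj_ge1 p1.
have h i : exists2 K : R, 0 <= K & forall F : V -> \bar R, measurable_fun setT F -> (forall x, (0 <= F x)%E) ->
    (\int[mu]_(x in cell i) F x <= K%:E * 'N[mu]_q[F])%E.
  apply: (@Lnorm_integral_le _ _ _ mu q (cell i) (sigma ^+ D.+1)) => //.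
  - exact: measurable_cell.
  - by rewrite exprn_ge0// ltW.
  - exact: measure_cell.
have [Kf KfE] := choice (fun i => let: ex_intro2 K k0 hK := h i in ex_intro _ K (conj k0 hK)).
exists (\sum_(i <- els) B ^+ D.+1 * (sigma ^+ D.+1)^-1 * Kf i).
  by apply: sumr_ge0 => i _; rewrite !mulr_ge0 ?invr_ge0 ?exprn_ge0 ?(B0 hB) ?(ltW s0)//; exact: (KfE i).1.
move=> v c j rv /coefsP[i [m [ie mL ->]]]; have ei := (elsP i).1 ie.
have vE x : cell i x -> v x = gsum bpP (loc c i) i x by move=> cx; exact: (rep_cell rv ei cx).
rewrite -(lam_gsum s0 n0 mL vE).
have iv : mu.-integrable (cell i) (EFin \o v).
  have [i1 _] := Rint_sum (loc c i) (measurable_cell sigma a i) (fun m : Lx => (cell_integral a s0 (fun d => bpP d (m d)) i).1).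
  by apply: eq_integrable i1 => [|x /set_mem cx]; [exact: measurable_cell|rewrite /= vE].
apply: (@le_trans _ _ ((B ^+ D.+1 * (sigma ^+ D.+1)^-1)%:E * \int[mu]_(x in cell i) `|(v x)%:E|)%E); first by apply: lam_bound.
have mg := measurable_rep_gd rv.
have -> : (\int[mu]_(x in cell i) `|(v x)%:E| = \int[mu]_(x in cell i) `|((v \_ gd) x)%:E|)%E.
  apply: eq_integral => x /set_mem cx; rewrite /patch mem_set//; exact: cell_domain ei _ cx.
have := (KfE i).2 (fun x => `|((v \_ gd) x)%:E|%E) _ _ => /(_ _ _)/[dup] _ _.
have K1 : (\int[mu]_(x in cell i) `|((v \_ gd) x)%:E| <= (Kf i)%:E * Lp_norm gd q v)%E.
  apply: le_trans ((KfE i).2 _ _ _) _ => //; first by apply: measurableT_comp => //; exact/measurable_EFinP.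
  by rewrite Lnorm_abse.
have c0 : 0 <= B ^+ D.+1 * (sigma ^+ D.+1)^-1 by rewrite mulr_ge0 ?invr_ge0 ?exprn_ge0 ?(B0 hB) ?(ltW s0).
apply: (@le_trans _ _ ((B ^+ D.+1 / sigma ^+ D.+1)%:E * ((Kf i)%:E * Lp_norm gd q v))%E).
  by rewrite lee_wpmul2l ?lee_fin.
rewrite muleA -EFinM lee_wpmul2r ?Lnorm_ge0// lee_fin (bigD1_seq i)//= lerDl sumr_ge0// => i' _.
by rewrite mulr_ge0//; exact: (KfE i').1.
Qed.

Lemma dual_of_coefs f (phi : Z -> R) : (forall v c, rep v c -> f v = \sum_(j <- coefs) c j * phi j) ->
  spline_dual sigma a Om n p f.
Proof.
move=> fE; split=> [k u v su sv|].
  have [cu ru] := spline_on_rep su; have [cv rv] := spline_on_rep sv.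
  rewrite (fE _ _ (rep_lin k ru rv)) (fE _ _ ru) (fE _ _ rv) mulr_sumr -big_split/=.
  by apply: eq_bigr => j _; rewrite mulrDl mulrA.
have [K K0 KE] := coef_bound; exists (\sum_(j <- coefs) K * `|phi j|) => v sv.
have [c rv] := spline_on_rep sv; rewrite (fE _ _ rv).
apply: (@le_trans _ _ (\sum_(j <- coefs) (`|c j| * `|phi j|)%:E)%E).
  by rewrite sumEFin lee_fin; apply: le_trans (ler_norm_sum _ _ _) _; apply: ler_sum => j _; rewrite normrM.
rewrite -sumEFin ge0_sume_distrl; last by move=> j _; rewrite lee_fin mulr_ge0.
rewrite big_seq [leRHS]big_seq; apply: lee_sum => j jc; rewrite !EFinM muleAC lee_wpmul2r ?lee_fin//.
exact: KE.
Qed.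

End Dual.

Lemma Aloc_coefs eps c c' : Aloc (@off D n) els (acoef eps) c c' =
  \sum_(j <- coefs) c' j * Aloc (@off D n) els (acoef eps) c (delta j).
Proof.
rewrite -Aloc_restr {1}(supp_expand coefs_uniq (@restr_supp c')) Aloc_sumr.
rewrite big_seq [RHS]big_seq; apply: eq_bigr => j jc; rewrite {1}/restr jc; congr (_ * _).
rewrite -[RHS]Aloc_restr; congr Aloc; apply/funext => z; rewrite /restr /delta.
by case: ifP => // zc; case: eqVneq => // E; rewrite E jc in zc.
Qed.

(** In terms of coefficients all three claims are finite-dimensional: boundedness follows from
    [coef_bound], existence from [Aloc_solve], and uniqueness from coercivity applied to the
    difference of the coefficients. *)
Lemma invertible p eps K : (1 <= p)%E -> 1 <= eps -> chain_condition sigma a Om K ->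
  A_eps_invertible sigma a Om n p eps.
Proof.
move=> p1 eps1 chK.
have co x := coercive x eps1 chK; have c0 := @coer_cst_gt0 R D n K.
split.
- move=> u su; have [c rc] := spline_on_rep su.
  apply: (dual_of_coefs p1 (phi := fun j => sigma ^+ D.+1 * Aloc (@off D n) els (acoef eps) c (delta j))) => v c' rv.
  rewrite (A_epsE eps rc rv) Aloc_coefs mulr_sumr; apply: eq_bigr => j _.
  by rewrite mulrCA.
- move=> f df.
  have [x xs xE] := @Aloc_solve R D.+1 Lx (@off D n) els (acoef eps) coefs _ (fun j => (sigma ^+ D.+1)^-1 * f (Bs j)) coefs_uniq c0 (fun x _ => co x).
  exists (spl coefs x (fun=> 0%N)); first exact: rep_spline_on (rep_spl xs).
  move=> v sv; have [c rc] := spline_on_rep sv.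
  rewrite (A_epsE eps (rep_spl xs) rc) -Aloc_restr.
  have -> : restr x = x by apply/funext => j; rewrite /restr; case: ifPn => // /xs.
  rewrite xE; last exact: restr_supp.
  rewrite (dual_rep p1 df rc) mulr_sumr big_seq [RHS]big_seq; apply: eq_bigr => j jc.
  by rewrite /restr jc; field; rewrite expf_neq0// gt_eqF.
- move=> u w su sw uw; have [cu ru] := spline_on_rep su; have [cw rw] := spline_on_rep sw.
  pose z := restr (fun j => cu j - cw j).
  have z0 : Aloc (@off D n) els (acoef eps) z z = 0.
    rewrite /z Aloc_restr Aloc_coefs big_seq big1// => j jc; rewrite Aloc_sub.
    have sN : sigma ^+ D.+1 != 0 by rewrite expf_neq0// gt_eqF.
    have := uw _ (rep_spline_on (rep_Bs jc)).
    rewrite (A_epsE eps ru (rep_Bs jc)) (A_epsE eps rw (rep_Bs jc)).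
    by move=> /(mulfI sN) ->; rewrite subrr mulr0.
  have zj j : j \in coefs -> cu j = cw j.
    move=> jc; have := co z; rewrite z0 => h.
    have h2 : \sum_(j <- coefs) z j ^+ 2 <= 0 by rewrite -(pmulr_rle0 _ c0).
    have : z j ^+ 2 <= 0.
      apply: le_trans h2; rewrite (bigD1_seq j) ?coefs_uniq//= lerDl sumr_ge0// => i _; exact: sqr_ge0.
    have -> : z j = cu j - cw j by rewrite /z /restr jc.
    by move=> h3; apply/eqP; rewrite -subr_eq0 -sqrf_eq0 eq_le h3 sqr_ge0.
  have E : restr cu = restr cw by apply/funext => j; rewrite /restr; case: ifP => // /zj.
  apply: filterS2 (rep_spl_ae ru) (rep_spl_ae rw) => x h1 h2 gx.
  by rewrite h1// h2// E.
Qed.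

Lemma Bs_bounded j : exists C : R, forall x, `|Bs j x| <= C.
Proof.
have [C hC] := ctens_bounded (corner sigma a j) (\row_d grid_coord sigma a d (j ord0 d + n%:Z)) (wchain_Bch a n s0 j) (fun d => leq0n n.-1).
exists `|C| => x; have [xb|xb] := pselect (cbox (corner sigma a j) (\row_d grid_coord sigma a d (j ord0 d + n%:Z)) x).
  exact: le_trans (hC x xb) (ler_norm _).
by rewrite /Bs ctens_Bch_supp// normr0.
Qed.

Lemma measurable_Bs j : measurable_fun setT (Bs j).
Proof. by apply: (measurable_ctens (wchain_Bch a n s0 j)) => d. Qed.

Lemma integrable_Bs h j : mu.-integrable Om (EFin \o h) -> mu.-integrable Om (EFin \o (fun x => h x * Bs j x)).
Proof.
move=> ih; have [C hC] := Bs_bounded j; apply: (integrable_bdd_mul (open_measurable_rV oOm) ih _ (fun x _ => hC x)).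
by apply: measurable_funTS; exact: measurable_Bs.
Qed.

Lemma mass_rep h v c : mu.-integrable Om (EFin \o h) -> rep v c ->
  mass_form Om h v = \sum_(j <- coefs) c j * mass_form Om h (Bs j).
Proof.
move=> ih rv; have mO := open_measurable_rV oOm.
have ih2 j : mu.-integrable setT (EFin \o (fun x => h x * Bs j x) \_ Om).
  by apply/(integrable_patch _ _ mO); exact: integrable_Bs.
have [i1 i2] := integrable_Rsum coefs c ih2.
transitivity (\int[mu]_x (\sum_(j <- coefs) c j * ((fun x => h x * Bs j x) \_ Om) x)).
  rewrite /mass_form Rintegral_mkcond /Rintegral; congr fine; apply: ae_eq_integral => //.
  - apply/measurable_EFinP; apply/(measurable_restrictT _ mO); apply: measurable_funM.
      by apply/measurable_EFinP; exact: (integrableP _ _ _ ih).1.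
    exact: measurable_rep rv.
  - exact: (integrableP _ _ _ i1).1.
  have RA := rep_spl_ae rv; apply: filterS RA => x hx _; congr (_%:E); rewrite /patch.
  case: ifPn => [/set_mem ox|_]; last by rewrite big1// => j _; rewrite mulr0.
  rewrite hx; last exact: Om_domain.
  rewrite /Submission.spl mulr_sumr big_seq [RHS]big_seq; apply: eq_bigr => j jc.
  by rewrite /restr jc mulrCA.
by rewrite i2; apply: eq_bigr => j _; rewrite /mass_form [in RHS]Rintegral_mkcond.
Qed.

Lemma mass_dual p h : (1 <= p)%E -> mu.-integrable Om (EFin \o h) -> spline_dual sigma a Om n p (mass_form Om h).
Proof. by move=> p1 ih; apply: (dual_of_coefs p1) => v c rv; exact: mass_rep. Qed.

(** The inverse is defined by choice; the choice is a solution because one exists for the bounded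
    functional [mass_form Om u]. *)
Lemma approx_extensionP p eps u : (1 <= p)%E -> A_eps_invertible sigma a Om n p eps ->
  mu.-integrable Om (EFin \o u) ->
  let w := approx_extension sigma a Om n eps u in
  spline_on sigma a Om n w /\ forall v, spline_on sigma a Om n v -> A_eps sigma a Om n eps w v = mass_form Om u v.
Proof.
move=> p1 [_ inv _] iu /=; have [w sw wE] := inv _ (mass_dual p1 iu).
exact: (getPex (ex_intro _ w (conj sw wE) : exists w0, [set u0 | spline_on sigma a Om n u0 /\
               forall v, spline_on sigma a Om n v -> A_eps sigma a Om n eps u0 v = mass_form Om u v] w0)).
Qed.

(** * The residual of the quasi-interpolant and the pointwise error *)

Notation dP := (@dP R D sigma n).
Notation mi0 := (mi0 D).
Variable k : nat.
Hypothesis kn : (k <= n)%N.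
Variable B : R.
Hypothesis hB : poly_bounds n B.

(** A product of two polynomials bounded by [B] in each direction, for one cell term and at most
    [D.+1] face terms per cell. *)
Definition acoef_cst (eps : R) : R := (B ^+ 2) ^+ D.+1 * (1 + `|eps| * D.+1%:R).

Lemma acoef_bound eps i (m m' : Lx) : `|acoef eps i m m'| <= acoef_cst eps.
Proof.
have sN : 0 < sigma ^+ D.+1 by rewrite exprn_gt0.
rewrite /acoef normrM normfV (gtr0_norm sN) ler_pdivrMl//.
have mn (m0 : Lx) d : (m0 d <= n)%N by rewrite -ltnS.
have hb : forall d t, 0 <= t <= 1 -> `|(bpP d (m d) * bpP d (m' d)).[t]| <= B ^+ 2.
  move=> d t t01; rewrite hornerM normrM expr2.
  by apply: ler_pM => //; exact: (bp_le hB).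
have hj : forall e d t, 0 <= t <= 1 -> `|(jP e d (m d) * jP e d (m' d)).[t]| <= B ^+ 2.
  move=> e d t t01; rewrite hornerM normrM expr2.
  by apply: ler_pM => //; exact: (jP_le hB).
apply: le_trans (ler_normD _ _) _.
rewrite /acoef_cst mulrCA mulrDr mulr1 mulrDr [_ * (_ * _) in leRHS]mulrCA.
have mc := measurable_cell sigma a i; have mcO := measurable_cellOm i.
apply: lerD; first exact: (cpoly_int_bound s0 mcO (@subIsetl _ _ _) hb).
rewrite normrM [leRHS](_ : _ = `|eps| * (D.+1%:R * ((B ^+ 2) ^+ D.+1 * sigma ^+ D.+1))); last by ring.
rewrite ler_wpM2l//; apply: le_trans (ler_norm_sum _ _ _) _.
apply: (@le_trans _ _ (\sum_(d < D.+1) (B ^+ 2) ^+ D.+1 * sigma ^+ D.+1)).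
  apply: ler_sum => d _; rewrite normrM -[leRHS]mul1r ler_pM//; first by case: (gh d i); rewrite ?normr1 ?normr0.
  by apply: (cpoly_int_bound s0) => //; exact: hj.
by rewrite sumr_const card_ord -[leLHS]mulr_natl.
Qed.

Variable g : multi_index D.+1 -> V -> R.
Hypotheses (lg : forall al, (mi_order al <= k)%N -> locint (g al)).
Hypotheses (wg : forall al d, (mi_order al < k)%N -> wpart d (g al) (g (minc al d))).
Notation HH := (HH sigma n k g).
Notation hr := (hr sigma a n k g).
Hypothesis finH : forall j, (\int[mu]_(x in cell j) HH x < +oo)%E.
Variables (u w : V -> R) (x : Z -> R) (eps : R) (K : nat).
Hypotheses (eps1 : 1 <= eps) (chK : chain_condition sigma a Om K) (iu : mu.-integrable Om (EFin \o u)).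
Hypotheses (ug : {ae mu, forall y, Om y -> u y = g mi0 y}) (rw : rep w x).
Hypotheses (wE : forall v, spline_on sigma a Om n v -> A_eps sigma a Om n eps w v = mass_form Om u v).

Let BN0 : 0 <= B ^+ D.+1. Proof. by rewrite exprn_ge0// (B0 hB). Qed.
Let sk0 : 0 <= sigma ^+ k. Proof. by rewrite exprn_ge0// ltW. Qed.
Let sN0 : 0 < sigma ^+ D.+1. Proof. by rewrite exprn_gt0. Qed.
Let hr0 j : 0 <= hr j. Proof. exact: hr_ge0. Qed.

Lemma gsum_bound (P : 'I_D.+1 -> nat -> {poly R}) (b : Lx -> R) i y :
  (forall d j t, (j <= n)%N -> 0 <= t <= 1 -> `|(P d j).[t]| <= B) -> cell i y ->
  `|gsum P b i y| <= B ^+ D.+1 * \sum_m `|b m|.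
Proof.
move=> hP cy; apply: le_trans (ler_norm_sum _ _ _) _; rewrite mulr_sumr; apply: ler_sum => m _.
rewrite normrM mulrC ler_wpM2r//; apply: (cpoly_bound s0 _ cy) => d t; apply: hP; by rewrite -ltnS.
Qed.

Lemma cell_int_bound W (F : V -> R) i c1 c2 : measurable W -> W `<=` cell i -> 0 <= c1 -> 0 <= c2 ->
  mu.-integrable W (EFin \o F) ->
  {ae mu, forall y, cell i y -> (`|F y|%:E <= c1%:E * HH y + c2%:E)%E} ->
  `|\int[mu]_(y in W) F y| <= sigma ^+ D.+1 * (c1 * hr i + c2).
Proof.
move=> mW sW c10 c20 iF hF; have mH := measurable_HH n s0 lg.
have H0 y : (0 <= HH y)%E by exact: HH_ge0.
have mc := measurable_cell sigma a i.
rewrite -lee_fin (EFin_normr_Rintegral mW iF).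
apply: le_trans (le_abse_integral mu mW (integrableP _ _ _ iF).1) _.
have mPhi : measurable_fun setT (fun y => (c1%:E * HH y + c2%:E)%E).
  by apply: emeasurable_funD; [apply: emeasurable_funM => //; exact: measurable_cst|exact: measurable_cst].
have Phi0 y : (0 <= c1%:E * HH y + c2%:E)%E by rewrite adde_ge0 ?mule_ge0 ?lee_fin.
apply: (@le_trans _ _ (\int[mu]_(y in W) (c1%:E * HH y + c2%:E))%E).
  apply: ae_ge0_le_integral => //.
  - by apply: measurableT_comp => //; exact: (integrableP _ _ _ iF).1.
  - exact: measurable_funTS.
  - by apply: filterS hF => y hy /sW; exact: hy.
apply: (@le_trans _ _ (\int[mu]_(y in cell i) (c1%:E * HH y + c2%:E))%E).
  by apply: ge0_subset_integral => //; exact: measurable_funTS.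
rewrite ge0_integralD//.
- rewrite ge0_integralZl//; last exact: measurable_funTS.
  have IC : (\int[mu]_(_ in cell i) c2%:E = (c2 * sigma ^+ D.+1)%:E)%E.
    by rewrite (integral_cst mu mc c2%:E) EFinM; congr (_ * _)%E; exact: measure_cell.
  rewrite IC mulrDr EFinD mulrCA !EFinM (hrE s0 finH i).
  have -> : ((sigma ^+ D.+1)%:E * ((sigma ^+ D.+1)^-1%:E * \int[mu]_(y in cell i) HH y) = \int[mu]_(y in cell i) HH y)%E.
    by rewrite muleA -EFinM mulfV ?gt_eqF// mul1e.
  by rewrite [((sigma ^+ D.+1)%:E * c2%:E)%E]muleC.
- by move=> y _; rewrite mule_ge0.
- by apply: emeasurable_funM; [exact: measurable_cst|exact: measurable_funTS].
Qed.

Definition zc (j : Z) : R := lam sigma a j (zeroL D n) (g mi0).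
(** Equal to 1 if [j] is among the local coefficients of cell [i], and to 0 otherwise. *)
Definition ind (i j : Z) : R := \sum_(m : Lx) (i - off m == j)%:R.
Definition hsum (i : Z) : R := \sum_(m : Lx) hr (i - off m).

Lemma hsum_ge0 i : 0 <= hsum i. Proof. by rewrite sumr_ge0. Qed.

Lemma hr_hsum i : hr i <= hsum i.
Proof. by rewrite /hsum (bigD1 (zeroL D n))//= off0 subr0 lerDl sumr_ge0. Qed.

Definition Gd (P : 'I_D.+1 -> nat -> {poly R}) i j : V -> R := gsum P (fun m : Lx => delta j (i - off m)) i.

Lemma Gd_bound P i j y : (forall d l t, (l <= n)%N -> 0 <= t <= 1 -> `|(P d l).[t]| <= B) -> cell i y ->
  `|Gd P i j y| <= B ^+ D.+1 * ind i j.
Proof.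
move=> hP cy; apply: le_trans (gsum_bound _ hP cy) _; rewrite ler_wpM2l// le_eqVlt; apply/orP; left; apply/eqP.
by apply: eq_bigr => m _; rewrite /delta ger0_norm.
Qed.

Let bpB (d : 'I_D.+1) j t : (j <= n)%N -> 0 <= t <= 1 -> `|(bpP d j).[t]| <= B. Proof. exact: (bp_le hB). Qed.
Let jPB e (d : 'I_D.+1) j t : (j <= n)%N -> 0 <= t <= 1 -> `|(jP e d j).[t]| <= B. Proof. exact: (jP_le hB). Qed.

Definition Zs (P : 'I_D.+1 -> nat -> {poly R}) i : V -> R := gsum P (loc zc i) i.

(** The share of cell [i] in the residual at the B-spline [j]: the consistency error of the
    quasi-interpolant on the part of the cell inside the domain, minus its jump terms. *)
Definition Tres i j : R :=
  \int[mu]_(y in cell i `&` Om) ((g mi0 y - Zs bpP i y) * Gd bpP i j y) -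
  eps * \sum_d (gh d i)%:R * \int[mu]_(y in cell i) (Zs (jP d) i y * Gd (jP d) i j y).

Lemma measurable_gsum P (b : Lx -> R) i : measurable_fun (cell i) (gsum P b i).
Proof.
apply/measurable_EFinP.
exact: (integrableP _ _ _ (Rint_sum b (measurable_cell sigma a i) (fun m : Lx => (cell_integral a s0 (fun d => P d (m d)) i).1)).1).1.
Qed.

Lemma integrable_gsum P (b : Lx -> R) i : mu.-integrable (cell i) (EFin \o gsum P b i).
Proof. exact: (Rint_sum b (measurable_cell sigma a i) (fun m : Lx => (cell_integral a s0 (fun d => P d (m d)) i).1)).1. Qed.

Lemma integrable_Zs P i : mu.-integrable (cell i) (EFin \o Zs P i).
Proof. exact: integrable_gsum. Qed.

Lemma integrable_mulG (F : V -> R) P i j : (forall d l t, (l <= n)%N -> 0 <= t <= 1 -> `|(P d l).[t]| <= B) ->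
  mu.-integrable (cell i) (EFin \o F) -> mu.-integrable (cell i) (EFin \o (fun y => F y * Gd P i j y)).
Proof.
move=> hP iF; have mG : measurable_fun (cell i) (Gd P i j) by exact: measurable_gsum.
have bG y : cell i y -> `|Gd P i j y| <= B ^+ D.+1 * ind i j by exact: Gd_bound.
exact: (integrable_bdd_mul (measurable_cell sigma a i) iF mG bG).
Qed.

Let l0 : locint (g mi0). Proof. by apply: lg; rewrite mi_order0. Qed.

Let cO_cell i : cell i `&` Om `<=` cell i. Proof. exact: subIsetl. Qed.

Let integrable_cO F i : mu.-integrable (cell i) (EFin \o F) -> mu.-integrable (cell i `&` Om) (EFin \o F).
Proof. by apply: integrableS => //; [exact: measurable_cell|exact: measurable_cellOm]. Qed.

Lemma integrable_g0Z i j : mu.-integrable (cell i `&` Om) (EFin \o (fun y => (g mi0 y - Zs bpP i y) * Gd bpP i j y)).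
Proof.
have mc := measurable_cell sigma a i.
have i1 : mu.-integrable (cell i) (EFin \o (fun y => g mi0 y - Zs bpP i y)).
  have h1 : mu.-integrable (cell i) (EFin \o g mi0) by exact: locint_cell.
  have h2 := integrable_Zs bpP i; exact: (integrableB mc h1 h2).
by apply: integrable_cO; apply: integrable_mulG.
Qed.

(** The equation for [w] is tested with the B-spline [j], and [u] is replaced by [g mi0], with which
    it agrees almost everywhere on the domain. *)
Lemma residual j : j \in coefs ->
  sigma ^+ D.+1 * Aloc (@off D n) els (acoef eps) (fun z => x z - zc z) (delta j) = \sum_(i <- els) Tres i j.
Proof.
move=> jc; rewrite Aloc_sub mulrBr.
have rB := rep_Bs jc.
have mO := open_measurable_rV oOm.
have mu_ : measurable_fun Om u by apply/measurable_EFinP; exact: (integrableP _ _ _ iu).1.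
have mB : measurable_fun Om (Bs j) by apply: measurable_funTS; exact: measurable_Bs.
have mg : measurable_fun Om (g mi0) by apply: measurable_funTS; exact: l0.1.
have E1 : sigma ^+ D.+1 * Aloc (@off D n) els (acoef eps) x (delta j) =
    \sum_(i <- els) \int[mu]_(y in cell i `&` Om) (g mi0 y * Gd bpP i j y).
  rewrite -(A_epsE eps rw rB) wE; last exact: rep_spline_on rB.
  transitivity (\int[mu]_(y in Om) (g mi0 y * Bs j y)).
    rewrite /mass_form /Rintegral; congr fine; apply: ae_eq_integral => //.
    - by apply/measurable_EFinP; exact: measurable_funM.
    - by apply/measurable_EFinP; exact: measurable_funM.
    - by apply: filterS ug => y uy oy; rewrite uy.
  have ii i : i \in els -> mu.-integrable (cell i `&` Om) (EFin \o (fun y => g mi0 y * Bs j y)).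
    move=> _; have [C hC] := Bs_bounded j.
    apply: integrable_cO; apply: (integrable_bdd_mul (measurable_cell sigma a i) _ _ (fun y _ => hC y)).
      exact: locint_cell.
    by apply: measurable_funTS; exact: measurable_Bs.
  have mgB : measurable_fun Om (fun y => g mi0 y * Bs j y) by exact: measurable_funM.
  rewrite (Om_split mgB ii).2 big_seq [RHS]big_seq; apply: eq_bigr => i /elsP ei.
  by apply: eq_Rintegral => y /set_mem[cy _]; rewrite (rep_cell rB ei cy).
rewrite E1 Aloc_local// -sumrB; apply: eq_bigr => i _; rewrite /local_form /Tres opprD addrA; congr (_ - _).
have i1 : mu.-integrable (cell i `&` Om) (EFin \o (fun y => g mi0 y * Gd bpP i j y)).
  apply: integrable_cO; apply: integrable_mulG => //.
  exact: locint_cell.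
have i2 : mu.-integrable (cell i `&` Om) (EFin \o (fun y => Zs bpP i y * Gd bpP i j y)).
  apply: integrable_cO; apply: integrable_mulG => //.
  exact: integrable_Zs.
rewrite -RintegralB//; last exact: measurable_cellOm.
by apply: eq_Rintegral => y _; rewrite mulrBl.
Qed.

Definition res_cst : R := B ^+ D.+1 * (1 + B ^+ D.+1 * B ^+ D.+1) * (1 + eps * D.+1%:R).

(** The local polynomial is inserted: [g] differs from it by at most [sigma^k HH], the coefficients
    of the quasi-interpolant differ from those of the polynomial by averages of [HH], and the
    polynomial has no jumps. Only upper bounds of integrals over the cut part of the cell are used,
    so its shape does not matter. *)
Lemma Tres_bound i j : `|Tres i j| <= sigma ^+ D.+1 * (sigma ^+ k * res_cst * ind i j * hsum i).
Proof.
have [P [pl [[mP PE] jpl zpl gP _]]] := local_approx s0 n0 kn hB lg wg finH i.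
have ind0 : 0 <= ind i j by rewrite sumr_ge0.
have e0 : 0 <= eps by exact: le_trans eps1.
have S0 := hsum_ge0 i.
have zpl_sum : \sum_(m : Lx) `|zc (i - off m) - pl (i - off m)| <= B ^+ D.+1 * sigma ^+ k * hsum i.
  by rewrite mulr_sumr; apply: ler_sum => m _; exact: zpl.
have A : `|\int[mu]_(y in cell i `&` Om) ((g mi0 y - Zs bpP i y) * Gd bpP i j y)| <=
    sigma ^+ D.+1 * (B ^+ D.+1 * ind i j * sigma ^+ k * hr i + B ^+ D.+1 * ind i j * (B ^+ D.+1 * (B ^+ D.+1 * sigma ^+ k * hsum i))).
  apply: (cell_int_bound (measurable_cellOm i) (@cO_cell i) _ _ (integrable_g0Z i j)).
  - by rewrite !mulr_ge0.
  - by rewrite !mulr_ge0.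
  apply: filterS gP => y hy cy; have hy2 := hy cy.
  have E : g mi0 y - Zs bpP i y = (g mi0 y - P y) - gsum bpP (fun m : Lx => zc (i - off m) - pl (i - off m)) i y.
    by rewrite gsum_sub -PE// /Zs; ring.
  rewrite normrM EFinM E; have G1 := Gd_bound j bpB cy.
  apply: (@le_trans _ _ ((`|g mi0 y - P y| + B ^+ D.+1 * (B ^+ D.+1 * sigma ^+ k * hsum i)) * (B ^+ D.+1 * ind i j))%:E).
    rewrite lee_fin ler_pM//; apply: le_trans (ler_normB _ _) _; rewrite lerD2l.
    by apply: le_trans (gsum_bound _ bpB cy) _; rewrite ler_wpM2l.
  rewrite [leLHS](_ : _ = (B ^+ D.+1 * ind i j)%:E * `|g mi0 y - P y|%:E +
     (B ^+ D.+1 * ind i j * (B ^+ D.+1 * (B ^+ D.+1 * sigma ^+ k * hsum i)))%:E)%E; last first.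
    by rewrite -EFinM -EFinD; congr (_%:E); ring.
  by apply: leeD => //; rewrite [(B ^+ D.+1 * ind i j * sigma ^+ k)%:E]EFinM -muleA lee_wpmul2l ?lee_fin ?mulr_ge0.
have F d : `|\int[mu]_(y in cell i) (Zs (jP d) i y * Gd (jP d) i j y)| <=
    sigma ^+ D.+1 * (0 * hr i + B ^+ D.+1 * ind i j * (B ^+ D.+1 * (B ^+ D.+1 * sigma ^+ k * hsum i))).
  apply: cell_int_bound => //.
  - exact: measurable_cell.
  - by rewrite !mulr_ge0.
  - by apply: integrable_mulG; [exact: jPB|exact: integrable_Zs].
  apply: aeW => y cy; rewrite mul0e add0e lee_fin normrM mulrC ler_pM//; first exact: (Gd_bound j (@jPB d) cy).
  have -> : Zs (jP d) i y = gsum (jP d) (fun m : Lx => zc (i - off m) - pl (i - off m)) i y.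
    by rewrite gsum_sub jpl// subr0.
  by apply: le_trans (gsum_bound _ (@jPB d) cy) _; rewrite ler_wpM2l.
apply: le_trans (ler_normB _ _) _.
have F2 : `|eps * \sum_d (gh d i)%:R * \int[mu]_(y in cell i) (Zs (jP d) i y * Gd (jP d) i j y)| <=
    eps * (D.+1%:R * (sigma ^+ D.+1 * (B ^+ D.+1 * ind i j * (B ^+ D.+1 * (B ^+ D.+1 * sigma ^+ k * hsum i))))).
  rewrite normrM (ger0_norm e0) ler_wpM2l//; apply: le_trans (ler_norm_sum _ _ _) _.
  rewrite [leRHS](_ : _ = \sum_(d < D.+1) sigma ^+ D.+1 * (B ^+ D.+1 * ind i j * (B ^+ D.+1 * (B ^+ D.+1 * sigma ^+ k * hsum i)))); last first.
    by rewrite sumr_const card_ord mulr_natl.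
  apply: ler_sum => d _.
  have := F d; rewrite mul0r add0r => Fd; apply: le_trans Fd; rewrite normrM -[leRHS]mul1r ler_wpM2r//.
  by case: (gh d i); rewrite ?normr1 ?normr0 ?ler01.
have h1 := hr_hsum i; rewrite /res_cst.
set b := B ^+ D.+1 in A F2 *; set s := sigma ^+ D.+1 in A F2 *; set q := sigma ^+ k in A F2 *.
have X : s * (b * ind i j * q * hr i) <= s * (b * ind i j * q * hsum i).
  by rewrite ler_wpM2l ?(ltW sN0)// ler_wpM2l// !mulr_ge0.
(* This nonnegative term is added so that the bound factors as in [res_cst]. *)
have Y : 0 <= eps * (D.+1%:R * (s * (b * ind i j * q * hsum i))) by rewrite !mulr_ge0// ltW.
rewrite [leRHS](_ : _ = s * (b * ind i j * q * hsum i) + s * (b * ind i j * (b * (b * q * hsum i))) +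
  eps * (D.+1%:R * (s * (b * ind i j * (b * (b * q * hsum i))))) + eps * (D.+1%:R * (s * (b * ind i j * q * hsum i)))); last by ring.
rewrite mulrDr in A; lra.
Qed.

(** Collects the averages from all cells that have [j] among their local coefficients. *)
Definition nearh j : R := \sum_(m : Lx) hsum (j + off m).

Lemma nearh_ge0 j : 0 <= nearh j. Proof. by rewrite sumr_ge0// => m _; exact: hsum_ge0. Qed.

Lemma res_ge0 : 0 <= res_cst.
Proof. by rewrite /res_cst !mulr_ge0 ?addr_ge0 ?mulr_ge0//; exact: le_trans eps1. Qed.

Lemma residual_bound j : j \in coefs ->
  `|Aloc (@off D n) els (acoef eps) (fun z => x z - zc z) (delta j)| <= sigma ^+ k * res_cst * nearh j.
Proof.
move=> jc; rewrite -(ler_pM2l sN0) -{1}(gtr0_norm sN0) -normrM residual//.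
apply: le_trans (ler_norm_sum _ _ _) _.
apply: (@le_trans _ _ (\sum_(i <- els) sigma ^+ D.+1 * (sigma ^+ k * res_cst * ind i j * hsum i))).
  by apply: ler_sum => i _; exact: Tres_bound.
rewrite -mulr_sumr ler_wpM2l ?(ltW sN0)//.
under eq_bigr do rewrite -mulrA; rewrite -mulr_sumr ler_wpM2l ?(mulr_ge0 sk0 res_ge0)//.
rewrite /nearh /ind; under eq_bigr do rewrite mulr_suml; rewrite exchange_big/=; apply: ler_sum => m _.
have [je|je] := boolP (j + off m \in els).
  rewrite (bigD1_seq (j + off m))//= addrK eqxx mul1r big1 ?addr0// => i ne.
  by rewrite subr_eq (negbTE ne) mul0r.
rewrite big_seq big1 ?hsum_ge0// => i ie; rewrite subr_eq; case: eqVneq => [E|]; last by rewrite mul0r.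
by rewrite -E ie in je.
Qed.

Definition ee : Z -> R := restr (fun z => x z - zc z).

Variables (t Cd : R).
Hypotheses (Cd0 : 0 <= Cd) (t01 : 0 < t < 1).
Hypotheses (dec : decay_bound (@off D n) (coer_cst D n K) (acoef_cst eps) t Cd).

(** [ee] solves the form equation on [coefs] with the residual as right-hand side, so [dec] applies
    with the bounds of [coercive] and [acoef_bound]. *)
Lemma ee_bound i : `|ee i| <= Cd * (sigma ^+ k * res_cst * \sum_(j <- coefs) expw t (j - i) * nearh j).
Proof.
have h := dec els_uniq coefs_uniq (acoef_bound eps) (fun y _ => coercive y eps1 chK).
have := h ee (fun j => Aloc (@off D n) els (acoef eps) (fun z => x z - zc z) (delta j)) (@restr_supp _).
move=> /(_ _ i) h2; apply: le_trans (h2 _) _.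
  move=> y ys; have yE : y = restr y by apply/funext => j; rewrite /restr; case: ifPn => // /ys.
  rewrite {1}yE /ee Aloc_restr// Aloc_coefs//; apply: eq_bigr => j _; exact: mulrC.
rewrite ler_wpM2l// mulr_sumr big_seq [leRHS]big_seq; apply: ler_sum => j jc.
rewrite mulrCA ler_wpM2l ?expw_ge0//; first by have /andP[/ltW] := t01.
exact: residual_bound.
Qed.

(** All cell averages that influence the error on cell [i]: those near the cell, from the
    quasi-interpolant, and the exponentially weighted distant ones, from inverting the form. *)
Definition QQ i : R := hsum i + \sum_(m : Lx) \sum_(j <- coefs) expw t (j - (i - off m)) * nearh j.

Definition pt_cst : R := B ^+ D.+1 * (B ^+ D.+1 + Cd * res_cst).

Lemma QQ_ge0 i : 0 <= QQ i.
Proof.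
rewrite addr_ge0 ?hsum_ge0// sumr_ge0// => m _; rewrite sumr_ge0// => j _; rewrite mulr_ge0 ?nearh_ge0// expw_ge0//.
by have /andP[/ltW] := t01.
Qed.

Lemma pt_ge0 : 0 <= pt_cst.
Proof. by rewrite mulr_ge0// addr_ge0// mulr_ge0// res_ge0. Qed.

Lemma cpoly_dP_bound (al : multi_index D.+1) (m : Lx) i y : (forall d, al d <= n)%N -> cell i y ->
  `|cpoly (fun d => dP al d (m d)) i y| <= sigma^-1 ^+ mi_order al * B ^+ D.+1.
Proof.
move=> aln cy; have -> : cpoly (fun d => dP al d (m d)) i y = sigma^-1 ^+ mi_order al * cpoly (fun d => (bp n (m d))^`(al d)) i y.
  rewrite /Submission.cpoly /tens /mi_order -prodrXr -big_split/=; apply: eq_bigr => d _.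
  by rewrite /Submission.dP hornerZ.
rewrite normrM ger0_norm ?exprn_ge0 ?invr_ge0 ?(ltW s0)// ler_wpM2l ?exprn_ge0 ?invr_ge0 ?(ltW s0)//.
have [_ h _ _] := hB; have mn d : (m d <= n)%N by rewrite -ltnS.
by apply: (cpoly_bound s0 _ cy) => d s s01; exact: h.
Qed.

(** The coefficients of [w] minus those of the local polynomial are split at the quasi-interpolant,
    which leads to [ee_bound] and [local_approx]. For orders at least [k] the derivative of the
    polynomial vanishes, so [W] itself is bounded. *)
Lemma pointwise i (al : multi_index D.+1) : i \in els -> (forall d, al d <= n)%N ->
  let W := gsum (dP al) (loc x i) i in
  let bnd y := ((sigma ^+ k * sigma^-1 ^+ mi_order al)%:E * (HH y + (pt_cst * QQ i)%:E))%E in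
  ((mi_order al <= k)%N -> {ae mu, forall y, cell i y -> (`|g al y - W y|%:E <= bnd y)%E}) /\
  ((k <= mi_order al)%N -> {ae mu, forall y, cell i y -> (`|W y|%:E <= bnd y)%E}).
Proof.
move=> ie aln W bnd.
have [P [pl [_ _ zpl _ glob]]] := local_approx s0 n0 kn hB lg wg finH i.
have c0 : 0 <= sigma ^+ k * sigma^-1 ^+ mi_order al by rewrite mulr_ge0// exprn_ge0// invr_ge0 ltW.
have E y : cell i y -> `|W y - gsum (dP al) (loc pl i) i y| <=
    sigma ^+ k * sigma^-1 ^+ mi_order al * (pt_cst * QQ i).
  move=> cy; rewrite -gsum_sub.
  have -> : gsum (dP al) (fun m : Lx => x (i - off m) - pl (i - off m)) i y =
     gsum (dP al) (fun m : Lx => ee (i - off m) + (zc (i - off m) - pl (i - off m))) i y.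
    apply: gsum_ext => [m [d md]|m mL].
      by rewrite /Submission.cpoly /tens (bigD1 d)//= md dP_top// horner0 mul0r.
    by rewrite /ee restr_in//; ring.
  apply: le_trans (ler_norm_sum _ _ _) _.
  apply: (@le_trans _ _ (\sum_(m : Lx) (sigma^-1 ^+ mi_order al * B ^+ D.+1) * (Cd * (sigma ^+ k * res_cst * \sum_(j <- coefs) expw t (j - (i - off m)) * nearh j) + B ^+ D.+1 * sigma ^+ k * hr (i - off m)))).
    apply: ler_sum => m _; rewrite normrM mulrC ler_pM//; first exact: cpoly_dP_bound.
    by apply: le_trans (ler_normD _ _) _; apply: lerD; [exact: ee_bound|exact: zpl].
  rewrite -mulr_sumr big_split/= -!mulr_sumr -/(hsum i) /pt_cst /QQ.
  set S := \sum_m _; have S0 : 0 <= S.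
    rewrite sumr_ge0// => m _; rewrite sumr_ge0// => j _; rewrite mulr_ge0 ?nearh_ge0// expw_ge0//.
    by have /andP[/ltW] := t01.
  have h0 := hsum_ge0 i; have r0 := res_ge0.
  rewrite -subr_ge0 [X in 0 <= X](_ : _ = sigma ^+ k * sigma^-1 ^+ mi_order al * B ^+ D.+1 * (B ^+ D.+1 * S + Cd * res_cst * hsum i)); last by ring.
  rewrite mulr_ge0//; first by rewrite mulr_ge0.
  by rewrite addr_ge0 ?(mulr_ge0 BN0 S0) ?(mulr_ge0 (mulr_ge0 Cd0 r0) h0).
have [g1 g2] := glob al; have H0 y : (0 <= HH y)%E by exact: HH_ge0.
split=> hal.
  apply: filterS (g1 hal) => y hy cy; have hy2 := hy cy.
  rewrite /bnd ge0_muleDr//; last by rewrite lee_fin mulr_ge0 ?pt_ge0 ?QQ_ge0.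
  rewrite -EFinM; apply: le_trans (leeD hy2 (_ : ((`|W y - gsum (dP al) (loc pl i) i y|)%:E <= _)%E)); last first.
    by rewrite lee_fin; exact: E.
  rewrite -EFinD lee_fin -[_ - W y](subrKA (gsum (dP al) (loc pl i) i y)).
  by apply: le_trans (ler_normD _ _) _; rewrite lerD2l distrC.
apply: filterS (g2 hal) => y hy cy; have := E y cy; rewrite (hy cy) subr0 => h.
rewrite /bnd; apply: le_trans (_ : ((sigma ^+ k * sigma^-1 ^+ mi_order al * (pt_cst * QQ i))%:E <= _)%E); first by rewrite lee_fin.
by rewrite EFinM lee_wpmul2l ?lee_fin// leeDr.
Qed.

(** * From cell averages to averages over translates *)

Open Scope ereal_scope.

Let H0 y : 0 <= HH y. Proof. exact: HH_ge0. Qed.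
Let mH : measurable_fun setT HH. Proof. exact: (measurable_HH n s0 lg). Qed.

Definition svec (s : Z) : V := (\row_d ((s ord0 d)%:~R * sigma))%R.

(** For [y] in cell [i] the cube of half-side [sigma] around [y], moved by [s] cells, contains cell
    [i + s]. Cell averages are thus dominated by an operator that commutes with translations. *)
Definition SHi (s : Z) (y : V) : \bar R := \int[mu]_(v in @pcube R D.+1 sigma) HH (y + (v + svec s))%R.
Definition SH (s : Z) (y : V) : \bar R := (sigma ^+ D.+1)^-1%:E * SHi s y.

Let mtau s : measurable_fun setT (fun v : V => (v + svec s)%R).
Proof. exact: measurable_translate. Qed.

Let sV0 : (0 <= (sigma ^+ D.+1)^-1)%R. Proof. by rewrite invr_ge0 exprn_ge0// ltW. Qed.

Lemma SHi_ge0 s y : 0 <= SHi s y. Proof. exact: integral_ge0. Qed.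

Lemma SH_ge0 s y : 0 <= SH s y. Proof. by rewrite mule_ge0 ?lee_fin// SHi_ge0. Qed.

Let mpc : measurable (@pcube R D.+1 sigma). Proof. exact: measurable_cbox. Qed.
Let pc0 : (0 <= (2 * sigma) ^+ D.+1)%R. Proof. by rewrite exprn_ge0// mulr_ge0// ltW. Qed.

Lemma measurable_SHi s : measurable_fun setT (SHi s).
Proof.
exact: (@measurable_avg _ _ _ _ mu _ _ _ mpc (mtau s) mH H0 id (@measurable_id _ _ setT) (fun y h => h)).
Qed.

Lemma measurable_SH s : measurable_fun setT (SH s).
Proof. by apply: emeasurable_funM; [exact: measurable_cst|exact: measurable_SHi]. Qed.

(** The factor is the ratio of the volume of the averaging cube to that of a cell. *)
Lemma Lnorm_SH p s : 1 <= p -> 'N[mu]_p[SH s] <= (2 ^+ D.+1)%:E * 'N[mu]_p[HH].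
Proof.
move=> p1; rewrite /SH (Lnorm_scale _ p1 sV0 (measurable_SHi s)).
have h := Lnorm_avg mpc pc0 (measure_pcube D.+1 s0) (mtau s) mH H0 p1.
apply: le_trans (lee_wpmul2l _ h) _; first by rewrite lee_fin.
rewrite muleA -EFinM exprMn mulrCA mulVf ?mulr1//.
by rewrite expf_neq0// gt_eqF.
Qed.

Lemma hr_SH i s y : cell i y -> (hr (i + s))%:E <= SH s y.
Proof.
move=> cy; rewrite (hrE s0 finH) lee_wpmul2l ?lee_fin// /SHi.
pose F (z : V) : \bar R := HH z * (\1_(cell (i + s)) z)%:E.
have mF : measurable_fun setT F.
  by apply: emeasurable_funM => //; apply/measurable_EFinP; apply: measurable_indic; exact: measurable_cell.
have F0 z : 0 <= F z by rewrite mule_ge0// lee_fin indicE.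
rewrite integral_indicM -/F -(integral_translate (y + svec s) mF F0) [leRHS]integral_indicM.
apply: ge0_le_integral => //.
- exact: (measurableT_comp mF (measurable_translate _)).
- apply: emeasurable_funM; last by apply/measurable_EFinP; exact: measurable_indic.
  apply: (measurableT_comp mH); apply: measurable_rV => d.
  have -> : (fun z : V => (y + (z + svec s))%R ord0 d) = (fun z : V => (z ord0 d + (y ord0 d + svec s ord0 d))%R).
    by apply/funext => z; rewrite !mxE; ring.
  by apply: measurable_funD; [exact: measurable_coor|exact: measurable_cst].
move=> z _; rewrite /F (_ : z + (y + svec s) = y + (z + svec s))%R; last by rewrite addrCA.
apply: lee_wpmul2l => //; rewrite lee_fin !indicE.
have [zc|_] := boolP (_ \in cell _); last exact: ler0n.
rewrite mem_set// => d; have := (set_mem zc) d; have := cy d; rewrite /grid_coord !mxE !intrD.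
move=> /andP[h1 h2] /andP[h3 h4]; apply/andP; split; nra.
Qed.

Definition DD : seq Z := undup [seq (j - i)%R | j <- coefs, i <- els].

(** A majorant of [QQ i] on each cell [i] that no longer mentions the cell: the sum runs over all
    differences in [DD], of which those starting at [i] are a part. *)
Definition MM (y : V) : \bar R := \sum_(m : Lx) SH (- off m)%R y +
  \sum_(m : Lx) \sum_(r <- DD) (expw t (r + off m)%R)%:E * \sum_(q : Lx * Lx) SH (r + off q.1 - off q.2)%R y.

Let e0 (z : Z) : (0 <= expw t z)%R. Proof. by apply: expw_ge0; have /andP[/ltW] := t01. Qed.

Lemma sum_subseq_le (T : eqType) (s1 s2 : seq T) (F : T -> \bar R) : uniq s1 -> uniq s2 -> {subset s1 <= s2} ->
  (forall z, 0 <= F z) -> \sum_(z <- s1) F z <= \sum_(z <- s2) F z.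
Proof.
move=> u1 u2 s12 F0; have -> : \sum_(z <- s1) F z = \sum_(z <- [seq z <- s2 | z \in s1]) F z.
  apply: perm_big; apply: uniq_perm => //; first exact: filter_uniq.
  by move=> z; rewrite mem_filter; case: (boolP (z \in s1)) => // /s12 ->.
rewrite big_filter [leRHS](bigID (fun z => z \in s1))/= leeDl//.
exact: sume_ge0.
Qed.

Lemma QQ_MM i y : i \in els -> cell i y -> (QQ i)%:E <= MM y.
Proof.
move=> ie cy; rewrite /QQ /MM EFinD; apply: leeD.
  by rewrite /hsum -sumEFin; apply: lee_sum => m _; exact: hr_SH.
rewrite -sumEFin; apply: lee_sum => m _; rewrite -sumEFin.
pose F (r : Z) := (expw t (r + off m)%R)%:E * \sum_(q : Lx * Lx) SH (r + off q.1 - off q.2)%R y.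
have F0 r : 0 <= F r by rewrite mule_ge0 ?lee_fin//; apply: sume_ge0 => q _; exact: SH_ge0.
apply: (@le_trans _ _ (\sum_(r <- [seq (j - i)%R | j <- coefs]) F r)).
  rewrite big_map; apply: lee_sum => j _; rewrite EFinM /F.
  have -> : (j - (i - off m) = j - i + off m)%R by rewrite opprB addrA addrAC.
  rewrite lee_wpmul2l ?lee_fin// /nearh /hsum pair_bigA/= -sumEFin; apply: lee_sum => q _.
  have -> : (j + off q.1 - off q.2 = i + (j - i + off q.1 - off q.2))%R by rewrite !addrA [(i + j)%R]addrC addrK.
  exact: hr_SH.
apply: sum_subseq_le => //.
- rewrite map_inj_uniq ?coefs_uniq// => j j'; exact: addIr.
- exact: undup_uniq.
- by move=> _ /mapP[j jc ->]; rewrite mem_undup; apply/allpairsP; exists (j, i).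
Qed.

Lemma measurable_MM : measurable_fun setT MM.
Proof.
apply: emeasurable_funD; first by apply: emeasurable_sum => m; exact: measurable_SH.
apply: emeasurable_sum => m; apply: emeasurable_sum => r; apply: emeasurable_funM; first exact: measurable_cst.
by apply: emeasurable_sum => q; exact: measurable_SH.
Qed.

Lemma MM_ge0 y : 0 <= MM y.
Proof.
rewrite adde_ge0//; first by apply: sume_ge0 => m _; exact: SH_ge0.
apply: sume_ge0 => m _; apply: sume_ge0 => r _; rewrite mule_ge0 ?lee_fin//.
by apply: sume_ge0 => q _; exact: SH_ge0.
Qed.

Definition MM_cst : R := ((#|{: Lx}|)%:R * 2 ^+ D.+1 + (#|{: Lx}|)%:R * ((2 / (1 - t)) ^+ D.+1 * ((#|{: Lx * Lx}|)%:R * 2 ^+ D.+1)))%R.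

Let sum_cst (I : finType) (X : \bar R) : 0 <= X -> \sum_(i : I) X = (#|{: I}|)%:R%:E * X.
Proof.
move=> X0; rewrite big_const; elim: #|I| => [|m IH]; first by rewrite mul0e.
by rewrite iterS IH -natr1 addrC EFinD ge0_muleDl ?lee_fin// mul1e.
Qed.

(** Minkowski's inequality for the sums of [SH]. The weights add up to at most
    [(2 / (1 - t)) ^+ D.+1] whatever the list [DD], so the number of cells does not enter. *)
Lemma Lnorm_MM p : 1 <= p -> 'N[mu]_p[MM] <= MM_cst%:E * 'N[mu]_p[HH].
Proof.
move=> p1; set N := 'N[mu]_p[HH]; have N0 : 0 <= N by exact: Lnorm_ge0.
pose T2 (m : Lx) (r : Z) (y : V) : \bar R := (expw t (r + off m)%R)%:E * \sum_(q : Lx * Lx) SH (r + off q.1 - off q.2)%R y.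
have mS r : measurable_fun setT (fun y => \sum_(q : Lx * Lx) SH (r + off q.1 - off q.2)%R y).
  by apply: emeasurable_sum => q; exact: measurable_SH.
have S0 r y : 0 <= \sum_(q : Lx * Lx) SH (r + off q.1 - off q.2)%R y by apply: sume_ge0 => q _; exact: SH_ge0.
have mT m r : measurable_fun setT (T2 m r) by apply: emeasurable_funM; [exact: measurable_cst|exact: mS].
have T0 m r y : 0 <= T2 m r y by rewrite mule_ge0 ?lee_fin.
have mT1 m : measurable_fun setT (fun y => \sum_(r <- DD) T2 m r y) by exact: emeasurable_sum.
have T10 m y : 0 <= \sum_(r <- DD) T2 m r y by exact: sume_ge0.
have c2 : (0 <= 2 ^+ D.+1 :> R)%R by exact: exprn_ge0.
have AS (I : finType) (r : I -> Z) : Lnorm mu p (fun y => \sum_(m : I) SH (r m) y) <= ((#|{: I}|)%:R * 2 ^+ D.+1)%:E * N.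
  apply: le_trans (Lnorm_sum _ _ p1 _ _) _ => //; [by move=> m; exact: measurable_SH|by move=> m y; exact: SH_ge0|].
  apply: (@le_trans _ _ (\sum_(m : I) (2 ^+ D.+1)%:E * N)); first by apply: lee_sum => m _; exact: Lnorm_SH.
  by rewrite sum_cst// ?mule_ge0 ?lee_fin// muleA -EFinM.
have A1 := AS _ (fun m : Lx => - off m)%R.
have A2 r := AS _ (fun q : Lx * Lx => r + off q.1 - off q.2)%R.
have A3 m : Lnorm mu p (fun y => \sum_(r <- DD) T2 m r y) <= ((2 / (1 - t)) ^+ D.+1 * ((#|{: Lx * Lx}|)%:R * 2 ^+ D.+1))%:E * N.
  apply: le_trans (Lnorm_sum _ _ p1 _ _) _ => //.
  apply: (@le_trans _ _ (\sum_(r <- DD) (expw t (r + off m)%R)%:E * (((#|{: Lx * Lx}|)%:R * 2 ^+ D.+1)%:E * N))).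
    apply: lee_sum => r _; rewrite /T2 (Lnorm_scale _ p1 _ (mS r))//.
    by rewrite lee_wpmul2l ?lee_fin.
  rewrite -ge0_sume_distrl; last by move=> r _; rewrite lee_fin.
  rewrite [in leRHS]EFinM -muleA lee_wpmul2r ?mule_ge0 ?lee_fin ?mulr_ge0// sumEFin lee_fin.
  rewrite -(big_map (fun r => r + off m)%R predT (fun z => expw t z)); apply: sum_expw.
    by have /andP[/ltW -> ->] := t01.
  by rewrite map_inj_uniq ?undup_uniq// => r r'; exact: addIr.
apply: le_trans (@Lnorm_add _ _ _ mu p (fun y => \sum_(m : Lx) SH (- off m)%R y)
  (fun y => \sum_(m : Lx) \sum_(r <- DD) T2 m r y) p1 _ _ _ _) _.
- by apply: emeasurable_sum => m; exact: measurable_SH.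
- by move=> y; apply: sume_ge0 => m _; exact: SH_ge0.
- by apply: emeasurable_sum => m; exact: mT1.
- by move=> y; apply: sume_ge0 => m _; exact: T10.
have t1 : (0 <= 2 / (1 - t))%R by rewrite divr_ge0// subr_ge0; have /andP[_ /ltW] := t01.
rewrite /MM_cst EFinD ge0_muleDl ?lee_fin ?mulr_ge0 ?exprn_ge0//; apply: leeD => //.
apply: le_trans (Lnorm_sum _ _ p1 _ _) _ => //.
apply: (@le_trans _ _ (\sum_(m : Lx) ((2 / (1 - t)) ^+ D.+1 * ((#|{: Lx * Lx}|)%:R * 2 ^+ D.+1))%:E * N)).
  by apply: lee_sum => m _; exact: A3.
rewrite sum_cst//; last by rewrite mule_ge0 ?lee_fin ?mulr_ge0 ?exprn_ge0.
by rewrite muleA -EFinM.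
Qed.

Lemma MM_cst_ge0 : (0 <= MM_cst)%R.
Proof.
have t1 : (0 <= 2 / (1 - t))%R by rewrite divr_ge0// subr_ge0; have /andP[_ /ltW] := t01.
by rewrite /MM_cst addr_ge0 ?mulr_ge0 ?exprn_ge0.
Qed.

(** * Majorant of all derivatives and norm estimates *)

Notation pt := pt_cst.
Notation HHc := (@HH_cst R D n k).
Variables (v : V -> R) (p : \bar R).
Hypotheses (s1 : (sigma <= 1)%R) (wv : forall al, (mi_order al <= k)%N -> is_weak_partial setT v al (g al)).
Hypotheses (p1 : 1 <= p).

Let mg al : (mi_order al <= k)%N -> measurable_fun setT (g al).
Proof. by move=> /lg[]. Qed.

Let pt0 : (0 <= pt)%R. Proof. exact: pt_ge0. Qed.
Let mM : measurable_fun setT MM. Proof. exact: measurable_MM. Qed.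
Let M0 y : 0 <= MM y. Proof. exact: MM_ge0. Qed.
Let GS : \bar R := \sum_(al <- mis k.+1) 'N[mu]_p[EFin \o g al].
Let Hcst : (0 <= HHc)%R. Proof. exact: HH_cst_ge0. Qed.
Let NH : 'N[mu]_p[HH] <= HHc%:E * GS. Proof. exact: Lnorm_HH. Qed.

Definition gk (al : multi_index D.+1) (y : V) : \bar R := if (mi_order al <= k)%N then `|g al y|%:E else 0.

Let gk0 al y : 0 <= gk al y. Proof. by rewrite /gk; case: ifP. Qed.

Let mgk al : measurable_fun setT (gk al).
Proof.
rewrite /gk; have [ak|_] := boolP (mi_order al <= k)%N; last exact: measurable_cst.
by apply/measurable_EFinP; apply: measurableT_comp => //; exact: mg.
Qed.

(** The last sum pays for the triangle inequality that passes from the error to [w] itself at orders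
    below [k]. *)
Definition majorant y : \bar R := HH y + pt%:E * MM y + \sum_(al <- mis k.+1) gk al y.

Let S0 y : 0 <= \sum_(al <- mis k.+1) gk al y.
Proof. exact: sume_ge0. Qed.

Let mS : measurable_fun setT (fun y => \sum_(al <- mis k.+1) gk al y).
Proof.
by apply: emeasurable_sum => al; exact: mgk.
Qed.

Lemma majorant_ge0 y : 0 <= majorant y.
Proof. by rewrite adde_ge0// adde_ge0// mule_ge0. Qed.

Let mpM : measurable_fun setT (fun y => pt%:E * MM y).
Proof. by apply: emeasurable_funM => //; exact: measurable_cst. Qed.

Let pM0 y : 0 <= pt%:E * MM y. Proof. by rewrite mule_ge0. Qed.

Lemma measurable_majorant : measurable_fun setT majorant.
Proof. by rewrite /majorant; apply: emeasurable_funD; [apply: emeasurable_funD|]. Qed.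

Definition majorant_cst : R := (HHc * (1 + pt * MM_cst) + 1)%R.

Lemma Lnorm_majorant : 'N[mu]_p[majorant] <= majorant_cst%:E * GS.
Proof.
have MC := MM_cst_ge0.
have GS0 : 0 <= GS by apply: sume_ge0 => al _; exact: Lnorm_ge0.
have NM : Lnorm mu p (fun y => pt%:E * MM y) <= (HHc * (pt * MM_cst))%:E * GS.
  rewrite (Lnorm_scale _ p1 pt0 mM) mulrCA [in leRHS]EFinM -muleA; apply: lee_wpmul2l => //.
  apply: le_trans (Lnorm_MM p1) _; rewrite [(_ * MM_cst)%R]mulrC EFinM -muleA.
  by apply: lee_wpmul2l; [rewrite lee_fin|exact: NH].
have NS : Lnorm mu p (fun y => \sum_(al <- mis k.+1) gk al y) <= GS.
  apply: le_trans (Lnorm_sum _ _ p1 mgk gk0) _.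
  rewrite /GS big_seq [leRHS]big_seq; apply: lee_sum => al; rewrite mem_mis ltnS => ak.
  rewrite (_ : gk al = abse \o (EFin \o g al)); last by apply/funext => y; rewrite /gk ak.
  rewrite Lnorm_abse; exact: lexx.
apply: le_trans (Lnorm_add _ p1 _ _ _ _) _ => //.
- exact: emeasurable_funD.
- by move=> y; rewrite adde_ge0.
have c1 : (0 <= pt * MM_cst)%R by exact: mulr_ge0.
have c2 : (0 <= HHc * (1 + pt * MM_cst))%R.
  by apply: mulr_ge0 Hcst _; exact: addr_ge0.
have c3 : (0 <= HHc * (pt * MM_cst))%R by exact: mulr_ge0.
rewrite /majorant_cst EFinD ge0_muleDl ?lee_fin// mul1e.
apply: leeD => //; apply: le_trans (Lnorm_add _ p1 _ _ _ _) _ => //.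
rewrite mulrDr mulr1 EFinD ge0_muleDl ?lee_fin//.
exact: leeD.
Qed.

Definition scl l : R := (sigma ^+ k * sigma^-1 ^+ l)%R.

Lemma scl_ge0 l : (0 <= scl l)%R.
Proof. by rewrite mulr_ge0// exprn_ge0// ?invr_ge0 ltW. Qed.

Let sV1 : (1 <= sigma^-1)%R. Proof. by rewrite invf_ge1. Qed.

(** Here [sigma <= 1] enters: in a norm of order [l] the lower derivatives have the smaller scale
    and are absorbed. *)
Lemma scl_le l m : (l <= m)%N -> (scl l <= scl m)%R.
Proof. move=> lm; apply: ler_wpM2l; first exact/exprn_ge0/ltW.
by apply: ler_weXn2l. Qed.

Lemma scl_ge1 l : (k <= l)%N -> (1 <= scl l)%R.
Proof. by move=> /scl_le; apply: le_trans; rewrite /scl -exprMn divff ?gt_eqF// expr1n. Qed.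

Definition Fl l y : \bar R := (scl l)%:E * majorant y.

Lemma Fl_ge0 l y : 0 <= Fl l y.
Proof. by rewrite mule_ge0 ?lee_fin ?scl_ge0 ?majorant_ge0. Qed.

Lemma measurable_Fl l : measurable_fun setT (Fl l).
Proof. by apply: emeasurable_funM; [exact: measurable_cst|exact: measurable_majorant]. Qed.

Lemma Lnorm_Fl l : 'N[mu]_p[Fl l] <= (majorant_cst * scl l)%:E * GS.
Proof.
rewrite (Lnorm_scale _ p1 (scl_ge0 l) measurable_majorant) [(majorant_cst * _)%R]mulrC [in leRHS]EFinM -muleA.
by apply: lee_wpmul2l Lnorm_majorant; rewrite lee_fin scl_ge0.
Qed.

Let Wd al i := gsum (dP al) (fun m : Lx => x (i - off m)%R) i.

(** [pointwise] with [QQ] replaced by [MM]. In the second part, derivatives of order below [k] are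
    bounded by the error plus [g al], which is affordable because [scl l >= 1] for [l >= k]. *)
Lemma cell_estimate i (al : multi_index D.+1) l : i \in els -> (mi_order al <= l)%N -> (l <= n)%N ->
  ((l <= k)%N -> {ae mu, forall y, cell i y -> `|g al y - Wd al i y|%:E <= Fl l y}) /\
  ((k <= l)%N -> {ae mu, forall y, cell i y -> `|Wd al i y|%:E <= Fl l y}).
Proof.
move=> ie al_l ln; have aln d : (al d <= n)%N.
  exact: leq_trans (leq_mi_order al d) (leq_trans al_l ln).
have [P1 P2] := pointwise ie aln.
have bnd y : cell i y -> (sigma ^+ k * sigma^-1 ^+ mi_order al)%:E * (HH y + (pt * QQ i)%:E)
    <= (scl l)%:E * (HH y + pt%:E * MM y).
  move=> cy; apply: lee_pmul.
  - by rewrite lee_fin; exact: scl_ge0.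
  - by rewrite adde_ge0// lee_fin mulr_ge0// QQ_ge0.
  - by rewrite lee_fin; exact: scl_le.
  - by apply: leeD2l; rewrite EFinM lee_wpmul2l//; exact: QQ_MM.
have bF y : (scl l)%:E * (HH y + pt%:E * MM y) <= Fl l y.
  by apply: lee_wpmul2l; [rewrite lee_fin scl_ge0|rewrite leeDl].
split=> [lk|kl].
  apply: filterS (P1 (leq_trans al_l lk)) => y h cy.
  by apply: le_trans (h cy) _; apply: le_trans (bnd y cy) _.
have [ka|ak] := leqP k (mi_order al).
  by apply: filterS (P2 ka) => y h cy; apply: le_trans (h cy) _; apply: le_trans (bnd y cy) _.
apply: filterS (P1 (ltnW ak)) => y h cy.
apply: (@le_trans _ _ (`|g al y - Wd al i y|%:E + `|g al y|%:E)).
  rewrite -EFinD lee_fin distrC; have := ler_normD (Wd al i y - g al y)%R (g al y).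
  by rewrite subrK.
rewrite /Fl /majorant ge0_muleDr//; last by rewrite adde_ge0.
apply: leeD; first by apply: le_trans (h cy) _; exact: bnd.
apply: (@le_trans _ _ (\sum_(be <- mis k.+1) gk be y)).
  have alk := ltnW ak; rewrite (bigD1_seq al)/= ?mis_uniq ?mem_mis ?ltnS// {1}/gk alk.
  by rewrite leeDl//; exact: sume_ge0.
by rewrite -[leLHS]mul1e lee_wpmul2r// lee_fin scl_ge1.
Qed.

Let dspl al := spl coefs (restr x) al.

Let spl_W (al : multi_index D.+1) i y : i \in els -> cell i y -> dspl al y = Wd al i y.
Proof.
move=> ie cy; rewrite /dspl (spl_cell s0 n0 _ coefs_uniq (@restr_supp x) cy).
apply: gsum_ext => [m [d md]|m mL]; last exact: restr_in.
by rewrite /Submission.cpoly /tens (bigD1 d)//= md dP_top// horner0 mul0r.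
Qed.

Let mgd : measurable gd. Proof. exact: open_measurable_rV open_gd. Qed.

(** On the grid domain [w] agrees almost everywhere with its B-spline sum, which has weak
    derivatives up to order [n - 1] across the faces. *)
Let weak_gd (al : multi_index D.+1) l : (mi_order al <= l)%N -> (l <= n - 1)%N -> is_weak_partial gd w al (dspl al).
Proof.
move=> al_l ln; apply: (@weak_ae _ _ gd (spl coefs (restr x) (fun=> 0%N)) _ _ _ mgd).
- by apply/(measurable_restrictT _ mgd); exact: measurable_rep_gd rw.
- by apply: filterS (rep_spl_ae rw) => y h gy; rewrite h.
apply: (spl_weak s0) => //; first exact: open_gd.
by move=> d; rewrite -subn1; exact: leq_trans (leq_mi_order al d) (leq_trans al_l ln).
Qed.

Let weak_cell (al : multi_index D.+1) i : i \in els -> is_weak_partial (cell i) w al (Wd al i).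
Proof. by move=> /elsP ie; apply: (cell_weak s0) => y cy; exact: rep_cell rw ie cy. Qed.

Let ae_gd (P : V -> Prop) : (forall i, i \in els -> {ae mu, forall y, cell i y -> P y}) ->
  {ae mu, forall y, gd y -> P y}.
Proof.
move=> h; have h1 := ae_forall_seq h; have h2 := ae_domain_cell a Om s0.
by apply: filterS2 h1 h2 => y h1 h2 gy; have [i /elsP ie ci] := h2 gy; exact: h1 ie ci.
Qed.

Let msz l : R := ((size (@mis D.+1 l.+1)).+1%:R)%R.

Let gd_le l f : (forall al, (mi_order al <= l)%N -> exists2 h, is_weak_partial gd f al h &
     {ae mu, forall y, gd y -> (`|h y|%:E <= Fl l y)}) ->
  sobolev_norm gd l p f <= (msz l * majorant_cst * scl l)%:E * GS.
Proof.
move=> H; apply: le_trans (sobolev_ae_le p1 mgd (measurable_Fl l) (Fl_ge0 l) H) _.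
rewrite -mulrA EFinM -muleA; apply: lee_wpmul2l; first by rewrite lee_fin.
by apply: le_trans (Lnorm_restrict_le p1 mgd (measurable_Fl l) (Fl_ge0 l)) (Lnorm_Fl l).
Qed.

Let cell_le l f : (forall i al, i \in els -> (mi_order al <= l)%N -> exists2 h, is_weak_partial (cell i) f al h &
     {ae mu, forall y, cell i y -> (`|h y|%:E <= Fl l y)}) ->
  broken_sobolev_norm sigma a Om l p f <= (msz l * majorant_cst * scl l)%:E * GS.
Proof.
move=> H; have m0 : (0 <= msz l)%R by exact: ler0n.
pose F y : \bar R := (msz l)%:E * Fl l y.
have mF : measurable_fun setT F by apply: emeasurable_funM; [exact: measurable_cst|exact: measurable_Fl].
apply: (@le_trans _ _ 'N[mu]_p[F]).
  apply: (lp_sum_cells p1 els_uniq elsP (C := cell)) => //.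
  - by move=> i; exact: measurable_cell.
  - by move=> i j y; exact: cell_inj.
  - by move=> y; rewrite mule_ge0 ?Fl_ge0 ?lee_fin.
  move=> i /elsP ie; rewrite sobolev_norm_ge0//=.
  have mc := measurable_cell sigma a i.
  apply: le_trans (sobolev_ae_le p1 mc (measurable_Fl l) (Fl_ge0 l) (fun al => H i al ie)) _.
  rewrite /F; under [in leRHS]eq_fun do rewrite -muleA.
  rewrite (Lnorm_scale _ p1 m0)//; apply: emeasurable_funM; first exact: measurable_Fl.
  by apply/measurable_EFinP; apply: measurable_indic.
rewrite (Lnorm_scale _ p1 m0 (measurable_Fl l)) -mulrA EFinM -muleA.
by apply: lee_wpmul2l; [rewrite lee_fin|exact: Lnorm_Fl].
Qed.

Lemma estimates l X : X = (msz l * majorant_cst * scl l)%:E * GS ->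
  [/\ (l <= k)%N -> (l <= n - 1)%N -> sobolev_norm gd l p (fun y => v y - w y)%R <= X,
      (k <= l)%N -> (l <= n - 1)%N -> sobolev_norm gd l p w <= X,
      (l <= k)%N -> (l <= n)%N -> broken_sobolev_norm sigma a Om l p (fun y => v y - w y)%R <= X &
      (k <= l)%N -> (l <= n)%N -> broken_sobolev_norm sigma a Om l p w <= X].
Proof.
move=> ->; have nn : (n - 1 <= n)%N by exact: leq_subr.
split=> [lk ln|kl ln|lk ln|kl ln].
- apply: gd_le => al al_l; exists (fun y => g al y - dspl al y)%R.
    exact: weak_sub mgd (weak_restrict mgd (wv (leq_trans al_l lk))) (weak_gd al_l ln).
  apply: ae_gd => i ie; have [/(_ lk) h _] := cell_estimate ie al_l (leq_trans ln nn).
  by apply: filterS h => y h cy; rewrite (spl_W al ie cy); exact: h.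
- apply: gd_le => al al_l; exists (dspl al); first exact: weak_gd al_l ln.
  apply: ae_gd => i ie; have [_ /(_ kl) h] := cell_estimate ie al_l (leq_trans ln nn).
  by apply: filterS h => y h cy; rewrite (spl_W al ie cy); exact: h.
- apply: cell_le => i al ie al_l; exists (fun y => g al y - Wd al i y)%R.
    apply: weak_sub => //; first exact: measurable_cell.
      by apply: weak_restrict (wv (leq_trans al_l lk)); exact: measurable_cell.
    exact: weak_cell.
  by have [/(_ lk)] := cell_estimate ie al_l ln.
- apply: cell_le => i al ie al_l; exists (Wd al i); first exact: weak_cell.
  by have [_ /(_ kl)] := cell_estimate ie al_l ln.
Qed.

End ApproximateExtension.

(** * Integrability on the domain and the extended function *)

Section Setup.
Context {R : realType} (D : nat) (Om : set 'rV[R]_D.+1).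
Notation mu := (lebesgue_rV D.+1).
Notation V := ('rV[R]_D.+1).
Hypotheses (oOm : open Om) (bOm : bounded_set Om).

Lemma bounded_cbox : exists b c : V, Om `<=` cbox b c.
Proof.
have /= [M [_ bM]] := bOm; have {}bM : forall x, Om x -> `|x| <= M + 1 by apply: bM; rewrite ltrDl.
exists (const_mx (- (M + 1))), (const_mx (M + 1)) => x /bM xM d; rewrite !mxE -ler_norml.
by apply: le_trans xM; rewrite [leRHS]mx_normrE; apply: (le_trans _ (le_bigmax _ _ (ord0, d))).
Qed.

Lemma measure_bounded : exists2 c : R, 0 <= c & mu Om = c%:E.
Proof.
have [b [c bc]] := bounded_cbox; have fO : mu Om \is a fin_num.
  rewrite ge0_fin_numE//; apply: le_lt_trans (cbox_lty b c).
  by apply: le_measure => //; rewrite inE; [exact: open_measurable_rV|exact: measurable_cbox].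
by exists (fine (mu Om)); rewrite ?fineK// fine_ge0.
Qed.

(** On a bounded domain the [L^p] norm controls the [L^1] norm; the restriction property of the
    extension operator is stated for [L^1]. *)
Lemma in_sobolev_L1 k p u : (1 <= p)%E -> in_sobolev Om k p u -> in_sobolev Om 0 1%E u /\ measurable_fun Om u.
Proof.
move=> p1 /ereal_inf_lt[_ [g gw <-] gfin].
have w0 := gw (mi0 D) (leq_trans (eq_leq (mi_order0 D)) (leq0n k)).
have [[mu_ _] [mg _] _] := w0; split=> //; have mO := open_measurable_rV oOm.
have N0 : (Lp_norm Om p (g (mi0 D)) < +oo)%E.
  apply: le_lt_trans gfin; apply: (le_lp_sum (b := fun al => Lp_norm Om p (g al))) => //.
    by rewrite /= mi_order0.
  exact: Lnorm_ge0.
have mgO : measurable_fun setT (g (mi0 D) \_ Om) by apply/(measurable_restrictT _ mO).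
have N1 : (Lp_norm Om 1 (g (mi0 D)) < +oo)%E.
  have [c c0 cO] := measure_bounded; rewrite /Lp_norm Lnorm1.
  have mF : measurable_fun setT (abse \o (EFin \o (g (mi0 D) \_ Om))).
    by apply: measurableT_comp => //; exact/measurable_EFinP.
  have := Lnorm_lty_integral p1 mO c0 cO mF (fun x => abse_ge0 _).
  rewrite Lnorm_abse => /(_ N0); rewrite integral_mkcond; congr (_ < _)%E; apply: eq_integral => x _.
  by rewrite /= /patch /=; case: (x \in Om); rewrite ?normr0.
apply: (@le_lt_trans _ _ ((size (@mis D.+1 1)).+1%:R%:E * Lp_norm Om 1 (g (mi0 D)))%E); last first.
  by rewrite lte_mul_pinfty// lee_fin.
apply: sobolev_le => //; first exact: Lnorm_ge0.
move=> al; rewrite leqn0 => /eqP al0; exists (g (mi0 D)) => //.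
suff -> : al = mi0 D by [].
by apply/ffunP => d; rewrite ffunE; apply/eqP; rewrite -leqn0 -al0; exact: leq_mi_order.
Qed.

Lemma weak_family k v (g : multi_index D.+1 -> V -> R) :
  (forall al, (mi_order al <= k)%N -> is_weak_partial setT v al (g al)) ->
  [/\ forall al, (mi_order al <= k)%N -> locint (g al),
      forall al d, (mi_order al < k)%N -> wpart d (g al) (g (minc al d)) &
      {ae mu, forall y, v y = g (mi0 D) y}].
Proof.
move=> wv; split=> [al ak|al d ak|]; first exact: weak_locint (wv al ak).
  by apply: weak_wpart (wv _ (ltnW ak)) (wv _ _); rewrite mi_order_minc.
by apply: weak0_ae; apply: wv; rewrite mi_order0.
Qed.

Lemma stein_integrable E k p u : (1 <= p)%E -> stein_extension Om E -> in_sobolev Om k p u ->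
  (exists g, is_weak_partial setT (E u) (mi0 D) g) ->
  mu.-integrable Om (EFin \o u) /\ {ae mu, forall y, Om y -> E u y = u y}.
Proof.
move=> p1 [_ Eae _] /(in_sobolev_L1 p1)[u1 mu_] [g [[mE iE] _ _]].
have EO := Eae u u1; split => //; have [b [c bc]] := bounded_cbox; have mO := open_measurable_rV oOm.
have /integrableP[m1 i1] : mu.-integrable Om (EFin \o E u).
  by apply: (integrableS (measurable_cbox b c) mO bc); apply: iE => //; exact: compact_cbox.
apply/integrableP; split; first exact/measurable_EFinP.
apply: le_lt_trans i1; rewrite le_eqVlt; apply/orP; left; apply/eqP; apply: ae_eq_integral => //.
- by apply: measurableT_comp => //; exact/measurable_EFinP.
- exact: measurableT_comp.
- by apply: filterS EO => y h Oy /=; rewrite h.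
Qed.

End Setup.

Theorem theorem4p5 (R : realType) (D : nat) (Om : set 'rV[R]_D.+1)
    (E : ('rV[R]_D.+1 -> R) -> 'rV[R]_D.+1 -> R) (K n k : nat) (p : \bar R) :
  open Om -> bounded_set Om -> lipschitz_domain Om ->
  stein_extension Om E ->
  (1 <= n)%N -> (k <= n)%N -> (1 <= p)%E ->
  exists sigma0 eps0 : R, [/\ 0 < sigma0, 0 < eps0 &
    forall eps : R, eps0 <= eps -> exists2 C : R, 0 < C &
    forall (sigma : R) (a : 'rV[R]_D.+1), 0 < sigma <= sigma0 ->
      chain_condition sigma a Om K ->
      A_eps_invertible sigma a Om n p eps /\
      forall u : 'rV[R]_D.+1 -> R, in_sobolev Om k p u ->
        let w := approx_extension sigma a Om n eps u in
        let bound (l : nat) :=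
          ((C * sigma ^ (k%:Z - l%:Z))%:E * sobolev_norm Om k p u)%E in
        [/\ forall l : nat, (l <= minn k (n - 1))%N ->
              (sobolev_norm (grid_domain sigma a Om) l p (fun x => E u x - w x)%R
                 <= bound l)%E,
            forall l : nat, (k <= l <= n - 1)%N ->
              (sobolev_norm (grid_domain sigma a Om) l p w <= bound l)%E,
            forall l : nat, (l <= minn k n)%N ->
              (broken_sobolev_norm sigma a Om l p (fun x => E u x - w x)%R
                 <= bound l)%E &
            forall l : nat, (k <= l <= n)%N ->
              (broken_sobolev_norm sigma a Om l p w <= bound l)%E]].
Proof.
move=> oOm bOm _ SE n0 kn p1; exists 1, 1; split => // eps eps1.
have [B hB] := @poly_bounds_exists R n.
have B0 : 0 <= B by have [/(le_trans ler01)] := hB.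
have La0 : 0 <= acoef_cst D B eps by rewrite mulr_ge0 ?exprn_ge0// addr_ge0// mulr_ge0.
have offn (m m' : Lx D n) d : (`|(off m : 'rV[int]_D.+1) ord0 d - (off m' : 'rV[int]_D.+1) ord0 d| <= n)%N.
  rewrite !mxE; have := ltn_ord (m d); have := ltn_ord (m' d); lia.
(* The decay rate and its constant are fixed here from the dimension, [n], [K] and [eps], before
   [sigma] and the grid origin are introduced. *)
have [t [Cd [t01 Cd0 dec]]] := decay offn (coer_cst_gt0 D n K) La0.
have [_ _ /(_ k p p1)[CE hE]] := SE.
pose msz l : R := (size (@mis D.+1 l.+1)).+1%:R.
(* Summing over all orders makes the final constant independent of [l]. *)
pose M := \sum_(l < n.+1) msz l.
pose mk : R := (size (@mis D.+1 k.+1)).+1%:R.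
pose mc := @majorant_cst R D n k B eps t Cd.
have mc1 : 1 <= mc.
  rewrite /mc /majorant_cst lerDr mulr_ge0//.
    exact: HH_cst_ge0.
  by rewrite addr_ge0// mulr_ge0// ?(MM_cst_ge0 D n t01)// (pt_ge0 D hB eps1 Cd0).
have msz_le l : (l <= n)%N -> msz l <= M.
  move=> ln; rewrite /M (bigD1 (Ordinal (ln : (l < n.+1)%N)))//= lerDl.
  by rewrite sumr_ge0// => i _; exact: ler0n.
have M1 : 1 <= M by apply: le_trans (msz_le 0%N (leq0n n)); rewrite /msz ler1n.
have mk1 : 1 <= mk by rewrite ler1n.
pose C1 := M * mc * mk.
have C1_gt0 : 0 < C1 by rewrite /C1 !mulr_gt0//; exact: lt_le_trans ltr01 _.
(* The added 1 keeps the constant positive even if [CE] is 0. *)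
exists (C1 * `|CE| + 1); first by rewrite ltr_wpDl// mulr_ge0// ltW.
move=> sigma a /andP[s0 s1] chK.
have [els [els_uniq elsP]] := finite_elements a s0 oOm bOm.
have Ainv := invertible s0 n0 oOm els_uniq elsP p1 eps1 chK.
split=> // u us w bound.
have Efin : (sobolev_norm setT k p (E u) < +oo)%E.
  apply: le_lt_trans (hE u us) _.
  apply: (@le_lt_trans _ _ (`|CE|%:E * sobolev_norm Om k p u)%E); last by rewrite lte_mul_pinfty.
  by apply: lee_wpmul2r; [exact: sobolev_norm_ge0|rewrite lee_fin ler_norm].
have [_ [g0 g0w _] _] := ereal_inf_lt Efin.
have [iu EO] := stein_integrable oOm bOm p1 SE us
  (ex_intro _ (g0 (mi0 D)) (g0w (mi0 D) (leq_trans (eq_leq (mi_order0 D)) (leq0n k)))).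
have [sw wE] := approx_extensionP s0 n0 oOm els_uniq elsP p1 Ainv iu.
have [x rw] := spline_on_rep s0 n0 sw.
pose bd l X := (X <= (C1 * (sigma ^+ k * sigma^-1 ^+ l))%:E * sobolev_norm setT k p (E u))%E.
have fin_bound l X : bd l X -> (X <= bound l)%E.
  move=> h; apply: le_trans h _; rewrite /bound.
  have -> : sigma ^ (k%:Z - l%:Z) = sigma ^+ k * sigma^-1 ^+ l.
    by rewrite expfzDr ?gt_eqF// exprVn exprnN.
  have S0 : 0 <= sigma ^+ k * sigma^-1 ^+ l by exact: (@scl_ge0 R sigma s0 k l).
  apply: le_trans (lee_wpmul2l _ (hE u us)) _; first by rewrite lee_fin mulr_ge0// ltW.
  rewrite muleA -EFinM; apply: lee_wpmul2r; first exact: sobolev_norm_ge0.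
  rewrite lee_fin mulrAC ler_wpM2r//; apply: (@le_trans _ _ (C1 * `|CE|)); last by rewrite lerDl.
  by rewrite ler_wpM2l ?ler_norm// ltW.
have key l : (l <= n)%N -> [/\ (l <= k)%N -> (l <= n - 1)%N -> bd l (sobolev_norm (grid_domain sigma a Om) l p (fun y => E u y - w y)%R),
      (k <= l)%N -> (l <= n - 1)%N -> bd l (sobolev_norm (grid_domain sigma a Om) l p w),
      (l <= k)%N -> bd l (broken_sobolev_norm sigma a Om l p (fun y => E u y - w y)%R) &
      (k <= l)%N -> bd l (broken_sobolev_norm sigma a Om l p w)].
  move=> ln; have S0 : 0 < sigma ^+ k * sigma^-1 ^+ l by rewrite mulr_gt0// exprn_gt0// invr_gt0.
  have CS0 : 0 < C1 * (sigma ^+ k * sigma^-1 ^+ l) by exact: mulr_gt0.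
  (* The Sobolev norm of [E u] is an infimum over families of weak derivatives, so it is enough to
     bound [X] by each family. A family of infinite norm gives a trivial bound; a finite one
     supplies the finiteness required for the cell averages of [HH]. *)
  suff H X : (forall g, (forall al, (mi_order al <= k)%N -> is_weak_partial setT (E u) al (g al)) ->
      (forall al, (mi_order al <= k)%N -> ('N[lebesgue_rV D.+1]_p[EFin \o g al] < +oo)%E) ->
      (X <= (msz l * mc * (sigma ^+ k * sigma^-1 ^+ l))%:E * \sum_(al <- mis k.+1) 'N[lebesgue_rV D.+1]_p[EFin \o g al])%E) -> bd l X.
    have ug (g : multi_index D.+1 -> 'rV[R]_D.+1 -> R) : {ae lebesgue_rV D.+1, forall y, E u y = g (mi0 D) y} ->
        {ae lebesgue_rV D.+1, forall y, Om y -> u y = g (mi0 D) y}.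
      by move=> h; apply: filterS2 h EO => y h1 h2 Oy; rewrite -h2.
    have est g gw gf := let: And3 lg wg Eg := weak_family gw in
      estimates (g := g) s0 n0 oOm els_uniq elsP kn hB lg wg (fun j => HH_lty a n s0 lg p1 j gf)
        eps1 chK iu (ug g Eg) rw wE Cd0 t01 dec s1 gw p1 (l := l) erefl.
    split=> [lk ln1|kl ln1|lk|kl]; apply: H => g gw gf; have [h1 h2 h3 h4] := est g gw gf.
    - exact: h1.
    - exact: h2.
    - exact: h3.
    - exact: h4.
  move=> HX; rewrite /bd /sobolev_norm -ereal_inf_pZl//.
  apply: le_ereal_inf_tmp => _ [_ [g gw <-] <-]; set L := lp_sum _ _ _.
  have L0 : (0 <= L)%E by exact: lp_sum_ge0.
  have [Loo|Loo] := eqVneq L +oo%E; first by rewrite Loo gt0_muley ?leey// lte_fin.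
  have gL al : (mi_order al <= k)%N -> ('N[lebesgue_rV D.+1]_p[EFin \o g al] <= L)%E.
    move=> ak; have := @le_lp_sum R _ [set al | (mi_order al <= k)%N] p (fun al => Lp_norm setT p (g al)) al p1 ak (Lnorm_ge0 _ _ _).
    by rewrite {1}/Lp_norm patch_setT.
  have gf al : (mi_order al <= k)%N -> ('N[lebesgue_rV D.+1]_p[EFin \o g al] < +oo)%E.
    by move=> ak; apply: le_lt_trans (gL al ak) _; rewrite ltey.
  apply: le_trans (HX g gw gf) _.
  have GL : (\sum_(al <- mis k.+1) 'N[lebesgue_rV D.+1]_p[EFin \o g al] <= mk%:E * L)%E.
    apply: (@le_trans _ _ (\sum_(al <- @mis D.+1 k.+1) L)%E).
      by rewrite big_seq [leRHS]big_seq; apply: lee_sum => al; rewrite mem_mis ltnS; exact: gL.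
    rewrite big_const_seq count_predT /mk; elim: (size _) => [|m IH] /=; first by rewrite mule_ge0 ?lee_fin.
    by rewrite -[m.+2%:R]natr1 EFinD ge0_muleDl ?lee_fin// mul1e addrC; exact: leeD.
  apply: le_trans (lee_wpmul2l _ GL) _.
    by rewrite lee_fin; apply: mulr_ge0 (ltW S0); apply: mulr_ge0 => //; exact: le_trans ler01 mc1.
  rewrite muleA -EFinM; apply: lee_wpmul2r => //; rewrite lee_fin /C1 mulrAC.
  apply: ler_wpM2r (ltW S0) _ _ _; apply: ler_wpM2r (le_trans ler01 mk1) _ _ _.
  by apply: ler_wpM2r (le_trans ler01 mc1) _ _ _; exact: msz_le.
split=> l; rewrite ?leq_min => /andP[h1 h2]; apply: fin_bound.
- by have [H _ _ _] := key l (leq_trans h1 kn); exact: H.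
- by have [_ H _ _] := key l (leq_trans h2 (leq_subr _ _)); exact: H.
- by have [_ _ H _] := key l h2; exact: H.
- by have [_ _ _ H] := key l h2; exact: H.
Qed.
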